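(* Let $n\ge2$ be an integer, let $\lambda\in\rho(\Delta_{\mathcal F})$, choose $\nu\in\mathbb C$ with $\lambda=\nu(\nu+1)$, and set $\alpha_k=|k|/n$. Consider the ordered bases $$\beta^\#=(f_0^\#,g_0^\#;\,f_1^\#,g_{-1}^\#,\,f_{-1}^\#,g_1^\#;\,\dots;\,f_{n-1}^\#,g_{-(n-1)}^\#,\,f_{-(n-1)}^\#,g_{n-1}^\#)$$ of $\mathcal F^\#$ and $$\beta=(f_0,g_0;\,f_1,g_{-1},\,f_{-1},g_1;\,\dots;\,f_{n-1},g_{-(n-1)},\,f_{-(n-1)},g_{n-1})$$ of $\mathcal F$. With respect to the domain basis $\beta^\#$ and the codomain basis $\beta$, the matrix of the Weyl function $M_{\mathcal F,\mathcal F^\#}(\lambda):\mathcal F^\#\to\mathcal F$ (the $S$-matrix) is block diagonal with $2\times2$ blocks: $$S^{\beta,\beta^\#}_{\mathcal F,\mathcal F^\#}(\lambda)=\operatorname{diag}\bigl(S_0(\lambda),S_1(\lambda),S_1(\lambda),\dots,S_{n-1}(\lambda),S_{n-1}(\lambda)\bigr),$$ where $$S_0(\lambda)=-\frac1n\begin{pmatrix}\gamma_E+\psi(\nu+1)+\frac\pi2\cot(\pi\nu)&\frac{\pi}{2\sin(\pi\nu)}\\[2mm]\frac{\pi}{2\sin(\pi\nu)}&\gamma_E+\psi(\nu+1)+\frac\pi2\cot(\pi\nu)\end{pmatrix}$$ and, for $1\le k\le n-1$, $$S_k(\lambda)=-\frac{\Gamma(1-\alpha_k)}{\Gamma(1+\alpha_k)}\frac{\Gamma(\nu+\alpha_k+1)}{\Gamma(\nu-\alpha_k+1)}\frac{1}{\sin(\pi(\nu-\alpha_k))}\begin{pmatrix}\sin(\pi\nu)&\sin(\pi\alpha_k)\\[2mm]\sin(\pi\alpha_k)&\sin(\pi\nu)\end{pmatrix},$$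 the expressions involving $\sin(\pi(\nu-\alpha_k))$ being understood by meromorphic continuation at removable singularities.
   Context: **Geometry.** Let $n\ge2$. On $\mathbb P^1$ use affine coordinates $x$ on $\mathbb P^1\setminus\{\infty\}$ and $y=x^{-1}$ on $\mathbb P^1\setminus\{0\}$; $X'=\mathbb P^1\setminus\{0,\infty\}$; polar coordinates $x=re^{i\theta}$, $y=\rho e^{i\eta}$ (so $\rho=r^{-1}$, $\eta=-\theta$). The metric is $ds_n^2=\frac{4n^2|x|^{2n-2}}{(1+|x|^{2n})^2}|dx|^2$ (the same formula holds in $y$), with area form $dA=\frac{4n^2r^{2n-1}}{(1+r^{2n})^2}dr\wedge d\theta$. The nonnegative Laplacian is $\Delta=-\frac{(1+|x|^{2n})^2}{n^2|x|^{2n-2}}\frac{\partial^2}{\partial x\partial\bar x}$, and $\mathcal D_{\max}(\Delta)=\{u\in L^2(X',dA):\Delta u\in L^2(X',dA)\text{ in the distributional sense on }X'\}$. A formal solution of $(\Delta-\lambda)u=0$ is an element $u\in\mathcal D_{\max}(\Delta)$ satisfying the equation in the distributional sense on $X'$; $\ker(\Delta-\lambda)$ is the space of these. **Boundary data.** For $u\in\mathcal D_{\max}(\Delta)$ let $u_k(r)=\frac1{2\pi}\int_0^{2\pi}u\,e^{-ik\theta}d\theta$ (in the $x$-coordinate) and $v_k(\rho)=\frac1{2\pi}\int_0^{2\pi}u\,e^{-ik\eta}d\eta$ (in the $y$-coordinate). For $|k|\le n-1$ there are unique complex numbers $c_k,c_k^\#,d_k,d_k^\#$ with $u_0(r)=c_0+c_0^\#\log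 r+o(1)$, $u_k(r)=c_kr^{|k|}+c_k^\#r^{-|k|}+o(r^{|k|})$ ($k\ne0$) as $r\to0^+$, and $v_0(\rho)=d_0+d_0^\#\log\rho+o(1)$, $v_k(\rho)=d_k\rho^{|k|}+d_k^\#\rho^{-|k|}+o(\rho^{|k|})$ ($k\neq0$) as $\rho\to0^+$. Set $\pi_0(u)=c_0+c_0^\#\log r+\sum_{0<|k|\le n-1}(c_kr^{|k|}+c_k^\#r^{-|k|})e^{ik\theta}$ and $\pi_\infty(u)=d_0+d_0^\#\log\rho+\sum_{0<|k|\le n-1}(d_k\rho^{|k|}+d_k^\#\rho^{-|k|})e^{ik\eta}$, and $\pi_S=\pi_0\oplus\pi_\infty$. Bases: $f_0=\frac1{\sqrt{2\pi}}$, $f_0^\#=-\frac1{\sqrt{2\pi}}\log r$, and for $1\le|j|\le n-1$, $f_j=\frac{1}{\sqrt{4\pi|j|}}r^{|j|}e^{ij\theta}$, $f_j^\#=\frac1{\sqrt{4\pi|j|}}r^{-|j|}e^{ij\theta}$. Define $g_j,g_j^\#$ by the same formulas with $(\rho,\eta)$ in place of $(r,\theta)$. Let $V_0=\operatorname{span}\{f_j,f_j^\#\}$, $V_\infty=\operatorname{span}\{g_j,g_j^\#\}$, $V_S=V_0\oplus V_\infty$, $\mathcal F=\operatorname{span}\{f_j,g_j\}$, $\mathcal F^\#=\operatorname{span}\{f_j^\#,g_j^\#\}$ (complex spans, $|j|\le n-1$), so $V_S=\mathcal F\oplus\mathcal F^\#$, and $\pi_S:\mathcal D_{\max}(\Delta)\to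 V_S$ is linear and surjective. **Friedrichs extension and Weyl function.** $\Delta_{\mathcal F}$ is the restriction of $\Delta$ to $\mathcal D_{\mathcal F}=\{u\in\mathcal D_{\max}(\Delta):\pi_S(u)\in\mathcal F\}$; it is self-adjoint, and $\rho(\Delta_{\mathcal F})$ is its resolvent set. For $\lambda\in\rho(\Delta_{\mathcal F})$ and $h^\#\in\mathcal F^\#$ there is a unique formal solution $\Gamma(\lambda)h^\#\in\ker(\Delta-\lambda)$ such that the $\mathcal F^\#$-component of $\pi_S(\Gamma(\lambda)h^\#)$ is $h^\#$. The Weyl function $M_{\mathcal F,\mathcal F^\#}(\lambda)h^\#$ is the $\mathcal F$-component of $\pi_S(\Gamma(\lambda)h^\#)$. **Special functions.** $\gamma_E$ is the Euler constant, $\Gamma(\cdot)$ with a scalar argument formed from $\nu,\alpha_k$ is the gamma function, and $\psi=\Gamma'/\Gamma$ is the digamma function. *)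

(* Defs.v *)
From HB Require Import structures.
From mathcomp Require Import all_boot all_order all_algebra.
From mathcomp Require Import complex.
From mathcomp Require Import all_classical all_reals all_analysis.

Set Implicit Arguments.
Unset Strict Implicit.
Unset Printing Implicit Defensive.

Import Order.TTheory GRing.Theory Num.Theory.
Import numFieldNormedType.Exports.
Import ComplexField.Normc.

Local Open Scope classical_set_scope.
Local Open Scope ring_scope.
Local Open Scope complex_scope.

Section SpecialFunctions.
Variable R : realType.
Implicit Types z w : R[i].

Definition polar (r t : R) : R[i] := (r * cos t) +i* (r * sin t).

Definition expi (t : R) : R[i] := polar 1 t.

Definition cexp z : R[i] := polar (expR (complex.Re z)) (complex.Im z).

Definition csin z : R[i] := (cexp ('i%C * z) - cexp (- ('i%C * z))) / (2 * 'i%C).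

Definition ccos z : R[i] := (cexp ('i%C * z) + cexp (- ('i%C * z))) / 2.

Definition ccot z : R[i] := ccos z / csin z.

(* Euler's product form of the gamma function, the limit of                   *)
(*   m! m^z / (z (z + 1) ... (z + m)),                                        *)
(* valid at every z that is not a nonpositive integer.  At a pole the value   *)
(* is 0, since division by 0 yields 0.                                        *)
Definition cGamma (z : R[i]^o) : R[i]^o :=
  lim ((fun m : nat => m`!%:R * cexp (z * (ln m%:R)%:C)
                       / (\prod_(0 <= j < m.+1) (z + j%:R)) : R[i]^o) @ \oo).

Definition digamma (z : R[i]^o) : R[i]^o := derive1 cGamma z / cGamma z.

Definition euler_gamma : R :=
  lim ((fun m : nat => \sum_(1 <= k < m.+1) k%:R^-1 - ln m%:R : R) @ \oo).

(* The value at z of g, continued across the zeros of s at which the          *)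
(* singularity of g is removable.                                             *)
Definition continued (s g : R[i]^o -> R[i]^o) (z : R[i]^o) : R[i]^o :=
  if s z == 0 then lim (g w @[w --> z^']) else g z.

End SpecialFunctions.

Section Geometry.
Variables (R : realType) (n : nat).
Implicit Types (u f phi : R[i] -> R[i]).

Local Notation leb := (@lebesgue_measure R).
Local Notation leb2 := (leb \x leb)%E.

Definition cintegral d (T : measurableType d) (mu : {measure set T -> \bar R})
    (D : set T) (g : T -> R[i]) : R[i] :=
  Rintegral mu D (fun x => complex.Re (g x))
  +i* Rintegral mu D (fun x => complex.Im (g x)).

(* Functions on X' are represented by total functions of the coordinate x;    *)
(* their value at x = 0 never matters.  X' is parametrized by x = r e^(it),   *)
(* (r, t) in polar_dom.                                                       *)
Definition polar_dom : set (R * R) := `]0, +oo[ `*` `[0, 2 * pi[.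

(* dA = area_density r dr dt *)
Definition area_density (r : R) : R :=
  4 * n%:R ^+ 2 * r ^+ (2 * n - 1) / (1 + r ^+ (2 * n)) ^+ 2.

Definition integral_dA f : R[i] :=
  cintegral leb2 polar_dom
    (fun p => (area_density p.1)%:C * f (polar p.1 p.2)).

Definition L2norm2 u : \bar R :=
  (\int[leb2]_(p in polar_dom)
     (area_density p.1 * normc (u (polar p.1 p.2)) ^+ 2)%:E)%E.

Definition in_L2 u : Prop :=
  [/\ measurable_fun polar_dom (fun p => complex.Re (u (polar p.1 p.2))),
      measurable_fun polar_dom (fun p => complex.Im (u (polar p.1 p.2)))
    & (L2norm2 u < +oo)%E].

Definition L2norm u : R := Num.sqrt (fine (L2norm2 u)).

Definition re_cart phi (p : R * R) : R := complex.Re (phi (p.1 +i* p.2)).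
Definition im_cart phi (p : R * R) : R := complex.Im (phi (p.1 +i* p.2)).

Definition iter_derive (s : seq (R * R)) (g : R * R -> R) : R * R -> R :=
  foldr (fun v h => fun p => 'D_v h p) g s.

Definition smooth2 (g : R * R -> R) : Prop :=
  forall s : seq (R * R), continuous (iter_derive s g) /\
    forall p v, derivable (iter_derive s g) p v.

Definition tsupport phi : set (R * R) :=
  closure [set p | phi (p.1 +i* p.2) != 0].

(* C_c^oo(X'), extended by 0 at x = 0 *)
Definition test_function phi : Prop :=
  [/\ smooth2 (re_cart phi), smooth2 (im_cart phi),
      compact (tsupport phi) & ~ tsupport phi (0, 0)].

Definition cderive (v : R * R) phi (z : R[i]) : R[i] :=
  'D_v (re_cart phi) (complex.Re z, complex.Im z)
  +i* 'D_v (im_cart phi) (complex.Re z, complex.Im z).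

Definition wirtinger phi (z : R[i]) : R[i] :=
  2^-1 * (cderive (1, 0) phi z - 'i%C * cderive (0, 1) phi z).

Definition wirtinger_bar phi (z : R[i]) : R[i] :=
  2^-1 * (cderive (1, 0) phi z + 'i%C * cderive (0, 1) phi z).

Definition laplacian phi (z : R[i]) : R[i] :=
  - ((1 + normc z ^+ (2 * n)) ^+ 2 / (n%:R ^+ 2 * normc z ^+ (2 * n - 2)))%:C
  * wirtinger (wirtinger_bar phi) z.

(* Delta u = f in the distributional sense on X'; Delta is formally           *)
(* symmetric with respect to dA and has real coefficients.                    *)
Definition dist_laplacian u f : Prop :=
  forall phi, test_function phi ->
    integral_dA (fun z => u z * laplacian phi z)
    = integral_dA (fun z => f z * phi z).

Definition D_max u : Prop :=
  in_L2 u /\ exists2 f, in_L2 f & dist_laplacian u f.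

Definition formal_solution (lam : R[i]) u : Prop :=
  D_max u /\ dist_laplacian u (fun z => lam * u z).

Definition x_polar u (r t : R) : R[i] := u (polar r t).

(* y = x^-1 = rho e^(i eta) *)
Definition y_polar u (rho eta : R) : R[i] := u ((polar rho eta)^-1).

End Geometry.

Section BoundaryData.
Variable R : realType.
Implicit Types (w : R -> R -> R[i]) (k : int).

Definition fourier w k (r : R) : R[i] :=
  ((2 * pi)^-1)%:C *
  cintegral (@lebesgue_measure R) `[0, 2 * pi]
    (fun t => w r t * expi (- (k%:~R * t))).

Definition regular_radial k (r : R) : R := if k == 0 then 1 else r ^+ `|k|%N.
Definition singular_radial k (r : R) : R :=
  if k == 0 then ln r else r ^- `|k|%N.

(* g(r) = o(h(r)) as r -> 0+.  An element of L^2 determines its Fourier modes *)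
(* only up to null sets of radii, so the estimate is required almost          *)
(* everywhere; for the continuous representative it is the usual one.         *)
Definition ae_little_o (g : R -> R[i]) (h : R -> R) : Prop :=
  forall eps : R, 0 < eps -> exists2 delta : R, 0 < delta &
    {ae @lebesgue_measure R, forall r : R,
      0 < r < delta -> normc (g r) <= eps * h r}.

Definition boundary_expansion w k (c : R[i] * R[i]) : Prop :=
  ae_little_o
    (fun r => fourier w k r
       - (c.1 * (regular_radial k r)%:C + c.2 * (singular_radial k r)%:C))
    (regular_radial k).

Definition boundary_coef w k : R[i] * R[i] :=
  xget (0, 0) [set c | boundary_expansion w k c].

(* 0, 1, -1, 2, -2, ..., n - 1, -(n - 1) *)
Definition modes (n : nat) : seq int :=
  0 :: flatten [seq [:: j%:Z; - j%:Z] | j <- iota 1 n.-1].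

Definition boundary_part (n : nat) w : R -> R -> R[i] := fun r t =>
  \sum_(k <- modes n)
    ((boundary_coef w k).1 * (regular_radial k r)%:C
     + (boundary_coef w k).2 * (singular_radial k r)%:C) * expi (k%:~R * t).

(* Ambient space of V_S = V_0 (+) V_oo: pairs of functions of (r, theta) and  *)
(* (rho, eta).                                                                *)
Definition boundary_space : lmodType R[i] :=
  ((R -> R -> R[i]) * (R -> R -> R[i]))%type.

Definition pi_S (n : nat) (u : R[i] -> R[i]) : boundary_space :=
  (boundary_part n (x_polar u), boundary_part n (y_polar u)).

Definition mode_norm k : R :=
  if k == 0 then (Num.sqrt (2 * pi))^-1
  else (Num.sqrt (4 * pi * `|k|%N%:R))^-1.

Definition mode_regular k : R -> R -> R[i] := fun r t =>
  (mode_norm k * regular_radial k r)%:C * expi (k%:~R * t).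

Definition mode_singular k : R -> R -> R[i] := fun r t =>
  ((if k == 0 then -1 else 1) * mode_norm k * singular_radial k r)%:C
  * expi (k%:~R * t).

Definition f_ k : boundary_space := (mode_regular k, 0).
Definition g_ k : boundary_space := (0, mode_regular k).
Definition f_sharp k : boundary_space := (mode_singular k, 0).
Definition g_sharp k : boundary_space := (0, mode_singular k).

Definition cspan (s : seq boundary_space) : set boundary_space :=
  [set v | exists a : 'I_(size s) -> R[i], v = \sum_i a i *: s`_i].

Definition F_space (n : nat) : set boundary_space :=
  cspan ([seq f_ k | k <- modes n] ++ [seq g_ k | k <- modes n]).

Definition F_sharp_space (n : nat) : set boundary_space :=
  cspan ([seq f_sharp k | k <- modes n] ++ [seq g_sharp k | k <- modes n]).

(* Components in V_S = F (+) F^# *)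
Definition F_component (n : nat) (v : boundary_space) : boundary_space :=
  xget 0 [set h | F_space n h /\ exists2 h', F_sharp_space n h' & v = h + h'].

Definition F_sharp_component (n : nat) (v : boundary_space) : boundary_space :=
  xget 0 [set h' | F_sharp_space n h' /\ exists2 h, F_space n h & v = h + h'].

End BoundaryData.

Section WeylFunction.
Variables (R : realType) (n : nat).
Implicit Types (u f g : R[i] -> R[i]) (lam : R[i]).

Definition D_F u : Prop := D_max n u /\ F_space n (pi_S n u).

(* Delta_F - lam maps D_F onto L^2 and has a bounded inverse; the estimate    *)
(* also gives injectivity modulo null functions.                              *)
Definition resolvent_set lam : Prop :=
  (forall g, in_L2 n g -> exists2 u, D_F u &
     dist_laplacian n u (fun z => lam * u z + g z)) /\
  (exists K : R, forall u f, D_F u -> in_L2 n f -> dist_laplacian n u f ->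
     L2norm n u <= K * L2norm n (fun z => f z - lam * u z)).

Definition Gamma_field lam (h : boundary_space R) : R[i] -> R[i] :=
  xget (fun=> 0)
    [set u | formal_solution n lam u /\ F_sharp_component n (pi_S n u) = h].

Definition weyl lam (h : boundary_space R) : boundary_space R :=
  F_component n (pi_S n (Gamma_field lam h)).

Definition ordered_basis (s : seq (boundary_space R))
    (V : set (boundary_space R)) : Prop :=
  cspan s = V /\
  forall a : 'I_(size s) -> R[i], \sum_i a i *: s`_i = 0 -> forall i, a i = 0.

(* L : V -> W is linear with matrix A in the ordered bases b of V, c of W. *)
Definition is_matrix_of p q (V W : set (boundary_space R))
    (b c : seq (boundary_space R)) (L : boundary_space R -> boundary_space R)
    (A : 'M[R[i]]_(q, p)) : Prop :=
  [/\ size b = p /\ ordered_basis b V, size c = q /\ ordered_basis c W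
    & forall a : 'cV[R[i]]_p,
        L (\sum_i a i 0 *: b`_i) = \sum_i (A *m a) i 0 *: c`_i].

Definition beta_sharp : seq (boundary_space R) :=
  [:: f_sharp R 0; g_sharp R 0] ++
  flatten [seq [:: f_sharp R j%:Z; g_sharp R (- j%:Z);
                   f_sharp R (- j%:Z); g_sharp R j%:Z] | j <- iota 1 n.-1].

Definition beta : seq (boundary_space R) :=
  [:: f_ R 0; g_ R 0] ++
  flatten [seq [:: f_ R j%:Z; g_ R (- j%:Z);
                   f_ R (- j%:Z); g_ R j%:Z] | j <- iota 1 n.-1].

Definition mx22 (a b c d : R[i]) : 'M[R[i]]_2 :=
  \matrix_(i, j) if i == 0 then (if j == 0 then a else b)
                 else (if j == 0 then c else d).

Definition S_zero (nu : R[i]) : 'M[R[i]]_2 :=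
  let D := (euler_gamma R)%:C + digamma (nu + 1)
           + (pi / 2)%:C * ccot (pi%:C * nu) in
  let E := pi%:C / (2 * csin (pi%:C * nu)) in
  - n%:R^-1 *: mx22 D E E D.

Definition S_pos (k : nat) (nu : R[i]) : 'M[R[i]]_2 :=
  let al : R[i] := k%:R / n%:R in
  let entry (e : R[i] -> R[i]) :=
    continued (fun w => csin (pi%:C * (w - al)))
      (fun w => - (cGamma (1 - al) / cGamma (1 + al))
                * (cGamma (w + al + 1) / cGamma (w - al + 1))
                * (csin (pi%:C * (w - al)))^-1 * e w) nu in
  let D := entry (fun w => csin (pi%:C * w)) in
  let E := entry (fun=> csin (pi%:C * al)) in
  mx22 D E E D.

Definition S_block (k : nat) (nu : R[i]) : 'M[R[i]]_2 :=
  if k == 0%N then S_zero nu else S_pos k nu.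

(* The b-th diagonal block, b = 0, ..., 2n - 2, has index ceil(b / 2). *)
Definition S_matrix (nu : R[i]) : 'M[R[i]]_(\sum_(b < n.*2.-1) 2) :=
  \mxdiag_(b < n.*2.-1) S_block (uphalf b) nu.

End WeylFunction.

(* Main.v *)
Require Import Defs.
From HB Require Import structures.
From mathcomp Require Import all_boot all_order all_algebra.
From mathcomp Require Import complex ring lra zify.
From mathcomp Require Import all_classical all_reals all_analysis.
From mathcomp Require Import measurable_realfun.

(** Separation of variables reduces the equation to one ordinary differential
    equation for each angular mode. Put al = |k| / n and
    xi = r^(2n) / (1 + r^(2n)). After removal of a factor r^|k|, the equation of
    mode k is Gauss's hypergeometric equation in xi with parameters - nu,
    nu + 1, 1 + al. Its solution Y(r) = r^|k| F(xi) is regular at 0, and since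
    the metric is invariant under r -> 1/r, which exchanges xi and 1 - xi, the
    function Y(1/r) is a solution regular at infinity ([ysol_sol],
    [radial_sol_inv]). As r -> 0+,

      Y(r) = r^|k| + o(r^|k|),    Y(1/r) = A reg + B sing + o(reg),

    where reg and sing are the regular and the singular radial functions of the
    mode and A, B are connection coefficients ([ysol_inv_zero]). A separated
    solution (a Y(r) + b Y(1/r)) exp(i k theta) therefore has regular and singular
    coefficients a + b A and b B at 0 in mode k, and b + a A and a B at infinity
    in mode - k. Eliminating a and b, the Weyl function couples mode k at 0 with
    mode - k at infinity only, through the matrix with diagonal entries A / B and
    off-diagonal entries 1 / B, with a sign change for k = 0, where the singular
    basis vector is a negative multiple of log r ([weyl_bform]).

    The coefficients are those of the expansion of F at 1. For al > 0 the value
    B = F(1) is a quotient of gamma values by Gauss's theorem, which follows from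
    the contiguous relation between al and al + 1 ([hsum_rgam]), and A comes from
    comparing Taylor coefficients with those of (1 - (1 - x)^al) / al
    ([hF_pos]). For al = 0 the comparison function is - ln (1 - x), and the
    constant term is the limit of the case al > 0 after subtraction of a pole,
    which brings in the digamma function ([hF_zero], [hconst_psi]). Sines enter
    through the reflection formula, itself a consequence of Gauss's theorem at
    al = 1/2, where F is elementary ([rgam_reflection]). The outcome is
    [S_block_con].

    Two facts link separated solutions with arbitrary formal solutions. They
    solve the equation in the distributional sense, by integration by parts in
    polar coordinates ([mode_dist]). Conversely, if u is any formal solution, the
    separated solution E with the same singular data leaves a difference u - E
    that lies in the domain of the Friedrichs extension and is annihilated by
    Delta - lam, so that the resolvent estimate forces it to be null
    ([formal_pi_S]). The same estimate shows that B is not 0 ([conB_neq0]). *)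

Set Implicit Arguments.
Unset Strict Implicit.
Unset Printing Implicit Defensive.

Import Order.TTheory GRing.Theory Num.Theory.
Import numFieldNormedType.Exports.
Import ComplexField.Normc.

Local Open Scope classical_set_scope.
Local Open Scope ring_scope.
Local Open Scope complex_scope.

(** * Complex moduli and limits *)

Section ComplexNorm.
Variable R : realType.
Implicit Types (z w : R[i]).

Lemma normc_ge0 z : 0 <= normc z.
Proof. by case: z => a b; rewrite /= sqrtr_ge0. Qed.

Lemma normrE z : `|z| = (normc z)%:C.
Proof. by case: z. Qed.

Lemma normc_eq0 z : (normc z == 0) = (z == 0).
Proof. by apply/eqP/eqP => [/eq0_normc //|->]; exact: normc0. Qed.

Lemma normc_gt0 z : (0 < normc z) = (z != 0).
Proof. by rewrite lt_neqAle normc_ge0 andbT eq_sym normc_eq0. Qed.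

Lemma normc_real (x : R) : normc x%:C = `|x|.
Proof. by rewrite /= expr0n /= addr0 sqrtr_sqr. Qed.

Lemma normc_nat (m : nat) : normc (m%:R : R[i]) = m%:R.
Proof. by rewrite -(rmorph_nat (real_complex R)) normc_real ger0_norm. Qed.

Lemma Re_le_normc z : `|complex.Re z| <= normc z.
Proof.
by case: z => a b /=; rewrite -sqrtr_sqr ler_wsqrtr// lerDl sqr_ge0.
Qed.

Lemma Im_le_normc z : `|complex.Im z| <= normc z.
Proof.
by case: z => a b /=; rewrite -sqrtr_sqr ler_wsqrtr// lerDr sqr_ge0.
Qed.

Lemma normc_le_ReIm z : normc z <= `|complex.Re z| + `|complex.Im z|.
Proof.
case: z => a b /=.
rewrite -(@ler_pXn2r _ 2) ?nnegrE ?sqrtr_ge0 ?addr_ge0//.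
rewrite sqr_sqrtr ?addr_ge0 ?sqr_ge0// sqrrD !real_normK ?num_real//.
by rewrite lerD2r lerDl mulrn_wge0 // mulr_ge0.
Qed.

Lemma normcB z w : normc (z - w) = normc (w - z).
Proof. by rewrite -normcN opprB. Qed.

Lemma le_dist_normc z w : normc z - normc w <= normc (z - w).
Proof. by rewrite lerBlDr -{1}(subrK w z) le_normcD. Qed.

Lemma dist_normc_le z w : `|normc z - normc w| <= normc (z - w).
Proof.
rewrite ler_norml le_dist_normc andbT lerNl opprB normcB.
exact: le_dist_normc.
Qed.

Lemma normc_sum (I : Type) (s : seq I) (P : pred I) (F : I -> R[i]) :
  normc (\sum_(i <- s | P i) F i) <= \sum_(i <- s | P i) normc (F i).
Proof.
elim/big_ind2 : _ => [|x1 x2 y1 y2 h1 h2|//]; first by rewrite normc0.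
by rewrite (le_trans (le_normcD _ _))// lerD.
Qed.

Lemma ReM z w : complex.Re (z * w)
  = complex.Re z * complex.Re w - complex.Im z * complex.Im w.
Proof. by case: z; case: w. Qed.
Lemma ImM z w : complex.Im (z * w)
  = complex.Re z * complex.Im w + complex.Im z * complex.Re w.
Proof. by case: z; case: w => a b c d /=; ring. Qed.
Lemma ReD z w : complex.Re (z + w) = complex.Re z + complex.Re w.
Proof. by case: z; case: w. Qed.
Lemma ImD z w : complex.Im (z + w) = complex.Im z + complex.Im w.
Proof. by case: z; case: w. Qed.
Lemma ReN z : complex.Re (- z) = - complex.Re z.
Proof. by case: z. Qed.
Lemma ImN z : complex.Im (- z) = - complex.Im z.
Proof. by case: z. Qed.
Lemma ReB z w : complex.Re (z - w) = complex.Re z - complex.Re w.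
Proof. by rewrite ReD ReN. Qed.
Lemma ImB z w : complex.Im (z - w) = complex.Im z - complex.Im w.
Proof. by rewrite ImD ImN. Qed.

Lemma Re_sum (I : Type) (s : seq I) (P : pred I) (F : I -> R[i]) :
  complex.Re (\sum_(i <- s | P i) F i) = \sum_(i <- s | P i) complex.Re (F i).
Proof. by apply: (big_morph _ ReD). Qed.
Lemma Im_sum (I : Type) (s : seq I) (P : pred I) (F : I -> R[i]) :
  complex.Im (\sum_(i <- s | P i) F i) = \sum_(i <- s | P i) complex.Im (F i).
Proof. by apply: (big_morph _ ImD). Qed.

Lemma complexP z w : complex.Re z = complex.Re w ->
  complex.Im z = complex.Im w -> z = w.
Proof. by case: z; case: w => a b c d /= -> ->. Qed.

Lemma rCD (a b : R) : (a + b)%:C = a%:C + b%:C :> R[i].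
Proof. by apply: complexP; rewrite /= ?addr0. Qed.
Lemma rCN (a : R) : (- a)%:C = - a%:C :> R[i].
Proof. by apply: complexP; rewrite /= ?oppr0. Qed.
Lemma rCB (a b : R) : (a - b)%:C = a%:C - b%:C :> R[i].
Proof. by rewrite rCD rCN. Qed.
Lemma rCM (a b : R) : (a * b)%:C = a%:C * b%:C :> R[i].
Proof. by apply: complexP; rewrite /= ?mulr0 ?mul0r ?subr0 ?addr0. Qed.
Lemma rCnat (m : nat) : (m%:R : R)%:C = m%:R :> R[i].
Proof. by elim: m => [//|m IH]; rewrite -!natr1 rCD IH. Qed.
Lemma rCX (a : R) (m : nat) : (a ^+ m)%:C = a%:C ^+ m :> R[i].
Proof. by elim: m => [//|m IH]; rewrite !exprS rCM IH. Qed.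
Lemma rC_eq0 (a : R) : (a%:C == 0 :> R[i]) = (a == 0).
Proof. by apply/eqP/eqP => [[]|->]. Qed.
Lemma rCV (a : R) : (a^-1)%:C = (a%:C)^-1 :> R[i].
Proof.
have [->|a0] := eqVneq a 0; first by rewrite !invr0.
apply: (@mulfI _ a%:C); first by rewrite rC_eq0.
by rewrite -rCM !divff// rC_eq0.
Qed.

Lemma rCprod (m p : nat) (F : nat -> R) :
  (\prod_(m <= j < p) F j)%:C = \prod_(m <= j < p) (F j)%:C :> R[i].
Proof. by elim/big_rec2 : _ => [//|j x y _ <-]; rewrite rCM. Qed.

Lemma rCsum (m p : nat) (F : nat -> R) :
  (\sum_(m <= j < p) F j)%:C = \sum_(m <= j < p) (F j)%:C :> R[i].
Proof. by elim/big_rec2 : _ => [//|j x y _ <-]; rewrite rCD. Qed.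

(** Convergence of complex-valued functions, measured by the real-valued
    modulus so that all estimates take place in R. *)
Definition ctends {T : Type} (F : set_system T) (f : T -> R[i]) (l : R[i]) :=
  (fun x => normc (f x - l)) @ F --> (0 : R).

Section Cvg.
Context {T : Type} (F : set_system T) {FF : Filter F}.
Implicit Types f g : T -> R[i].

Lemma ctendsP f l :
  ctends F f l <-> ((f : T -> R[i]^o) @ F --> (l : R[i]^o)).
Proof.
split => [/cvgrPdist_lt h|/cvgrPdist_lt h]; apply/cvgrPdist_lt => e e0.
- have /complex_realP [r er] : e \is Num.real by rewrite ger0_real // ltW.
  move: e0; rewrite er ltcR => r0; have := h r r0.
  apply: filterS => x; rewrite normrE ltcR sub0r normrN ger0_norm ?normc_ge0//.
  by rewrite normcB.
- have := h e%:C; rewrite ltcR => /(_ e0).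
  apply: filterS => x; rewrite normrE ltcR sub0r normrN ger0_norm ?normc_ge0//.
  by rewrite normcB.
Qed.

Lemma ctends_le f l (b : T -> R) : b @ F --> (0 : R) ->
  (\forall x \near F, normc (f x - l) <= b x) -> ctends F f l.
Proof.
move=> b0 h; apply: (@squeeze_cvgr _ _ _ _ (cst 0) b) => //; last exact: cvg_cst.
by near=> x; rewrite normc_ge0 /=; near: x.
Unshelve. all: by end_near. Qed.

Lemma ctends_ReIm f l :
  (fun x => complex.Re (f x)) @ F --> complex.Re l ->
  (fun x => complex.Im (f x)) @ F --> complex.Im l -> ctends F f l.
Proof.
move=> hr hi; apply: (@ctends_le _ _
   (fun x => `|complex.Re (f x) - complex.Re l| + `|complex.Im (f x) - complex.Im l|)).
- have -> : (0 : R) = `|complex.Re l - complex.Re l| + `|complex.Im l - complex.Im l|.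
    by rewrite !subrr normr0 addr0.
  by apply: cvgD; apply: cvg_norm; apply: cvgB => //; exact: cvg_cst.
- by near=> x; rewrite (le_trans (normc_le_ReIm _))// ReB ImB.
Unshelve. all: by end_near. Qed.

Lemma ctends_lip f l (h : R[i] -> R) :
  (forall z w, `|h z - h w| <= normc (z - w)) ->
  ctends F f l -> (fun x => h (f x)) @ F --> h l.
Proof.
move=> hl /cvgrPdist_lt fl; apply/cvgrPdist_lt => e /fl.
apply: filterS => x; rewrite sub0r normrN ger0_norm ?normc_ge0//.
by apply: le_lt_trans; rewrite normcB.
Qed.

Lemma ctends_Re f l : ctends F f l ->
  (fun x => complex.Re (f x)) @ F --> complex.Re l.
Proof. by apply: ctends_lip => z w; rewrite -ReB Re_le_normc. Qed.

Lemma ctends_Im f l : ctends F f l ->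
  (fun x => complex.Im (f x)) @ F --> complex.Im l.
Proof. by apply: ctends_lip => z w; rewrite -ImB Im_le_normc. Qed.

Lemma ctends_normc f l : ctends F f l ->
  (fun x => normc (f x)) @ F --> normc l.
Proof. by apply: ctends_lip => z w; exact: dist_normc_le. Qed.

Lemma ctends_cst l : ctends F (fun=> l) l.
Proof. by rewrite /ctends subrr normc0; exact: cvg_cst. Qed.

Lemma ctendsD f g l m : ctends F f l -> ctends F g m ->
  ctends F (fun x => f x + g x) (l + m).
Proof.
move=> fl gm; apply: (@ctends_le _ _ (fun x => normc (f x - l) + normc (g x - m))).
  by rewrite -(addr0 0); exact: cvgD.
near=> x; rewrite (_ : f x + g x - (l + m) = (f x - l) + (g x - m)).
  exact: le_normcD.
by ring.
Unshelve. all: by end_near. Qed.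

Lemma ctendsM f g l m : ctends F f l -> ctends F g m ->
  ctends F (fun x => f x * g x) (l * m).
Proof.
move=> fl gm; apply: (@ctends_le _ _
   (fun x => normc (f x) * normc (g x - m) + normc (f x - l) * normc m)).
  rewrite -(addr0 0); apply: cvgD.
    by rewrite -(mulr0 (normc l)); apply: cvgM => //; exact: ctends_normc.
  by rewrite -(mul0r (normc m)); apply: cvgM => //; exact: cvg_cst.
near=> x; rewrite -!normcM.
rewrite (_ : f x * g x - l * m = f x * (g x - m) + (f x - l) * m).
  exact: le_normcD.
by ring.
Unshelve. all: by end_near. Qed.

Lemma ctendsZ (c : R[i]) f l : ctends F f l -> ctends F (fun x => c * f x) (c * l).
Proof. by apply: ctendsM; exact: ctends_cst. Qed.

Lemma ctendsN f l : ctends F f l -> ctends F (fun x => - f x) (- l).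
Proof.
move=> /(@ctendsZ (-1)); rewrite mulN1r.
by under [X in ctends _ X]eq_fun do rewrite mulN1r.
Qed.

Lemma ctendsB f g l m : ctends F f l -> ctends F g m ->
  ctends F (fun x => f x - g x) (l - m).
Proof. by move=> fl /ctendsN; exact: ctendsD. Qed.

Lemma ctendsV f l : l != 0 -> ctends F f l ->
  ctends F (fun x => (f x)^-1) l^-1.
Proof.
move=> l0 fl; apply: (@ctends_le _ _
   (fun x => normc (f x - l) / (normc (f x) * normc l))).
  rewrite -(mul0r (normc l * normc l)^-1); apply: cvgM => //.
  apply: cvgV; first by rewrite mulf_neq0 ?normc_eq0.
  by apply: cvgM; [exact: ctends_normc|exact: cvg_cst].
have f0 : \forall x \near F, 0 < normc (f x).
  by apply: (cvgr_gt _ (ctends_normc fl)); rewrite normc_gt0.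
near=> x; have : 0 < normc (f x) by near: x.
rewrite normc_gt0 => fx0.
rewrite -normcM -normcV -normcM normcB.
rewrite (_ : l^-1 - (f x)^-1 = (f x - l) / (f x * l))//.
by field; rewrite fx0 l0.
Unshelve. all: by end_near. Qed.

Lemma ctends_eq f g l : (\forall x \near F, f x = g x) ->
  ctends F f l -> ctends F g l.
Proof.
move=> fg fl; apply: (@ctends_le _ _ (fun x => normc (f x - l))) => //.
by apply: filterS fg => x ->.
Qed.

Lemma ctends_ext f g l : (forall x, f x = g x) -> ctends F f l -> ctends F g l.
Proof. by move=> /funext ->. Qed.

Lemma ctends_realC (f : T -> R) (l : R) : f @ F --> l ->
  ctends F (fun x => (f x)%:C) l%:C.
Proof. by move=> h; apply: ctends_ReIm => //=; exact: cvg_cst. Qed.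

Lemma ctends0 f : ctends F f 0 <-> (fun x => normc (f x)) @ F --> (0 : R).
Proof. by rewrite /ctends; under eq_fun do rewrite subr0. Qed.
End Cvg.

Lemma rC1B (t : R) : (1 - t)%:C = 1 - t%:C :> R[i].
Proof. exact: rCB. Qed.

Lemma rC1B_neq0 (t : R) : t < 1 -> 1 - t%:C != 0 :> R[i].
Proof. by move=> t1; rewrite -rC1B rC_eq0 gt_eqF// subr_gt0. Qed.

Lemma ctends_uniq {T : Type} (F : set_system T) {FF : ProperFilter F}
  (f : T -> R[i]) l m : ctends F f l -> ctends F f m -> l = m.
Proof. 
move=> /ctendsP h1 /ctendsP h2.
exact: (cvg_unique _ h1 h2).
Qed.

Lemma ctends_normc_le {T : Type} (F : set_system T) {FF : ProperFilter F}
  (f : T -> R[i]) l (M : R) : ctends F f l ->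
  (\forall x \near F, normc (f x) <= M) -> normc l <= M.
Proof.
move=> /ctends_normc hl h; rewrite -(cvg_lim _ hl)//.
by apply: limr_le => //; apply/cvg_ex; eexists; exact: hl.
Qed.

Lemma ctends_lim {T : Type} (F : set_system T) {FF : ProperFilter F}
  (f : T -> R[i]^o) l : ctends F f l -> lim (f @ F) = l.
Proof. by move=> /ctendsP h; apply: cvg_lim. Qed.
End ComplexNorm.

(** * The complex exponential *)

Section Exponential.
Variable R : realType.
Implicit Types (z w : R[i]).

(** Comparison with 1 / (1 - s), whose remainder after the linear term is explicit. *)
Lemma expR_sub2 (s : R) : 0 <= s <= 2^-1 -> expR s - 1 - s <= 2 * s ^+ 2.
Proof.
move=> /andP[s0 s1].
have h : expR s <= (1 - s)^-1.
  rewrite -[expR s]invrK -expRN lef_pV2 ?posrE ?expR_gt0//; last by lra.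
  by have := expR_ge1Dx (- s); lra.
apply: (@le_trans _ _ ((1 - s)^-1 - 1 - s)); first by lra.
have -> : (1 - s)^-1 - 1 - s = s ^+ 2 / (1 - s) by field; lra.
by rewrite mulrC ler_wpM2r ?sqr_ge0// invf_ple ?posrE; lra.
Qed.

Lemma expR_sub2_abs (a : R) : `|a| <= 2^-1 -> `|expR a - 1 - a| <= 2 * a ^+ 2.
Proof.
move=> ha; have h1 := expR_ge1Dx a; rewrite ger0_norm; last by lra.
have [a0|a0] := leP 0 a.
  by apply: expR_sub2; rewrite a0 /=; move: ha; rewrite ger0_norm.
move: ha; rewrite ltr0_norm // => ha.
have h2 := expR_ge1Dx (- a); rewrite expRN in h2.
have h3 : expR a <= (1 - a)^-1.
  by rewrite -[expR a]invrK lef_pV2 ?posrE ?invr_gt0 ?expR_gt0//; lra.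
apply: (@le_trans _ _ ((1 - a)^-1 - 1 - a)); first by lra.
have -> : (1 - a)^-1 - 1 - a = a ^+ 2 / (1 - a) by field; lra.
by rewrite mulrC ler_wpM2r ?sqr_ge0// invf_ple ?posrE; lra.
Qed.

Lemma sin_le_abs (x : R) : `|sin x| <= `|x|.
Proof.
wlog x0 : x / 0 <= x => [h|].
  have [/h //|x0] := leP 0 x.
  by rewrite -normrN -sinN -[leRHS]normrN; apply: h; lra.
have [|c _] := @MVT_segment R (@sin R) cos 0 x x0 (fun x _ => is_derive_sin x).
  by apply: continuous_subspaceT => y; exact: continuous_sin.
rewrite sin0 !subr0 => ->; rewrite normrM ler_piMl//.
by rewrite ler_norml cos_geN1 cos_le1.
Qed.

(** Half-angle formula: 1 - cos x = 2 sin^2 (x/2). *)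
Lemma cos_sub1_abs (x : R) : `|cos x - 1| <= x ^+ 2 / 2.
Proof.
have -> : cos x - 1 = - 2 * sin (x / 2) ^+ 2.
  have -> : cos x = cos (x / 2 *+ 2) by congr cos; rewrite mulr2n -splitr.
  by rewrite cos_mulr2n cos2sin2 mulr2n; ring.
rewrite -normrN mulNr opprK normrM normrX (ger0_norm (_ : 0 <= 2))//.
have : `|sin (x / 2)| ^+ 2 <= `|x / 2| ^+ 2 by rewrite lerXn2r ?nnegrE ?sin_le_abs.
by rewrite [leRHS]real_normK ?num_real//; lra.
Qed.

Lemma sin_sub_abs (x : R) : `|sin x - x| <= 2^-1 * `|x| ^+ 3.
Proof.
wlog x0 : x / 0 <= x => [h|].
  have [/h //|x0] := leP 0 x.
  have -> : sin x - x = - (sin (- x) - - x) by rewrite sinN; ring.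
  by rewrite normrN -[in leRHS](normrN x); apply: h; lra.
have [|c] := @MVT_segment R (@sin R) cos 0 x x0 (fun x _ => is_derive_sin x).
  by apply: continuous_subspaceT => y; exact: continuous_sin.
rewrite in_itv /= => /andP[c0 cx].
rewrite sin0 !subr0 => ->.
have -> : cos c * x - x = (cos c - 1) * x by ring.
rewrite normrM; have := cos_sub1_abs c => h.
rewrite exprSr mulrA ler_wpM2r// (le_trans h)// ger0_norm //.
have : c ^+ 2 <= x ^+ 2 by rewrite lerXn2r ?nnegrE.
by lra.
Qed.

Lemma cexp0 : cexp (0 : R[i]) = 1.
Proof. by rewrite /cexp /polar /= expR0 cos0 sin0 mulr0 mulr1. Qed.

Lemma cexpD z w : cexp (z + w) = cexp z * cexp w.
Proof.
case: z => a b; case: w => c d; rewrite /cexp /polar /= expRD cosD sinD.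
by apply: complexP; rewrite /= ; ring.
Qed.

Lemma cexp_neq0 z : cexp z != 0.
Proof.
apply/negP => /eqP h; have := cexpD z (- z).
by rewrite h mul0r subrr cexp0 => /eqP; rewrite oner_eq0.
Qed.

Lemma cexpN z : cexp (- z) = (cexp z)^-1.
Proof.
apply: (mulfI (cexp_neq0 z)); rewrite -cexpD subrr cexp0 divff//.
exact: cexp_neq0.
Qed.

Lemma cexp_real (x : R) : cexp x%:C = (expR x)%:C.
Proof. by rewrite /cexp /polar /= cos0 sin0 mulr1 mulr0. Qed.

(** The quadratic remainder is what makes infinite products of factors
    (1 + z/j) exp (- z/j) converge absolutely. *)
Lemma cexp_sub1 z : normc z <= 2^-1 -> normc (cexp z - 1 - z) <= 8 * normc z ^+ 2.
Proof.
case: z => a b; set N := normc _ => hN.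
have ha : `|a| <= N := Re_le_normc (a +i* b).
have hb : `|b| <= N := Im_le_normc (a +i* b).
have N0 : 0 <= N := normc_ge0 _.
have aN : a ^+ 2 <= N ^+ 2 by rewrite -real_normK ?num_real// lerXn2r ?nnegrE.
have bN : b ^+ 2 <= N ^+ 2 by rewrite -real_normK ?num_real// lerXn2r ?nnegrE.
have e2 : expR a <= 2.
  have : `|a| <= 2^-1 by lra.
  move=> /expR_sub2_abs; rewrite ler_norml => /andP[_]; rewrite -real_normK ?num_real//.
  have : `|a| ^+ 2 <= 2^-1 ^+ 2 by rewrite lerXn2r ?nnegrE//; lra.
  by have := ler_norm a; lra.
have N2 := sqr_ge0 N.
have h1 : `|expR a - 1 - a| <= 2 * N ^+ 2.
  have : `|a| <= 2^-1 by lra.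
  by move=> /expR_sub2_abs; lra.
rewrite (le_trans (normc_le_ReIm _))//.
rewrite !(ReB, ImB) /=.
have hre : `|expR a * cos b - 1 - a| <= 3 * N ^+ 2.
  have -> : expR a * cos b - 1 - a = (expR a - 1 - a) + expR a * (cos b - 1) by ring.
  rewrite (le_trans (ler_normD _ _))// normrM ger0_norm ?expR_ge0//.
  have : expR a * `|cos b - 1| <= 2 * (b ^+ 2 / 2).
    by rewrite ler_pM ?expR_ge0// cos_sub1_abs.
  by lra.
have him : `|expR a * sin b - 0 - b| <= 5 * N ^+ 2.
  have -> : expR a * sin b - 0 - b = (expR a - 1 - a) * sin b + (a * sin b + (sin b - b)) by ring.
  rewrite (le_trans (ler_normD _ _))// normrM.
  have s1 : `|sin b| <= N by rewrite (le_trans (sin_le_abs _)).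
  have : `|expR a - 1 - a| * `|sin b| <= 2 * N ^+ 2 * 1.
    by rewrite ler_pM//; lra.
  have : `|a * sin b + (sin b - b)| <= 2 * N ^+ 2.
    rewrite (le_trans (ler_normD _ _))// normrM.
    have : `|a| * `|sin b| <= N ^+ 2 by rewrite expr2 ler_pM.
    have := sin_sub_abs b; rewrite (exprS `|b| 2).
    have : `|b| * `|b| ^+ 2 <= 1 * N ^+ 2.
      by rewrite ler_pM ?sqr_ge0 ?lerXn2r ?nnegrE//; lra.
    by lra.
  by lra.
by lra.
Qed.

End Exponential.

(** * Telescoping majorants *)

Section Majorant.
Variable R : realType.
Implicit Types (z w : R[i]) (u x : nat -> R[i]) (b : nat -> R).

(** Convergence of the products and series below is proved by bounding the
    increments of a sequence by those of an explicit decreasing sequence b, which makes tails computable without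
    any theory of absolute convergence. *)
Lemma le_telescope u b (m p : nat) : (m <= p)%N ->
  (forall j, (m <= j)%N -> normc (u j.+1 - u j) <= b j - b j.+1) ->
  normc (u p - u m) <= b m - b p.
Proof.
move=> /subnK <- h; elim: (p - m)%N => [|d IH].
  by rewrite add0n !subrr normc0.
have -> : u (d.+1 + m)%N - u m = (u (d.+1 + m)%N - u (d + m)%N) + (u (d + m)%N - u m).
  by rewrite addrA subrK.
rewrite (le_trans (le_normcD _ _))//.
by have := h (d + m)%N (leq_addl _ _); rewrite addSn; lra.
Qed.

Lemma cvg_telescope u b (m : nat) :
  (forall j, 0 <= b j) ->
  (forall j, (m <= j)%N -> normc (u j.+1 - u j) <= b j - b j.+1) ->
  exists l, ctends \oo u l.
Proof.
move=> b0 h.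
have key (f : R[i] -> R) : (forall z w, `|f z - f w| <= normc (z - w)) ->
    cvgn (fun j => f (u j)).
  move=> fl.
  have db j : b (j + m).+1 <= b (j + m)%N.
    by have := h (j + m)%N (leq_addl _ _); have := normc_ge0 (u (j + m).+1 - u (j + m)%N); lra.
  have cb : cvgn (fun j => b (j + m)%N).
    apply: nonincreasing_is_cvgn.
      by apply/nonincreasing_seqP => j; rewrite addSn.
    by exists 0 => _ [j _ <-].
  have cfb : cvgn (fun j => f (u (j + m)%N) + b (j + m)%N).
    apply: nonincreasing_is_cvgn.
      apply/nonincreasing_seqP => j; rewrite addSn.
      have := fl (u (j + m).+1) (u (j + m)%N); have := h (j + m)%N (leq_addl _ _).
      by rewrite ler_norml => h1 /andP[h2 h3]; lra.
    exists (f (u m) - b m) => _ [j _ <-].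
    have := le_telescope (leq_addl j m) h; have := fl (u (j + m)%N) (u m).
    by have := b0 (j + m)%N; rewrite ler_norml => h1 /andP[h2 h3] h4; lra.
  have : cvgn (fun j => f (u (j + m)%N)).
    rewrite (_ : (fun j => f (u (j + m)%N))
      = (fun j => (f (u (j + m)%N) + b (j + m)%N) - b (j + m)%N)).
      exact: is_cvgB.
    by apply/funext => j; rewrite addrK.
  by move=> /cvg_ex[l]; rewrite (cvg_shiftn m (fun j => f (u j))) => hl; apply/cvg_ex; exists l.
have /cvg_ex[lr hr] : cvgn (fun j => complex.Re (u j)).
  by apply: key => z w; rewrite -ReB Re_le_normc.
have /cvg_ex[li hi] : cvgn (fun j => complex.Im (u j)).
  by apply: key => z w; rewrite -ImB Im_le_normc.
by exists (lr +i* li); exact: ctends_ReIm.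
Qed.

Lemma lim_telescope u b (m : nat) l :
  (forall j, 0 <= b j) ->
  (forall j, (m <= j)%N -> normc (u j.+1 - u j) <= b j - b j.+1) ->
  ctends \oo u l -> normc (l - u m) <= b m.
Proof.
move=> b0 h ul.
have h1 : (fun p => normc (u p - u m)) @ \oo --> normc (l - u m).
  by apply: ctends_normc; apply: ctendsB => //; exact: ctends_cst.
rewrite -(cvg_lim _ h1)//.
apply: limr_le; first by apply/cvg_ex; eexists; exact: h1.
near=> p; have mp : (m <= p)%N by near: p; exact: nbhs_infty_ge.
by rewrite (le_trans (le_telescope mp h))// lerBlDr lerDl.
Unshelve. all: by end_near. Qed.

(** Second-order control of a finite product by its first-order expansion. *)
Lemma prod1D_bounds x b (m p : nat) : (m <= p)%N ->
  (forall j, (m <= j)%N -> normc (x j) <= b j - b j.+1) ->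
  let P := \prod_(m <= j < p) (1 + x j) in
  let s := b m - b p in
  [/\ 0 <= s, normc P <= expR s, normc (P - 1) <= expR s - 1 &
      normc (P - 1 - \sum_(m <= j < p) x j) <= expR s - 1 - s].
Proof.
move=> /subnK <- h; elim: (p - m)%N => [|d [IH0 IH1 IH2 IH3]] /=.
  rewrite add0n !big_geq// !subrr expR0 !subrr normc1 normc0.
  by split.
rewrite addSn !big_nat_recr ?leq_addl//=.
set P := \prod_(_ <= _ < _) _ in IH1 IH2 IH3 *.
set S := \sum_(_ <= _ < _) _ in IH3 *.
set s := b m - b _ in IH0 IH1 IH2 IH3; set y := x _.
have hy := h (d + m)%N (leq_addl _ _).
set t := b (d + m)%N - b (d + m).+1 in hy.
have y0 := normc_ge0 y.
have -> : b m - b (d + m).+1 = s + t by rewrite /s /t; lra.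
have t0 : 0 <= t by lra.
have e1 := expR_ge1Dx t; have es := expR_ge1Dx s.
split; first by lra.
- rewrite normcM expRD ler_pM ?normc_ge0//.
  by rewrite (le_trans (le_normcD _ _))// normc1; lra.
- have -> : P * (1 + y) - 1 = (P - 1) + P * y by ring.
  rewrite (le_trans (le_normcD _ _))// normcM.
  have : normc P * normc y <= expR s * t by rewrite ler_pM ?normc_ge0.
  have : expR s * (1 + t) <= expR s * expR t by rewrite ler_pM2l ?expR_gt0.
  by rewrite expRD; lra.
- have -> : P * (1 + y) - 1 - (S + y) = (P - 1 - S) + (P - 1) * y by ring.
  rewrite (le_trans (le_normcD _ _))// normcM.
  have : normc (P - 1) * normc y <= (expR s - 1) * t.
    by rewrite ler_pM ?normc_ge0//; lra.
  have : expR s * (1 + t) <= expR s * expR t by rewrite ler_pM2l ?expR_gt0.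
  by rewrite expRD; lra.
Qed.

(** The majorant sequence c/j; its increments c/(j(j+1)) dominate every
    quadratically decaying term met below. *)
Definition inv1 (c : R) (j : nat) : R := c / j%:R.

Lemma inv1_ge0 c j : 0 <= c -> 0 <= inv1 c j.
Proof. by move=> c0; rewrite divr_ge0. Qed.

Lemma inv1_1 c : inv1 c 1 = c.
Proof. by rewrite /inv1 mulr1n divr1. Qed.

Lemma inv1B c j : (0 < j)%N -> inv1 c j - inv1 c j.+1 = c / (j%:R * j.+1%:R).
Proof.
move=> j0; rewrite /inv1.
have j1 : (j%:R : R) != 0 by rewrite pnatr_eq0 -lt0n.
have j2 : (j.+1%:R : R) != 0 by rewrite pnatr_eq0.
by field; rewrite addrC natr1 j1 j2.
Qed.

Lemma cvg_inv1 c : inv1 c @ \oo --> (0 : R).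
Proof.
rewrite -(mulr0 c); apply: cvgM; first exact: cvg_cst.
rewrite -(cvg_shiftn 1) /=.
by under eq_fun do rewrite addn1; exact: cvg_harmonic.
Qed.

(** The increments of the logarithm stand in for 1/j, since the definition of
    the gamma function contains m^z = exp (z ln m). *)
Definition dln (j : nat) : R := ln j.+1%:R - ln j%:R.

Lemma dln_le j : (0 < j)%N -> dln j <= j%:R^-1.
Proof.
move=> j0; have j1 : (0 : R) < j%:R by rewrite ltr0n.
rewrite /dln -ln_div ?posrE ?ltr0n//.
have -> : j.+1%:R / j%:R = 1 + j%:R^-1 :> R.
  by rewrite -natr1 mulrDl divff ?gt_eqF// mul1r.
have : 0 < j%:R^-1 :> R by rewrite invr_gt0.
by move=> ?; apply: le_ln1Dx; lra.
Qed.

Lemma dln_ge j : (0 < j)%N -> j.+1%:R^-1 <= dln j.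
Proof.
move=> j0; have j1 : (0 : R) < j%:R by rewrite ltr0n.
have j2 : (0 : R) < j.+1%:R by rewrite ltr0n.
rewrite -[leRHS]opprK lerNr opprB -ln_div ?posrE//.
have -> : j%:R / j.+1%:R = 1 + - j.+1%:R^-1 :> R.
  by rewrite -natr1; field; rewrite natr1 gt_eqF.
apply: le_ln1Dx; rewrite ltrN2 invf_lt1// ltr1n; lia.
Qed.

Lemma dln_ge0 j : (0 < j)%N -> 0 <= dln j.
Proof. by move=> /dln_ge; apply: le_trans; rewrite invr_ge0. Qed.

Lemma dln_near j : (0 < j)%N -> `|dln j - j.+1%:R^-1| <= inv1 1 j - inv1 1 j.+1.
Proof.
move=> j0; have := dln_ge j0; have := dln_le j0; rewrite /inv1 !mul1r => h1 h2.
by rewrite ger0_norm ?lerD2r// subr_ge0.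
Qed.

Lemma invX2_le j : (0 < j)%N -> j%:R^-1 ^+ 2 <= 2 * (inv1 1 j - inv1 1 j.+1).
Proof.
move=> j0; rewrite inv1B//.
have j1 : (0 : R) < j%:R by rewrite ltr0n.
have j2 : (0 : R) < j.+1%:R by rewrite ltr0n.
rewrite mul1r expr2 -invfM -[2 in leRHS]invrK -invfM lef_pV2 ?posrE ?mulr_gt0//.
have h1 : (1 : R) <= j%:R by rewrite ler1n.
rewrite -[j.+1%:R]natr1; move: (j%:R : R) h1 j1 => a h1 a0.
by have := mulr_ge0 (ltW a0) (_ : 0 <= a - 1); rewrite subr_ge0 => /(_ h1); lra.
Qed.
End Majorant.

(** * The reciprocal gamma function *)

Section ReciprocalGamma.
Variable R : realType.
Implicit Types (z w h u : R[i]) (x : nat -> R[i]) (b : nat -> R) (v : R).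

(** The partial products are bounded by exp (b m), so their increments are again
    dominated by a telescoping sequence. *)
Lemma prod1D_cvg x b (m : nat) : (forall j, 0 <= b j) ->
  (forall j, (m <= j)%N -> normc (x j) <= b j - b j.+1) ->
  exists P, ctends \oo (fun p => \prod_(m <= j < p) (1 + x j)) P /\
    normc (P - 1) <= expR (b m) - 1.
Proof.
move=> b0 h; pose P p := \prod_(m <= j < p) (1 + x j).
have E p : (m <= p)%N -> normc (P p) <= expR (b m).
  move=> mp; have [_ h1 _ _] := prod1D_bounds mp h.
  by rewrite (le_trans h1)// ler_expR gerBl.
have [|j mj|l hl] := @cvg_telescope R P (fun j => expR (b m) * b j) m.
- by move=> j; rewrite mulr_ge0 ?expR_ge0.
- rewrite /P big_nat_recr//= -mulrBr.
  have -> : \prod_(m <= i < j) (1 + x i) * (1 + x j) - \prod_(m <= i < j) (1 + x i)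
    = P j * x j by rewrite /P; ring.
  by rewrite normcM ler_pM ?normc_ge0 ?E ?h.
exists l; split => //.
have h1 : (fun p => normc (P p - 1)) @ \oo --> normc (l - 1).
  by apply: ctends_normc; apply: ctendsB => //; exact: ctends_cst.
rewrite -(cvg_lim _ h1)//.
apply: limr_le; first by apply/cvg_ex; eexists; exact: h1.
near=> p; have mp : (m <= p)%N by near: p; exact: nbhs_infty_ge.
have [_ _ h2 _] := prod1D_bounds mp h.
by rewrite (le_trans h2)// lerD2r ler_expR gerBl.
Unshelve. all: by end_near. Qed.

(** First-order expansion in h of one factor of the product for 1/Gamma: the
    terms of order h cancel up to u - v. *)
Lemma factor_bound h u v : 0 <= v -> normc h * v <= 2^-1 ->
  normc ((1 + h * u) * cexp (- (h * v%:C)) - 1 - h * (u - v%:C))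
  <= normc h ^+ 2 * (normc u * v + 8 * v ^+ 2 * (1 + normc h * normc u)).
Proof.
move=> v0 hv; set E := cexp _.
have nv : normc (- (h * v%:C)) = normc h * v.
  by rewrite normcN normcM normc_real ger0_norm.
have hE : normc (E - 1 - - (h * v%:C)) <= 8 * (normc h * v) ^+ 2.
  by rewrite -nv; apply: cexp_sub1; rewrite nv.
rewrite (_ : _ - 1 - _ = (1 + h * u) * (E - 1 - - (h * v%:C)) - h ^+ 2 * u * v%:C); last by ring.
rewrite (le_trans (le_normcD _ _))// normcN !normcM -expr2 normc_real (ger0_norm v0).
have h1 : normc (1 + h * u) <= 1 + normc h * normc u.
  by rewrite (le_trans (le_normcD _ _))// normc1 normcM.
have := ler_pM (normc_ge0 _) (normc_ge0 _) h1 hE.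
by rewrite exprMn; nra.
Qed.

(** The reciprocal of Euler's product. It is entire in z, so working with it
    removes every case distinction at the poles of the gamma function. *)
Definition rg (m : nat) z : R[i] :=
  (\prod_(0 <= j < m.+1) (z + j%:R)) / (m`!%:R * cexp (z * (ln m%:R)%:C)).

Definition rgam z : R[i] := lim ((fun m => rg m z : R[i]^o) @ \oo).

Definition nonpole z := forall j : nat, z + j%:R != 0.

Lemma natC_neq0 (m : nat) : (m.+1%:R : R[i]) != 0.
Proof. by rewrite pnatr_eq0. Qed.

Lemma rgS m z :
  rg m.+1 z = rg m z * ((1 + z / m.+1%:R) * cexp (- (z * (dln R m)%:C))).
Proof.
rewrite /rg big_nat_recr//= factS natrM.
have -> : ln m.+1%:R = ln m%:R + dln R m by rewrite /dln addrC subrK.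
rewrite rCD [z * (_ + _)]mulrDr cexpD cexpN.
set P := \prod_(_ <= _ < _) _; field.
by rewrite !cexp_neq0 /= addrC natr1 natC_neq0 /= pnatr_eq0 -lt0n fact_gt0.
Qed.

(** Splitting off finitely many factors leaves a convergent product whose limit
    is close to 1, hence nonzero. *)
Lemma rg_tail z : exists M, exists P, [/\ P != 0,
  ctends \oo (fun p => \prod_(M <= j < p)
     ((1 + z / j.+1%:R) * cexp (- (z * (dln R j)%:C)))) P &
  forall p, (M <= p)%N -> rg p z = rg M z * \prod_(M <= j < p)
     ((1 + z / j.+1%:R) * cexp (- (z * (dln R j)%:C)))].
Proof.
pose N := normc z; have N0 : 0 <= N := normc_ge0 z.
pose C := N + 2 * N ^+ 2 * (9 + 8 * N).
have C0 : 0 <= C by rewrite addr_ge0// mulr_ge0 ?addr_ge0 ?mulr_ge0 ?sqr_ge0.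
(* 2 N <= M makes the exponents small enough for factor_bound; 4 C <= M makes
   the tail product differ from 1 by less than 1. *)
have [M hM] : exists M : nat, (0 < M)%N /\ 2 * N <= M%:R /\ 4 * C <= M%:R.
  exists (Num.truncn (2 * N + 4 * C)).+1; split => //.
  by have := truncnS_gt (2 * N + 4 * C); lra.
have [M0 [MN MC]] := hM.
pose x j := (1 + z / j.+1%:R) * cexp (- (z * (dln R j)%:C)) - 1.
have hx j : (M <= j)%N -> normc (x j) <= inv1 C j - inv1 C j.+1.
  move=> Mj; have j0 : (0 < j)%N by exact: leq_trans Mj.
  have jr : (0 : R) < j%:R by rewrite ltr0n.
  have dj := dln_le R j0; have dj0 := dln_ge0 R j0.
  have MjR : (M%:R : R) <= j%:R by rewrite ler_nat.
  have ij : (j%:R : R)^-1 <= 1 by rewrite invf_le1// ler1n.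
  have hd : normc z * dln R j <= 2^-1.
    apply: (@le_trans _ _ (N * j%:R^-1)); first by rewrite ler_wpM2l.
    by rewrite ler_pdivrMr//; lra.
  set uj : R[i] := (j.+1%:R)^-1.
  have nu : normc uj = j.+1%:R^-1 by rewrite normcV normc_nat.
  have nu1 : normc uj <= j%:R^-1.
    by rewrite nu lef_pV2 ?posrE ?ltr0n// ler_nat.
  have fb := factor_bound uj dj0 hd.
  have du : normc (uj - (dln R j)%:C) <= inv1 1 j - inv1 1 j.+1.
    have -> : uj - (dln R j)%:C = - (dln R j - j.+1%:R^-1)%:C.
      by rewrite /uj (rCB (dln R j)) opprB rCV rCnat.
    by rewrite normcN normc_real dln_near.
  set D := inv1 1 j - inv1 1 j.+1 in du.
  have -> : inv1 C j - inv1 C j.+1 = C * D by rewrite /D /inv1 !mul1r mulrBr.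
  have D0 : 0 <= D := le_trans (normc_ge0 _) du.
  have j2 := invX2_le R j0; rewrite -/D in j2.
  rewrite (_ : x j = (1 + z * uj) * cexp (- (z * (dln R j)%:C)) - 1
      - z * (uj - (dln R j)%:C) + z * (uj - (dln R j)%:C)); last by rewrite subrK.
  rewrite (le_trans (le_normcD _ _))// normcM.
  have h1 : normc z * normc (uj - (dln R j)%:C) <= N * D by rewrite ler_wpM2l.
  have h2 : normc uj * dln R j <= 2 * D.
    by rewrite (le_trans _ j2)// expr2 ler_pM ?normc_ge0.
  have h3 : dln R j ^+ 2 <= 2 * D.
    by rewrite (le_trans _ j2)// lerXn2r ?nnegrE// ltW// invr_gt0.
  have h4 : dln R j ^+ 2 * (1 + normc z * normc uj) <= 2 * D * (1 + N).
    rewrite ler_pM ?sqr_ge0 ?addr_ge0 ?mulr_ge0 ?normc_ge0//.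
    by rewrite lerD2l ler_piMr// (le_trans nu1).
  have h5 : normc z ^+ 2 * (normc uj * dln R j + 8 * dln R j ^+ 2 * (1 + normc z * normc uj))
     <= N ^+ 2 * (2 * D * (9 + 8 * N)).
    rewrite ler_wpM2l ?sqr_ge0//; lra.
  rewrite (le_trans (lerD fb h1))// (le_trans (lerD h5 (lexx _)))// /C.
  by lra.
have [P [hP1 hP2]] := prod1D_cvg (fun j => inv1_ge0 j C0) hx.
exists M, P; split.
- apply/eqP => P0; move: hP2; rewrite P0 sub0r normcN normc1.
  have : expR (inv1 C M) - 1 - inv1 C M <= 2 * inv1 C M ^+ 2.
    apply: expR_sub2; rewrite inv1_ge0//= ler_pdivrMr ?ltr0n//; lra.
  have : inv1 C M <= 4^-1 by rewrite ler_pdivrMr ?ltr0n//; lra.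
  have := inv1_ge0 M C0; move: (inv1 C M) => t t0 t1.
  have : t * t <= t * 4^-1 by rewrite ler_wpM2l.
  by rewrite expr2; lra.
- by move: hP1; under [X in ctends _ X]eq_fun do under eq_bigr do rewrite /x addrC subrK.
- move=> p /subnK <-; elim: (p - M)%N => [|d IH].
    by rewrite add0n big_geq// mulr1.
  by rewrite addSn rgS IH big_nat_recr ?leq_addl//= -mulrA.
Qed.

Lemma rg_cvg z : ctends \oo (rg^~ z) (rgam z).
Proof.
have [M [P [_ hP h]]] := rg_tail z.
have hl : ctends \oo (rg^~ z) (rg M z * P).
  apply: ctends_eq (ctendsZ (rg M z) hP).
  by near=> p; rewrite (h p)//; near: p; exact: nbhs_infty_ge.
by rewrite /rgam (ctends_lim hl).
Unshelve. all: by end_near. Qed.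

Lemma rg_neq0 z m : nonpole z -> rg m z != 0.
Proof.
move=> hz; rewrite /rg mulf_neq0//.
  by rewrite prodf_seq_neq0; apply/allP => j _ /=; exact: hz.
by rewrite invr_eq0 mulf_neq0 ?cexp_neq0// pnatr_eq0 -lt0n fact_gt0.
Qed.

(** A finite product of nonzero factors times the nonzero tail. *)
Lemma rgam_neq0 z : nonpole z -> rgam z != 0.
Proof.
have [M [P [P0 hP h]]] := rg_tail z => hz.
have hl : ctends \oo (rg^~ z) (rg M z * P).
  apply: ctends_eq (ctendsZ (rg M z) hP).
  by near=> p; rewrite (h p)//; near: p; exact: nbhs_infty_ge.
by rewrite (ctends_uniq (rg_cvg z) hl) mulf_neq0 ?rg_neq0.
Unshelve. all: by end_near. Qed.

Lemma rg_pole z (j m : nat) : z + j%:R = 0 -> (j <= m)%N -> rg m z = 0.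
Proof.
move=> zj jm; rewrite /rg big_mkord (bigD1 (inord j)) //= inordK ?ltnS//.
by rewrite zj !mul0r.
Qed.

Lemma rgam_pole z (j : nat) : z + j%:R = 0 -> rgam z = 0.
Proof.
move=> zj; apply: ctends_uniq (rg_cvg z) _.
apply: ctends_eq (@ctends_cst _ _ \oo _ 0).
by near=> m; rewrite (rg_pole zj)//; near: m; exact: nbhs_infty_ge.
Unshelve. all: by end_near. Qed.

Lemma nonpoleP z : nonpole z \/ exists j : nat, z + j%:R = 0.
Proof.
have [h|h] := pselect (exists j : nat, z + j%:R = 0); first by right.
by left => j; apply/eqP => zj; apply: h; exists j.
Qed.

Lemma rgam_neq0P z : rgam z != 0 -> nonpole z.
Proof.
have [//|[j /rgam_pole ->]] := nonpoleP z.
by rewrite eqxx.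
Qed.

Lemma cGammaE z : cGamma z = (rgam z)^-1.
Proof.
have e : (fun m : nat => m`!%:R * cexp (z * (ln m%:R)%:C)
     / (\prod_(0 <= j < m.+1) (z + j%:R))) = (fun m => (rg m z)^-1).
  by apply/funext => m; rewrite /rg invfM invrK mulrC.
rewrite /cGamma e; apply: ctends_lim.
have [hz|[j zj]] := nonpoleP z.
  by apply: ctendsV (rg_cvg z); exact: rgam_neq0.
rewrite (rgam_pole zj) invr0; apply: ctends_eq (@ctends_cst _ _ \oo _ 0).
by near=> m; rewrite (rg_pole zj) ?invr0//; near: m; exact: nbhs_infty_ge.
Unshelve. all: by end_near. Qed.

Lemma ctends_natV : ctends \oo (fun m : nat => (m%:R : R[i])^-1) 0.
Proof.
rewrite (_ : (fun _ => _) = fun m : nat => (inv1 1 m)%:C).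
  by apply: ctends_realC; exact: (@cvg_inv1 R 1).
by apply/funext => m; rewrite /inv1 mul1r rCV rCnat.
Qed.

(** The finite products satisfy the functional equation up to the factor
    1 + (z + 1)/m, which tends to 1. *)
Lemma rgamD1 z : rgam z = z * rgam (z + 1).
Proof.
apply: (@ctends_uniq _ _ \oo _ (fun m => (1 + (z + 1) / m%:R) * rg m z)).
  rewrite -[X in ctends _ _ X]mul1r; apply: ctendsM (rg_cvg z).
  rewrite -[X in ctends _ _ X]addr0; apply: ctendsD; first exact: ctends_cst.
  by rewrite -(mulr0 (z + 1)); apply: ctendsZ; exact: ctends_natV.
have key m : (0 < m)%N -> z * rg m (z + 1) = (1 + (z + 1) / m%:R) * rg m z; last first.
  apply: ctends_eq (ctendsZ z (rg_cvg (z + 1))).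
  by near=> m; apply: key; near: m; exact: nbhs_infty_gt.
case: m => // m _.
rewrite /rg [in RHS]big_nat_recl//= [in LHS]big_nat_recr//=.
have -> : \prod_(0 <= i < m.+1) (z + i.+1%:R) = \prod_(0 <= i < m.+1) (z + 1 + i%:R).
  by apply: eq_bigr => i _; rewrite -natr1 addrA addrAC.
rewrite addr0 !mulrDl mul1r cexpD cexp_real lnK ?posrE ?ltr0n// rCnat.
set P := \prod_(_ <= _ < _) _.
have f0 : ((m.+1)`!%:R : R[i]) != 0 by rewrite pnatr_eq0 -lt0n fact_gt0.
have c0 := cexp_neq0 (z * (ln m.+1%:R)%:C).
by field; rewrite f0 c0 addrC natr1 natC_neq0.
Unshelve. all: by end_near. Qed.

Lemma prodD1_nat m : \prod_(0 <= j < m) (1 + j%:R) = (m`!)%:R :> R[i].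
Proof.
elim: m => [|m IH]; first by rewrite big_geq.
by rewrite big_nat_recr//= IH factS natrM mulrC addrC natr1.
Qed.

Lemma rgam1 : rgam 1 = 1.
Proof.
apply: ctends_uniq (rg_cvg 1) _.
have key m : (0 < m)%N -> 1 + (m%:R)^-1 = rg m 1 :> R[i]; last first.
  apply: (@ctends_eq _ _ _ _ (fun m => 1 + (m%:R)^-1)); last first.
    rewrite -[X in ctends _ _ X]addr0; apply: ctendsD; first exact: ctends_cst.
    exact: ctends_natV.
  by near=> m; apply: key; near: m; exact: nbhs_infty_gt.
case: m => // m _.
rewrite /rg prodD1_nat mul1r cexp_real lnK ?posrE ?ltr0n// rCnat.
rewrite [(m.+2)`!]factS natrM -[m.+2%:R]natr1.
have f0 : ((m.+1)`!%:R : R[i]) != 0 by rewrite pnatr_eq0 -lt0n fact_gt0.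
by field; rewrite f0 addrC natr1 natC_neq0.
Unshelve. all: by end_near. Qed.
End ReciprocalGamma.

(** * Complex derivatives with quadratic remainder *)

Section QuadraticDerivative.
Variable R : realType.
Implicit Types (z w h d : R[i]) (f g : R[i] -> R[i]).

(** Complex differentiability with a quadratic remainder: it holds for every
    analytic function and, being free of filters, is easy to combine. *)
Definition qder f z d := exists C delta : R, [/\ 0 <= C, 0 < delta &
  forall h, normc h <= delta -> normc (f (z + h) - f z - h * d) <= C * normc h ^+ 2].

Lemma qder_lip f z d : qder f z d -> exists C delta : R, [/\ 0 <= C, 0 < delta &
  forall h, normc h <= delta -> normc (f (z + h) - f z) <= C * normc h].
Proof.
move=> [C [e [C0 e0 H]]]; exists (C * e + normc d), e; split => //.
  by rewrite addr_ge0 ?normc_ge0 ?mulr_ge0// ltW.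
move=> h he; rewrite -(subrK (h * d) (f (z + h) - f z)) (le_trans (le_normcD _ _))//.
rewrite normcM; have := H _ he; have n0 := normc_ge0 h.
have : C * normc h ^+ 2 <= C * e * normc h.
  by rewrite expr2 mulrA ler_wpM2r// ler_wpM2l.
by rewrite mulrDl [normc d * _]mulrC; lra.
Qed.

Lemma qder_ctends f z d : qder f z d ->
  ctends (nbhs (z : R[i]^o)) f (f z).
Proof.
move=> /qder_lip[C [e [C0 e0 H]]].
have idz : ctends (nbhs (z : R[i]^o)) id z by apply/ctendsP; exact: cvg_id.
apply: (@ctends_le _ _ _ _ _ _ (fun w => C * normc (w - z))).
  by rewrite -(mulr0 C); apply: cvgM => //; exact: cvg_cst.
have := idz => /cvgrPdist_lt/(_ e e0); apply: filterS => w.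
rewrite sub0r normrN ger0_norm ?normc_ge0// => we.
by have := H (w - z) (ltW we); rewrite [z + _]addrC subrK.
Qed.

Lemma dnbhs0_normc :
  (fun h : R[i]^o => normc h) @ (0 : R[i]^o)^' --> (0 : R).
Proof.
apply/ctends0/ctendsP => /=.
by move=> A A0; apply: (@nbhs_dnbhs _ (0 : R[i]^o) A A0).
Qed.

Lemma dnbhs0_neq : \forall h \near (0 : R[i]^o)^', (h : R[i]) != 0.
Proof. exact: (@nbhs_dnbhs_neq (R[i]^o) 0). Qed.

Lemma qder_quot f z d : qder f z d ->
  ctends ((0 : R[i]^o)^') (fun h => h^-1 * (f (h + z) - f z)) d.
Proof.
move=> [C [e [C0 e0 H]]].
apply: (@ctends_le _ _ _ _ _ _ (fun h => C * normc h)).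
  by rewrite -(mulr0 C); apply: cvgM; [exact: cvg_cst|exact: dnbhs0_normc].
have := dnbhs0_normc => /cvgrPdist_lt/(_ e e0) hn.
near=> h.
have h0 : h != 0 by near: h; exact: dnbhs0_neq.
have he : normc h < e.
  near: h; apply: filterS hn => h.
  by rewrite sub0r normrN ger0_norm ?normc_ge0.
have := H h (ltW he); rewrite (_ : _ - _ - _ = h * (h^-1 * (f (h + z) - f z) - d)); last first.
  by rewrite [z + h]addrC; field.
rewrite normcM expr2 mulrCA ler_pM2l// normc_gt0//.
Unshelve. all: by end_near. Qed.

Lemma qder_derive1 f z d : qder f z d ->
  derive1 (f : R[i]^o -> R[i]^o) (z : R[i]^o) = d.
Proof. by move=> /qder_quot/ctends_lim. Qed.

Lemma qder_uniq f z d d' : qder f z d -> qder f z d' -> d = d'.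
Proof. by move=> /qder_derive1 <- /qder_derive1 <-. Qed.

Lemma qderM f g z d e : qder f z d -> qder g z e ->
  qder (fun w => f w * g w) z (d * g z + f z * e).
Proof.
move=> hf hg; have [L1 [e1 [L10 e10 H1]]] := qder_lip hf.
have [L2 [e2 [L20 e20 H2]]] := qder_lip hg.
move: hf hg => [C1 [e3 [C10 e30 H3]]] [C2 [e4 [C20 e40 H4]]].
exists (L1 * L2 + C1 * normc (g z) + normc (f z) * C2).
exists (Num.min (Num.min e1 e2) (Num.min e3 e4)); split.
- by rewrite !addr_ge0 ?mulr_ge0 ?normc_ge0.
- by rewrite !lt_min e10 e20 e30 e40.
move=> h; rewrite !le_min => /andP[/andP[h1 h2] /andP[h3 h4]].
rewrite (_ : _ - _ - _ = (f (z + h) - f z) * (g (z + h) - g z)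
  + (f (z + h) - f z - h * d) * g z + f z * (g (z + h) - g z - h * e)); last by ring.
rewrite (le_trans (le_normcD _ _))// [leRHS]mulrDl lerD//; last first.
  by rewrite normcM -mulrA ler_wpM2l ?normc_ge0// H4.
rewrite (le_trans (le_normcD _ _))// [leRHS]mulrDl lerD//; last first.
  by rewrite normcM mulrAC ler_wpM2r ?normc_ge0// H3.
rewrite normcM expr2 mulrACA ler_pM ?normc_ge0//; [exact: H1|exact: H2].
Qed.

Lemma qder_aff f z d (a c : R[i]) : a != 0 -> qder f (a * z + c) d ->
  qder (fun w => f (a * w + c)) z (a * d).
Proof.
move=> a0 [C [e [C0 e0 H]]]; have na : 0 < normc a by rewrite normc_gt0.
exists (C * normc a ^+ 2), (e / normc a); split.
- by rewrite mulr_ge0// sqr_ge0.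
- by rewrite divr_gt0.
move=> h; rewrite ler_pdivlMr// => he.
have := H (a * h); rewrite normcM mulrC => /(_ he).
rewrite (_ : a * (z + h) + c = a * z + c + h * a); last by ring.
by rewrite [a * h]mulrC mulrA exprMn mulrA [_ * normc a ^+ 2]mulrAC mulrAC.
Qed.

Lemma qder_ext f g z d : (forall w, f w = g w) -> qder f z d -> qder g z d.
Proof. by move=> /funext ->. Qed.

Lemma qder_scale (c : R[i]) f z d : qder f z d -> qder (fun w => c * f w) z (c * d).
Proof.
move=> [C [e [C0 e0 H]]]; exists (normc c * C), e; split => //.
  by rewrite mulr_ge0 ?normc_ge0.
move=> h he; rewrite (_ : _ - _ - _ = c * (f (z + h) - f z - h * d)); last by ring.
by rewrite normcM -mulrA ler_wpM2l ?normc_ge0// H.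
Qed.

Lemma qderD f g z d e : qder f z d -> qder g z e ->
  qder (fun w => f w + g w) z (d + e).
Proof.
move=> [C1 [e1 [C10 e10 H1]]] [C2 [e2 [C20 e20 H2]]].
exists (C1 + C2), (Num.min e1 e2); split; first exact: addr_ge0.
  by rewrite lt_min e10 e20.
move=> h; rewrite le_min => /andP[h1 h2].
rewrite (_ : _ - _ - _ = (f (z + h) - f z - h * d) + (g (z + h) - g z - h * e)); last by ring.
by rewrite (le_trans (le_normcD _ _))// [leRHS]mulrDl lerD ?H1 ?H2.
Qed.

Lemma qder_cexp z : qder (@cexp R) z (cexp z).
Proof.
exists (normc (cexp z) * 8), 2^-1; split => //.
  by rewrite mulr_ge0 ?normc_ge0.
move=> h hh; rewrite cexpD (_ : _ - _ - _ = cexp z * (cexp h - 1 - h)); last by ring.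
by rewrite normcM -mulrA ler_wpM2l ?normc_ge0// cexp_sub1.
Qed.

Lemma qder_csin z : qder (@csin R) z (ccos z).
Proof.
have i0 : ('i%C : R[i]) != 0 by rewrite eq_complex /= oner_eq0 andbF.
have h1 := qder_cexp ('i%C * z + 0).
have h2 := qder_cexp (- 'i%C * z + 0).
have := qderD (qder_scale (2 * 'i%C)^-1 (qder_aff i0 h1))
  (qder_scale (- (2 * 'i%C)^-1) (qder_aff _ h2)).
rewrite oppr_eq0 i0 => /(_ isT).
rewrite !addr0 !mulNr.
have -> : (2 * 'i%C)^-1 * ('i%C * cexp ('i%C * z))
   - (2 * 'i%C)^-1 * (- ('i%C * cexp (- ('i%C * z)))) = ccos z.
  by rewrite /ccos; field; rewrite i0.
by apply: qder_ext => w; rewrite !addr0 !mulNr /csin; field; rewrite i0.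
Qed.

(** Logarithmic differentiation without logarithms: the ratio of the products at
    z + h and z is again a product of factors close to 1, and the second-order
    product bounds identify its first-order term in h. *)
Lemma qder_rgam z : nonpole z -> exists S, ctends \oo
  (fun m => \sum_(1 <= j < m) ((z + j%:R)^-1 - (dln R j)%:C)) S /\
  qder (@rgam R) z (rgam z * (z^-1 + S)).
Proof.
move=> hz.
have [K [K1 hK]] : exists K : R, 1 <= K /\
    forall j, (0 < j)%N -> normc (z + j%:R)^-1 <= K / j%:R.
  pose J := (Num.truncn (2 * normc z)).+1.
  have J0 : 2 * normc z < J%:R := truncnS_gt (2 * normc z).
  pose K0 := \sum_(0 <= i < J) i%:R * normc (z + i%:R)^-1.
  have K00 : 0 <= K0.
    by apply: sumr_ge0 => i _; rewrite mulr_ge0 ?normc_ge0.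
  exists (2 + K0); split; first by lra.
  move=> j j0; have jr : (0 : R) < j%:R by rewrite ltr0n.
  rewrite ler_pdivlMr// mulrC.
  have [jJ|jJ] := ltnP j J.
    have : j%:R * normc (z + j%:R)^-1 <= K0.
      rewrite /K0 big_mkord (bigD1 (Ordinal jJ))//= lerDl.
      by apply: sumr_ge0 => i _; rewrite mulr_ge0 ?normc_ge0.
    by lra.
  have zj : 2^-1 * j%:R <= normc (z + j%:R).
    have JR : (J%:R : R) <= j%:R by rewrite ler_nat.
    have := le_normcD (z + j%:R) (- z).
    by rewrite normcN (_ : z + j%:R - z = j%:R) ?normc_nat; [lra|ring].
  have : j%:R * normc (z + j%:R)^-1 <= 2; last by lra.
  rewrite normcV ler_pdivrMr; first by lra.
  by rewrite normc_gt0.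
have K0 : 0 <= K by lra.
pose D (j : nat) : R := inv1 1 j - inv1 1 j.+1.
pose u j := (z + j%:R)^-1; pose v j := dln R j.
pose c j := u j - (v j)%:C.
pose C0 := K * normc (1 - z) + 1.
pose C1 := 2 * K + 16 * (1 + K).
have n1 := normc_ge0 (1 - z).
have C00 : 0 <= C0 by rewrite addr_ge0 ?mulr_ge0.
have C10 : 0 <= C1 by rewrite /C1; lra.
have DE j t : t * D j = inv1 t j - inv1 t j.+1.
  by rewrite /D /inv1 !mul1r mulrBr.
have base j : (0 < j)%N -> [/\ 0 <= D j, normc (c j) <= C0 * D j,
    normc (u j) * v j <= 2 * K * D j, v j ^+ 2 <= 2 * D j & normc (u j) <= K].
  move=> j0; have jr : (0 : R) < j%:R by rewrite ltr0n.
  have j2 := invX2_le R j0; rewrite -/(D j) in j2.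
  have dj := dln_le R j0; have dj0 := dln_ge0 R j0.
  have D0 : 0 <= D j by have := sqr_ge0 (j%:R^-1 : R); lra.
  have ij : (j%:R : R)^-1 <= 1 by rewrite invf_le1// ler1n.
  have hu := hK j j0; rewrite -/(u j) in hu.
  split => //.
  - rewrite (_ : c j = (u j - (j.+1%:R)^-1) - (v j - j.+1%:R^-1)%:C); last first.
      by rewrite rCB rCV rCnat /c; ring.
    rewrite (le_trans (le_normcD _ _))// normcN normc_real /C0 [leRHS]mulrDl mul1r lerD//; last first.
      exact: dln_near.
    have -> : u j - (j.+1%:R)^-1 = (1 - z) * u j / j.+1%:R.
      rewrite /u -natr1; field; rewrite hz/=.
      by rewrite natr1 natC_neq0.
    rewrite !normcM (normcV j.+1%:R) normc_nat /D inv1B// mul1r invfM.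
    rewrite [K * _]mulrC -!mulrA ler_wpM2l// [leRHS]mulrA ler_wpM2r ?invr_ge0//.
  - apply: (@le_trans _ _ (K / j%:R * j%:R^-1)).
      by rewrite ler_pM ?normc_ge0.
    by rewrite -mulrA -expr2 [2 * K]mulrC -mulrA ler_wpM2l.
  - by rewrite (le_trans _ j2)// lerXn2r ?nnegrE// ltW// invr_gt0.
  - by rewrite (le_trans hu)// ler_piMr.
have [S hS] : exists S, ctends \oo (fun m => \sum_(1 <= j < m) c j) S.
  apply: (@cvg_telescope _ _ (inv1 C0) 1) => [j|j j1]; first exact: inv1_ge0.
  rewrite big_nat_recr//= [_ + c j]addrC addrK -DE.
  by have [] := base j j1.
exists S; split => //.
pose C2 := C0 + C1; have C20 : 0 <= C2 by rewrite addr_ge0.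
pose C3 := 2 * C2 ^+ 2 + C1.
have C30 : 0 <= C3 by rewrite addr_ge0// mulr_ge0 ?sqr_ge0.
pose y h j := (1 + h * u j) * cexp (- (h * (v j)%:C)) - 1.
have hy1 h j : normc h <= 2^-1 -> (0 < j)%N -> normc (y h j - h * c j) <= normc h ^+ 2 * C1 * D j.
  move=> hh j0; have [D0 h1 h2 h3 h4] := base j j0; have n0 := normc_ge0 h.
  have v1 : v j <= 1.
    by rewrite (le_trans (dln_le R j0))// invf_le1 ?ltr0n// ler1n.
  have v0 : 0 <= v j := dln_ge0 R j0.
  apply: (le_trans (factor_bound _ v0 _)).
    by rewrite (le_trans (_ : _ <= normc h * 1))// ?ler_wpM2l// mulr1.
  rewrite -[leRHS]mulrA ler_wpM2l ?sqr_ge0// /C1 [leRHS]mulrDl lerD//.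
  have -> : 16 * (1 + K) * D j = 8 * (2 * D j) * (1 + K) by ring.
  have hv8 : 8 * v j ^+ 2 <= 8 * (2 * D j) by rewrite ler_wpM2l.
  have hk : 1 + normc h * normc (u j) <= 1 + K.
    have h1' : normc h <= 1 by lra.
    by have := ler_pM n0 (normc_ge0 (u j)) h1' h4; rewrite mul1r lerD2l.
  apply: ler_pM hv8 hk; first by rewrite mulr_ge0 ?sqr_ge0.
  by rewrite addr_ge0// mulr_ge0 ?normc_ge0.
have hP h : normc h <= 2^-1 -> C2 * normc h <= 2^-1 -> exists P,
    ctends \oo (fun m => \prod_(1 <= j < m) (1 + y h j)) P /\
    normc (P - 1 - h * S) <= C3 * normc h ^+ 2.
  move=> hh hC; have n0 := normc_ge0 h.
  have hy j : (1 <= j)%N -> normc (y h j) <= inv1 (C2 * normc h) j - inv1 (C2 * normc h) j.+1.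
    move=> j0; have [D0 h1 h2 h3 h4] := base j j0.
    rewrite -DE -(subrK (h * c j) (y h j)) (le_trans (le_normcD _ _))//.
    have := hy1 h j hh j0; rewrite normcM.
    have : normc h * normc (c j) <= normc h * (C0 * D j) by rewrite ler_wpM2l.
    have : normc h ^+ 2 * (C1 * D j) <= normc h * (C1 * D j).
      rewrite ler_wpM2r ?mulr_ge0// expr2 ler_piMr//; lra.
    rewrite /C2; lra.
  have b0 j : 0 <= inv1 (C2 * normc h) j by rewrite inv1_ge0 ?mulr_ge0.
  have [P [hP _]] := prod1D_cvg b0 hy; exists P; split => //.
  have hl : ctends \oo (fun m => \prod_(1 <= j < m) (1 + y h j) - 1 - h * \sum_(1 <= j < m) c j)
     (P - 1 - h * S).
    apply: ctendsB; last exact: ctendsZ.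
    by apply: ctendsB => //; exact: ctends_cst.
  rewrite -(cvg_lim _ (ctends_normc hl))//.
  apply: limr_le; first by apply/cvg_ex; eexists; exact: (ctends_normc hl).
  near=> p; have mp : (1 <= p)%N by near: p; exact: nbhs_infty_ge.
  have [s0 _ _ h2] := prod1D_bounds mp hy.
  set s := inv1 _ 1 - _ in s0 h2.
  have sle : s <= C2 * normc h.
    by rewrite /s inv1_1 gerBl.
  have hs : normc (\prod_(1 <= j < p) (1 + y h j) - 1 - \sum_(1 <= j < p) y h j) <= 2 * C2 ^+ 2 * normc h ^+ 2.
    rewrite (le_trans h2)//.
    have : expR s - 1 - s <= 2 * s ^+ 2 by apply: expR_sub2; rewrite s0; lra.
    have : s ^+ 2 <= (C2 * normc h) ^+ 2 by rewrite lerXn2r ?nnegrE ?mulr_ge0.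
    by rewrite exprMn; lra.
  have hd : normc (\sum_(1 <= j < p) y h j - h * \sum_(1 <= j < p) c j) <= C1 * normc h ^+ 2.
    have := @le_telescope R (fun m => \sum_(1 <= j < m) y h j - h * \sum_(1 <= j < m) c j)
       (inv1 (normc h ^+ 2 * C1)) 1 p mp.
    rewrite [X in _ - (X - _)]big_geq// [X in _ - (_ - _ * X)]big_geq// mulr0 !subr0.
    rewrite inv1_1 => H; apply: (le_trans (H _)).
      move=> j j0; rewrite !big_nat_recr//= -DE.
      by rewrite (_ : _ - _ = y h j - h * c j); [exact: hy1|ring].
    by rewrite [C1 * _]mulrC gerBl inv1_ge0// mulr_ge0 ?sqr_ge0.
  rewrite (_ : _ - _ - _ = (\prod_(1 <= j < p) (1 + y h j) - 1 - \sum_(1 <= j < p) y h j)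
    + (\sum_(1 <= j < p) y h j - h * \sum_(1 <= j < p) c j)); last by ring.
  by rewrite (le_trans (le_normcD _ _))// /C3 [leRHS]mulrDl lerD.
have z0 : z != 0 by have := hz 0; rewrite addr0.
have ratio h m : (0 < m)%N -> rg m (z + h) = rg m z * (1 + h / z) * (1 + h * u m)
    * \prod_(1 <= j < m) (1 + y h j).
  elim: m => // -[|m] IH _.
    rewrite big_geq// mulr1 /rg !big_nat_recr//= !big_geq// !mul1r ln1 !mulr0 cexp0.
    by have hz1 := hz 1%N; rewrite !addr0 /u; field; rewrite z0 hz1.
  have alg (a e E1 E2 : R[i]) : a != 0 -> a + 1 != 0 -> e != 0 ->
      (1 + h / a) * ((1 + ((a + 1 - e) + h) / e) * (E1 * E2))
      = ((1 + (a + 1 - e) / e) * E1) * (1 + h / (a + 1)) * ((1 + h / a) * E2).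
    by move=> h1 h2 h3; field; rewrite h1 h2 h3.
  have hyE : 1 + y h m.+1 = (1 + h * u m.+1) * cexp (- (h * (v m.+1)%:C)).
    by rewrite /y addrC subrK.
  have zE : z + m.+1%:R + 1 - m.+2%:R = z by rewrite -[m.+2%:R]natr1; ring.
  have := alg (z + m.+1%:R) m.+2%:R (cexp (- (z * (v m.+1)%:C)))
     (cexp (- (h * (v m.+1)%:C))) (hz _) _ (natC_neq0 _ _).
  rewrite zE -addrA natr1 => /(_ (hz _)) {}alg.
  rewrite rgS IH// [in RHS]rgS [in RHS]big_nat_recr//= hyE.
  rewrite [(z + h) * _%:C]mulrDl opprD cexpD -/(v _).
  set P := \prod_(_ <= _ < _) _; set r := rg _ _.
  transitivity (r * (1 + h / z) * P * ((1 + h / (z + m.+1%:R)) * ((1 + (z + h) / m.+2%:R)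
     * (cexp (- (z * (v m.+1)%:C)) * cexp (- (h * (v m.+1)%:C)))))).
    by rewrite /u; ring.
  by rewrite alg /u; ring.
have nz : 0 < normc z by rewrite normc_gt0.
pose Q := normc (rgam z) * (C3 + normc z^-1 * (normc S + C3)).
exists Q, (Num.min 2^-1 (2 * (C2 + 1))^-1); split.
- by rewrite /Q mulr_ge0 ?normc_ge0// addr_ge0// mulr_ge0 ?normc_ge0// addr_ge0 ?normc_ge0.
- by rewrite lt_min !invr_gt0 mulr_gt0//; lra.
move=> h; rewrite le_min => /andP[hh]; have n0 := normc_ge0 h.
rewrite -[(_ * _)^-1]mul1r ler_pdivlMr ?mulr_gt0//; last by lra.
move=> hC; have hC2 : C2 * normc h <= 2^-1 by nra.
have [P [hP1 hP2]] := hP h hh hC2.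
have um : ctends \oo (fun m => 1 + h * u m) 1.
  rewrite -[X in ctends _ _ X]addr0; apply: ctendsD; first exact: ctends_cst.
  apply/ctends0; apply: (@squeeze_cvgr _ _ _ _ (cst 0) (inv1 (normc h * K))).
  - near=> m; rewrite normc_ge0/= normcM /inv1 -mulrA ler_wpM2l// hK//.
    by near: m; exact: nbhs_infty_gt.
  - exact: cvg_cst.
  - exact: cvg_inv1.
have e : rgam (z + h) = rgam z * (1 + h / z) * 1 * P.
  apply: ctends_uniq (rg_cvg (z + h)) _.
  apply: (@ctends_eq _ _ _ _ (fun m => rg m z * (1 + h / z) * (1 + h * u m)
      * \prod_(1 <= j < m) (1 + y h j))).
    by near=> m; rewrite ratio//; near: m; exact: nbhs_infty_gt.
  apply: ctendsM => //; apply: ctendsM => //; apply: ctendsM; first exact: rg_cvg.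
  exact: ctends_cst.
rewrite e (_ : _ - _ - _ = rgam z * ((P - 1 - h * S) + h * z^-1 * (P - 1))); last first.
  by field.
have hP3 : normc (P - 1) <= (normc S + C3) * normc h.
  rewrite -(subrK (h * S) (P - 1)) (le_trans (le_normcD _ _))// normcM.
  have : C3 * normc h ^+ 2 <= C3 * normc h by rewrite ler_wpM2l// expr2 ler_piMr//; lra.
  by lra.
rewrite normcM /Q -[leRHS]mulrA ler_wpM2l ?normc_ge0// (le_trans (le_normcD _ _))//.
rewrite [leRHS]mulrDl lerD// !normcM.
have := ler_wpM2l (mulr_ge0 n0 (normc_ge0 z^-1)) hP3.
by rewrite expr2; lra.
Unshelve. all: by end_near. Qed.

(** The series - 1/z + sum (ln (1 + 1/j) - 1/(z + j)), minus the logarithmic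
    derivative of 1/Gamma. *)
Definition psi z : R[i] := - (z^-1 + lim ((fun m : nat =>
  \sum_(1 <= j < m) ((z + j%:R)^-1 - (dln R j)%:C) : R[i]^o) @ \oo)).

Lemma psi_cvg z : nonpole z -> ctends \oo
  (fun m => \sum_(1 <= j < m) ((z + j%:R)^-1 - (dln R j)%:C)) (- psi z - z^-1).
Proof.
move=> hz; have [S [hS _]] := qder_rgam hz.
by rewrite /psi (ctends_lim hS) opprK addrC addKr.
Qed.

Lemma rgam_qder z : nonpole z -> qder (@rgam R) z (- psi z * rgam z).
Proof.
move=> hz; have [S [hS h]] := qder_rgam hz.
by rewrite /psi (ctends_lim hS) opprK mulrC.
Qed.
End QuadraticDerivative.

(** * The digamma function and Euler's constant *)

Section Digamma.
Variable R : realType.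
Implicit Types (z w h d : R[i]) (f g : R[i] -> R[i]).

Lemma qder_inv_derive1 f z d : f z != 0 -> qder f z d ->
  derive1 ((fun w => (f w)^-1) : R[i]^o -> R[i]^o) (z : R[i]^o) = - d / f z ^+ 2.
Proof.
move=> fz0 fd; apply: ctends_lim.
have fc : ctends ((0 : R[i]^o)^') (fun h => f (h + z)) (f z).
  have [C [e [C0 e0 H]]] := qder_lip fd.
  apply: (@ctends_le _ _ _ _ _ _ (fun h => C * normc h)).
    by rewrite -(mulr0 C); apply: cvgM; [exact: cvg_cst|exact: dnbhs0_normc].
  have := @dnbhs0_normc R => /cvgrPdist_lt/(_ e e0); apply: filterS => h.
  rewrite sub0r normrN ger0_norm ?normc_ge0// => he.
  by rewrite [h + z]addrC H// ltW.
have q := ctendsM (ctendsN (qder_quot fd)) (ctendsV (mulf_neq0 fz0 fz0) (ctendsM fc (@ctends_cst _ _ ((0 : R[i]^o)^') _ (f z)))).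
have fn0 : \forall h \near (0 : R[i]^o)^', 0 < normc (f (h + z)).
  by apply: (cvgr_gt _ (ctends_normc fc)); rewrite normc_gt0.
have alg (x a b : R[i]) : x != 0 -> a != 0 -> b != 0 ->
    - (x^-1 * (a - b)) / (a * b) = x^-1 * (a^-1 - b^-1).
  by move=> h1 h2 h3; field; rewrite h1 h2 h3.
rewrite expr2.
apply: (@ctends_eq _ _ ((0:R[i]^o)^') _ (fun h => - (h^-1*(f (h+z)-f z)) * (f (h+z) * f z)^-1)); last exact: q.
near=> h.
have h0 : h != 0 by near: h; exact: dnbhs0_neq.
have : 0 < normc (f (h + z)) by near: h.
by rewrite normc_gt0 => fh; exact: alg.
Unshelve. all: by end_near. Qed.

Lemma digammaE z : nonpole z -> digamma z = psi z.
Proof.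
move=> hz; rewrite /digamma.
have -> : @cGamma R = (fun w => (rgam w)^-1) by apply/funext => w; exact: cGammaE.
rewrite (qder_inv_derive1 (rgam_neq0 hz) (rgam_qder hz)).
by have h := rgam_neq0 hz; field.
Qed.

Lemma nonpole1 : nonpole (1 : R[i]).
Proof. by move=> j; rewrite addrC natr1 natC_neq0. Qed.

(** Up to sign, the partial sums of psi at z = 1 are harmonic sums minus logarithms. *)
Lemma euler_gammaE : (euler_gamma R)%:C = - psi (1 : R[i]).
Proof.
have h := psi_cvg nonpole1; rewrite invr1 in h.
have e m : \sum_(1 <= j < m.+1) ((1 + j%:R)^-1 - (dln R j)%:C) + 1
   = (\sum_(1 <= k < m.+2) k%:R^-1 - ln m.+1%:R)%:C :> R[i].
  elim: m => [|m IH].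
    by rewrite big_geq// big_nat1 ln1 add0r mulr1n invr1 subr0.
  rewrite big_nat_recr//= addrAC IH [in RHS]big_nat_recr//=.
  by rewrite [1 + m.+1%:R]addrC natr1 /dln !(rCB, rCD) rCV rCnat; ring.
have h1 : ctends \oo (fun m => (\sum_(1 <= k < m.+1) k%:R^-1 - ln m%:R)%:C) (- psi (1 : R[i])).
  rewrite -[X in ctends _ _ X](subrK 1).
  apply: (@ctends_eq _ _ _ _ (fun m => \sum_(1 <= j < m) ((1 + j%:R)^-1 - (dln R j)%:C) + 1)).
    near=> m; have : (0 < m)%N by near: m; exact: nbhs_infty_gt.
    by move=> /prednK <-; rewrite e.
  by apply: ctendsD => //; exact: ctends_cst.
have hR := ctends_Re h1; have hI := ctends_Im h1.
apply: complexP; first by rewrite /euler_gamma /=; apply: cvg_lim => //; exact: hR.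
have {}hI : (fun=> 0 : R) @ \oo --> complex.Im (- psi (1 : R[i])) by exact: hI.
by rewrite /= -(cvg_lim _ hI)// lim_cst.
Unshelve. all: by end_near. Qed.
End Digamma.

(** * Hypergeometric coefficients *)

Section HypergeometricCoefficients.
Variable R : realType.
Implicit Types (al : R) (m : nat).
Variable lam : R[i].

(** Taylor coefficients of the hypergeometric function with parameters - nu,
    nu + 1 and 1 + al. Only lam = nu (nu + 1) enters, since
    (j - nu) (j + nu + 1) = j (j + 1) - lam. *)
Definition hc al m : R[i] := \prod_(0 <= j < m)
  ((j%:R * j.+1%:R - lam) / (j.+1%:R * (j.+1%:R + al%:C))).

(** Taylor coefficients of (1 - (1 - x)^al) / al, or of - ln (1 - x) when al = 0:
    the comparison series carrying the singular behaviour at x = 1. *)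
Definition qc al m : R :=
  if m is m'.+1 then (\prod_(0 <= j < m') (j.+1%:R - al)) / (m'.+1)`!%:R else 0.

(** The product m! / ((1 + al) ... (m + al)), by which the coefficients for
    exponent al differ from those for exponent 0. *)
Definition tprod al m : R := \prod_(0 <= j < m) (j.+1%:R / (j.+1%:R + al)).

(** The ratio of the hypergeometric coefficients to the comparison coefficients. *)
Definition rho al m : R[i] := - lam / (1 + al%:C) * \prod_(0 <= j < m)
  (1 + (al%:C * (1 + al%:C) - lam) / ((j.+2%:R + al%:C) * (j.+1%:R - al%:C))).

Lemma hc0 al : hc al 0 = 1. Proof. by rewrite /hc big_geq. Qed.

Lemma natD_neq0 al (j : nat) : 0 <= al -> (j.+1%:R + al%:C : R[i]) != 0.
Proof. by move=> a0; rewrite -rCnat -rCD rC_eq0 gt_eqF// ltr_wpDr// ltr0n. Qed.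

Lemma hcS al m : 0 <= al ->
  m.+1%:R * (m.+1%:R + al%:C) * hc al m.+1 = (m%:R * m.+1%:R - lam) * hc al m.
Proof.
move=> a0; rewrite /hc big_nat_recr//=.
have n0 := natC_neq0 R m; have d0 := natD_neq0 m a0.
by move: (m.+1%:R : R[i]) (al%:C) n0 d0 => c a n0 d0; field; rewrite n0 d0.
Qed.

Lemma qcS al m : m.+2%:R * qc al m.+2 = (m.+1%:R - al) * qc al m.+1.
Proof.
rewrite /qc big_nat_recr//= [m.+2`!]factS natrM.
have f0 : ((m.+1)`!%:R : R) != 0 by rewrite pnatr_eq0 -lt0n fact_gt0.
have m0 : (m.+2%:R : R) != 0 by rewrite pnatr_eq0.
move: (\prod_(_ <= _ < _) _) (_`!%:R : R) (m.+2%:R : R) f0 m0 => P f c f0 c0.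
by field; rewrite c0 f0.
Qed.

Lemma qc1 al : qc al 1 = 1.
Proof. by rewrite /qc big_geq// divr1. Qed.

Lemma qc_ge0 al m : al <= 1 -> 0 <= qc al m.
Proof.
case: m => //= m a1; rewrite divr_ge0// prodr_ge0// => j _.
by rewrite subr_ge0 (le_trans a1)// ler1n.
Qed.

Lemma qc0 m : qc 0 m.+1 = m.+1%:R^-1.
Proof.
elim: m => [|m IH]; first by rewrite qc1 invr1.
have m0 : (m.+2%:R : R) != 0 by rewrite pnatr_eq0.
apply: (mulfI m0); rewrite qcS IH subr0 !divff// pnatr_eq0//.
Qed.

Lemma hc_rho al m : 0 <= al < 1 -> hc al m.+1 = rho al m * (qc al m.+1)%:C.
Proof.
move=> /andP[a0 a1]; elim: m => [|m IH].
  rewrite qc1 mulr1 /rho /hc big_nat1 big_geq//.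
  by rewrite !mulr1; congr (_ / _); ring.
have d1 := natD_neq0 m.+1 a0.
have d2 : (m.+1%:R - al%:C : R[i]) != 0.
  rewrite -rCnat -rCB rC_eq0 gt_eqF// subr_gt0 (lt_le_trans a1)// ler1n//.
have n2 := natC_neq0 R m.+1.
apply: (mulfI (mulf_neq0 n2 d1)); rewrite hcS// IH.
rewrite /rho [in RHS]big_nat_recr//=.
set P := \prod_(_ <= _ < _) _; set r := - lam / _.
have -> : m.+2%:R * (m.+2%:R + al%:C) * (r * (P * (1 + (al%:C * (1 + al%:C) - lam) /
    ((m.+2%:R + al%:C) * (m.+1%:R - al%:C)))) * (qc al m.+2)%:C)
  = (m.+2%:R + al%:C) * (r * (P * (1 + (al%:C * (1 + al%:C) - lam) /
    ((m.+2%:R + al%:C) * (m.+1%:R - al%:C))))) * (m.+2%:R * (qc al m.+2)%:C) by ring.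
have -> : m.+2%:R * (qc al m.+2)%:C = (m.+1%:R - al%:C) * (qc al m.+1)%:C.
  by rewrite -(rCnat R m.+2) -rCM qcS rCM rCB rCnat.
clearbody P r; move: ((qc al m.+1)%:C) => q.
move: d1 d2; rewrite -[m.+2%:R]natr1; move: (m.+1%:R : R[i]) (al%:C) => c a d1 d2.
by field; rewrite d1 d2.
Qed.

Lemma rho_factor al j : 0 <= al < 1 ->
  normc ((al%:C * (1 + al%:C) - lam) / ((j.+2%:R + al%:C) * (j.+1%:R - al%:C)))
  <= inv1 (normc (al%:C * (1 + al%:C) - lam) / (1 - al)) j.+1
    - inv1 (normc (al%:C * (1 + al%:C) - lam) / (1 - al)) j.+2.
Proof.
move=> /andP[a0 a1]; rewrite inv1B// normcM -mulrA ler_wpM2l ?normc_ge0//.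
rewrite normcV normcM -(rCnat R j.+2) -(rCnat R j.+1) -rCD -rCB !normc_real.
have j1 : (1 : R) <= j.+1%:R by rewrite ler1n.
have j2 : (0 : R) < j.+2%:R by rewrite ltr0n.
move: (j.+1%:R : R) (j.+2%:R : R) j1 j2 => c d c1 d0.
rewrite (ger0_norm (_ : 0 <= d + al)); last by lra.
rewrite (ger0_norm (_ : 0 <= c - al)); last by lra.
have h1 : (1 - al) * c <= c - al by have := ler_wpM2l a0 c1; lra.
have h0 : 0 < (1 - al) * c by rewrite mulr_gt0//; lra.
have hd : d <= d + al by lra.
rewrite -invfM lef_pV2 ?posrE ?mulr_gt0//; [|by lra..].
by have := ler_pM (ltW d0) (ltW h0) hd h1; lra.
Qed.

Lemma rho_cvg al : 0 <= al < 1 -> exists kap M, [/\ 0 <= M, ctends \oo (rho al) kap,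
  (forall m, normc (rho al m) <= M) &
  forall m, normc (rho al m - kap) <= M / m.+1%:R].
Proof.
move=> ha; have /andP[a0 a1] := ha.
set C := normc (al%:C * (1 + al%:C) - lam) / (1 - al).
have C0 : 0 <= C by rewrite divr_ge0 ?normc_ge0// subr_ge0 ltW.
pose b j := inv1 C j.+1.
pose x j := (al%:C * (1 + al%:C) - lam) / ((j.+2%:R + al%:C) * (j.+1%:R - al%:C)).
have b0 j : 0 <= b j by exact: inv1_ge0.
have hx j : (0 <= j)%N -> normc (x j) <= b j - b j.+1 by move=> _; exact: rho_factor.
pose r := normc (- lam / (1 + al%:C)).
have r0 : 0 <= r := normc_ge0 _.
pose M := r * expR (b 0).
have M0 : 0 <= M by rewrite mulr_ge0 ?expR_ge0.
have hr m : normc (rho al m) <= M.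
  rewrite normcM ler_wpM2l//; have [_ h _ _] := prod1D_bounds (leq0n m) hx.
  by rewrite (le_trans h)// ler_expR gerBl.
have step j : (0 <= j)%N -> normc (rho al j.+1 - rho al j) <= M * b j - M * b j.+1.
  move=> _; rewrite {1}/rho big_nat_recr//= -/(x j).
  rewrite (_ : _ - _ = rho al j * x j); last by rewrite /rho; ring.
  by rewrite normcM -mulrBr ler_pM ?normc_ge0// hx.
have Mb0 j : 0 <= M * b j by rewrite mulr_ge0.
have [kap hk] := cvg_telescope Mb0 step.
exists kap, (M + M * C); split => //.
- by rewrite addr_ge0// mulr_ge0.
- by move=> m; rewrite (le_trans (hr m))// lerDl mulr_ge0.
move=> m; rewrite normcB (le_trans (lim_telescope Mb0 (fun j _ => step j (leq0n j)) hk))//.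
by rewrite /b /inv1 mulrA ler_wpM2r ?invr_ge0// lerDr.
Qed.

(** The limit of the ratio of coefficients: hc and kap times qc have the same
    leading asymptotics, so that their difference is summable. *)
Definition kap al : R[i] := lim ((fun m => rho al m : R[i]^o) @ \oo).

Lemma kap_spec al : 0 <= al < 1 -> exists M, [/\ 0 <= M, ctends \oo (rho al) (kap al),
  (forall m, normc (rho al m) <= M) &
  forall m, normc (rho al m - kap al) <= M / m.+1%:R].
Proof.
move=> /rho_cvg[k [M [h1 h2 h3 h4]]].
by exists M; rewrite /kap (ctends_lim h2).
Qed.

Lemma rg_prod (z : R[i]) m :
  \prod_(0 <= j < m.+1) (z + j%:R) = rg m z * (m`!%:R * cexp (z * (ln m%:R)%:C)).
Proof.
rewrite /rg mulfVK// mulf_neq0 ?cexp_neq0// pnatr_eq0 -lt0n fact_gt0//.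
Qed.

Lemma natD_nonpole al : 0 < al -> nonpole (al%:C).
Proof. by move=> a0 j; rewrite -rCnat -rCD rC_eq0 gt_eqF// ltr_wpDr. Qed.

Lemma natD1_nonpole al : 0 <= al -> nonpole (1 + al%:C).
Proof.
move=> a0 j; rewrite (_ : 1 + al%:C + j%:R = j.+1%:R + al%:C) ?natD_neq0//.
by rewrite -natr1; ring.
Qed.

Section WithNu.
Variable nu : R[i].
Hypothesis hnu : lam = nu * (nu + 1).

Lemma num_prod m : \prod_(0 <= j < m) (j%:R * j.+1%:R - lam)
  = \prod_(0 <= j < m) (- nu + j%:R) * \prod_(0 <= j < m) (1 + nu + j%:R).
Proof. by rewrite -big_split; apply: eq_bigr => j _ /=; rewrite hnu -natr1; ring. Qed.

(** Both products defining the ratio are quotients of Euler products; the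
    factorials and the powers of m cancel because the arguments - nu, 1 + nu
    and 1 + al, 1 - al have the same sum up to integers. *)
Lemma kap_rgam al : 0 <= al < 1 -> kap al
  = rgam (- nu) * rgam (1 + nu) / (rgam (1 + al%:C) * rgam (1 - al%:C)).
Proof.
move=> ha; have /andP[a0 a1] := ha; have [M [_ hk _ _]] := kap_spec ha.
have np1 := natD1_nonpole a0.
have np2 : nonpole (1 - al%:C).
  move=> j; have -> : 1 - al%:C + j%:R = (1 - al + j%:R)%:C by rewrite rCD rCB rCnat.
  rewrite rC_eq0 gt_eqF//.
  by rewrite ltr_wpDr// subr_gt0.
have hc_rg m : rho al m.+1 = rg m.+1 (- nu) * rg m.+1 (1 + nu) / (rg m.+1 (1 + al%:C) * rg m.+1 (1 - al%:C))
    * (1 + (1 - al%:C) / m.+1%:R).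
  have q0 : qc al m.+2 != 0.
    rewrite /qc mulf_neq0 ?invr_eq0 ?pnatr_eq0 -?lt0n ?fact_gt0//.
    rewrite prodf_seq_neq0; apply/allP => j _ /=; rewrite gt_eqF// subr_gt0.
    by rewrite (lt_le_trans a1)// ler1n.
  have qC0 : (qc al m.+2)%:C != 0 by rewrite rC_eq0.
  apply: (mulIf qC0); rewrite -hc_rho//.
  rewrite {1}/hc big_split /= num_prod prodfV big_split /=.
  have e1 : \prod_(0 <= j < m.+2) (j.+1%:R + al%:C) = \prod_(0 <= j < m.+2) (1 + al%:C + j%:R).
    by apply: eq_bigr => j _; rewrite -natr1; ring.
  have e2 : \prod_(0 <= j < m.+2) j.+1%:R = (m.+2)`!%:R :> R[i].
    rewrite -prodD1_nat; apply: eq_bigr => j _; by rewrite addrC natr1.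
  have e3 : (qc al m.+2)%:C = (\prod_(0 <= j < m.+2) (1 - al%:C + j%:R)) / (1 - al%:C + m.+1%:R) / (m.+2)`!%:R.
    rewrite [in RHS]big_nat_recr//= mulfK ?np2// /qc rCM rCV rCnat; congr (_ / _).
    by rewrite rCprod; apply: eq_bigr => j _; rewrite rCB rCnat -natr1; ring.
  rewrite e3 e1 e2 !rg_prod !mulrDl !mulNr !cexpD !cexpN !mul1r.
  have := rg_neq0 m.+1 np1; have := rg_neq0 m.+1 np2; have := np2 m.+1.
  have := cexp_neq0 (nu * (ln m.+1%:R)%:C).
  have := cexp_neq0 (al%:C * (ln m.+1%:R)%:C).
  have f1 : ((m.+2)`!%:R : R[i]) != 0 by rewrite pnatr_eq0 -lt0n fact_gt0.
  have f2 : ((m.+1)`!%:R : R[i]) != 0 by rewrite pnatr_eq0 -lt0n fact_gt0.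
  have f3 := natC_neq0 R m.
  rewrite cexp_real lnK ?posrE ?ltr0n// rCnat.
  move: (rg _ (- nu)) (rg _ (1 + nu)) (rg _ (1 + _)) (rg _ (1 - _)) => r1 r2 r3 r4.
  move: (cexp (al%:C * (ln m.+1%:R)%:C)) => A.
  move: (cexp (nu * (ln m.+1%:R)%:C)) => E.
  move: ((m.+1)`!%:R : R[i]) f2 => F F0.
  move: ((m.+2)`!%:R : R[i]) f1 => G G0.
  move: (m.+1%:R : R[i]) f3 => c c0.
  move: (al%:C) => a A0 E0 h1 h2 h3.
  by field; do ?[apply/andP; split].
apply: ctends_uniq hk _.
apply: (@ctends_eq _ _ _ _ (fun m => rg m (- nu) * rg m (1 + nu) / (rg m (1 + al%:C) * rg m (1 - al%:C))
    * (1 + (1 - al%:C) / m%:R))).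
  near=> m; have : (0 < m)%N by near: m; exact: nbhs_infty_gt.
  by move=> /prednK <-; rewrite hc_rg.
rewrite -[X in ctends _ _ X]mulr1; apply: ctendsM; last first.
  rewrite -[X in ctends _ _ X]addr0; apply: ctendsD; first exact: ctends_cst.
  by rewrite -(mulr0 (1 - al%:C)); apply: ctendsZ; exact: ctends_natV.
apply: ctendsM; first by apply: ctendsM; exact: rg_cvg.
apply: ctendsV; first by rewrite mulf_neq0 ?rgam_neq0.
by apply: ctendsM; exact: rg_cvg.
Unshelve. all: by end_near. Qed.
End WithNu.
End HypergeometricCoefficients.

(** * Gauss's summation *)

Section GaussSum.
Variable R : realType.
Implicit Types (al : R) (m : nat).

Lemma tprod0 al : tprod al 0 = 1. Proof. by rewrite /tprod big_geq. Qed.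

Lemma tprodS al m : tprod al m.+1 = tprod al m * (m.+1%:R / (m.+1%:R + al)).
Proof. by rewrite /tprod big_nat_recr. Qed.

Lemma nat_gt0 m : (0 : R) < m.+1%:R. Proof. by rewrite ltr0n. Qed.

Lemma tprod_gt0 al m : 0 <= al -> 0 < tprod al m.
Proof.
move=> a0; elim: m => [|m IH]; first by rewrite tprod0.
by rewrite tprodS mulr_gt0// divr_gt0 ?ltr0n// ltr_wpDr// ltr0n.
Qed.

Lemma tprod_ge0 al m : 0 <= al -> 0 <= tprod al m.
Proof. by move=> a0; rewrite ltW// tprod_gt0. Qed.

Lemma tprod_diff al m : 0 <= al -> tprod al m - tprod al m.+1 = al / m.+1%:R * tprod al m.+1.
Proof.
move=> a0; rewrite tprodS; have := nat_gt0 m; move: (m.+1%:R : R) (tprod al m) => c t c0.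
by field; rewrite !gt_eqF// ltr_wpDr.
Qed.

Lemma tprod_le1 al m : 0 <= al -> tprod al m <= 1.
Proof.
move=> a0; elim: m => [|m IH]; first by rewrite tprod0.
rewrite (le_trans _ IH)// -subr_ge0 tprod_diff// mulr_ge0 ?divr_ge0//.
by rewrite tprod_ge0.
Qed.

Lemma tprod_ge al m : 0 <= al -> 1 - tprod al m <= al * m%:R.
Proof.
move=> a0; elim: m => [|m IH]; first by rewrite tprod0 subrr mulr0.
rewrite -[m.+1%:R]natr1 mulrDr mulr1.
have : tprod al m - tprod al m.+1 <= al.
  rewrite tprod_diff// -mulrA ler_piMr// mulrC ler_pdivrMr ?ltr0n// mul1r.
  by rewrite (le_trans (tprod_le1 _ a0))// ler1n.
by lra.
Qed.

(** A Bernoulli-type bound; the decay 1 / (1 + al ln (m + 1)) is crude but suffices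
    for the boundary terms of telescoping sums. *)
Lemma tprod_ln al m : 0 <= al -> tprod al m * (1 + al * ln m.+1%:R) <= 1.
Proof.
move=> a0; elim: m => [|m IH]; first by rewrite tprod0 ln1 mulr0 addr0 mulr1.
rewrite (le_trans _ IH)// tprodS -mulrA ler_wpM2l ?tprod_ge0//.
have -> : ln m.+2%:R = ln m.+1%:R + dln R m.+1 by rewrite /dln addrC subrK.
have := dln_le R (ltn0Sn m); have l0 : 0 <= ln m.+1%:R :> R by rewrite ln_ge0// ler1n.
have := nat_gt0 m; move: (m.+1%:R : R) (dln R m.+1) l0 => c d l0 c0 dc.
rewrite [leLHS]mulrAC ler_pdivrMr ?ltr_wpDr//.
have : c * d <= 1 by rewrite -ler_pdivlMl// mulr1.
have := mulr_ge0 a0 (mulr_ge0 a0 l0).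
by move=> h1 /(ler_wpM2l a0); lra.
Qed.

Lemma cvg_ln_nat : (fun m => ln m.+1%:R : R) @ \oo --> +oo.
Proof.
apply/cvgryPge => A; near=> m.
rewrite -[A]expRK ler_ln ?posrE ?expR_gt0 ?ltr0n//.
rewrite (@le_trans _ _ m%:R)// ?ler_nat//.
by near: m; exact: nbhs_infty_ger.
Unshelve. all: by end_near. Qed.

Lemma tprod_cvg0 al : 0 < al -> tprod al @ \oo --> (0 : R).
Proof.
move=> a0; apply/cvgrPdist_le => e e0.
have := cvg_ln_nat => /cvgryPge/(_ (e^-1 / al)) h.
near=> m; rewrite sub0r normrN ger0_norm ?tprod_ge0 ?(ltW a0)//.
have := tprod_ln m (ltW a0).
have : e^-1 / al <= ln m.+1%:R by near: m.
rewrite ler_pdivrMr// mulrC => h1 h2.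
have t0 := tprod_gt0 m (ltW a0).
rewrite -(@ler_pM2r _ e^-1) ?invr_gt0// divff ?gt_eqF//.
apply: le_trans h2; rewrite ler_wpM2l ?(ltW t0)//; lra.
Unshelve. all: by end_near. Qed.

Variable lam : R[i].

Lemma hc_tprod al m : 0 <= al -> hc lam al m = hc lam 0 m * (tprod al m)%:C.
Proof.
move=> a0; elim: m => [|m IH]; first by rewrite !hc0 tprod0 mulr1.
have n0 := natC_neq0 R m; have d0 := natD_neq0 m a0.
apply: (mulfI (mulf_neq0 n0 d0)); rewrite hcS// IH tprodS rCM rCM rCV rCD rCnat.
have := @hcS R lam 0 m (lexx 0); rewrite addr0.
move: (hc lam 0 m) (hc lam 0 m.+1) (m.+1%:R : R[i]) (al%:C) n0 d0 => h h' c a n0 d0 e.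
transitivity (c * c * h' * (tprod al m)%:C); first by rewrite e mulrA.
by field; rewrite d0.
Qed.

Lemma hc_bound : exists M, 0 <= M /\ forall al m, 0 <= al ->
  normc (hc lam al m.+1) <= M / m.+1%:R * tprod al m.+1.
Proof.
have h01 : 0 <= (0 : R) < 1 by rewrite lexx ltr01.
have [M [M0 _ hM _]] := kap_spec lam h01.
exists M; split => // al m a0.
rewrite hc_tprod// normcM normc_real ger0_norm ?tprod_ge0// ler_wpM2r ?tprod_ge0//.
rewrite hc_rho// normcM qc0 normc_real ger0_norm ?invr_ge0//.
by rewrite ler_wpM2r ?invr_ge0.
Qed.

(** Summability of the coefficients for al > 0, in telescoping form. *)
Lemma hc_diff : exists M, 0 <= M /\ forall al m, 0 < al ->
  normc (hc lam al m.+1) <= M / al * tprod al m - M / al * tprod al m.+1.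
Proof.
have [M [M0 hM]] := hc_bound; exists M; split => // al m a0.
rewrite (le_trans (hM al m (ltW a0)))// -mulrBr tprod_diff ?(ltW a0)//.
move: (m.+1%:R : R) (nat_gt0 m) (tprod al m.+1) => c c0 t.
rewrite (_ : M / al * (al / c * t) = M / c * t)//.
by field; rewrite !gt_eqF.
Qed.

(** The value at x = 1 of the hypergeometric function, al > 0. *)
Definition hsum al : R[i] :=
  lim ((fun N => \sum_(0 <= m < N) hc lam al m : R[i]^o) @ \oo).

Lemma hsum_spec : exists M, 0 <= M /\ forall al, 0 < al ->
  ctends \oo (fun N => \sum_(0 <= m < N) hc lam al m) (hsum al) /\
  normc (hsum al - 1) <= M / al.
Proof.
have [M [M0 hM]] := hc_diff; exists M; split => // al a0.
pose b N := M / al * tprod al N.-1.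
have b0 j : 0 <= b j by rewrite mulr_ge0 ?divr_ge0 ?tprod_ge0 ?(ltW a0)//.
have step j : (1 <= j)%N -> normc (\sum_(0 <= m < j.+1) hc lam al m - \sum_(0 <= m < j) hc lam al m)
   <= b j - b j.+1.
  case: j => // j _; rewrite big_nat_recr//= [_ + hc _ _ _]addrC addrK.
  exact: hM.
have [l hl] := cvg_telescope b0 step.
have e : hsum al = l by exact: ctends_lim hl.
rewrite e; split => //.
have := lim_telescope b0 step hl.
by rewrite big_nat1 hc0 /b tprod0 mulr1.
Qed.

(** Gauss's contiguous relation between al and al + 1: the combination of
    partial sums telescopes to - (1 + al) N hc_N, which tends to 0. *)
Lemma hsum_rec al : 0 < al ->
  al%:C * (1 + al%:C) * hsum al = (al%:C * (1 + al%:C) - lam) * hsum (al + 1).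
Proof.
move=> a0; have [M [M0 hM]] := hsum_spec.
have [h1 _] := hM al a0; have a1 : 0 < al + 1 by lra.
have [h2 _] := hM (al + 1) a1.
apply/eqP; rewrite -subr_eq0; apply/eqP.
apply: (@ctends_uniq _ _ \oo _ (fun N => al%:C * (1 + al%:C) * (\sum_(0 <= m < N) hc lam al m)
   - (al%:C * (1 + al%:C) - lam) * \sum_(0 <= m < N) hc lam (al + 1) m)).
  by apply: ctendsB; exact: ctendsZ.
have sh m : (1 + al%:C + m%:R) * hc lam (al + 1) m = (1 + al%:C) * hc lam al m.
  elim: m => [|m IH]; first by rewrite !hc0 addr0.
  have n0 := natC_neq0 R m; have d0 := natD_neq0 m (ltW a0).
  have d1 := natD_neq0 m (ltW a1).
  apply: (mulfI (mulf_neq0 n0 d0)).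
  have e1 := hcS lam m (ltW a0); have e2 := hcS lam m (ltW a1).
  transitivity ((m.+1%:R + al%:C) * (m.+1%:R * (m.+1%:R + (al + 1)%:C) * hc lam (al + 1) m.+1)).
    rewrite rCD (_ : 1%:C = 1)//; ring.
  rewrite e2; transitivity ((1 + al%:C) * (m.+1%:R * (m.+1%:R + al%:C) * hc lam al m.+1)); last by ring.
  rewrite e1; transitivity ((m%:R * m.+1%:R - lam) * ((1 + al%:C + m%:R) * hc lam (al + 1) m)).
    by rewrite -[m.+1%:R]natr1; ring.
  by rewrite IH; ring.
have tel N : al%:C * (1 + al%:C) * (\sum_(0 <= m < N) hc lam al m)
   - (al%:C * (1 + al%:C) - lam) * \sum_(0 <= m < N) hc lam (al + 1) m
   = - ((1 + al%:C) * (N%:R * hc lam al N)).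
  elim: N => [|N IH]; first by rewrite !big_geq// !mulr0 mul0r subrr mulr0 oppr0.
  have dist (X Y S1 S2 x1 x2 : R[i]) :
    X * (S1 + x1) - Y * (S2 + x2) = (X * S1 - Y * S2) + X * x1 - Y * x2 by ring.
  rewrite !big_nat_recr//= dist IH.
  have d1 : 1 + al%:C + N%:R != 0 by exact: natD1_nonpole (ltW a0) N.
  have e1 := hcS lam N (ltW a0).
  apply: (mulfI d1).
  transitivity (- ((1 + al%:C) * (1 + al%:C + N%:R) * (N%:R * hc lam al N)) +
    (1 + al%:C + N%:R) * (al%:C * (1 + al%:C) * hc lam al N)
    - (al%:C * (1 + al%:C) - lam) * ((1 + al%:C + N%:R) * hc lam (al + 1) N)); first by ring.
  rewrite sh; transitivity (- ((1 + al%:C) * (N.+1%:R * (N.+1%:R + al%:C) * hc lam al N.+1))).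
    by rewrite e1 -[N.+1%:R]natr1; ring.
  by rewrite -[N.+1%:R]natr1; ring.
have [K [K0 hK]] := hc_bound.
under [X in ctends _ X]eq_fun do rewrite tel.
apply/ctends0; apply: (@squeeze_cvgr _ _ _ _ (cst 0) (fun N => normc (1 + al%:C) * K * tprod al N)).
- near=> N; rewrite normc_ge0/= normcN normcM -mulrA ler_wpM2l ?normc_ge0//.
  have N0 : (0 < N)%N by near: N; exact: nbhs_infty_gt.
  rewrite -(prednK N0) normcM normc_nat.
  rewrite (le_trans (ler_wpM2l _ (hK al N.-1 (ltW a0))))//.
  by rewrite mulrA mulrCA divff ?mulr1// pnatr_eq0.
- exact: cvg_cst.
- rewrite -(mulr0 (normc (1 + al%:C) * K)); apply: cvgM; first exact: cvg_cst.
  exact: tprod_cvg0.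
Unshelve. all: by end_near. Qed.

Lemma hsum_iter al N : 0 < al -> hsum al =
  \prod_(0 <= j < N) (1 - lam / ((al%:C + j%:R) * (1 + al%:C + j%:R))) * hsum (al + N%:R).
Proof.
move=> a0; elim: N => [|N IH]; first by rewrite big_geq// mul1r addr0.
rewrite {1}IH big_nat_recr//= -mulrA; congr (_ * _).
have aN : 0 < al + N%:R by rewrite ltr_wpDr.
have := hsum_rec aN; rewrite -addrA natr1 !rCD rCnat => e.
have d1 : al%:C + N%:R != 0 := natD_nonpole a0 N.
have d2 : 1 + al%:C + N%:R != 0 := natD1_nonpole (ltW a0) N.
rewrite addrA in e.
apply: (mulfI (mulf_neq0 d1 d2)); rewrite e.
by field; rewrite d1 d2.
Qed.

(** Gauss's theorem: iterating the contiguous relation N times leaves the value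
    at al + N, which tends to 1, times a product of Euler factors. *)
Lemma hsum_rgam nu al : lam = nu * (nu + 1) -> 0 < al -> hsum al
  = rgam (al%:C - nu) * rgam (1 + al%:C + nu) / (rgam al%:C * rgam (1 + al%:C)).
Proof.
move=> hnu a0; have [M [M0 hM]] := hsum_spec.
have np1 := natD_nonpole a0; have np2 := natD1_nonpole (ltW a0).
have l1 : ctends \oo (fun N => hsum (al + N%:R)) 1.
  apply: (@ctends_le _ _ _ _ _ _ (inv1 M)); first exact: cvg_inv1.
  near=> N; have N0 : (0 < N)%N by near: N; exact: nbhs_infty_gt.
  have aN : 0 < al + N%:R by rewrite ltr_wpDr.
  have [_ h] := hM _ aN; rewrite (le_trans h)// ler_wpM2l// lef_pV2 ?posrE ?ltr0n//.
  by rewrite lerDr ltW.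
have l2 : ctends \oo (fun N => (rg N (al%:C - nu) * rg N (1 + al%:C + nu) / (rg N al%:C * rg N (1 + al%:C))) * hsum (al + N.+1%:R))
   (rgam (al%:C - nu) * rgam (1 + al%:C + nu) / (rgam al%:C * rgam (1 + al%:C)) * 1).
  apply: ctendsM; last first.
    have := l1; rewrite /ctends -(cvg_shiftS (fun N => normc (hsum (al + N%:R) - 1))).
    exact.
  apply: ctendsM; first by apply: ctendsM; exact: rg_cvg.
  apply: ctendsV; first by rewrite mulf_neq0 ?rgam_neq0.
  by apply: ctendsM; exact: rg_cvg.
rewrite mulr1 in l2; apply: ctends_uniq _ l2.
apply: (@ctends_eq _ _ \oo _ (fun=> hsum al)); last exact: ctends_cst.
near=> N; rewrite {1}(hsum_iter N.+1 a0); congr (_ * _).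
have -> : \prod_(0 <= j < N.+1) (1 - lam / ((al%:C + j%:R) * (1 + al%:C + j%:R)))
  = \prod_(0 <= j < N.+1) (((al%:C - nu + j%:R) * (1 + al%:C + nu + j%:R)) / ((al%:C + j%:R) * (1 + al%:C + j%:R))).
  apply: eq_bigr => j _; have d1 := np1 j; have d2 := np2 j.
  by rewrite hnu; field; rewrite d1 d2.
rewrite big_split /= prodfV !big_split /= !rg_prod !mulrDl !mulNr !cexpD !cexpN.
have := rg_neq0 N np1; have := rg_neq0 N np2.
have := cexp_neq0 (nu * (ln N%:R)%:C); have := cexp_neq0 (al%:C * (ln N%:R)%:C).
have := cexp_neq0 (1 * (ln (N%:R : R))%:C).
have f2 : (N`!%:R : R[i]) != 0 by rewrite pnatr_eq0 -lt0n fact_gt0.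
move: (rg _ _) (rg _ _) (rg _ _) (rg _ _) => r1 r2 r3 r4.
move: (cexp (al%:C * (ln N%:R)%:C)) => A.
move: (cexp (nu * (ln N%:R)%:C)) => E.
move: (cexp (1 * (ln N%:R)%:C)) => G.
move: (N`!%:R : R[i]) f2 => F F0 h1 h2 h3 h4 h5.
by field; do ?[apply/andP; split].
Unshelve. all: by end_near. Qed.
End GaussSum.

(** * The logarithmic case *)

Section ConstantTerm.
Local Arguments qc : simpl never.
Variable R : realType.
Variable lam : R[i].

(** What remains of the coefficients after removal of the singular comparison
    series; it decays one power faster. *)
Definition hrem al m : R[i] := hc lam al m - kap lam al * (qc al m)%:C.

Lemma hrem_bound al : 0 <= al < 1 -> exists M, 0 <= M /\ forall m,
  normc (hrem al m.+1) <= M / m.+1%:R * qc al m.+1.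
Proof.
move=> ha; have /andP[a0 a1] := ha.
have [M [M0 _ _ hM]] := kap_spec lam ha; exists M; split => // m.
rewrite /hrem hc_rho// -mulrBl normcM normc_real ger0_norm ?qc_ge0 ?(ltW a1)//.
by rewrite ler_wpM2r// qc_ge0// ltW.
Qed.

Lemma h01 : 0 <= (0 : R) < 1. Proof. by rewrite lexx ltr01. Qed.

Lemma hrem0_bound : exists M, 0 <= M /\ forall m,
  normc (hrem 0 m.+1) <= M / m.+1%:R * m.+1%:R^-1 /\
  normc (hrem 0 m.+2) <= inv1 M m.+1 - inv1 M m.+2.
Proof.
have [M [M0 hM]] := hrem_bound h01; exists M; split => // m; split.
  by have := hM m; rewrite qc0.
rewrite (le_trans (hM _))// qc0 inv1B// -mulrA ler_wpM2l// -invfM lef_pV2 ?posrE ?mulr_gt0 ?ltr0n//.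
by rewrite ler_wpM2r// ler_nat.
Qed.

(** The constant term at x = 1 in the logarithmic case al = 0. *)
Definition hconst : R[i] := lim ((fun N => \sum_(0 <= m < N) hrem 0 m : R[i]^o) @ \oo).

Lemma hconst_cvg : ctends \oo (fun N => \sum_(0 <= m < N) hrem 0 m) hconst.
Proof.
have [M [M0 hM]] := hrem0_bound.
have [||l hl] := @cvg_telescope R (fun N => \sum_(0 <= m < N) hrem 0 m) (fun j => inv1 M j.-1) 2.
- by move=> j; exact: inv1_ge0.
- move=> [|[|j]]// _; rewrite big_nat_recr//= [_ + hrem _ _]addrC addrK.
  by have [] := hM j.
by rewrite /hconst (ctends_lim hl).
Qed.

(** The comparison series at al = 0, weighted by the product, telescopes. *)
Lemma tprod_sum (al : R) N : 0 < al -> \sum_(0 <= m < N) qc 0 m.+1 * tprod al m.+1 = (1 - tprod al N) / al.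
Proof.
move=> a0; elim: N => [|N IH]; first by rewrite big_geq// tprod0 subrr mul0r.
rewrite big_nat_recr//= IH -(tprod0 al) qc0.
have := tprod_diff N (ltW a0); move: (tprod al N) (tprod al N.+1) (N.+1%:R : R) (nat_gt0 R N) => t u c c0 e.
have -> : t = u + al / c * u by lra.
by field; rewrite !gt_eqF.
Qed.

(** The logarithmic case is the limit of the power case: as the exponent tends
    to 0, the pole of the Gauss sum is cancelled by the comparison series. *)
Lemma hconst_lim (al := fun N : nat => (N.+1%:R ^- 2 : R)) :
  ctends \oo (fun N => hsum lam (al N) - kap lam 0 / (al N)%:C) hconst.
Proof.
have [M [M0 hM]] := hrem0_bound; have [K [K0 hK]] := hsum_spec lam.
have al0 N : 0 < al N by rewrite invr_gt0 exprn_gt0// ltr0n.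
have part a N : 0 < a -> \sum_(0 <= m < N.+1) hc lam a m
   = \sum_(0 <= m < N.+1) hrem 0 m * (tprod a m)%:C + kap lam 0 * ((1 - tprod a N) / a)%:C.
  move=> a0; rewrite -tprod_sum// rCsum mulr_sumr big_nat_recl// [in RHS]big_nat_recl//=.
  rewrite -addrA -big_split/=; congr (_ + _).
    by rewrite /hrem /= !hc0 tprod0 mulr0 subr0 mulr1.
  apply: eq_bigr => m _; rewrite hc_tprod ?(ltW a0)// /hrem (rCM (qc 0 m.+1)).
    by move: (hc lam 0 m.+1) ((tprod a m.+1)%:C) ((qc 0 m.+1)%:C) (kap lam 0) => h t q k; ring.
have lim1 a : 0 < a -> ctends \oo (fun N => \sum_(0 <= m < N.+1) hrem 0 m * (tprod a m)%:C)
    (hsum lam a - kap lam 0 / a%:C).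
  move=> a0; have [h1 _] := hK a a0.
  apply: (@ctends_eq _ _ _ _ (fun N => \sum_(0 <= m < N.+1) hc lam a m - kap lam 0 * ((1 - tprod a N) / a)%:C)).
    by near=> N; rewrite part// addrK.
  apply: ctendsB.
    have := h1; rewrite /ctends -(cvg_shiftS (fun N => normc (\sum_(0 <= m < N) hc lam a m - hsum lam a))).
    exact.
  have hcv : (fun N => (1 - tprod a N) / a) @ \oo --> (1 - 0) / a.
    apply: cvgM; last exact: cvg_cst.
    by apply: cvgB; [exact: cvg_cst|exact: tprod_cvg0].
  rewrite subr0 mul1r in hcv.
  by apply: ctendsZ; rewrite -rCV; exact: ctends_realC.
have bd N : normc (hsum lam (al N) - kap lam 0 / (al N)%:C - hconst) <= (2 * M) / N.+1%:R.
  have hs : ctends \oo (fun p => \sum_(0 <= m < p.+1) hrem 0 m) hconst.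
    have := hconst_cvg; rewrite /ctends -(cvg_shiftS (fun N => normc (\sum_(0 <= m < N) hrem 0 m - hconst))).
    exact.
  apply: (ctends_normc_le (ctendsB (lim1 _ (al0 N)) hs)).
  near=> p; have pN : (N.+2 <= p.+1)%N by near: p; exists N.+2 => // p /= /leqW.
  (* Terms up to N + 1 are small because al N = 1 / (N + 1)^2, later ones because
     the remainder series converges. *)
  rewrite -sumrB (@big_cat_nat _ _ _ N.+2)//=.
  set S1 := \sum_(0 <= _ < _) _; set S2 := \sum_(_ <= _ < p.+1) _.
  have n1 : (N.+1%:R : R) != 0 by rewrite pnatr_eq0.
  have b1 : normc S1 <= M / N.+1%:R.
    rewrite /S1 (le_trans (normc_sum _ _ _))// big_nat_recl//= tprod0 mulr1 subrr normc0 add0r.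
    apply: (@le_trans _ _ (\sum_(0 <= i < N.+1) (M * al N))); last first.
      rewrite sumr_const_nat subn0 -[leLHS]mulr_natr /al; move: (N.+1%:R : R) n1 => c c0.
      by rewrite (_ : M * c ^- 2 * c = M / c)//; field.
    apply: ler_sum_nat => i _.
    rewrite (_ : _ - _ = hrem 0 i.+1 * (- (1 - tprod (al N) i.+1))%:C); last first.
      by rewrite rCN rCB (_ : 1%:C = 1)//; ring.
    have [hb _] := hM i.
    have t1 := tprod_ge i.+1 (ltW (al0 N)).
    have t0 : 0 <= 1 - tprod (al N) i.+1 by rewrite subr_ge0 tprod_le1// ltW.
    rewrite normcM normc_real normrN (ger0_norm t0).
    apply: (le_trans (ler_pM (normc_ge0 _) t0 hb t1)).
    move: (i.+1%:R : R) (nat_gt0 R i) (ler1n R i.+1) (al N) (al0 N) => c c0 c1 a aN.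
    rewrite (_ : M / c / c * (a * c) = M * a * c^-1); last by field; rewrite gt_eqF.
    by rewrite ler_piMr ?mulr_ge0 ?(ltW aN)// invf_le1// c1.
  have b2 : normc S2 <= M / N.+1%:R.
    have hh (j : nat) : (N.+2 <= j)%N -> normc (hrem 0 j * (tprod (al N) j)%:C - hrem 0 j) <= inv1 M j.-1 - inv1 M j.
      case: j => [|[|j]]// _.
      rewrite (_ : _ - _ = hrem 0 j.+2 * (- (1 - tprod (al N) j.+2))%:C); last first.
        by rewrite rCN rCB (_ : 1%:C = 1)//; ring.
      have t0 : 0 <= 1 - tprod (al N) j.+2 by rewrite subr_ge0 tprod_le1// ltW.
      rewrite normcM normc_real normrN (ger0_norm t0).
      have [_ hb] := hM j.
      apply: le_trans hb; rewrite ler_piMr ?normc_ge0//.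
      by have := tprod_ge0 j.+2 (ltW (al0 N)); lra.
    have := @le_telescope R (fun q => \sum_(N.+2 <= j < q) (hrem 0 j * (tprod (al N) j)%:C - hrem 0 j))
      (fun j => inv1 M j.-1) N.+2 p.+1 pN.
    rewrite [X in _ - X]big_geq// subr0 => H; apply: (le_trans (H _)).
      move=> j Nj; rewrite big_nat_recr//= addrAC subrr add0r; exact: hh.
    by rewrite /= gerBl inv1_ge0.
  by rewrite (le_trans (le_normcD _ _))// -mulrA mulrC mulr_natr mulr2n lerD.
apply: (@ctends_le _ _ _ _ _ _ (fun N => inv1 (2 * M) N.+1)); last by near=> N; exact: bd.
by rewrite (cvg_shiftS (inv1 (2 * M))); exact: cvg_inv1.
Unshelve. all: by end_near. Qed.
End ConstantTerm.

(** * Real power series *)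

Section RealPowerSeries.
Variable R : realType.
Implicit Types (c : nat -> R) (x K : R).

(** Radius of convergence at least 1, in the form stable under formal
    differentiation. *)
Definition rad1 c := forall K, 0 < K < 1 -> exists M, forall m, `|c m| * K ^+ m <= M.

Lemma rad1_cvg c K : rad1 c -> 0 < K < 1 -> cvgn (pseries c K).
Proof.
move=> hc /andP[K0 K1]; pose L := (K + 1) / 2.
have L0 : 0 < L by rewrite /L; lra.
have L1 : L < 1 by rewrite /L; lra.
have KL : K < L by rewrite /L; lra.
have [|M hM] := hc L; first by rewrite L0 L1.
have M0 : 0 <= M by rewrite (le_trans _ (hM 0))// mulr_ge0.
apply: normed_cvg; apply: (@series_le_cvg _ _ (geometric M (K / L))) => [m|m|m|].
- exact: normr_ge0.
- by rewrite /geometric/= mulr_ge0// exprn_ge0// divr_ge0// ltW.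
- rewrite /geometric /= normrM (ger0_norm (exprn_ge0 _ (ltW K0))) expr_div_n.
  rewrite mulrA ler_pdivlMr ?exprn_gt0// mulrAC ler_wpM2r ?exprn_ge0 ?(ltW K0)//.
- have KL0 : 0 <= K / L by rewrite divr_ge0 // ltW.
  apply: is_cvg_geometric_series; rewrite (ger0_norm KL0).
  by rewrite ltr_pdivrMr// mul1r.
Qed.

Lemma rad1_diffs c : rad1 c -> rad1 (pseries_diffs c).
Proof.
move=> hc K /andP[K0 K1]; pose L := (K + 1) / 2.
have L0 : 0 < L by rewrite /L; lra.
have L1 : L < 1 by rewrite /L; lra.
have KL : K < L by rewrite /L; lra.
have [|M hM] := hc L; first by rewrite L0 L1.
have M0 : 0 <= M by rewrite (le_trans _ (hM 0))// mulr_ge0.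
pose d := L / K - 1; have d0 : 0 < d.
  by rewrite /d subr_gt0 ltr_pdivlMr// mul1r.
have bern m : 1 + m%:R * d <= (L / K) ^+ m.
  have -> : L / K = 1 + d by rewrite /d; lra.
  elim: m => [|m IH]; first by rewrite mul0r addr0 expr0.
  rewrite exprS -[m.+1%:R]natr1.
  have : (1 + d) * (1 + m%:R * d) <= (1 + d) * (1 + d) ^+ m.
    by rewrite ler_wpM2l//; lra.
  have : 0 <= m%:R * d * d by rewrite !mulr_ge0 ?(ltW d0).
  by lra.
exists (M / L * (1 + d^-1)) => m.
rewrite /pseries_diffs normrM normr_nat.
have h1 : m.+1%:R <= (1 + d^-1) * (L / K) ^+ m.
  have := bern m; have : 0 <= (m%:R : R) by [].
  have e1 : 1 <= (L / K) ^+ m by rewrite exprn_ege1// ler_pdivlMr// mul1r ltW.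
  rewrite -[m.+1%:R]natr1 => m0 h.
  have : m%:R * d <= (L / K) ^+ m by lra.
  rewrite -ler_pdivlMr// mulrC.
  by lra.
have h2 : `|c m.+1| <= M / L ^+ m.+1 by rewrite ler_pdivlMr ?exprn_gt0.
have -> : M / L * (1 + d^-1) = ((1 + d^-1) * (L / K) ^+ m) * (M / L ^+ m.+1) * K ^+ m.
  rewrite expr_div_n exprS; have : L ^+ m != 0 by rewrite gt_eqF ?exprn_gt0.
  have : K ^+ m != 0 by rewrite gt_eqF ?exprn_gt0.
  move: (L ^+ m) (K ^+ m) (gt_eqF L0) (gt_eqF d0) => l k L00 d00 k0 l0.
  by field; rewrite k0 l0 L00 d00.
rewrite ler_wpM2r ?exprn_ge0 ?(ltW K0)//.
by rewrite ler_pM ?mulr_ge0.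
Qed.

Definition psum c x : R := limn (pseries c x).

Lemma rad1_cvg_abs c x : rad1 c -> `|x| < 1 -> cvgn (pseries c x).
Proof.
move=> hc x1; pose K := (`|x| + 1) / 2; have n0 := normr_ge0 x.
have K1 : 0 < K < 1 by rewrite /K; apply/andP; split; lra.
apply: (is_cvg_pseries_inside (rad1_cvg hc K1)).
by rewrite (ger0_norm (_ : 0 <= K)) /K; lra.
Qed.

Lemma psum_cvg c x : rad1 c -> `|x| < 1 -> pseries c x @ \oo --> psum c x.
Proof. exact: rad1_cvg_abs. Qed.

Lemma psum_derive c x : rad1 c -> `|x| < 1 ->
  is_derive x 1 (psum c) (psum (pseries_diffs c) x).
Proof.
move=> hc x1; pose K := (`|x| + 1) / 2; have n0 := normr_ge0 x.
have K1 : 0 < K < 1 by rewrite /K; apply/andP; split; lra.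
apply: (@pseries_snd_diffs _ c K).
- exact: rad1_cvg.
- by apply: rad1_cvg => //; exact: rad1_diffs.
- by apply: rad1_cvg => //; apply: rad1_diffs; exact: rad1_diffs.
- by rewrite (ger0_norm (_ : 0 <= K)) /K; lra.
Qed.
End RealPowerSeries.

(** * Complex functions of a real variable *)

Section ComplexDerivative.
Variable R : realType.
Implicit Types (f g : R -> R[i]) (x : R) (d e : R[i]) (c : nat -> R[i]).

(** Componentwise, so that the mean value theorem and the fundamental theorem
    of calculus for real functions apply. *)
Definition cder f x d := is_derive x 1 (fun t => complex.Re (f t)) (complex.Re d)
  /\ is_derive x 1 (fun t => complex.Im (f t)) (complex.Im d).

Lemma is_derive_eqd (h : R -> R) x (a b : R) : is_derive x 1 h a -> a = b -> is_derive x 1 h b.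
Proof. by move=> H <-. Qed.

Lemma is_deriveDf (h k : R -> R) x (a b : R) : is_derive x 1 h a -> is_derive x 1 k b ->
  is_derive x 1 (fun t => h t + k t) (a + b).
Proof. by move=> ha kb; exact: is_deriveD. Qed.

Lemma is_deriveBf (h k : R -> R) x (a b : R) : is_derive x 1 h a -> is_derive x 1 k b ->
  is_derive x 1 (fun t => h t - k t) (a - b).
Proof. by move=> ha kb; exact: is_deriveB. Qed.

Lemma is_deriveMf (h k : R -> R) x (a b : R) : is_derive x 1 h a -> is_derive x 1 k b ->
  is_derive x 1 (fun t => h t * k t) (a * k x + h x * b).
Proof.
move=> ha kb; apply: (is_derive_eqd (is_deriveM ha kb)).
by rewrite /GRing.scale /=; ring.
Qed.

Lemma is_deriveZf (c : R) (h : R -> R) x (a : R) : is_derive x 1 h a ->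
  is_derive x 1 (fun t => c * h t) (c * a).
Proof.
move=> ha; apply: (is_derive_eqd (is_deriveMf (is_derive_cst c x 1) ha)).
by rewrite mul0r add0r.
Qed.

Lemma cder_cst d x : cder (fun=> d) x 0.
Proof. by split; exact: is_derive_cst. Qed.

Lemma cderD f g x d e : cder f x d -> cder g x e -> cder (fun t => f t + g t) x (d + e).
Proof.
move=> [fr fi] [gr gi]; split.
- rewrite (_ : (fun _ => _) = (fun t => complex.Re (f t)) + (fun t => complex.Re (g t))).
    by rewrite ReD; exact: is_deriveD.
  by apply/funext => t; rewrite ReD.
- rewrite (_ : (fun _ => _) = (fun t => complex.Im (f t)) + (fun t => complex.Im (g t))).
    by rewrite ImD; exact: is_deriveD.
  by apply/funext => t; rewrite ImD.
Qed.

Lemma cderM f g x d e : cder f x d -> cder g x e ->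
  cder (fun t => f t * g t) x (d * g x + f x * e).
Proof.
move=> [fr fi] [gr gi]; split.
- rewrite (_ : (fun _ => _) = (fun t => complex.Re (f t)) * (fun t => complex.Re (g t))
     - (fun t => complex.Im (f t)) * (fun t => complex.Im (g t))).
    apply: (is_derive_eqd (is_deriveB (is_deriveM fr gr) (is_deriveM fi gi))).
    by rewrite ReD !ReM /GRing.scale /=; ring.
  by apply/funext => t; rewrite ReM.
- rewrite (_ : (fun _ => _) = (fun t => complex.Re (f t)) * (fun t => complex.Im (g t))
     + (fun t => complex.Im (f t)) * (fun t => complex.Re (g t))).
    apply: (is_derive_eqd (is_deriveD (is_deriveM fr gi) (is_deriveM fi gr))).
    by rewrite ImD !ImM /GRing.scale /=; ring.
  by apply/funext => t; rewrite ImM.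
Qed.

Lemma cder_real (h : R -> R) x (a : R) : is_derive x 1 h a -> cder (fun t => (h t)%:C) x a%:C.
Proof. by move=> H; split => //=; exact: is_derive_cst. Qed.

Lemma cderZ (k : R[i]) f x d : cder f x d -> cder (fun t => k * f t) x (k * d).
Proof.
move=> /(cderM (cder_cst k x)); by rewrite mul0r add0r.
Qed.

Lemma cderN f x d : cder f x d -> cder (fun t => - f t) x (- d).
Proof.
move=> /(cderZ (-1)); rewrite mulN1r.
by rewrite (_ : (fun t => -1 * f t) = (fun t => - f t))//; apply/funext => t; rewrite mulN1r.
Qed.

Lemma cderB f g x d e : cder f x d -> cder g x e -> cder (fun t => f t - g t) x (d - e).
Proof. by move=> hf /cderN; exact: cderD. Qed.

Lemma is_derive1_compE (h k : R -> R) x (a b : R) : is_derive (k x) 1 h a -> is_derive x 1 k b ->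
  is_derive x 1 (fun t => h (k t)) (a * b).
Proof. by move=> ha kb; exact: (is_derive1_comp ha kb). Qed.

Lemma cder_comp f (k : R -> R) x d (b : R) : cder f (k x) d -> is_derive x 1 k b ->
  cder (fun t => f (k t)) x (d * b%:C).
Proof.
move=> [fr fi] kb; split.
- apply: is_derive_eqd; first exact: (is_derive1_compE fr kb).
  by rewrite ReM /= mulr0 subr0.
- apply: is_derive_eqd; first exact: (is_derive1_compE fi kb).
  by rewrite ImM /= mulr0 add0r.
Qed.

Lemma cder_eq f x d e : cder f x d -> d = e -> cder f x e.
Proof. by move=> h <-. Qed.

Lemma cder_cont f x d : cder f x d -> ctends (nbhs x) f (f x).
Proof.
move=> [fr fi]; apply: ctends_ReIm.
- by apply: differentiable_continuous; apply/derivable1_diffP; case: fr.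
- by apply: differentiable_continuous; apply/derivable1_diffP; case: fi.
Qed.

Lemma is_derive_0_cst (h : R -> R) (a b : R) : (forall t, a < t < b -> is_derive t 1 h 0) ->
  forall s t, a < s < b -> a < t < b -> h s = h t.
Proof.
move=> H s t; wlog st : s t / s <= t => [W|] hs ht.
  by have [/W|/ltW/W] := leP s t; [exact|move=> /(_ ht hs)].
have ab u : u \in `[s, t] -> a < u < b.
  rewrite in_itv /= => /andP[u1 u2].
  by move: hs ht => /andP[s1 s2] /andP[t1 t2]; apply/andP; split; lra.
have [||c _] := @MVT_segment R h (fun=> 0) s t st.
- move=> u; rewrite in_itv /= => /andP[u1 u2]; apply: H; apply: ab.
  by rewrite in_itv /= !ltW.
- apply: derivable_within_continuous => u /ab /H [] //.
by rewrite mul0r => /eqP; rewrite subr_eq0 => /eqP.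
Qed.

Lemma cder0_cst f (a b : R) : (forall t, a < t < b -> cder f t 0) ->
  forall s t, a < s < b -> a < t < b -> f s = f t.
Proof.
move=> H s t hs ht; apply: complexP.
- by apply: (@is_derive_0_cst (fun t => complex.Re (f t)) a b) => // u /H[].
- by apply: (@is_derive_0_cst (fun t => complex.Im (f t)) a b) => // u /H[].
Qed.

Definition crad1 c := rad1 (fun m => complex.Re (c m)) /\ rad1 (fun m => complex.Im (c m)).

Definition cpsum c x : R[i] := psum (fun m => complex.Re (c m)) x +i* psum (fun m => complex.Im (c m)) x.

Definition cdiffs c m : R[i] := m.+1%:R * c m.+1.

Lemma cdiffs_Re c : (fun m => complex.Re (cdiffs c m)) = pseries_diffs (fun m => complex.Re (c m)).
Proof.
by apply/funext => m; rewrite /cdiffs /pseries_diffs -rCnat ReM /= mul0r subr0.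
Qed.

Lemma cdiffs_Im c : (fun m => complex.Im (cdiffs c m)) = pseries_diffs (fun m => complex.Im (c m)).
Proof.
by apply/funext => m; rewrite /cdiffs /pseries_diffs -rCnat ImM /= mul0r addr0.
Qed.

Lemma crad1_diffs c : crad1 c -> crad1 (cdiffs c).
Proof. by move=> [h1 h2]; split; rewrite ?cdiffs_Re ?cdiffs_Im; exact: rad1_diffs. Qed.

Lemma cpsum_derive c x : crad1 c -> `|x| < 1 -> cder (cpsum c) x (cpsum (cdiffs c) x).
Proof.
move=> [h1 h2] x1; split => /=.
- by rewrite cdiffs_Re; exact: psum_derive.
- by rewrite cdiffs_Im; exact: psum_derive.
Qed.

Lemma crad1_bound c (M : R) : (forall m, normc (c m) <= M) -> crad1 c.
Proof.
move=> hM; have H (F : R[i] -> R) : (forall z, `|F z| <= normc z) -> rad1 (fun m => F (c m)).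
  move=> hF K /andP[K0 K1]; exists M => m.
  rewrite -[leRHS]mulr1 ler_pM ?exprn_ge0 ?(ltW K0)//.
    by rewrite (le_trans (hF _)).
  by rewrite exprn_ile1 ?(ltW K0)// ltW.
by split; apply: H => z; [exact: Re_le_normc|exact: Im_le_normc].
Qed.

Lemma cpsum_cvg c x : crad1 c -> `|x| < 1 ->
  ctends \oo (fun N => \sum_(0 <= m < N) c m * (x ^+ m)%:C) (cpsum c x).
Proof.
move=> [h1 h2] x1; apply: ctends_ReIm => /=.
- have := psum_cvg h1 x1; apply: cvg_trans; apply: near_eq_cvg; near=> N.
  rewrite /pseries /series /= Re_sum; apply: eq_bigr => m _.
  by rewrite ReM /= mulr0 subr0.
- have := psum_cvg h2 x1; apply: cvg_trans; apply: near_eq_cvg; near=> N.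
  rewrite /pseries /series /= Im_sum; apply: eq_bigr => m _.
  by rewrite ImM /= mulr0 add0r.
Unshelve. all: by end_near. Qed.
End ComplexDerivative.

(** * Sums of complex power series *)

Section SeriesRelation.
Variable R : realType.
Implicit Types (c d : nat -> R[i]) (x : R) (l k : R[i]).

(** Convergence kept as a relation, so that power series identities can be
    combined termwise before limits are named. *)
Definition csum c x l := ctends \oo (fun N => \sum_(0 <= m < N) c m * (x ^+ m)%:C) l.

Definition cshift c m : R[i] := if m is m'.+1 then c m' else 0.

Lemma csumD c d x l k : csum c x l -> csum d x k -> csum (fun m => c m + d m) x (l + k).
Proof.
move=> h1 h2; apply: ctends_ext (ctendsD h1 h2) => N.
by rewrite -big_split/=; apply: eq_bigr => m _; rewrite mulrDl.
Qed.

Lemma csumZ k c x l : csum c x l -> csum (fun m => k * c m) x (k * l).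
Proof.
move=> h; apply: ctends_ext (ctendsZ k h) => N.
by rewrite mulr_sumr; apply: eq_bigr => m _; rewrite mulrA.
Qed.

Lemma csum_shift c x l : csum c x l -> csum (cshift c) x (x%:C * l).
Proof.
move=> /(ctendsZ x%:C) h; rewrite /csum /ctends.
rewrite -(cvg_shiftS (fun N => normc (\sum_(0 <= m < N) cshift c m * (x ^+ m)%:C - x%:C * l))).
move: h; rewrite /ctends; apply: cvg_trans; apply: near_eq_cvg; near=> N.
congr normc; congr (_ - _); rewrite big_nat_recl//= mul0r add0r mulr_sumr.
by apply: eq_bigr => m _; rewrite exprS rCM; ring.
Unshelve. all: by end_near. Qed.

Lemma csum0 x : csum (fun=> 0) x 0.
Proof.
apply: (@ctends_ext _ _ _ (fun=> 0)); last exact: ctends_cst.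
by move=> N; rewrite big1// => m _; rewrite mul0r.
Qed.

Lemma csum_uniq c d x l k : (forall m, c m = d m) -> csum c x l -> csum d x k -> l = k.
Proof. by move=> /funext ->; exact: ctends_uniq. Qed.

Lemma csum_cpsum c x : crad1 c -> `|x| < 1 -> csum c x (cpsum c x).
Proof. exact: cpsum_cvg. Qed.

Lemma cpsum0 c : cpsum c 0 = c 0.
Proof.
have h : ctends \oo (fun N => \sum_(0 <= m < N) c m * (0 ^+ m)%:C) (c 0).
  rewrite /ctends -(cvg_shiftS (fun N => normc (\sum_(0 <= m < N) c m * (0 ^+ m)%:C - c 0))).
  rewrite (_ : (fun _ => _) = fun=> 0); first exact: cvg_cst.
  apply/funext => N; rewrite big_nat_recl// expr0 mulr1 big1 ?addr0 ?subrr ?normc0// => m _.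
  by rewrite exprS mul0r mulr0.
apply: complexP => /=.
- have := ctends_Re h => /(_ _) hr; rewrite /psum.
  apply: cvg_lim => //; apply: cvg_trans hr; apply: near_eq_cvg; near=> N.
  rewrite /pseries /series /= Re_sum; apply: eq_bigr => m _.
  by rewrite ReM /= mulr0 subr0.
- have := ctends_Im h => /(_ _) hr; rewrite /psum.
  apply: cvg_lim => //; apply: cvg_trans hr; apply: near_eq_cvg; near=> N.
  rewrite /pseries /series /= Im_sum; apply: eq_bigr => m _.
  by rewrite ImM /= mulr0 add0r.
Unshelve. all: by end_near. Qed.
End SeriesRelation.

(** * The hypergeometric function and its behaviour at 1 *)

Section HypergeometricFunction.
Variable R : realType.
Variable lam : R[i].
Implicit Types (al x : R).
Local Arguments qc : simpl never.

(** The hypergeometric function F (- nu, nu + 1; 1 + al; x) with its two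
    derivatives. *)
Definition hF al := cpsum (hc lam al).
Definition hF' al := cpsum (cdiffs (hc lam al)).
Definition hF'' al := cpsum (cdiffs (cdiffs (hc lam al))).

Lemma crad1_hc al : 0 <= al -> crad1 (hc lam al).
Proof.
move=> a0; have [M [M0 hM]] := hc_bound lam.
apply: (@crad1_bound _ _ (1 + M)) => -[|m].
  by rewrite hc0 normc1 lerDl.
rewrite (le_trans (hM al m a0))// (le_trans (_ : _ <= M))//; last by rewrite lerDr.
rewrite -mulrA ler_piMr// mulr_ile1 ?invr_ge0 ?tprod_ge0 ?tprod_le1//.
by rewrite invf_le1 ?ltr0n// ler1n.
Qed.

Lemma hF_der al x : 0 <= al -> `|x| < 1 -> cder (hF al) x (hF' al x).
Proof. by move=> a0; apply: cpsum_derive; exact: crad1_hc. Qed.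

Lemma hF'_der al x : 0 <= al -> `|x| < 1 -> cder (hF' al) x (hF'' al x).
Proof. by move=> a0; apply: cpsum_derive; apply: crad1_diffs; exact: crad1_hc. Qed.

Lemma hF_0 al : hF al 0 = 1.
Proof. by rewrite /hF cpsum0 hc0. Qed.

(** Gauss's hypergeometric equation, the form taken by the radial equation. *)
Lemma hF_ode al x : 0 <= al -> `|x| < 1 ->
  x%:C * (1 - x%:C) * hF'' al x + (1 + al%:C - 2 * x%:C) * hF' al x + lam * hF al x = 0.
Proof.
move=> a0 x1; have r0 := crad1_hc a0; have r1 := crad1_diffs r0; have r2 := crad1_diffs r1.
have s0 := csum_cpsum r0 x1; have s1 := csum_cpsum r1 x1; have s2 := csum_cpsum r2 x1.
have h := csumD (csumD (csum_shift s2) (csumZ (-1) (csum_shift (csum_shift s2))))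
  (csumD (csumD (csumZ (1 + al%:C) s1) (csumZ (- 2) (csum_shift s1))) (csumZ lam s0)).
rewrite -[RHS](csum_uniq _ h (csum0 x)); last first.
  have e m := hcS lam m a0.
  move=> [|m] /=.
    rewrite /cdiffs; have := e 0%N; rewrite mul0r sub0r !mul1r => e0.
    transitivity ((1 + al%:C) * hc lam al 1 + lam * hc lam al 0); first by ring.
    by rewrite e0; ring.
  rewrite /cdiffs.
  transitivity (m.+2%:R * (m.+2%:R + al%:C) * hc lam al m.+2 - (m.+1%:R * m.+2%:R - lam) * hc lam al m.+1).
    case: m => [|m] /=; first by rewrite /cdiffs; ring.
    rewrite /cdiffs -[m.+3%:R]natr1 -[m.+2%:R]natr1; ring.
  by rewrite e subrr.
by rewrite /hF /hF' /hF''; ring.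
Qed.

Definition cq al m : R[i] := (qc al m)%:C.
(** The comparison function, determined by its first-order equation. *)
Definition hQ al := cpsum (cq al).

Lemma qc_le1 al m : 0 <= al <= 1 -> qc al m <= 1.
Proof.
move=> /andP[a0 a1]; case: m => [|m]; first exact: ler01.
elim: m => [|m IH]; first by rewrite qc1.
have q0 := qc_ge0 m.+1 a1.
have n2 := nat_gt0 R m.+1.
rewrite -(ler_pM2l n2) qcS mulr1.
have : (m.+1%:R - al) * qc al m.+1 <= m.+1%:R * 1.
  rewrite (le_trans (_ : _ <= m.+1%:R * qc al m.+1))//; last by rewrite ler_wpM2l.
  by rewrite ler_wpM2r// gerBl.
by rewrite -[m.+2%:R]natr1; lra.
Qed.

Lemma crad1_cq al : 0 <= al <= 1 -> crad1 (cq al).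
Proof.
move=> ha; apply: (@crad1_bound _ _ 1) => m; have /andP[_ a1] := ha.
by rewrite normc_real ger0_norm ?qc_le1 ?qc_ge0.
Qed.

(** The recurrence (m + 2) q_(m+2) = (m + 1 - al) q_(m+1). *)
Lemma hQ_ode al x : 0 <= al <= 1 -> `|x| < 1 ->
  (1 - x%:C) * cpsum (cdiffs (cq al)) x + al%:C * hQ al x = 1.
Proof.
move=> ha x1; have r0 := crad1_cq ha; have r1 := crad1_diffs r0.
have s0 := csum_cpsum r0 x1; have s1 := csum_cpsum r1 x1.
have h := csumD (csumD s1 (csumZ (-1) (csum_shift s1))) (csumZ al%:C s0).
have one : csum (fun m => if m is 0%N then 1 else 0 : R[i]) x 1.
  rewrite /csum /ctends -(cvg_shiftS (fun N => normc (\sum_(0 <= m < N) (if m is 0%N then 1 else 0) * (x ^+ m)%:C - 1))).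
  rewrite (_ : (fun _ => _) = fun=> 0); first exact: cvg_cst.
  apply/funext => N; rewrite big_nat_recl// expr0 mulr1 big1 ?addr0 ?subrr ?normc0// => m _.
  by rewrite mul0r.
rewrite -[RHS](csum_uniq _ h one); last first.
  move=> [|m] /=; rewrite /cdiffs /cq.
    by rewrite qc1 /qc; ring.
  rewrite -[m.+2%:R]rCnat -rCM qcS rCM rCB rCnat; ring.
by rewrite /hQ; ring.
Qed.

Lemma hQ_0 al : hQ al 0 = 0.
Proof. by rewrite /hQ cpsum0 /cq /qc. Qed.

Lemma is_derive_ln1B (x : R) : x < 1 -> is_derive x 1 (fun t => ln (1 - t)) (- (1 - x)^-1).
Proof.
move=> x1; have h : is_derive x 1 (fun t : R => 1 - t) (- 1).
  by apply: (is_derive_eqd (is_deriveBf (is_derive_cst (1 : R) x 1) (is_derive_id x 1))); rewrite sub0r.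
have l : is_derive (1 - x) 1 (@ln R) (1 - x)^-1 by apply: is_derive1_ln; rewrite subr_gt0.
apply: (is_derive_eqd (@is_derive1_compE _ (@ln R) (fun t => 1 - t) x _ _ l h)).
by rewrite mulrN1.
Qed.

Lemma hQ_zero x : 0 <= x < 1 -> hQ 0 x = (- ln (1 - x))%:C.
Proof.
move=> /andP[x0 x1].
have h00 : 0 <= (0 : R) <= 1 by rewrite lexx ler01.
have D t : -1 < t < 1 -> cder (fun t => hQ 0 t + (ln (1 - t))%:C) t 0.
  move=> /andP[t0 t1]; have tn : `|t| < 1 by rewrite ltr_norml t0 t1.
  have e := hQ_ode h00 tn; rewrite mul0r addr0 in e.
  have t10 := rC1B_neq0 t1.
  apply: cder_eq; first apply: cderD.
  - exact: (cpsum_derive (crad1_cq h00) tn).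
  - by apply: cder_real; exact: is_derive_ln1B.
  rewrite rCN rCV rC1B.
  apply: (mulfI t10); rewrite mulr0 mulrDr e mulrN divff// subrr//.
have /(cder0_cst D) : -1 < x < 1 by apply/andP; split; lra.
move=> /(_ 0); rewrite ltr01 ltrN10 => /(_ isT).
rewrite hQ_0 subr0 ln1 addr0 => /eqP; rewrite addr_eq0 => /eqP ->.
by rewrite rCN.
Qed.

(** Both sides solve the same first-order linear equation: divided by
    (1 - x)^al, their difference has derivative 0. *)
Lemma hQ_pos al x : 0 < al <= 1 -> 0 <= x < 1 ->
  hQ al x = ((1 - (1 - x) `^ al) / al)%:C.
Proof.
move=> /andP[a0 a1] /andP[x0 x1].
have ha : 0 <= al <= 1 by rewrite ltW.
have D t : -1 < t < 1 -> cder (fun t => (1 - al%:C * hQ al t) * (expR (- al * ln (1 - t)))%:C) t 0.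
  move=> /andP[t0 t1]; have tn : `|t| < 1 by rewrite ltr_norml t0 t1.
  have e := hQ_ode ha tn.
  have t10 := rC1B_neq0 t1.
  apply: cder_eq; first apply: cderM.
  - apply: cderB; first exact: cder_cst.
    by apply: cderZ; exact: (cpsum_derive (crad1_cq ha) tn).
  - exact: cder_real (@is_derive1_compE _ expR (fun t => - al * ln (1 - t)) t _ _
      (is_derive_expR _) (is_deriveZf (- al) (is_derive_ln1B t1))).
  rewrite !rCM !rCN rCV rC1B.
  move: (cpsum (cdiffs (cq al)) t) (hQ al t) ((expR (- al * ln (1 - t)))%:C) e => q' q w e.
  transitivity (w * al%:C * (1 - t%:C)^-1 * (1 - ((1 - t%:C) * q' + al%:C * q))).
    by field; rewrite t10.
  by rewrite e subrr mulr0.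
have /(cder0_cst D) : -1 < x < 1 by apply/andP; split; lra.
move=> /(_ 0); rewrite ltr01 ltrN10 => /(_ isT).
rewrite hQ_0 mulr0 !subr0 ln1 mulr0 expR0 mul1r => e.
have p : (1 - x) `^ al = expR (al * ln (1 - x)).
  by rewrite /powR gt_eqF// subr_gt0.
have e2 : 1 - al%:C * hQ al x = ((1 - x) `^ al)%:C.
  rewrite p; have := congr1 (fun z => z * (expR (al * ln (1 - x)))%:C) e.
  rewrite -mulrA -rCM -expRD mulNr addNr expR0 mulr1 => ->.
  by rewrite mul1r.
have aC : al%:C != 0 :> R[i] by rewrite rC_eq0 gt_eqF.
apply: (mulfI aC); rewrite -rCM [al * _]mulrC divfK ?gt_eqF// rC1B -e2; ring.
Qed.

Lemma hF_split al x : 0 <= al < 1 -> `|x| < 1 ->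
  csum (hrem lam al) x (hF al x - kap lam al * hQ al x).
Proof.
move=> /andP[a0 a1] x1.
have ha : 0 <= al <= 1 by rewrite a0 ltW.
have s0 := csum_cpsum (crad1_hc a0) x1; have s1 := csum_cpsum (crad1_cq ha) x1.
have := csumD s0 (csumZ (- kap lam al) s1).
rewrite mulNr; apply: ctends_ext => N; apply: eq_bigr => m _.
by rewrite /hrem /cq mulNr.
Qed.

Lemma expr1B_le (x : R) m : 0 <= x <= 1 -> 0 <= 1 - x ^+ m <= m%:R * (1 - x).
Proof.
move=> /andP[x0 x1]; rewrite subr_ge0 exprn_ile1//=.
elim: m => [|m IH]; first by rewrite expr0 subrr mul0r.
rewrite exprS -natr1.
have : x * (1 - x ^+ m) <= 1 * (m%:R * (1 - x)).
  by rewrite ler_pM// subr_ge0 exprn_ile1.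
by lra.
Qed.

Lemma mqc_telescope al N : 0 < al -> \sum_(0 <= m < N) qc al m.+1 = (1 - N.+1%:R * qc al N.+1) / al.
Proof.
move=> a0; elim: N => [|N IH]; first by rewrite big_geq// qc1 mulr1 subrr mul0r.
rewrite big_nat_recr//= IH qcS.
by field; rewrite gt_eqF.
Qed.

Lemma mqc_le_tprod al N : 0 < al < 1 -> N.+1%:R * qc al N.+1 <= tprod al N.
Proof.
move=> /andP[a0 a1]; elim: N => [|N IH]; first by rewrite qc1 mulr1 tprod0.
rewrite qcS tprodS; have n0 := nat_gt0 R N.
have q0 := qc_ge0 N.+1 (ltW a1).
have -> : (N.+1%:R - al) * qc al N.+1 = (N.+1%:R * qc al N.+1) * ((N.+1%:R - al) / N.+1%:R).
  by move: (N.+1%:R : R) n0 => c c0; field; rewrite gt_eqF.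
have c1 : 1 <= N.+1%:R :> R by rewrite ler1n.
move: (N.+1%:R : R) n0 c1 IH => c c0 c1 IH.
apply: (ler_pM (mulr_ge0 (ltW c0) q0) _ IH); first by rewrite divr_ge0 ?(ltW c0)//; lra.
rewrite ler_pdivrMr// mulrAC ler_pdivlMr; last by lra.
by have := sqr_ge0 al; rewrite expr2; lra.
Qed.

Lemma hrem_sum al : 0 < al < 1 ->
  ctends \oo (fun N => \sum_(0 <= m < N.+1) hrem lam al m) (hsum lam al - kap lam al / al%:C).
Proof.
move=> /andP[a0 a1]; have [K [K0 hK]] := hsum_spec lam; have [h1 _] := hK al a0.
have e N : \sum_(0 <= m < N.+1) hrem lam al m = \sum_(0 <= m < N.+1) hc lam al m
   - kap lam al * ((1 - N.+1%:R * qc al N.+1) / al)%:C.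
  rewrite -mqc_telescope// rCsum mulr_sumr big_nat_recl// [in RHS]big_nat_recl//.
  rewrite -[RHS]addrA -sumrB; congr (_ + _).
  by rewrite /hrem (_ : qc al 0 = 0)// mulr0 subr0.
under [X in ctends _ X]eq_fun do rewrite e.
apply: ctendsB.
  have := h1; rewrite /ctends -(cvg_shiftS (fun N => normc (\sum_(0 <= m < N) hc lam al m - hsum lam al))).
  exact.
apply: ctendsZ; rewrite -rCV; apply: ctends_realC.
rewrite -[X in _ --> X]mul1r -[X in X / _]subr0; apply: cvgM; last exact: cvg_cst.
apply: cvgB; first exact: cvg_cst.
apply: (@squeeze_cvgr _ _ _ _ (cst 0) (tprod al)); last 2 first.
- exact: cvg_cst.
- exact: tprod_cvg0.
near=> N; rewrite mqc_le_tprod ?a0 ?a1//= mulr_ge0// qc_ge0// ltW.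
Unshelve. all: by end_near. Qed.

(** The remainder series is compared with its value at x = 1: one has
    1 - x^m <= m (1 - x), and m times its coefficients is still summable. With
    1 - x = xi r the error is O(r^(2n)), which after division by r^k is still
    negligible against r^k because k < n. *)
Lemma hF_pos al : 0 < al < 1 -> exists C, forall x, 0 <= x < 1 ->
  normc (hF al x - (hsum lam al - kap lam al / al%:C * ((1 - x) `^ al)%:C)) <= C * (1 - x).
Proof.
move=> ha; have /andP[a0 a1] := ha.
have ha' : 0 <= al < 1 by rewrite ltW.
have ha1 : 0 < al <= 1 by rewrite a0 ltW.
have [M [M0 hM]] := hrem_bound lam ha'.
exists (M / al) => x hx; have /andP[x0 x1] := hx.
have xn : `|x| < 1 by rewrite ger0_norm.
have aC : al%:C != 0 :> R[i] by rewrite rC_eq0 gt_eqF.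
have s := hF_split ha' xn; rewrite hQ_pos// in s.
have s' : ctends \oo (fun N => \sum_(0 <= m < N.+1) hrem lam al m * (x ^+ m)%:C)
   (hF al x - kap lam al * ((1 - (1 - x) `^ al) / al)%:C).
  have := s; rewrite /csum /ctends -(cvg_shiftS (fun N => normc (\sum_(0 <= m < N) hrem lam al m * (x ^+ m)%:C - _))).
  exact.
have := ctendsB s' (hrem_sum ha).
rewrite (_ : hF al x - _ - _ = hF al x - (hsum lam al - kap lam al / al%:C * ((1 - x) `^ al)%:C)); last first.
  by rewrite rCM rCB rCV (_ : 1%:C = 1)//; field; rewrite aC.
move=> /(_ _) h; apply: (ctends_normc_le h); near=> N.
rewrite -sumrB (le_trans (normc_sum _ _ _))//.
have hx1 : 0 <= x <= 1 by rewrite x0 ltW.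
rewrite big_nat_recl//= expr0 mulr1 subrr normc0 add0r.
apply: (@le_trans _ _ (\sum_(0 <= m < N) M * (1 - x) * qc al m.+1)).
  apply: ler_sum_nat => m _.
  rewrite (_ : _ - _ = hrem lam al m.+1 * (- (1 - x ^+ m.+1))%:C); last first.
    by rewrite rCN rCB (_ : 1%:C = 1)//; ring.
  have /andP[e0 e1] := expr1B_le m.+1 hx1.
  rewrite normcM normc_real normrN (ger0_norm e0).
  apply: (le_trans (ler_pM (normc_ge0 _) e0 (hM m) e1)).
  move: (m.+1%:R : R) (nat_gt0 R m) (qc al m.+1) => c c0 q.
  by rewrite (_ : M / c * q * (c * (1 - x)) = M * (1 - x) * q)//; field; rewrite gt_eqF.
rewrite -mulr_sumr mqc_telescope//.
rewrite [leRHS]mulrAC ler_wpM2l ?mulr_ge0 ?subr_ge0 ?(ltW x1)// -[leRHS]mul1r ler_wpM2r ?invr_ge0 ?(ltW a0)//.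
by rewrite gerBl mulr_ge0// qc_ge0// ltW.
Unshelve. all: by end_near. Qed.

(** For al = 0 the products of m with the remainder coefficients decay only like
    1/m, so the series is cut at an index depending on e. *)
Lemma hF_zero (e : R) : 0 < e -> exists2 d : R, 0 < d & forall x, 0 <= x < 1 -> 1 - x < d ->
  normc (hF 0 x - (hconst lam - kap lam 0 * (ln (1 - x))%:C)) <= e.
Proof.
move=> e0; have [M [M0 hM]] := hrem0_bound lam.
(* The tail beyond K is at most M / (K + 1) <= e / 2; the head has K + 1 terms of
   size M (1 - x). *)
pose K := (Num.truncn (2 * M / e)).+1.
have hK : M / K.+1%:R <= e / 2.
  have := truncnS_gt (2 * M / e); rewrite -/K => h.
  rewrite ler_pdivrMr ?ltr0n// mulrAC ler_pdivlMr//.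
  have : 2 * M < K%:R * e by rewrite -ltr_pdivrMr.
  by rewrite -[K.+1%:R]natr1; lra.
pose D := M * K.+2%:R + 1.
have D0 : 0 < D by rewrite ltr_wpDl ?mulr_ge0.
exists (e / 2 / D); first by rewrite !divr_gt0.
move=> x hx; have /andP[x0 x1] := hx; rewrite ltr_pdivlMr// => xd.
have xn : `|x| < 1 by rewrite ger0_norm.
have hx1 : 0 <= x <= 1 by rewrite x0 ltW.
have s := hF_split (h01 R) xn; rewrite hQ_zero// in s.
have := ctendsB s (hconst_cvg lam).
rewrite (_ : hF 0 x - _ - _ = hF 0 x - (hconst lam - kap lam 0 * (ln (1 - x))%:C)); last first.
  by rewrite rCN; ring.
move=> /(_ _) h; apply: (ctends_normc_le h); near=> p.
have pN : (K.+2 <= p)%N by near: p; exact: nbhs_infty_ge.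
rewrite -sumrB (@big_cat_nat _ _ _ K.+2)//=.
have fac m : hrem lam 0 m * (x ^+ m)%:C - hrem lam 0 m = hrem lam 0 m * (- (1 - x ^+ m))%:C.
  by rewrite rCN rCB (_ : 1%:C = 1)//; ring.
have xm m := expr1B_le m hx1.
rewrite (le_trans (le_normcD _ _))// [leRHS]splitr lerD//.
  rewrite (le_trans (normc_sum _ _ _))// big_nat_recl//= expr0 mulr1 subrr normc0 add0r.
  apply: (@le_trans _ _ (\sum_(0 <= i < K.+1) (M * (1 - x)))).
    apply: ler_sum_nat => i _; rewrite fac.
    have /andP[y0 y1] := xm i.+1.
    rewrite normcM normc_real normrN (ger0_norm y0).
    have [hb _] := hM i.
    apply: (le_trans (ler_pM (normc_ge0 _) y0 hb y1)).
    move: (i.+1%:R : R) (nat_gt0 R i) (ler1n R i.+1) => c c0 c1.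
    rewrite (_ : M / c / c * (c * (1 - x)) = M * (1 - x) * c^-1); last by field; rewrite gt_eqF.
    by rewrite ler_piMr ?mulr_ge0 ?subr_ge0 ?(ltW x1)// invf_le1// c1.
  rewrite sumr_const_nat subn0 -mulr_natr.
  have : M * (1 - x) * K.+1%:R <= (1 - x) * D.
    have m0 : 0 <= M * (1 - x) by rewrite mulr_ge0// subr_ge0 ltW.
    by rewrite /D -[K.+2%:R]natr1; move: (K.+1%:R : R) => k; lra.
  by lra.
have hh (j : nat) : (K.+2 <= j)%N -> normc (hrem lam 0 j * (x ^+ j)%:C - hrem lam 0 j) <= inv1 M j.-1 - inv1 M j.
  case: j => [|[|j]]// _; rewrite fac.
  have /andP[y0 y1] := xm j.+2.
  rewrite normcM normc_real normrN (ger0_norm y0).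
  have [_ hb] := hM j.
  apply: le_trans hb; rewrite ler_piMr ?normc_ge0//.
  by have := exprn_ge0 j.+2 x0; lra.
have := @le_telescope R (fun q => \sum_(K.+2 <= j < q) (hrem lam 0 j * (x ^+ j)%:C - hrem lam 0 j))
  (fun j => inv1 M j.-1) K.+2 p pN.
rewrite [X in _ - X]big_geq// subr0 => H; apply: (le_trans (H _)).
  by move=> j Nj; rewrite big_nat_recr//= addrAC subrr add0r; exact: hh.
by rewrite (le_trans _ hK)//= gerBl inv1_ge0.
Unshelve. all: by end_near. Qed.

(** Domination by the logarithmic comparison series, uniform in al; this is what
    square-integrability needs. *)
Lemma hF_bound : exists M, 0 <= M /\ forall al x, 0 <= al -> 0 <= x < 1 ->
  normc (hF al x) <= 1 + M * - ln (1 - x).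
Proof.
have [M [M0 hM]] := hc_bound lam; exists M; split => // al x a0 hx.
have /andP[x0 x1] := hx; have xn : `|x| < 1 by rewrite ger0_norm.
have h00 : 0 <= (0 : R) <= 1 by rewrite lexx ler01.
have s0 := csum_cpsum (crad1_hc a0) xn.
have s1 : ctends \oo (fun N => \sum_(0 <= m < N) cq 0 m * (x ^+ m)%:C) (- ln (1 - x))%:C.
  by rewrite -hQ_zero//; exact: (csum_cpsum (crad1_cq h00) xn).
have := ctends_normc s0 => /(_ _) l0.
have l1 : (fun N => 1 + M * complex.Re (\sum_(0 <= m < N) cq 0 m * (x ^+ m)%:C)) @ \oo --> 1 + M * - ln (1 - x).
  apply: cvgD; first exact: cvg_cst.
  by apply: cvgM; [exact: cvg_cst|exact: (ctends_Re s1)].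
rewrite -/(hF al x) in l0.
apply: (ler_cvg_to l0 l1); near=> N.
have N0 : (0 < N)%N by near: N; exact: nbhs_infty_gt.
rewrite -(prednK N0); set p := N.-1.
rewrite (le_trans (normc_sum _ _ _))// Re_sum big_nat_recl// [in leRHS]big_nat_recl//=.
rewrite hc0 expr0 mulr1 normc1 /cq (_ : qc 0 0 = 0)// !mul0r subrr add0r lerD2l mulr_sumr.
apply: ler_sum_nat => i _.
rewrite normcM normc_real (ger0_norm (exprn_ge0 _ x0)) qc0 subr0 mulrA ler_wpM2r ?exprn_ge0//.
rewrite (le_trans (hM al i a0))// ler_piMr ?divr_ge0// tprod_le1//.
Unshelve. all: by end_near. Qed.
End HypergeometricFunction.

(** * Euler's reflection formula *)

Section Reflection.
Variable R : realType.
Implicit Types (z w : R[i]) (t x : R).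

Lemma i_neq0 : ('i%C : R[i]) != 0.
Proof. by rewrite eq_complex /= oner_eq0 andbF. Qed.

Lemma csin_ccos z : ccos z ^+ 2 + csin z ^+ 2 = 1.
Proof.
have i2 := sqr_i R; have i0 := i_neq0.
have e : cexp ('i%C * z) * cexp (- ('i%C * z)) = 1 by rewrite -cexpD subrr cexp0.
have e4 : (2 * 'i%C)^-1 ^+ 2 = - 4^-1 :> R[i] by rewrite exprVn exprMn i2; field.
rewrite /ccos /csin [((_ - _) * _) ^+ 2]exprMn e4.
move: (cexp ('i%C * z)) (cexp (- ('i%C * z))) e => a b e.
transitivity (a * b); last by [].
by field.
Qed.

Lemma csin0 : csin 0 = 0 :> R[i].
Proof. by rewrite /csin mulr0 oppr0 subrr mul0r. Qed.

Lemma ccos0 : ccos 0 = 1 :> R[i].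
Proof. by rewrite /ccos mulr0 oppr0 cexp0; field. Qed.

Lemma csinN z : csin (- z) = - csin z.
Proof. by rewrite /csin mulrN opprK -[RHS]mulNr opprB. Qed.

Lemma qder_ccos z : qder (@ccos R) z (- csin z).
Proof.
have i0 := i_neq0; have i2 := sqr_i R.
have h1 := qder_cexp ('i%C * z + 0).
have h2 := qder_cexp (- 'i%C * z + 0).
have := qderD (qder_scale (2)^-1 (qder_aff i0 h1))
  (qder_scale (2)^-1 (qder_aff _ h2)).
rewrite oppr_eq0 i0 => /(_ isT).
rewrite !addr0 !mulNr.
have -> : 2^-1 * ('i%C * cexp ('i%C * z))
   + 2^-1 * (- ('i%C * cexp (- ('i%C * z)))) = - csin z.
  rewrite /csin; move: (cexp ('i%C * z)) (cexp (- ('i%C * z))) => a b.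
  transitivity (2^-1 * 'i%C * (a - b)); first by ring.
  transitivity (2^-1 * 'i%C^-1 * ('i%C ^+ 2) * (a - b)); first by field; rewrite i0.
  by rewrite i2; field; rewrite i0.
by apply: qder_ext => w; rewrite !addr0 !mulNr /ccos; field.
Qed.

Lemma is_derive_quad (h : R -> R) (x d C e : R) : 0 <= C -> 0 < e ->
  (forall s, `|s| <= e -> `|h (x + s) - h x - s * d| <= C * s ^+ 2) -> is_derive x 1 h d.
Proof.
move=> C0 e0 H.
have L : (fun s : R => s^-1 *: ((h \o shift x) (s *: 1) - h x)) @ 0^' --> d.
  apply/cvgrPdist_le => r r0; near=> s.
  have s0 : s != 0 by near: s; exact: nbhs_dnbhs_neq.
  have se : `|s| <= e by near: s; apply: dnbhs0_le.
  have sr : `|s| <= r / (C + 1) by near: s; apply: dnbhs0_le; rewrite divr_gt0//; lra.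
  rewrite distrC.
  rewrite (_ : _ - d = s^-1 * (h (x + s) - h x - s * d)); last first.
    by rewrite /GRing.scale/= mulr1 [s + x]addrC; field.
  rewrite normrM normfV ler_pdivrMl ?normr_gt0// (le_trans (H s se))//.
  rewrite -[s ^+ 2]real_normK ?num_real// expr2 mulrCA ler_wpM2l//.
  move: sr; rewrite ler_pdivlMr; last by lra.
  by have := normr_ge0 s; lra.
split; first by apply/cvg_ex; exists d.
by apply/cvg_lim.
Unshelve. all: by end_near. Qed.

(** A complex derivative restricts to every real line through the origin. *)
Lemma qder_cder (f : R[i] -> R[i]) (w : R[i]) x d : qder f (w * x%:C) d ->
  cder (fun t => f (w * t%:C)) x (w * d).
Proof.
move=> [C [e [C0 e0 H]]].
pose W := normc w + 1; have W0 : 0 < W by rewrite ltr_wpDl ?normc_ge0.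
have key s : `|s| <= e / W -> normc (f (w * (x + s)%:C) - f (w * x%:C) - s%:C * (w * d)) <= (C * W ^+ 2) * s ^+ 2.
  move=> hs; have n0 := normc_ge0 w; have a0 := normr_ge0 s.
  have nh : normc (w * s%:C) <= `|s| * W by rewrite normcM normc_real /W; nra.
  have := H (w * s%:C); rewrite (_ : w * x%:C + w * s%:C = w * (x + s)%:C); last by rewrite rCD; ring.
  rewrite (_ : w * s%:C * d = s%:C * (w * d)); last by ring.
  move=> /(_ _)/le_trans; apply.
    by rewrite (le_trans nh)// -ler_pdivlMr.
  rewrite -mulrA ler_wpM2l// -[s ^+ 2]real_normK ?num_real// -exprMn lerXn2r ?nnegrE ?normc_ge0//.
    by rewrite mulr_ge0// ltW.
  by rewrite [W * _]mulrC.
have C2 : 0 <= C * W ^+ 2 by rewrite mulr_ge0 ?sqr_ge0.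
have e2 : 0 < e / W by rewrite divr_gt0.
split; apply: (is_derive_quad C2 e2) => s hs.
- apply: le_trans (key s hs); apply: le_trans (Re_le_normc _).
  by rewrite !ReB !ReM /= mul0r subr0.
- apply: le_trans (key s hs); apply: le_trans (Im_le_normc _).
  by rewrite !ImB !ImM /= !mul0r addr0.
Qed.

Lemma sq_sin_lt1 t : - (pi / 2) < t < pi / 2 -> 0 <= sin t ^+ 2 < 1.
Proof.
move=> h; rewrite sqr_ge0 /= sin2cos2 gtrBl exprn_gt0//.
by apply: cos_gt0_pihalf.
Qed.

(** With parameter 1/2 the hypergeometric function is elementary, and Gauss's
    summation at its endpoint becomes the product formula for the sine. *)
Lemma hF_half z t : - (pi / 2) < t < pi / 2 ->
  2 * z * (sin t)%:C * hF (z ^+ 2 - 4^-1) 2^-1 (sin t ^+ 2) = csin (2 * z * t%:C).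
Proof.
set lam := z ^+ 2 - 4^-1; set w := 2 * z => ht.
have a0 : 0 <= (2^-1 : R) by [].
pose X (t : R) := sin t ^+ 2 : R.
pose f t := (sin t)%:C * hF lam 2^-1 (X t).
pose g t := (cos t)%:C * (hF lam 2^-1 (X t) + 2 * (X t)%:C * hF' lam 2^-1 (X t)).
have Xn s : - (pi / 2) < s < pi / 2 -> `|X s| < 1.
  by move=> /sq_sin_lt1 /andP[h1 h2]; rewrite ger0_norm.
have dX (s : R) : is_derive s 1 X (2 * sin s * cos s).
  apply: (is_derive_eqd (is_deriveMf (is_derive_sin s) (is_derive_sin s))); ring.
have df s : - (pi / 2) < s < pi / 2 -> cder f s (g s).
  move=> /Xn xs.
  apply: (cder_eq (cderM (cder_real (is_derive_sin s)) (cder_comp (hF_der lam a0 xs) (dX s)))).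
  have xs2 : (X s)%:C = (sin s)%:C ^+ 2 :> R[i] by rewrite -rCX.
  rewrite /g xs2 (rCM (2 * sin s)) (rCM 2) rCnat; ring.
have dg s : - (pi / 2) < s < pi / 2 -> cder g s (- w ^+ 2 * f s).
  move=> /Xn xs.
  have d2 := cderM (cderM (cder_cst 2 s) (cder_real (dX s))) (cder_comp (hF'_der lam a0 xs) (dX s)).
  apply: (cder_eq (cderM (cder_real (is_derive_cos s)) (cderD (cder_comp (hF_der lam a0 xs) (dX s)) d2))).
  have o := hF_ode lam a0 xs.
  have e : (2^-1)%:C = 2^-1 :> R[i] by rewrite rCV rCnat.
  rewrite e in o.
  have cs : (cos s)%:C ^+ 2 = 1 - (X s)%:C :> R[i] by rewrite -rCX cos2sin2 rC1B.
  have xs2 : (sin s)%:C ^+ 2 = (X s)%:C :> R[i] by rewrite -rCX.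
  rewrite /f rCN -xs2 !(rCM (2 * sin s)) !(rCM 2) !rCnat.
  have lE : w ^+ 2 = 4 * lam + 1 by rewrite /w /lam; field.
  rewrite lE; move: o cs; rewrite -!xs2.
  move: (hF'' lam 2^-1 (X s)) (hF' lam 2^-1 (X s)) (hF lam 2^-1 (X s)) (sin s)%:C (cos s)%:C.
  move=> F2 F1 F0 S C o cs.
  transitivity (S * (2 * C ^+ 2 * (3 * F1 + 2 * S ^+ 2 * F2) - F0 - 2 * S ^+ 2 * F1)); first by ring.
  rewrite cs.
  transitivity (4 * S * (S ^+ 2 * (1 - S ^+ 2) * F2 + (1 + 2^-1 - 2 * S ^+ 2) * F1 + lam * F0) - S * F0 * (4 * lam + 1)).
    by field.
  by rewrite o; ring.
(* f and g solve the system of (sin wt)/w and cos wt; the two Wronskian-type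
   combinations below are constant on the interval. *)
pose C s := ccos (w * s%:C); pose S s := csin (w * s%:C).
have dC s : cder C s (w * - S s) by apply: qder_cder; exact: qder_ccos.
have dS s : cder S s (w * C s) by apply: qder_cder; exact: qder_csin.
have h0 : - (pi / 2) < (0 : R) < pi / 2.
  by rewrite oppr_lt0 divr_gt0 ?pi_gt0.
have f0 : f 0 = 0 by rewrite /f sin0 mul0r.
have g0 : g 0 = 1 by rewrite /g /X sin0 cos0 expr0n /= hF_0 mulr0 mul0r addr0 mulr1.
have S0 : S 0 = 0 by rewrite /S mulr0 csin0.
have C0 : C 0 = 1 by rewrite /C mulr0 ccos0.
have W1 : f t * w * C t - g t * S t = 0.
  have D s : - (pi / 2) < s < pi / 2 -> cder (fun s => f s * w * C s - g s * S s) s 0.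
    move=> hs; apply: (cder_eq (cderB (cderM (cderM (df s hs) (cder_cst w s)) (dC s)) (cderM (dg s hs) (dS s)))).
    ring.
  by rewrite (cder0_cst D ht h0) f0 S0 !mul0r mulr0 subrr.
have W2 : f t * w * S t + g t * C t = 1.
  have D s : - (pi / 2) < s < pi / 2 -> cder (fun s => f s * w * S s + g s * C s) s 0.
    move=> hs; apply: (cder_eq (cderD (cderM (cderM (df s hs) (cder_cst w s)) (dS s)) (cderM (dg s hs) (dC s)))).
    ring.
  by rewrite (cder0_cst D ht h0) f0 C0 g0 !mul0r mulr1 add0r.
have CS : C t ^+ 2 + S t ^+ 2 = 1 := csin_ccos _.
transitivity (f t * w); first by rewrite /f /X; ring.
transitivity (f t * w * (C t ^+ 2 + S t ^+ 2)); first by rewrite CS mulr1.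
transitivity ((f t * w * C t - g t * S t) * C t + (f t * w * S t + g t * C t) * S t); first by ring.
by rewrite W1 W2 mul0r add0r mul1r.
Qed.

(** Letting t tend to pi/2 in the previous identity, where sin^2 t tends to 1 and
    the square-root singularity of F contributes cos t, which tends to 0. *)
Lemma hsum_half z : 2 * z * hsum (z ^+ 2 - 4^-1) (2^-1 : R) = csin (pi%:C * z).
Proof.
set lam := z ^+ 2 - 4^-1.
have ha : 0 < (2^-1 : R) < 1 by rewrite invr_gt0 ltr0n invf_lt1 ?ltr1n.
pose s (N : nat) : R := N.+1%:R^-1.
have s0 N : 0 < s N by rewrite invr_gt0.
have s1 N : s N <= 1 by rewrite invf_le1// ler1n.
have sc : s @ \oo --> (0 : R) by exact: cvg_harmonic.
have pi2 : (1 : R) <= pi / 2 := pihalf_ge1 R.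
have [C hC] := hF_pos lam ha.
pose th N := pi / 2 - s N.
have thb N : - (pi / 2) < th N < pi / 2.
  by have := s0 N; have := s1 N; rewrite /th => h1 h2; apply/andP; split; lra.
have sth N : sin (th N) = cos (s N).
  by rewrite /th sinB sin_pihalf cos_pihalf mul1r mul0r subr0.
have cos1 : (fun N => cos (s N)) @ \oo --> (1 : R).
  by rewrite -cos0; apply: continuous_cvg => //; exact: continuous_cos.
have sin1 : (fun N => sin (s N)) @ \oo --> (0 : R).
  by rewrite -[X in _ --> X]sin0; apply: continuous_cvg => //; exact: continuous_sin.
have xb N : 0 <= cos (s N) ^+ 2 < 1 by rewrite -sth; exact: sq_sin_lt1.
have snn N : 0 <= sin (s N).
  apply: sin_ge0_pi; rewrite (ltW (s0 N))/=; have := s1 N; lra.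
have lF : ctends \oo (fun N => hF lam 2^-1 (cos (s N) ^+ 2)) (hsum lam 2^-1).
  pose k := kap lam 2^-1 / (2^-1 : R)%:C.
  apply: (@ctends_le _ _ _ _ _ _ (fun N => C * sin (s N) ^+ 2 + normc k * sin (s N))).
    rewrite [X in _ --> X](_ : _ = C * 0 ^+ 2 + normc k * 0); last by rewrite expr0n /= !mulr0 addr0.
    apply: cvgD; apply: cvgM => //; try exact: cvg_cst.
    have -> : (fun N => sin (s N) ^+ 2) = (fun N => sin (s N) * sin (s N)).
      by apply/funext => N; rewrite expr2.
    by rewrite expr2; apply: cvgM.
  near=> N; have := hC _ (xb N).
  have e : 1 - cos (s N) ^+ 2 = sin (s N) ^+ 2 by rewrite sin2cos2.
  have e2 : (1 - cos (s N) ^+ 2) `^ 2^-1 = sin (s N).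
    by rewrite e -powR_mulrn// -powRrM divff// powRr1.
  rewrite e2 e => h.
  rewrite (_ : _ - hsum _ _ = (hF lam 2^-1 (cos (s N) ^+ 2) - (hsum lam 2^-1 - k * (sin (s N))%:C)) + - (k * (sin (s N))%:C)); last by ring.
  rewrite (le_trans (le_normcD _ _))// lerD// normcN normcM normc_real ger0_norm//.
have l1 : ctends \oo (fun N => 2 * z * (sin (th N))%:C * hF lam 2^-1 (sin (th N) ^+ 2)) (2 * z * 1 * hsum lam 2^-1).
  apply: ctends_ext (_ : ctends \oo (fun N => 2 * z * (cos (s N))%:C * hF lam 2^-1 (cos (s N) ^+ 2)) _).
    by move=> N; rewrite sth.
  apply: ctendsM => //; apply: ctendsZ; exact: ctends_realC.
have thc : th @ \oo --> (pi / 2 : R).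
  by rewrite -[X in _ --> X]subr0; apply: cvgB => //; exact: cvg_cst.
have l2 : ctends \oo (fun N => csin (2 * z * (th N)%:C)) (csin (pi%:C * z)).
  have := cder_cont (qder_cder (qder_csin (2 * z * (pi / 2)%:C))).
  rewrite (_ : 2 * z * (pi / 2)%:C = pi%:C * z); last by rewrite rCM rCV rCnat; field.
  rewrite /ctends => h.
  apply: (cvg_comp th (fun x => normc (csin (2 * z * x%:C) - csin (pi%:C * z))) _ h).
  exact: thc.
have l3 : ctends \oo (fun N => csin (2 * z * (th N)%:C)) (2 * z * 1 * hsum lam 2^-1).
  by apply: ctends_ext l1 => N; exact: hF_half.
by rewrite (ctends_uniq l2 l3) mulr1.
Unshelve. all: by end_near. Qed.

Lemma rgam_halfs z : 2 * z * (rgam (1 - z) * rgam (1 + z)) = (rgam 2^-1 * rgam (1 + 2^-1)) * csin (pi%:C * z).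
Proof.
have ha : 0 < (2^-1 : R) by [].
have h := hsum_half z.
rewrite (@hsum_rgam _ _ (z - 2^-1) _ _ ha) in h; last by field.
have np1 : rgam ((2^-1 : R)%:C) != 0 by apply: rgam_neq0; exact: natD_nonpole.
have np2 : rgam (1 + (2^-1 : R)%:C) != 0 by apply: rgam_neq0; apply: natD1_nonpole.
rewrite (_ : (2^-1 : R)%:C = 2^-1) in h np1 np2; last by rewrite rCV rCnat.
rewrite -h (_ : 2^-1 - (z - 2^-1) = 1 - z); last by field.
rewrite (_ : 1 + 2^-1 + (z - 2^-1) = 1 + z); last by ring.
by field; rewrite np1 np2.
Qed.

(** Comparison of the derivatives of both sides at z = 0; this avoids the
    Gaussian integral. *)
Lemma rgam_half_const : rgam 2^-1 * rgam (1 + 2^-1) * pi%:C = 2 :> R[i].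
Proof.
set c := rgam 2^-1 * _.
have h1 : qder (@rgam R) 1 (- psi 1 * rgam 1) := rgam_qder (@nonpole1 R).
have q1 : qder (fun w : R[i] => rgam (-1 * w + 1)) 0 (-1 * (- psi 1 * rgam 1)).
  by apply: qder_aff; rewrite ?mulr0 ?add0r// oppr_eq0 oner_eq0.
have q2 : qder (fun w : R[i] => rgam (1 * w + 1)) 0 (1 * (- psi 1 * rgam 1)).
  by apply: qder_aff; rewrite ?mulr0 ?add0r// oner_eq0.
have q0 : qder (fun w : R[i] => 2 * w) 0 2.
  exists 0, 1; split => // h _; rewrite mul0r mulr0 subr0 add0r [h * 2]mulrC subrr normc0//.
have q3 : qder (fun w : R[i] => c * csin (pi%:C * w + 0)) 0 (c * (pi%:C * ccos 0)).
  apply: qder_scale; apply: qder_aff; first by rewrite rC_eq0 gt_eqF ?pi_gt0.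
  by rewrite mulr0 addr0; exact: qder_csin.
have q := qderM q0 (qderM q1 q2).
have e w : 2 * w * (rgam (-1 * w + 1) * rgam (1 * w + 1)) = c * csin (pi%:C * w + 0).
  rewrite addr0 /c -rgam_halfs mulN1r mul1r [- w + 1]addrC [w + 1]addrC.
  by [].
have := qder_uniq (qder_ext e q) q3.
rewrite !mulr0 !add0r rgam1 ccos0 !mulr1 mul0r addr0 => ->.
by [].
Qed.

Lemma piC_neq0 : (pi%:C : R[i]) != 0.
Proof. by rewrite rC_eq0 gt_eqF ?pi_gt0. Qed.

Lemma rgam_reflection z : rgam z * rgam (1 - z) = csin (pi%:C * z) / pi%:C.
Proof.
have p0 := piC_neq0; have h := rgam_halfs z; have c := rgam_half_const.
rewrite [X in X * _ = _]rgamD1; apply: (mulIf p0); rewrite divfK//.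
have c0 : rgam 2^-1 * rgam (1 + 2^-1) != 0 :> R[i].
  by apply/eqP => e; move: c; rewrite e mul0r => /eqP; rewrite eq_sym pnatr_eq0.
apply: (mulfI c0); rewrite -h -[in RHS]mulrA.
transitivity (z * (rgam (1 - z) * rgam (z + 1)) * (rgam 2^-1 * rgam (1 + 2^-1) * pi%:C)); first by ring.
by rewrite c [z + 1]addrC; ring.
Qed.
End Reflection.

(** * Connection coefficients *)

Section ConnectionCoefficients.
Variable R : realType.
Variables (n : nat) (lam nu : R[i]).
Hypothesis n0 : (0 < n)%N.
Hypothesis hnu : lam = nu * (nu + 1).
Implicit Types (z w : R[i]) (k : nat).

Definition mode_ratio k : R := k%:R / n%:R.

(** Coefficients of the regular and of the singular behaviour, as r -> 0+, of the
    radial solution that is regular at infinity. They are read off the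
    expansion of F at 1, since F is evaluated at 1 - xi r, with
    (xi r)^al ~ r^(2k) and ln (xi r) ~ 2n ln r. *)
Definition conA k : R[i] :=
  if k == 0%N then hconst lam else - kap lam (mode_ratio k) / (mode_ratio k)%:C.
Definition conB k : R[i] :=
  if k == 0%N then - (2 * n%:R * kap lam 0) else hsum lam (mode_ratio k).

Lemma mode_ratio_ge0 k : 0 <= mode_ratio k. Proof. by rewrite divr_ge0. Qed.

Lemma mode_ratio_bounds k : (0 < k < n)%N -> 0 < mode_ratio k < 1.
Proof.
move=> /andP[k0 kn]; rewrite /mode_ratio divr_gt0 ?ltr0n//=.
by rewrite ltr_pdivrMr ?ltr0n// mul1r ltr_nat.
Qed.

(** Reflection formula at - nu and at al. *)
Lemma kap_csin (al : R) : 0 < al < 1 ->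
  - kap lam al / al%:C = csin (pi%:C * nu) / csin (pi%:C * al%:C) /\ csin (pi%:C * al%:C) != 0.
Proof.
move=> ha; have /andP[a0 a1] := ha; have ha' : 0 <= al < 1 by rewrite ltW.
have p0 := piC_neq0 R.
have e1 := rgam_reflection (- nu); rewrite opprK mulrN csinN in e1.
have e2 := rgam_reflection al%:C; rewrite [X in X * _ = _]rgamD1 [al%:C + 1]addrC in e2.
have r1 : rgam (1 + al%:C) != 0 by apply: rgam_neq0; apply: natD1_nonpole; exact: ltW.
have r2 : rgam (1 - al%:C) != 0.
  apply: rgam_neq0 => j; rewrite -rC1B -rCnat -rCD rC_eq0 gt_eqF//.
  by rewrite ltr_wpDr// subr_gt0.
have aC : al%:C != 0 :> R[i] by rewrite rC_eq0 gt_eqF.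
have s0 : csin (pi%:C * al%:C) != 0.
  apply/eqP => s0; move: e2; rewrite s0 mul0r => /eqP.
  by rewrite !mulf_eq0 (negPf aC) (negPf r1) (negPf r2).
split => //; rewrite (kap_rgam hnu ha') e1.
have -> : csin (pi%:C * al%:C) = pi%:C * (al%:C * rgam (1 + al%:C) * rgam (1 - al%:C)).
  by rewrite e2 mulrCA divff// mulr1.
move: (csin _) => s; move: (rgam (1 + _)) r1 => x x0; move: (rgam (1 - _)) r2 => y y0.
move: (pi%:C : R[i]) p0 => p p0; move: (al%:C : R[i]) aC => a a0'.
by field; rewrite p0 a0' x0 y0.
Qed.

Lemma kap0_csin : kap lam 0 = - csin (pi%:C * nu) / pi%:C.
Proof.
have e1 := rgam_reflection (- nu); rewrite opprK mulrN csinN in e1.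
by rewrite (kap_rgam hnu (h01 R)) addr0 subr0 rgam1 mulr1 divr1 e1.
Qed.

(** By Gauss's theorem the Gauss sum minus its pole kap / al is, up to a factor
    tending to 1, the difference quotient at al = 0 of a combination of products
    of 1/Gamma, so its limit is a combination of logarithmic derivatives. *)
Lemma hconst_psi : nonpole (- nu) -> nonpole (1 + nu) ->
  hconst lam = - kap lam 0 * (psi (- nu) + psi (1 + nu) - 2 * psi 1).
Proof.
move=> np1 np2.
pose N w := rgam (1 * w + - nu) * rgam (1 * w + (1 + nu)).
pose g w := rgam (1 * w + 1).
have q1 : qder (fun w => rgam (1 * w + - nu)) 0 (1 * (- psi (- nu) * rgam (- nu))).
  by apply: qder_aff; rewrite ?mulr0 ?add0r ?oner_neq0//; exact: rgam_qder.
have q2 : qder (fun w => rgam (1 * w + (1 + nu))) 0 (1 * (- psi (1 + nu) * rgam (1 + nu))).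
  by apply: qder_aff; rewrite ?mulr0 ?add0r ?oner_neq0//; exact: rgam_qder.
have q3 : qder g 0 (1 * (- psi 1 * rgam 1)).
  by apply: qder_aff; rewrite ?mulr0 ?add0r ?oner_neq0//; apply: rgam_qder; exact: nonpole1.
have q := qderD (qderM q1 q2) (qder_scale (- kap lam 0) (qderM q3 q3)).
have K0 : kap lam 0 = rgam (- nu) * rgam (1 + nu).
  by rewrite (kap_rgam hnu (h01 R)) addr0 subr0 rgam1 mulr1 divr1.
rewrite !mulr0 !add0r rgam1 in q.
set d := (X in qder _ _ X) in q.
have dE : d = - kap lam 0 * (psi (- nu) + psi (1 + nu) - 2 * psi 1).
  by rewrite /d /g mulr0 add0r rgam1 K0; ring.
rewrite -dE.
(* The sequence of exponents along which the logarithmic constant was obtained. *)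
pose al := fun m : nat => (m.+1%:R ^- 2 : R).
have al0 m : 0 < al m by rewrite invr_gt0 exprn_gt0// ltr0n.
have alc : al @ \oo --> (0 : R).
  rewrite (_ : al = (fun m => m.+1%:R^-1 * m.+1%:R^-1)); last first.
    by apply/funext => m; rewrite /al -exprVn expr2.
  by rewrite -(mulr0 0); apply: cvgM; exact: cvg_harmonic.
have hs m : hsum lam (al m) - kap lam 0 / (al m)%:C =
   ((al m)%:C)^-1 * (N (al m)%:C + - kap lam 0 * (g (al m)%:C * g (al m)%:C)) * (rgam (1 + (al m)%:C))^-1 ^+ 2.
  rewrite (hsum_rgam hnu (al0 m)) [in X in _ / (X * _)]rgamD1 /N /g !mul1r [(al m)%:C + 1]addrC.
  have aC : (al m)%:C != 0 :> R[i] by rewrite rC_eq0 gt_eqF.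
  have r1 : rgam (1 + (al m)%:C) != 0 by apply: rgam_neq0; apply: natD1_nonpole; exact: ltW.
  rewrite [(al m)%:C + (1 + nu)]addrCA addrA.
  by move: (al m)%:C aC r1 => a aC r1; field; rewrite aC r1.
apply: ctends_uniq (hconst_lim lam) _.
apply: ctends_ext (fun m => esym (hs m)) _.
rewrite -[d]mulr1; apply: ctendsM; last first.
  have l : ctends \oo (fun m => rgam (1 + (al m)%:C)) 1.
    have := qder_ctends q3; rewrite /g mulr0 add0r rgam1 => h.
    have := qder_lip q3; move=> [C [e [C0 e0 H]]].
    apply: (@ctends_le _ _ _ _ _ _ (fun m => C * al m)).
      by rewrite -(mulr0 C); apply: cvgM => //; exact: cvg_cst.
    have := alc => /cvgrPdist_lt/(_ e e0); apply: filterS => m.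
    rewrite sub0r normrN => am.
    have := H (al m)%:C; rewrite normc_real (ltW am) => /(_ isT).
    rewrite (_ : g (0 + (al m)%:C) = rgam (1 + (al m)%:C)); last by rewrite /g add0r mul1r addrC.
    by rewrite (_ : g 0 = 1) ?(ger0_norm (ltW (al0 m)))//; rewrite /g mulr0 add0r rgam1.
  have := ctendsV (oner_neq0 _) l; rewrite invr1 => lV.
  have {}lV : ctends \oo (fun m => (rgam (1 + (al m)%:C))^-1) 1 by exact: lV.
  have lVV : ctends \oo (fun m => (rgam (1 + (al m)%:C))^-1 * (rgam (1 + (al m)%:C))^-1) (1 * 1) by exact: ctendsM.
  by rewrite mulr1 in lVV; apply: ctends_ext lVV => m; rewrite expr2.
move: q => [C [e [C0 e0 H]]].
apply: (@ctends_le _ _ _ _ _ _ (fun m => C * al m)).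
  by rewrite -(mulr0 C); apply: cvgM => //; exact: cvg_cst.
have := alc => /cvgrPdist_lt/(_ e e0); apply: filterS => m.
rewrite sub0r normrN => am.
have := H (al m)%:C; rewrite normc_real (ltW am) => /(_ isT).
have aC : (al m)%:C != 0 :> R[i] by rewrite rC_eq0 gt_eqF.
have z0 : rgam (1 * 0 + - nu) * rgam (1 * 0 + (1 + nu)) + - kap lam 0 * (g 0 * g 0) = 0.
  by rewrite /g !mulr0 !add0r rgam1 K0; ring.
rewrite z0 subr0 !add0r -/(N _) (ger0_norm (ltW (al0 m))).
set P := N _ + _; rewrite (_ : P - _ = (al m)%:C * ((al m)%:C^-1 * P - d)); last by field.
rewrite normcM normc_real (ger0_norm (ltW (al0 m))) expr2 mulrCA ler_pM2l//.
Qed.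

Lemma qder_isolated_zero (f : R[i] -> R[i]) z d : qder f z d -> f z = 0 -> d != 0 ->
  \forall w \near (z : R[i]^o)^', f w != 0.
Proof.
move=> [C [e [C0 e0 H]]] fz d0.
have nd : 0 < normc d by rewrite normc_gt0.
have idz : ctends ((z : R[i]^o)^') id z.
  apply/ctendsP; by move=> A A0; apply: (@nbhs_dnbhs _ (z : R[i]^o) A A0).
pose r := Num.min e (normc d / (C + 1)).
have r0 : 0 < r by rewrite lt_min e0 divr_gt0//; lra.
have := idz => /cvgrPdist_lt/(_ r r0) hr.
near=> w.
have wz : w != z.
  near: w; exact: (@nbhs_dnbhs_neq (R[i]^o) z).
have : normc (w - z) < r.
  near: w; apply: filterS hr => w; by rewrite sub0r normrN ger0_norm ?normc_ge0.
rewrite lt_min => /andP[we wd].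
have := H (w - z) (ltW we); rewrite [z + _]addrC subrK fz subr0 => h.
apply/eqP => fw; move: h; rewrite fw sub0r normcN normcM expr2 mulrCA.
have h0 : 0 < normc (w - z) by rewrite normc_gt0 subr_eq0.
rewrite ler_pM2l// leNgt => /negP; apply.
move: wd; rewrite ltr_pdivlMr; last by lra.
lra.
Unshelve. all: by end_near. Qed.

(** By the reflection formula the quotient of gamma factors and the sine in the
    denominator equal an expression in 1/Gamma that is continuous at nu, also
    where the sine vanishes. *)
Lemma entry_continued (al : R) (e : R[i] -> R[i]) (de : R[i]) :
  0 < al < 1 -> hsum lam al != 0 -> qder e nu de ->
  continued (fun w => csin (pi%:C * (w - al%:C)))
    (fun w => - (cGamma (1 - al%:C) / cGamma (1 + al%:C))
       * (cGamma (w + al%:C + 1) / cGamma (w - al%:C + 1))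
       * (csin (pi%:C * (w - al%:C)))^-1 * e w) nu
  = e nu / csin (pi%:C * al%:C) / hsum lam al.
Proof.
move=> ha B0 qe; have /andP[a0 a1] := ha.
have [_ s0] := kap_csin ha; have p0 := piC_neq0 R.
have r1 : rgam (1 + al%:C) != 0 by apply: rgam_neq0; apply: natD1_nonpole; exact: ltW.
have r0 : rgam (al%:C) != 0 by apply: rgam_neq0; apply: natD_nonpole.
have rr := @rgam_reflection R.
have BE := hsum_rgam hnu a0.
move: (al%:C : R[i]) (pi%:C : R[i]) s0 p0 r1 r0 rr BE => a PI s0 p0 r1 r0 rr BE.
have e2 := rr a.
have [ra rb] : rgam (a - nu) != 0 /\ rgam (1 + a + nu) != 0.
  by move: B0; rewrite BE !mulf_eq0 !negb_or => /andP[/andP[]].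
pose H w := rgam (1 + a) / rgam (1 - a) * (rgam (w + a + 1))^-1 * (rgam (a - w))^-1 / PI * e w.
have r2 : rgam (1 - a) != 0.
  apply/eqP => r2; move: e2; rewrite r2 mulr0 => /eqP.
  by rewrite eq_sym mulf_eq0 (negPf s0) invr_eq0 (negPf p0).
have gH w : csin (PI * (w - a)) != 0 ->
   - (cGamma (1 - a) / cGamma (1 + a)) * (cGamma (w + a + 1) / cGamma (w - a + 1))
       * (csin (PI * (w - a)))^-1 * e w = H w.
  move=> sw; rewrite !cGammaE !invrK /H.
  have := rr (w - a); rewrite [X in X * _ = _]rgamD1.
  have -> : 1 - (w - a) = 1 + (a - w) by ring.
  have e3 := rgamD1 (a - w); rewrite [a - w + 1]addrC in e3.
  have e4 : rgam (w - a + 1) * rgam (a - w) = - (csin (PI * (w - a)) / PI).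
    have := rr (a - w); rewrite mulrC (_ : 1 - (a - w) = w - a + 1); last by ring.
    move=> ->; rewrite (_ : a - w = - (w - a)); last by ring.
    by rewrite mulrN csinN mulNr.
  have rw : rgam (a - w) != 0.
    apply/eqP => rw; move: e4; rewrite rw mulr0 => /eqP.
    by rewrite eq_sym oppr_eq0 mulf_eq0 (negPf sw) invr_eq0 (negPf p0).
  move=> _; have -> : csin (PI * (w - a)) = - PI * (rgam (w - a + 1) * rgam (a - w)).
    by rewrite e4; field.
  have rw1 : rgam (w - a + 1) != 0.
    apply/eqP => rw1; move: e4; rewrite rw1 mul0r => /eqP.
    by rewrite eq_sym oppr_eq0 mulf_eq0 (negPf sw) invr_eq0 (negPf p0).
  have [->|rc] := eqVneq (rgam (w + a + 1)) 0; first by rewrite invr0 mul0r !(mulr0, mul0r).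
  by field; rewrite ?p0 ?r1 ?r2 ?rw ?rw1 ?rc.
have Hnu : H nu = e nu / csin (PI * a) / hsum lam al.
  have -> : csin (PI * a) = PI * (rgam a * rgam (1 - a)) by rewrite e2; field.
  rewrite /H BE (_ : nu + a + 1 = 1 + a + nu); last by ring.
  by field; rewrite p0 r0 r1 r2 ra rb.
rewrite /continued; case: ifPn => [/eqP sz|sz]; last by rewrite gH.
rewrite -Hnu; apply: ctends_lim.
have pa : nonpole (1 + a + nu) := rgam_neq0P rb.
have pb : nonpole (a - nu) := rgam_neq0P ra.
have dn (f : R[i] -> R[i]) l : ctends (nbhs (nu : R[i]^o)) f l -> ctends ((nu : R[i]^o)^') f l.
  by rewrite /ctends => h; apply: cvg_trans h => A; exact: nbhs_dnbhs.
have q1 : qder (fun w => rgam (1 * w + (a + 1))) nu (1 * (- psi (1 + a + nu) * rgam (1 + a + nu))).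
  apply: qder_aff; first exact: oner_neq0.
  by rewrite (_ : 1 * nu + (a + 1) = 1 + a + nu); [exact: rgam_qder|ring].
have q2 : qder (fun w => rgam (-1 * w + a)) nu (-1 * (- psi (a - nu) * rgam (a - nu))).
  apply: qder_aff; first by rewrite oppr_eq0 oner_eq0.
  by rewrite (_ : -1 * nu + a = a - nu); [exact: rgam_qder|ring].
have lH : ctends ((nu : R[i]^o)^') H (H nu).
  apply: dn; rewrite /H.
  apply: ctendsM; last exact: qder_ctends qe.
  apply: ctendsM; last exact: ctends_cst.
  apply: ctendsM; [apply: ctendsZ|]; apply: ctendsV.
  - by rewrite (_ : nu + a + 1 = 1 + a + nu); last by ring.
  - have := qder_ctends q1; rewrite mul1r addrA; apply: ctends_ext => w.
    by rewrite mul1r addrA.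
  - exact: ra.
  - have := qder_ctends q2; rewrite mulN1r addrC; apply: ctends_ext => w.
    by rewrite mulN1r addrC.
apply: ctends_eq _ lH.
have qs : qder (fun w => csin (PI * w + - (PI * a))) nu (PI * ccos (PI * (nu - a))).
  apply: qder_aff => //; rewrite mulrBr; exact: qder_csin.
have qs' : qder (fun w => csin (PI * (w - a))) nu (PI * ccos (PI * (nu - a))).
  by apply: qder_ext qs => w; rewrite mulrBr.
have := qder_isolated_zero qs' sz.
have -> : PI * ccos (PI * (nu - a)) != 0.
  rewrite mulf_neq0//; apply/eqP => c0; have := csin_ccos (PI * (nu - a)).
  by rewrite c0 sz !expr0n /= addr0 => /eqP; rewrite eq_sym oner_eq0.
move=> /(_ isT); apply: filterS => w; by move=> /gH ->.
Qed.

(** For k = 0 the reflection formula for psi turns psi (- nu) + psi (nu + 1) into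
    2 psi (nu + 1) + pi cot (pi nu); for k > 0 the entries are quotients of
    Gauss sums and sines. *)
Lemma S_block_con k : (k < n)%N -> conB k != 0 ->
  S_block n k nu = (if k == 0%N then -1 else 1) *:
    mx22 (conA k / conB k) (conB k)^-1 (conB k)^-1 (conA k / conB k).
Proof.
move=> kn; rewrite /conB /conA /S_block.
have [k0|k0] := eqVneq k 0%N => B0.
  have nC : (n%:R : R[i]) != 0 by rewrite pnatr_eq0 -lt0n.
  have p0 := piC_neq0 R.
  have s0 : csin (pi%:C * nu) != 0.
    move: B0; rewrite kap0_csin oppr_eq0 mulf_eq0 negb_or => /andP[_].
    by rewrite mulf_eq0 oppr_eq0 negb_or => /andP[].
  have e1 := rgam_reflection (- nu); rewrite opprK mulrN csinN in e1.
  have [np1 np2] : nonpole (- nu) /\ nonpole (1 + nu).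
    have : rgam (- nu) * rgam (1 + nu) != 0 by rewrite e1 mulf_neq0 ?oppr_eq0 ?invr_eq0.
    by rewrite mulf_eq0 negb_or => /andP[/rgam_neq0P ? /rgam_neq0P ?].
  have rr := @rgam_reflection R.
  rewrite /S_zero digammaE; last by rewrite addrC.
  rewrite euler_gammaE (hconst_psi np1 np2) kap0_csin [nu + 1]addrC.
  have -> : (pi / 2)%:C = pi%:C / 2 :> R[i] by rewrite rCM rCV rCnat.
  move: (pi%:C : R[i]) p0 s0 e1 rr => PI p0 s0 e1 rr.
  have refl : psi (- nu) - psi (1 + nu) = PI * ccot (PI * nu).
    have q1 : qder (fun w => rgam (-1 * w + 0)) nu (-1 * (- psi (- nu) * rgam (- nu))).
      apply: qder_aff; first by rewrite oppr_eq0 oner_eq0.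
      by rewrite mulN1r addr0; exact: rgam_qder.
    have q2 : qder (fun w => rgam (1 * w + 1)) nu (1 * (- psi (1 + nu) * rgam (1 + nu))).
      apply: qder_aff; first exact: oner_neq0.
      by rewrite mul1r addrC; exact: rgam_qder.
    have q3 : qder (fun w => - PI^-1 * csin (PI * w + 0)) nu (- PI^-1 * (PI * ccos (PI * nu))).
      by apply: qder_scale; apply: qder_aff => //; rewrite addr0; exact: qder_csin.
    have e w : rgam (-1 * w + 0) * rgam (1 * w + 1) = - PI^-1 * csin (PI * w + 0).
      have := rr (- w); rewrite opprK mulrN csinN mulN1r mul1r !addr0 [w + 1]addrC => ->.
      by rewrite mulNr mulrC mulNr.
    have := qder_uniq (qder_ext e (qderM q1 q2)) q3.
    rewrite !mul1r !mulN1r addr0 [nu + 1]addrC.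
    move=> E; apply: (mulIf (_ : csin (PI * nu) != 0)) => //.
    rewrite /ccot mulrA divfK//.
    transitivity (- PI * ((psi (- nu) - psi (1 + nu)) * (rgam (- nu) * rgam (1 + nu)))).
      by rewrite e1; field.
    transitivity (- PI * (- (- psi (- nu) * rgam (- nu)) * rgam (1 + nu) +
       rgam (- nu) * (- psi (1 + nu) * rgam (1 + nu)))); first by ring.
    by rewrite E; field.
  have -> : ccot (PI * nu) = (psi (- nu) - psi (1 + nu)) / PI by rewrite refl; field.
  apply/matrixP => i j; rewrite /mx22 !mxE.
  by case: (i == 0); case: (j == 0); field; rewrite ?nC ?p0 ?s0.
have kb : (0 < k < n)%N by rewrite lt0n k0.
have ha := mode_ratio_bounds kb.
have nC : (n%:R : R[i]) != 0 by rewrite pnatr_eq0 -lt0n.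
have aE : k%:R / n%:R = (mode_ratio k)%:C :> R[i] by rewrite /mode_ratio rCM rCV !rCnat.
have p0 := piC_neq0 R.
have q1 : qder (fun w => csin (pi%:C * w)) nu (pi%:C * ccos (pi%:C * nu)).
  apply: (qder_ext (f := fun w => csin (pi%:C * w + 0))); first by move=> w; rewrite addr0.
  by apply: qder_aff => //; rewrite addr0; exact: qder_csin.
have q2 : qder (fun=> csin (pi%:C * (mode_ratio k)%:C)) nu 0.
  by exists 0, 1; split => // h _; rewrite mulr0 !subr0 subrr normc0 mul0r.
have [eA s0] := kap_csin ha.
rewrite /S_pos aE (entry_continued ha B0 q1) (entry_continued ha B0 q2) scale1r eA.
by rewrite divff// mul1r.
Qed.
End ConnectionCoefficients.

(** * Radial solutions *)

Section RadialFunctions.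
Variable R : realType.
Variables (n : nat) (lam : R[i]).
Hypothesis n0 : (0 < n)%N.
Implicit Types (r : R) (k : nat) (U DU : R -> R[i]).
Local Arguments normc : simpl never.
Local Arguments area_density : simpl never.
Local Notation alpha := (@mode_ratio R n).

(** The coordinate that makes the radial equation hypergeometric; r -> 0 and
    r -> +oo correspond to the singular points 0 and 1. *)
Definition xi r : R := r ^+ (2 * n) / (1 + r ^+ (2 * n)).

Lemma onep_gt0 r m : 0 < r -> 0 < 1 + r ^+ m.
Proof. by move=> r0; rewrite addr_gt0// exprn_gt0. Qed.

Lemma xiB r : 0 < r -> 1 - xi r = (1 + r ^+ (2 * n))^-1.
Proof.
move=> r0; rewrite /xi; have := onep_gt0 (2 * n) r0; move: (r ^+ _) => t t0.
by field; rewrite gt_eqF.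
Qed.

Lemma xi_gt0 r : 0 < r -> 0 < xi r.
Proof. by move=> r0; rewrite divr_gt0 ?exprn_gt0 ?onep_gt0. Qed.

Lemma xi_lt1 r : 0 < r -> xi r < 1.
Proof. by move=> r0; rewrite -subr_gt0 xiB// invr_gt0 onep_gt0. Qed.

Lemma xi_norm r : 0 < r -> `|xi r| < 1.
Proof. by move=> r0; rewrite ger0_norm ?xi_lt1// ltW// xi_gt0. Qed.

Lemma xi_le r : 0 < r -> xi r <= r ^+ (2 * n).
Proof.
move=> r0; rewrite /xi ler_pdivrMr ?onep_gt0//.
by have := exprn_gt0 (2 * n) r0; move: (r ^+ _) => t t0; have := sqr_ge0 t; lra.
Qed.

Lemma xi_inv r : 0 < r -> xi r^-1 = 1 - xi r.
Proof.
move=> r0; rewrite xiB// /xi exprVn; have := exprn_gt0 (2 * n) r0; move: (r ^+ _) => t t0.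
have t1 : 1 + t != 0 by rewrite gt_eqF// addr_gt0.
have t2 : t + 1 != 0 by rewrite addrC.
by field; rewrite ?t1 ?t2 ?(gt_eqF t0).
Qed.

Lemma rdens r : 0 < r -> r * area_density n r = 4 * n%:R ^+ 2 * (xi r * (1 - xi r)).
Proof.
move=> r0; rewrite xiB// /area_density /xi.
have -> : r * (4 * n%:R ^+ 2 * r ^+ (2 * n - 1) / (1 + r ^+ (2 * n)) ^+ 2) =
    4 * n%:R ^+ 2 * (r * r ^+ (2 * n - 1)) / (1 + r ^+ (2 * n)) ^+ 2.
  by move: (r ^+ (2 * n - 1)) (r ^+ (2 * n)) (n%:R : R) => a b c; ring.
rewrite -exprS (_ : (2 * n - 1).+1 = 2 * n)%N; last by lia.
have := onep_gt0 (2 * n) r0; move: (r ^+ _) (n%:R : R) => t c t0.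
by field; rewrite gt_eqF.
Qed.

(** The metric is invariant under x -> 1/x. *)
Lemma rdens_inv r : 0 < r -> r^-1 * area_density n r^-1 = r * area_density n r.
Proof.
move=> r0; rewrite !rdens ?invr_gt0// xi_inv//; congr (_ * _).
by rewrite subKr mulrC.
Qed.

Lemma is_derive_pow m r : 0 < r -> is_derive r 1 (fun t : R => t ^+ m) (m%:R * r ^+ m / r).
Proof.
move=> r0; elim: m => [|m IH].
  by rewrite !mul0r (_ : (fun _ => _) = cst 1)//; exact: is_derive_cst.
rewrite (_ : (fun t => t ^+ m.+1) = (fun t => t * t ^+ m)); last by apply/funext => t; rewrite exprS.
apply: (is_derive_eqd (is_deriveMf (is_derive_id r 1) IH)).
rewrite exprS -natr1; move: (r ^+ m) (m%:R : R) => a c.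
by field; rewrite gt_eqF.
Qed.

Lemma is_derive_xi r : 0 < r -> is_derive r 1 xi (2 * n%:R * (xi r * (1 - xi r)) / r).
Proof.
move=> r0; have t0 := onep_gt0 (2 * n) r0.
have d1 := is_derive_pow (2 * n) r0.
have d2 : is_derive r 1 (fun t : R => 1 + t ^+ (2 * n)) ((2 * n)%:R * r ^+ (2 * n) / r).
  by apply: (is_derive_eqd (is_deriveDf (is_derive_cst (1 : R) r 1) d1)); rewrite add0r.
have t1 : 1 + r ^+ (2 * n) != 0 by rewrite gt_eqF.
have d3 := @is_deriveV R (fun t => 1 + t ^+ (2 * n)) r _ 1 t1 d2.
apply: (is_derive_eqd (is_deriveMf d1 d3)).
rewrite xiB// /xi natrM /GRing.scale /=.
move: (r ^+ _) (n%:R : R) t1 => t c t1.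
by field; rewrite t1 gt_eqF.
Qed.

(** The solution of the radial equation that is regular at r = 0; r -> 1/r gives
    the one that is regular at infinity. *)
Definition ysol k r : R[i] := (r ^+ k)%:C * hF lam (alpha k) (xi r).
Definition ysol' k r : R[i] := (r ^+ k)%:C *
  (k%:R * hF lam (alpha k) (xi r) + (2 * n%:R * (xi r * (1 - xi r)))%:C * hF' lam (alpha k) (xi r)).

(** [DU] is the image of [U] under the Euler operator r d/dr. *)
Definition radial_sol k U DU := forall r, 0 < r ->
  cder U r (DU r / r%:C) /\
  cder DU r ((k%:R ^+ 2 * U r - lam * (r * area_density n r)%:C * U r) / r%:C).

(** The chain rule for xi turns the radial equation into the hypergeometric one. *)
Lemma ysol_sol k : radial_sol k (ysol k) (ysol' k).
Proof.
move=> r r0; have x1 := xi_norm r0; have a0 := @mode_ratio_ge0 R n k.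
have rC : r%:C != 0 :> R[i] by rewrite rC_eq0 gt_eqF.
have nC : n%:R != 0 :> R[i] by rewrite pnatr_eq0 -lt0n.
have dx := is_derive_xi r0.
have dF := cder_comp (hF_der lam a0 x1) dx.
have dF' := cder_comp (hF'_der lam a0 x1) dx.
have dp := cder_real (is_derive_pow k r0).
have dq : is_derive r 1 (fun t => 2 * n%:R * (xi t * (1 - xi t)))
   (2 * n%:R * (2 * n%:R * (xi r * (1 - xi r)) / r * (1 - 2 * xi r))).
  apply: is_deriveZf.
  apply: (is_derive_eqd (is_deriveMf dx (is_deriveBf (is_derive_cst (1 : R) r 1) dx))).
  by rewrite /cst; move: (2 * n%:R * (xi r * (1 - xi r)) / r) (xi r) => a b; ring.
have ode := hF_ode lam a0 x1.
have aE : (alpha k)%:C = k%:R / n%:R :> R[i] by rewrite /mode_ratio rCM rCV !rCnat.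
split.
- apply: (cder_eq (cderM dp dF)); rewrite /ysol'.
  move: (xi r) (hF _ _ _) (hF' _ _ _) (r ^+ k : R) => x F F' p.
  rewrite !(rCM, rCV, rCB, rCnat).
  move: (r%:C : R[i]) rC (x%:C) (p%:C) => rr rC x' p'.
  by field.
- apply: (cder_eq (cderM dp (cderD (cderZ k%:R dF) (cderM (cder_real dq) dF')))).
  rewrite rdens//.
  have E : (xi r)%:C * (1 - (xi r)%:C) * hF'' lam (alpha k) (xi r) =
    - ((1 + k%:R / n%:R - 2 * (xi r)%:C) * hF' lam (alpha k) (xi r)) - lam * hF lam (alpha k) (xi r).
    by rewrite -aE; move: ode => /eqP; rewrite -addrA addr_eq0 opprD => /eqP.
  rewrite /ysol; move: (xi r) (hF _ _ _) (hF' _ _ _) (hF'' _ _ _) (r ^+ k : R) E => x F F' F'' p.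
  rewrite !(rCM, rCV, rCB, rCnat); move: (x%:C) (p%:C) => {}x {}p E.
  move: (r%:C : R[i]) (n%:R : R[i]) (k%:R : R[i]) rC nC E => rr c kk rC nC E.
  transitivity (p / rr * (kk ^+ 2 * F + 4 * kk * c * x * (1 - x) * F' +
    4 * c ^+ 2 * x * (1 - x) * ((1 - 2 * x) * F' + x * (1 - x) * F''))).
    by field.
  by rewrite E; field; rewrite nC rC.
Qed.

Lemma is_derive_inv r : 0 < r -> is_derive r 1 (fun t : R => t^-1) (- r ^- 2).
Proof.
move=> r0; have r1 : id r != 0 by rewrite gt_eqF.
by apply: (is_derive_eqd (is_deriveV r1 (is_derive_id r 1))); rewrite /GRing.scale /= mulr1.
Qed.

Lemma radial_sol_inv k U DU : radial_sol k U DU ->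
  radial_sol k (fun r => U r^-1) (fun r => - DU r^-1).
Proof.
move=> H r r0; have ri : 0 < r^-1 by rewrite invr_gt0.
have rC : r%:C != 0 :> R[i] by rewrite rC_eq0 gt_eqF.
have [h1 h2] := H _ ri; have di := is_derive_inv r0; split.
- apply: (cder_eq (cder_comp h1 di)).
  rewrite rCN !rCV rCX; move: (DU _) (r%:C : R[i]) rC => d rr rC; by field.
- apply: (cder_eq (cderN (cder_comp h2 di))).
  rewrite rdens_inv// rCN !rCV rCX.
  move: (U _) ((r * _)%:C) (r%:C : R[i]) rC => u d rr rC; by field.
Qed.

Lemma radial_sol_lin k U DU V DV (a b : R[i]) : radial_sol k U DU -> radial_sol k V DV ->
  radial_sol k (fun r => a * U r + b * V r) (fun r => a * DU r + b * DV r).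
Proof.
move=> hU hV r r0; have [u1 u2] := hU r r0; have [v1 v2] := hV r r0; split.
- by apply: (cder_eq (cderD (cderZ a u1) (cderZ b v1))); rewrite mulrDl !mulrA.
- apply: (cder_eq (cderD (cderZ a u2) (cderZ b v2))).
  move: (_%:C^-1) => ri; ring.
Qed.

(** g(r) = o(h(r)) as r -> 0+. *)
Definition osmall (g : R -> R[i]) (h : R -> R) := forall e, 0 < e ->
  exists2 d, 0 < d & forall r, 0 < r < d -> normc (g r) <= e * h r.

Lemma osmall_le (g : R -> R[i]) (h : R -> R) (K : R) : (forall r, 0 < r -> 0 <= h r) ->
  (forall r, 0 < r < 1 -> normc (g r) <= K * r * h r) -> osmall g h.
Proof.
move=> h0 H e e0; have K0 : 0 < `|K| + 1 by rewrite ltr_pwDr.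
exists (Num.min 1 (e / (`|K| + 1))); first by rewrite lt_min ltr01 divr_gt0.
move=> r /andP[r0]; rewrite lt_min => /andP[r1 r2].
rewrite (le_trans (H r _)) ?r0// ler_wpM2r ?h0//.
move: r2; rewrite ltr_pdivlMr// => r2.
have : K * r <= `|K| * r by rewrite ler_wpM2r ?(ltW r0)// ler_norm.
lra.
Qed.

Lemma osmallD g g' h : osmall g h -> osmall g' h -> osmall (fun r => g r + g' r) h.
Proof.
move=> H H' e e0; have e2 : 0 < e / 2 by rewrite divr_gt0.
have [d d0 hd] := H _ e2; have [d' d'0 hd'] := H' _ e2.
exists (Num.min d d'); first by rewrite lt_min d0.
move=> r /andP[r0]; rewrite lt_min => /andP[r1 r2].
rewrite (le_trans (le_normcD _ _))//.
have := hd r; rewrite r0 r1 => /(_ isT); have := hd' r; rewrite r0 r2 => /(_ isT).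
lra.
Qed.

Lemma osmallZ c g h : (forall r, 0 < r -> 0 <= h r) -> osmall g h -> osmall (fun r => c * g r) h.
Proof.
move=> h0 H e e0; have c0 := normc_ge0 c; have c1 : 0 < normc c + 1 by rewrite ltr_pwDr.
have [d d0 hd] := H (e / (normc c + 1)) (divr_gt0 e0 c1).
exists d => // r hr; have := hd r hr; have /andP[r0 _] := hr.
rewrite normcM => hh; rewrite (le_trans (ler_wpM2l c0 hh))// mulrA ler_wpM2r ?h0//.
by rewrite mulrCA -[leRHS]mulr1 ler_wpM2l ?(ltW e0)// ler_pdivrMr//; lra.
Qed.

Lemma osmall_ext g g' h : (forall r, 0 < r -> g r = g' r) -> osmall g h -> osmall g' h.
Proof.
move=> E H e e0; have [d d0 hd] := H e e0; exists d => // r hr.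
by rewrite -E ?hd//; case/andP: hr.
Qed.

Lemma pow2n_le r : 0 < r < 1 -> r ^+ (2 * n) <= r.
Proof.
move=> /andP[r0 r1]; rewrite -{2}(expr1 r) ler_wiXn2l ?(ltW r0) ?(ltW r1)//; lia.
Qed.

Lemma ysol_zero k : osmall (fun r => ysol k r - (r ^+ k)%:C) (fun r => r ^+ k).
Proof.
move=> e e0; have z1 : `|0 : R| < 1 by rewrite normr0.
have := cder_cont (hF_der lam (@mode_ratio_ge0 R n k) z1); rewrite hF_0 => /cvgrPdist_lt/(_ e e0).
move=> /nbhs_ballP[d /= d0 hd]; exists (Num.min d 1); first by rewrite lt_min d0 ltr01.
move=> r /andP[r0]; rewrite lt_min => /andP[r1 r2].
have xr : xi r < d.
  by rewrite (le_lt_trans (xi_le r0))// (le_lt_trans _ r1)// pow2n_le// r0.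
have := hd (xi r); rewrite /ball /= sub0r normrN (ger0_norm (ltW (xi_gt0 r0))) => /(_ xr).
rewrite sub0r normrN ger0_norm ?normc_ge0// => h.
rewrite /ysol (_ : _ - _ = (r ^+ k)%:C * (hF lam (alpha k) (xi r) - 1)); last by ring.
rewrite normcM normc_real ger0_norm ?exprn_ge0 ?(ltW r0)// mulrC.
by rewrite ler_wpM2r ?exprn_ge0 ?(ltW r0)// ltW.
Qed.

Lemma reg_nat k r : regular_radial k%:Z r = r ^+ k.
Proof. by rewrite /regular_radial; case: k. Qed.

Lemma sing_nat k r : singular_radial k%:Z r = if k == 0%N then ln r else r ^- k.
Proof. by rewrite /singular_radial; case: k. Qed.

Lemma xi_powR k r : 0 < r -> xi r `^ alpha k = r ^+ (2 * k) * ((1 + r ^+ (2 * n)) `^ alpha k)^-1.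
Proof.
move=> r0; have t0 := onep_gt0 (2 * n) r0.
rewrite /xi powRM ?invr_ge0 ?(ltW t0) ?exprn_ge0 ?(ltW r0)//; congr (_ * _).
  rewrite -(powR_mulrn (2 * n) (ltW r0)) -powRrM -(powR_mulrn (2 * k) (ltW r0)).
  congr (_ `^ _); rewrite /mode_ratio !natrM mulrA mulrAC; congr (_ * _).
  by rewrite mulfK// pnatr_eq0 -lt0n.
by rewrite -powR_inv1 ?(ltW t0)// -powRrM mulN1r powRN.
Qed.

(** The expansion of F at 1, with 1 - xi (1/r) = xi r. For k > 0 the factor
    r^(-k) in front of F(1) gives the singular part and
    r^(-k) xi^al = r^k (1 + o(1)) the regular one. *)
Lemma ysol_inv_zero k : (k < n)%N ->
  osmall (fun r => ysol k r^-1 - (conA n lam k * (regular_radial k%:Z r)%:C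
     + conB n lam k * (singular_radial k%:Z r)%:C)) (regular_radial k%:Z).
Proof.
move=> kn; have h0 r : 0 < r -> 0 <= regular_radial k r by move=> /ltW ?; rewrite reg_nat exprn_ge0.
rewrite /conA /conB; have [k0|k0] := eqVneq k 0%N.
  subst k; move=> e e0; have e2 : 0 < e / 2 by rewrite divr_gt0.
  have [d d0 hd] := hF_zero lam e2.
  have K0 : 0 < normc (kap lam 0 : R[i]) + 1 by rewrite ltr_pwDr// normc_ge0.
  exists (Num.min (Num.min d 1) (e / 2 / (normc (kap lam 0 : R[i]) + 1))).
    by rewrite !lt_min d0 ltr01 divr_gt0.
  move=> r /andP[r0]; rewrite !lt_min => /andP[/andP[r1 r2] r3].
  have a0 : alpha 0 = 0 by rewrite /mode_ratio mul0r.
  have xg := xi_gt0 r0; have xl := xi_lt1 r0; have t0 := onep_gt0 (2 * n) r0.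
  rewrite reg_nat sing_nat eqxx /ysol xi_inv// !expr0 !mulr1 mul1r a0.
  have := hd (1 - xi r); rewrite subr_ge0 ltrBlDl ltrDr xg (ltW xl) subKr.
  have -> : xi r < d by rewrite (le_lt_trans (xi_le r0))// (le_lt_trans _ r1)// pow2n_le// r0.
  move=> /(_ isT isT) h.
  have lx : ln (xi r) = 2 * n%:R * ln r - ln (1 + r ^+ (2 * n)).
    rewrite /xi ln_div ?posrE ?exprn_gt0// lnXn// -[ln _ *+ _]mulr_natl natrM//.
  rewrite lx in h.
  set z := hF _ _ _ - _ in h; set w := hF _ _ _ - _.
  have -> : w = z + kap lam 0 * (ln (1 + r ^+ (2 * n)))%:C.
    rewrite /w /z rCB !rCM !rCnat; move: (ln _)%:C (ln _)%:C => a b; ring.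
  have l1 : 0 <= ln (1 + r ^+ (2 * n)) by rewrite ln_ge0// lerDl exprn_ge0// ltW.
  have l2 : ln (1 + r ^+ (2 * n)) <= r.
    rewrite (le_trans (le_ln1Dx _))// ?pow2n_le ?r0// .
    by rewrite (lt_le_trans _ (exprn_ge0 _ (ltW r0)))// ltrN10.
  rewrite (le_trans (le_normcD _ _))// normcM normc_real (ger0_norm l1).
  have : normc (kap lam 0 : R[i]) * ln (1 + r ^+ (2 * n)) <= normc (kap lam 0 : R[i]) * r.
    by rewrite ler_wpM2l ?normc_ge0.
  move: r3; rewrite ltr_pdivlMr//; have := normc_ge0 (kap lam 0 : R[i]).
  move=> k1 k2 k3; have : r * normc (kap lam 0 : R[i]) + r < e / 2 by rewrite -[X in _ + X]mulr1 -mulrDr.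
  rewrite mulrC => k4; have e3 : e = e / 2 + e / 2 by lra.
  by rewrite (le_trans (lerD h k3))// [leRHS]e3 lerD2l ltW// (le_lt_trans _ k4)// lerDl ltW.
have kb : (0 < k < n)%N by rewrite lt0n k0.
have ha := mode_ratio_bounds R n0 kb; have /andP[a0 a1] := ha.
have [C hC] := hF_pos lam ha.
set B := hsum _ _; pose K := kap lam (alpha k) / (alpha k)%:C; rewrite -/K -/B in hC.
apply: (@osmall_le _ _ (C + normc K)) => // r /andP[r0 r1].
have xg := xi_gt0 r0; have xl := xi_lt1 r0; have t0 := onep_gt0 (2 * n) r0.
rewrite reg_nat sing_nat (negPf k0) /ysol xi_inv// exprVn.
have := hC (1 - xi r); rewrite subr_ge0 ltrBlDl ltrDr xg (ltW xl) subKr => /(_ isT).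
rewrite xi_powR//; set F := hF _ _ _; set P := (_ `^ _)^-1 => h.
have rk0 : 0 < r ^+ k by rewrite exprn_gt0.
have rkC : (r ^+ k)%:C != 0 :> R[i] by rewrite rC_eq0 gt_eqF.
have -> : (r ^- k)%:C * F - (- kap lam (alpha k) / (alpha k)%:C * (r ^+ k)%:C + B * (r ^- k)%:C) =
  (r ^- k)%:C * (F - (B - K * (r ^+ (2 * k) * P)%:C)) + K * (r ^+ k * (1 - P))%:C.
  have -> : - kap lam (alpha k) / (alpha k)%:C = - K by rewrite /K mulNr.
  rewrite mul2n -addnn exprD !rCM rCB rCV.
  move: F B K (P%:C) ((r ^+ k)%:C : R[i]) rkC {h hC} => F B K PC s s0.
  by field.
have P0 : 0 <= P by rewrite invr_ge0 powR_ge0.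
have P1 : 1 - P <= r ^+ (2 * n).
  have : (1 + r ^+ (2 * n))^-1 <= P.
    rewrite /P lef_pV2 ?posrE ?powR_gt0//.
    by rewrite -[leRHS]powRr1 ?(ltW t0)// ler_powR ?(ltW a1)// lerDl exprn_ge0 ?(ltW r0).
  have := xiB r0; have := xi_le r0; lra.
have P2 : P <= 1.
  rewrite invf_le1 ?powR_gt0// -[leLHS](powRr0 (1 + r ^+ (2 * n))).
  by rewrite ler_powR ?(ltW a0)// lerDl exprn_ge0 ?(ltW r0).
rewrite (le_trans (le_normcD _ _))// !normcM !normc_real.
rewrite (ger0_norm (_ : 0 <= r ^- k)) ?invr_ge0 ?(ltW rk0)//.
rewrite (ger0_norm (_ : 0 <= r ^+ k * (1 - P))); last by rewrite mulr_ge0 ?(ltW rk0)// subr_ge0.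
rewrite -[leRHS]mulrA mulrDl lerD//.
  rewrite mulrC ler_pdivrMr// (le_trans h)//.
  have C0 : 0 <= C.
    have := le_trans (normc_ge0 _) h; by rewrite pmulr_lge0.
  rewrite -!mulrA ler_wpM2l// (le_trans (xi_le r0))// -exprD -exprS.
  by rewrite ler_wiXn2l ?(ltW r0) ?(ltW r1)//; clear -kn; lia.
rewrite ler_wpM2l//; first by rewrite mulr_ge0// normc_ge0.
rewrite [leRHS]mulrC ler_wpM2l ?(ltW rk0)//.
by rewrite (le_trans P1)// pow2n_le// r0.
Qed.

Lemma ln_le_sqrt (s : R) : 1 <= s -> ln s <= 2 * Num.sqrt s.
Proof.
move=> s1; have s0 : 0 < s by lra.
have {1}-> : s = Num.sqrt s ^+ 2 by rewrite sqr_sqrtr ?ltW.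
rewrite lnXn ?sqrtr_gt0// -[ln _ *+ _]mulr_natl ler_wpM2l//.
by apply: ltW; apply: ln_sublinear; rewrite sqrtr_gt0.
Qed.

(** As r grows the density decays like r^(-2n-1), and k <= n - 1 leaves room for the
    logarithmic growth of F, which is bounded by a multiple of sqrt (1 + r). *)
Lemma ysol_L2 : exists C, forall k r, (k < n)%N -> 0 < r ->
  area_density n r * normc (ysol k r) ^+ 2 <= C / (1 + r ^+ 2).
Proof.
have [M [M0 hM]] := hF_bound lam; pose D := 1 + 4 * n%:R * M.
exists (16 * n%:R ^+ 2 * D ^+ 2) => k r kn r0.
have D0 : 0 <= D by rewrite addr_ge0// !mulr_ge0.
have t0 := onep_gt0 (2 * n) r0; have xg := xi_gt0 r0; have xl := xi_lt1 r0.
have s0 : 0 < 1 + r by lra.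
have F1 : normc (hF lam (alpha k) (xi r)) <= D * Num.sqrt (1 + r).
  have := hM (alpha k) (xi r) (@mode_ratio_ge0 R n k); rewrite (ltW xg) xl => /(_ isT) h.
  rewrite (le_trans h)// xiB// lnV ?posrE// opprK.
  have l1 : ln (1 + r ^+ (2 * n)) <= 2 * n%:R * (2 * Num.sqrt (1 + r)).
    rewrite (le_trans (_ : _ <= ln ((1 + r) ^+ (2 * n))))//.
      rewrite ler_ln ?posrE ?exprn_gt0//.
      have -> : (2 * n)%N = (2 * n).-1.+1 by lia.
      elim: (2 * n).-1 => [|m IH]; first by rewrite !expr1.
      have := exprn_gt0 m.+1 r0; have := exprn_gt0 m.+1 s0.
      rewrite [r ^+ m.+2]exprS [leRHS]exprS.
      move: (r ^+ m.+1) ((1 + r) ^+ m.+1) IH => a b ab b0 a0.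
      have : r * (1 + a) <= r * b by rewrite ler_wpM2l// ltW.
      lra.
    rewrite lnXn// -[ln _ *+ _]mulr_natl natrM ler_wpM2l ?mulr_ge0//; apply: ln_le_sqrt; lra.
  have q1 : 1 <= Num.sqrt (1 + r) by rewrite -{1}sqrtr1 ler_sqrt//; lra.
  have : M * ln (1 + r ^+ (2 * n)) <= M * (2 * n%:R * (2 * Num.sqrt (1 + r))) by rewrite ler_wpM2l.
  rewrite /D; move: (n%:R : R) (Num.sqrt _) (ln _) q1 => c q L q1; lra.
have F2 : normc (hF lam (alpha k) (xi r)) ^+ 2 <= D ^+ 2 * (1 + r).
  rewrite -[1 + r]sqr_sqrtr ?(ltW s0)// -exprMn ler_pXn2r// nnegrE ?normc_ge0//.
  by rewrite mulr_ge0 ?sqrtr_ge0.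
rewrite /ysol normcM normc_real exprMn -normrX ger0_norm ?exprn_ge0// ?(ltW r0)//.
have p1 : r ^+ (2 * n - 1) * (r ^+ k) ^+ 2 * (1 + r) * (1 + r ^+ 2) <= 4 * (1 + r ^+ (2 * n)) ^+ 2.
  rewrite -exprM -exprD.
  have T1 : 0 < r ^+ (2 * n) by rewrite exprn_gt0.
  have [r1|r1] := leP r 1.
    have e1 : r ^+ (2 * n - 1 + k * 2) <= 1 by rewrite exprn_ile1// ltW.
    have e2 : r ^+ 2 <= 1 by rewrite exprn_ile1// ltW.
    have r2 : 0 <= r ^+ 2 by rewrite exprn_ge0// ltW.
    have e3 : (1 + r) * (1 + r ^+ 2) <= 2 * 2.
      by apply: ler_pM; [exact: ltW|lra|lra|lra].
    have e4 : 1 <= (1 + r ^+ (2 * n)) ^+ 2 by rewrite exprn_ege1//; lra.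
    have e5 : 0 <= (1 + r) * (1 + r ^+ 2) by rewrite mulr_ge0; lra.
    have e6 : r ^+ (2 * n - 1 + k * 2) * ((1 + r) * (1 + r ^+ 2)) <= 1 * (2 * 2).
      by rewrite ler_pM// exprn_ge0// ltW.
    rewrite -mulrA; lra.
  have r2 : 1 <= r ^+ 2 by rewrite exprn_ege1// ltW.
  have e1 : r ^+ (2 * n - 1 + k * 2) <= r ^+ (4 * n - 3) by rewrite ler_eXn2l ?(ltW r1)//; clear -kn; lia.
  have e3 : (1 + r) * (1 + r ^+ 2) <= (2 * r) * (2 * r ^+ 2).
    by apply: ler_pM; lra.
  rewrite -mulrA (le_trans (_ : _ <= r ^+ (4 * n - 3) * (2 * r * (2 * r ^+ 2))))//.
    by rewrite ler_pM ?mulr_ge0 ?addr_ge0 ?exprn_ge0 ?(ltW r0).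
  have -> : r ^+ (4 * n - 3) * (2 * r * (2 * r ^+ 2)) = 4 * (r ^+ (2 * n)) ^+ 2.
    have -> : (r ^+ (2 * n)) ^+ 2 = r ^+ (4 * n - 3) * r ^+ 3.
      by rewrite -[LHS]exprM -[RHS]exprD; congr (_ ^+ _); clear -n0; lia.
    by move: (r ^+ (4 * n - 3)) => a; ring.
  by rewrite ler_wpM2l// ler_pXn2r ?nnegrE ?(ltW T1) ?(ltW t0)// lerDr.
rewrite ler_pdivlMr; last by rewrite ltr_pwDl// sqr_ge0.
rewrite /area_density.
set P := r ^+ (2 * n - 1) in p1 *; set Q := (r ^+ k) ^+ 2 in p1 *; set S := (1 + r ^+ (2 * n)) in p1 t0 *.
set N := normc _ ^+ 2 in F2 *.
have S2 : 0 < S ^+ 2 by rewrite exprn_gt0.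
have -> : 4 * n%:R ^+ 2 * P / S ^+ 2 * (Q * N) * (1 + r ^+ 2) = 4 * n%:R ^+ 2 * (P * Q * (1 + r ^+ 2) * N) / S ^+ 2.
  by move: (n%:R : R) (S ^+ 2)^-1 P Q N {F2 p1} => c s P' Q' N'; ring.
rewrite ler_pdivrMr//.
have -> : 16 * n%:R ^+ 2 * D ^+ 2 * S ^+ 2 = 4 * n%:R ^+ 2 * (4 * S ^+ 2 * D ^+ 2).
  by move: (n%:R ^+ 2 : R) (S ^+ 2) (D ^+ 2) => a b c; ring.
have c0 : 0 <= 4 * n%:R ^+ 2 :> R by rewrite mulr_ge0// sqr_ge0.
rewrite ler_wpM2l//.
have PQ : 0 <= P * Q * (1 + r ^+ 2).
  have p0 : 0 <= P by rewrite exprn_ge0// ltW.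
  have q0 : 0 <= Q by rewrite sqr_ge0.
  by apply: mulr_ge0; [exact: mulr_ge0 | rewrite addr_ge0// sqr_ge0].
rewrite (le_trans (ler_wpM2l PQ F2))//.
have -> : P * Q * (1 + r ^+ 2) * (D ^+ 2 * (1 + r)) = P * Q * (1 + r) * (1 + r ^+ 2) * D ^+ 2.
  by move: P Q (D ^+ 2) {p1 F2 PQ} => P' Q' d; ring.
by rewrite ler_wpM2r ?sqr_ge0.
Qed.

Lemma ysol_inv_L2 : exists C, forall k r, (k < n)%N -> 0 < r ->
  area_density n r * normc (ysol k r^-1) ^+ 2 <= C / (1 + r ^+ 2).
Proof.
have [C hC] := ysol_L2; exists C => k r kn r0.
have ri : 0 < r^-1 by rewrite invr_gt0.
have r2 : 0 < 1 + r ^+ 2 by rewrite ltr_pwDl// sqr_ge0.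
have := hC k _ kn ri.
have -> : area_density n r = r ^- 2 * area_density n r^-1.
  apply: (mulfI (_ : r != 0)); first by rewrite gt_eqF.
  rewrite -rdens_inv//; move: (area_density n _) => d; by field; rewrite gt_eqF.
rewrite -[r ^- 2 * _ * _]mulrA => h.
have q0 : 0 <= r ^- 2 by rewrite invr_ge0 sqr_ge0.
rewrite (le_trans (ler_wpM2l q0 h))//.
rewrite exprVn le_eqVlt; apply/orP; left; apply/eqP.
move: (r ^+ 2) r2 (exprn_gt0 2 r0) => s s1 s0.
have s2 : s + 1 != 0 by rewrite addrC gt_eqF.
by field; rewrite ?(gt_eqF s0) ?(gt_eqF s1) ?s2.
Qed.
End RadialFunctions.

(** * Integrals of complex functions *)

Section ComplexIntegral.
Context d (T : measurableType d) (R : realType).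
Variables (mu : {measure set T -> \bar R}) (D : set T).
Hypothesis mD : measurable D.
Implicit Types (f g : T -> R[i]) (c : R[i]).

Definition cmeas g := measurable_fun D (fun x => complex.Re (g x)) /\
  measurable_fun D (fun x => complex.Im (g x)).
Definition cint g := mu.-integrable D (EFin \o (fun x => complex.Re (g x))) /\
  mu.-integrable D (EFin \o (fun x => complex.Im (g x))).

Lemma cmeasD f g : cmeas f -> cmeas g -> cmeas (fun x => f x + g x).
Proof.
move=> [f1 f2] [g1 g2]; split.
- by under eq_fun do rewrite ReD; exact: measurable_funD.
- by under eq_fun do rewrite ImD; exact: measurable_funD.
Qed.

Lemma cmeasM f g : cmeas f -> cmeas g -> cmeas (fun x => f x * g x).
Proof.
move=> [f1 f2] [g1 g2]; split.
- by under eq_fun do rewrite ReM; apply: measurable_funB; exact: measurable_funM.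
- by under eq_fun do rewrite ImM; apply: measurable_funD; exact: measurable_funM.
Qed.

Lemma cmeas_cst c : cmeas (fun=> c).
Proof. by split; exact: measurable_cst. Qed.

Lemma cmeas_real (h : T -> R) : measurable_fun D h -> cmeas (fun x => (h x)%:C).
Proof. by move=> mh; split => //=; exact: measurable_cst. Qed.

Lemma cmeas_eq f g : (forall x, D x -> f x = g x) -> cmeas f -> cmeas g.
Proof.
move=> fg [f1 f2]; split; [apply: eq_measurable_fun f1|apply: eq_measurable_fun f2];
  by move=> x; rewrite inE => /fg ->.
Qed.

Lemma cmeas_normc2 f : cmeas f -> measurable_fun D (fun x => normc (f x) ^+ 2).
Proof.
move=> [f1 f2].
rewrite (_ : (fun _ => _) = (fun x => complex.Re (f x) ^+ 2 + complex.Im (f x) ^+ 2)).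
  by apply: measurable_funD; exact: measurable_funX.
by apply/funext => x; case: (f x) => a b /=; rewrite sqr_sqrtr// addr_ge0// sqr_ge0.
Qed.

Lemma cint_meas f : cint f -> cmeas f.
Proof. by move=> [f1 f2]; split; apply/measurable_EFinP; apply: measurable_int; eassumption. Qed.

Lemma cint_le f (h : T -> R) : cmeas f -> (forall x, D x -> normc (f x) <= h x) ->
  mu.-integrable D (EFin \o h) -> cint f.
Proof.
move=> [f1 f2] fh ih; split; apply: (le_integrable mD _ _ ih).
- exact/measurable_EFinP.
- move=> x Dx /=; rewrite lee_fin (le_trans (Re_le_normc _))// (le_trans (fh x Dx))// ler_norm//.
- exact/measurable_EFinP.
- move=> x Dx /=; rewrite lee_fin (le_trans (Im_le_normc _))// (le_trans (fh x Dx))// ler_norm//.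
Qed.

Lemma integrable_lin (h k : T -> R) (a b : R) : mu.-integrable D (EFin \o h) ->
  mu.-integrable D (EFin \o k) -> mu.-integrable D (EFin \o (fun x => a * h x + b * k x)).
Proof.
move=> ih ik; rewrite (_ : _ \o _ = (fun x => a%:E * (EFin \o h) x)%E \+ (fun x => b%:E * (EFin \o k) x)%E)//.
by apply: integrableD => //; exact: integrableZl.
Qed.

Lemma integrable_ext (h k : T -> R) : (forall x, h x = k x) -> mu.-integrable D (EFin \o h) ->
  mu.-integrable D (EFin \o k).
Proof. by move=> /funext ->. Qed.

Lemma Rintegral_lin (h k : T -> R) (a b : R) : mu.-integrable D (EFin \o h) ->
  mu.-integrable D (EFin \o k) ->
  Rintegral mu D (fun x => a * h x + b * k x) = a * Rintegral mu D h + b * Rintegral mu D k.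
Proof.
move=> ih ik; rewrite RintegralD ?RintegralZl//.
- exact: (integrableZl mD a ih).
- exact: (integrableZl mD b ik).
Qed.

Lemma cint_lin f g (a b : R[i]) : cint f -> cint g -> cint (fun x => a * f x + b * g x).
Proof.
move=> [f1 f2] [g1 g2]; split.
- apply: (integrable_ext _ (integrable_lin 1 1
    (integrable_lin (complex.Re a) (- complex.Im a) f1 f2)
    (integrable_lin (complex.Re b) (- complex.Im b) g1 g2))).
  by move=> x; rewrite ReD !ReM !mul1r !mulNr.
- apply: (integrable_ext _ (integrable_lin 1 1
    (integrable_lin (complex.Im a) (complex.Re a) f1 f2)
    (integrable_lin (complex.Im b) (complex.Re b) g1 g2))).
  move=> x; rewrite ImD !ImM !mul1r; ring.
Qed.

Lemma cintegral_lin f g (a b : R[i]) : cint f -> cint g ->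
  cintegral mu D (fun x => a * f x + b * g x) = a * cintegral mu D f + b * cintegral mu D g.
Proof.
move=> [f1 f2] [g1 g2]; apply: complexP; rewrite /cintegral.
- transitivity (Rintegral mu D (fun x =>
    1 * (complex.Re a * complex.Re (f x) + - complex.Im a * complex.Im (f x)) +
    1 * (complex.Re b * complex.Re (g x) + - complex.Im b * complex.Im (g x)))).
    by apply: eq_Rintegral => x _; rewrite ReD !ReM !mul1r !mulNr.
  rewrite !Rintegral_lin//; try exact: integrable_lin.
  by rewrite ReD !ReM /= !mul1r !mulNr.
- transitivity (Rintegral mu D (fun x =>
    1 * (complex.Im a * complex.Re (f x) + complex.Re a * complex.Im (f x)) +
    1 * (complex.Im b * complex.Re (g x) + complex.Re b * complex.Im (g x)))).
    by apply: eq_Rintegral => x _; rewrite ImD !ImM !mul1r; ring.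
  rewrite !Rintegral_lin//; try exact: integrable_lin.
  by rewrite ImD !ImM /= !mul1r; ring.
Qed.

Lemma eq_cintegral f g : (forall x, D x -> f x = g x) -> cintegral mu D f = cintegral mu D g.
Proof.
move=> fg; rewrite /cintegral; congr (_ +i* _); apply: eq_Rintegral => x;
  by rewrite inE => /fg ->.
Qed.

Lemma cint_eq f g : (forall x, D x -> f x = g x) -> cint f -> cint g.
Proof.
move=> fg [f1 f2]; split; [apply: eq_integrable f1|apply: eq_integrable f2] => // x;
  by rewrite inE => /fg; rewrite /= => ->.
Qed.
End ComplexIntegral.

(** * Integrals in polar coordinates *)

Section PolarIntegral.
Variable R : realType.
Variable n : nat.
Local Notation leb := (@lebesgue_measure R).
Local Notation leb2 := (leb \x leb)%E.
Local Notation RT := (measurableTypeR R).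
Local Notation dom := (@polar_dom R : set (RT * RT)).
Local Notation Rpos := (`]0%R, +oo[%classic : set RT).
Local Notation circ := (`[0%R, (2 * pi)%R[%classic : set RT).
Implicit Types (u v : R[i] -> R[i]).

Lemma measurable_dom : measurable dom.
Proof. by apply: measurableX; exact: measurable_itv. Qed.

Lemma domP (p : RT * RT) : dom p <-> 0 < p.1 /\ 0 <= p.2 < 2 * pi.
Proof.
by rewrite /polar_dom /setX /=; split => [[]|[]]; rewrite /= !in_itv /= ?andbT.
Qed.

Lemma leb_angle : leb circ = (2 * pi)%:E.
Proof.
rewrite lebesgue_measure_itv /= lte_fin mulr_gt0 ?pi_gt0//.
by rewrite -EFinB subr0.
Qed.

Lemma fubini_r (q : RT * RT -> R) : leb2.-integrable dom (EFin \o q) ->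
  (forall t, 0 <= t < 2 * pi -> (\int[leb]_(r in Rpos) (q (r, t))%:E = 0)%E) ->
  Rintegral leb2 dom q = 0.
Proof.
move=> iq q0; have mdom := measurable_dom.
rewrite /Rintegral integral_mkcond; have iq' := (integrable_mkcond _ mdom).1 iq.
rewrite -integral21_prod_meas1// integral0_eq// => t _; rewrite /fubini_G.
case: (boolP (0 <= t < 2 * pi)) => ht; last first.
  apply: integral0_eq => r _; rewrite patchE; case: ifPn => //; rewrite inE => /domP[_ h].
  by rewrite h in ht.
rewrite -[RHS](q0 t ht) [in RHS]integral_mkcond; apply: eq_integral => r _.
rewrite !patchE; congr (if _ then _ else _); apply/idP/idP; rewrite !inE => H.
- by have /domP[] := H; rewrite /= in_itv /= andbT.
- by apply/domP; move: H; rewrite /= in_itv /= andbT.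
Qed.

Lemma fubini_t (q : RT * RT -> R) : leb2.-integrable dom (EFin \o q) ->
  (forall r, 0 < r -> (\int[leb]_(t in circ) (q (r, t))%:E = 0)%E) ->
  Rintegral leb2 dom q = 0.
Proof.
move=> iq q0; have mdom := measurable_dom.
rewrite /Rintegral integral_mkcond; have iq' := (integrable_mkcond _ mdom).1 iq.
rewrite -integral12_prod_meas1// integral0_eq// => r _; rewrite /fubini_F.
case: (ltP 0 r) => hr; last first.
  apply: integral0_eq => t _; rewrite patchE; case: ifPn => //; rewrite inE => /domP[/= h].
  by move: (lt_le_trans h hr); rewrite ltxx.
rewrite -[RHS](q0 r hr) [in RHS]integral_mkcond; apply: eq_integral => t _.
rewrite !patchE; congr (if _ then _ else _); apply/idP/idP; rewrite !inE => H.
- by have /domP[_] := H; rewrite /= in_itv.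
- by apply/domP; move: H; rewrite /= in_itv.
Qed.

Lemma radial_tonelli (g : R -> R) : measurable_fun Rpos g -> (forall r, 0 < r -> 0 <= g r) ->
  (\int[leb2]_(p in dom) (g p.1)%:E = \int[leb]_(r in Rpos) ((2 * pi)%:E * (g r)%:E))%E.
Proof.
move=> mg g0; have mdom := measurable_dom.
rewrite integral_mkcond fubini_tonelli1.
- rewrite [RHS]integral_mkcond; apply: eq_integral => r _.
  rewrite /fubini_F patchE; case: ifPn => [|/negP]; rewrite inE /= in_itv /= andbT => hr.
    transitivity (\int[leb]_(t in circ) cst (g r)%:E t)%E; last first.
      by rewrite integral_cst//= leb_angle muleC.
    rewrite [RHS]integral_mkcond; apply: eq_integral => t _; rewrite !patchE.
    congr (if _ then _ else _); apply/idP/idP; rewrite !inE => H.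
    - by have /domP[_] := H; rewrite /= in_itv.
    - by apply/domP; move: H; rewrite /= in_itv.
  apply: integral0_eq => t _; rewrite patchE; case: ifPn => //.
  by rewrite inE => /domP[/= h]; case: hr.
- apply/(measurable_restrictT _ mdom); apply/measurable_EFinP.
  have := measurable_comp (measurable_itv `]0%R, +oo[) _ mg (measurable_funTS (D := dom) measurable_fst).
  by apply => r /= [p /domP[h _] <-]; rewrite /= in_itv /= h.
- move=> p; rewrite patchE; case: ifPn => // /set_mem /domP[h _].
  by rewrite lee_fin g0.
Qed.

Lemma radial_integrable (g : R -> R) : measurable_fun Rpos g -> (forall r, 0 < r -> 0 <= g r) ->
  (\int[leb]_(r in Rpos) (g r)%:E < +oo)%E ->
  leb2.-integrable dom (EFin \o (fun p : RT * RT => g p.1)).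
Proof.
move=> mg g0 fg; have mdom := measurable_dom; apply/integrableP; split.
  apply/measurable_EFinP.
  have := measurable_comp (measurable_itv `]0%R, +oo[) _ mg (measurable_funTS (D := dom) measurable_fst).
  by apply => r /= [p /domP[h _] <-]; rewrite /= in_itv /= h.
rewrite (eq_integral (fun p : RT * RT => (g p.1)%:E)); last first.
  by move=> p; rewrite inE => /domP[h _] /=; rewrite ger0_norm ?g0.
rewrite radial_tonelli// ge0_integralZl//.
- by rewrite lte_mul_pinfty// lee_fin mulr_ge0 ?pi_ge0.
- exact/measurable_EFinP.
- by move=> r /=; rewrite in_itv /= andbT lee_fin => /g0.
- by rewrite lee_fin mulr_ge0 ?pi_ge0.
Qed.

Lemma integrable_annulus (a b C : R) : 0 < a -> 0 <= C ->
  leb2.-integrable dom (EFin \o (fun p : RT * RT => C * (\1_(`[a, b]%classic) p.1))).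
Proof.
move=> a0 C0; apply: (@radial_integrable (fun r => C * \1_(`[a, b]%classic) r)).
- by apply: measurable_funM => //; apply: measurable_indic.
- by move=> r _; rewrite mulr_ge0.
- rewrite (eq_integral (fun r : RT => C%:E * (\1_(`[a, b]%classic) r)%:E)%E)//.
  rewrite ge0_integralZl//; last by apply/measurable_EFinP; exact: measurable_indic.
  rewrite lte_mul_pinfty// integral_indic//; apply: (@le_lt_trans _ _ (leb `[a, b])).
    by apply: le_measure; rewrite ?inE//; exact: measurableI.
  by rewrite lebesgue_measure_itv /=; case: ifP => // _; rewrite -EFinB ltry.
Qed.

Lemma integrable_oneDsqr (C : R) : 0 <= C ->
  leb2.-integrable dom (EFin \o (fun p : RT * RT => C / (1 + p.1 ^+ 2))).
Proof.
move=> C0; apply: (@radial_integrable (fun r => C / (1 + r ^+ 2))).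
- apply: measurable_funTS; apply: measurable_funM => //.
  by apply: continuous_measurable_fun; exact: continuous_oneDsqrV.
- by move=> r _; rewrite divr_ge0// addr_ge0// sqr_ge0.
- rewrite (eq_integral (fun r : RT => C%:E * ((oneDsqr r)^-1)%:E)%E)//.
  have m1 : measurable_fun Rpos (fun r : R => ((oneDsqr r)^-1)%:E).
    apply: measurable_funTS; apply/measurable_EFinP.
    by apply: continuous_measurable_fun; exact: continuous_oneDsqrV.
  rewrite ge0_integralZl//.
  rewrite lte_mul_pinfty// (le_lt_trans (_ : _ <= \int[leb]_(r in `[0%R, +oo[) ((oneDsqr r)^-1)%:E)%E)//.
    apply: ge0_subset_integral => //.
    + apply: measurable_funTS; apply/measurable_EFinP.
      by apply: continuous_measurable_fun; exact: continuous_oneDsqrV.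
    + by move=> r /=; rewrite !in_itv /= !andbT => /ltW.
  by rewrite integral0y_oneDsqr ltry.
Qed.

Lemma dens_ge0 (r : R) : 0 <= r -> 0 <= area_density n r.
Proof.
move=> r0; rewrite /area_density divr_ge0 ?mulr_ge0 ?exprn_ge0 ?sqr_ge0//.
all: by rewrite addr_ge0// exprn_ge0.
Qed.

Lemma continuous_dens (r : R) : 0 < r -> {for r, continuous (area_density n : R -> R)}.
Proof.
move=> r0; rewrite /area_density; apply: cvgM.
  by apply: cvgM; [exact: cvg_cst|exact: exprn_continuous].
apply: cvgV; first by rewrite gt_eqF// exprn_gt0// addr_gt0// exprn_gt0.
have c1 : {for r, continuous (fun x : R => 1 + x ^+ (2 * n))}.
  by apply: cvgD; [exact: cvg_cst|exact: exprn_continuous].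
by under eq_fun do rewrite expr2; rewrite expr2; exact: cvgM.
Qed.

Lemma measurable_radial (g : R -> R) : (forall r, 0 < r -> {for r, continuous g}) ->
  measurable_fun dom (fun p : RT * RT => g p.1).
Proof.
move=> cg; have mg : measurable_fun Rpos g.
  apply: measurable_realfun.open_continuous_measurable_fun; first exact: interval_open.
  by move=> r; rewrite inE /= in_itv /= andbT => /cg.
have := measurable_comp (measurable_itv `]0%R, +oo[) _ mg (measurable_funTS (D := dom) measurable_fst).
by apply => r /= [p /domP[h _] <-]; rewrite /= in_itv /= h.
Qed.

Lemma measurable_angular (g : R -> R) : continuous g -> measurable_fun dom (fun p : RT * RT => g p.2).
Proof.
move=> cg; apply: measurable_funTS; apply: (measurableT_comp (continuous_measurable_fun cg)).
exact: measurable_snd.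
Qed.

Definition dens2 u (p : RT * RT) := area_density n p.1 * normc (u (polar p.1 p.2)) ^+ 2.

Lemma dens2_ge0 u p : dom p -> 0 <= dens2 u p.
Proof. by move=> /domP[/ltW h _]; rewrite mulr_ge0 ?dens_ge0 ?sqr_ge0. Qed.

Lemma in_L2P u : in_L2 n u <-> cmeas dom (fun p : RT * RT => u (polar p.1 p.2)) /\
  leb2.-integrable dom (EFin \o dens2 u).
Proof.
have mdom := measurable_dom; rewrite /in_L2 /L2norm2.
have E : (\int[leb2]_(p in dom) `| (EFin \o dens2 u) p | = \int[leb2]_(p in dom) (dens2 u p)%:E)%E.
  by apply: eq_integral => p; rewrite inE => /dens2_ge0 h /=; rewrite ger0_norm.
split => [[m1 m2 fin]|[[m1 m2] /integrableP[_ fin]]]; last first.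
  by split => //; rewrite E in fin.
split => //; apply/integrableP; rewrite E; split => //.
apply/measurable_EFinP; apply: measurable_funM; last exact: cmeas_normc2.
exact: measurable_radial continuous_dens.
Qed.

Lemma normc_mul_le (z w : R[i]) : normc (z * w) <= normc z ^+ 2 + normc w ^+ 2.
Proof.
rewrite normcM; have a0 := normc_ge0 z; have b0 := normc_ge0 w.
have := sqr_ge0 (normc z - normc w); have := sqr_ge0 (normc z); have := sqr_ge0 (normc w).
by move: (normc z) (normc w) a0 b0 => a b a0 b0; lra.
Qed.

Lemma cmeas_dens : cmeas dom (fun p : RT * RT => (area_density n p.1)%:C).
Proof. have h := measurable_radial continuous_dens; exact (cmeas_real h). Qed.

(** Square-integrable functions pair integrably because |z w| <= |z|^2 + |w|^2. *)
Lemma L2_mul_cint u v : in_L2 n u -> in_L2 n v ->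
  cint leb2 dom (fun p : RT * RT => (area_density n p.1)%:C * (u (polar p.1 p.2) * v (polar p.1 p.2))).
Proof.
move=> /in_L2P[mu iu] /in_L2P[mv iv].
apply: (@cint_le _ _ _ _ _ measurable_dom _ (fun p : RT * RT => 1 * dens2 u p + 1 * dens2 v p)).
- exact (cmeasM cmeas_dens (cmeasM mu mv)).
- move=> p /domP[/ltW p0 _]; rewrite normcM normc_real (ger0_norm (dens_ge0 p0)).
  by rewrite !mul1r /dens2 -mulrDr ler_wpM2l ?dens_ge0// normc_mul_le.
- by apply: integrable_lin => //; exact: measurable_dom.
Qed.

Lemma in_L2_lin u v (a b : R[i]) : in_L2 n u -> in_L2 n v -> in_L2 n (fun z => a * u z + b * v z).
Proof.
move=> /in_L2P[mu iu] /in_L2P[mv iv]; have mdom := measurable_dom; apply/in_L2P.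
have ms : cmeas dom (fun p : RT * RT => a * u (polar p.1 p.2) + b * v (polar p.1 p.2)).
  exact (cmeasD (cmeasM (cmeas_cst _ a) mu) (cmeasM (cmeas_cst _ b) mv)).
split => //.
have := @integrable_lin _ _ _ leb2 _ mdom _ _ (2 * normc a ^+ 2) (2 * normc b ^+ 2) iu iv.
apply: (le_integrable mdom).
  apply/measurable_EFinP; apply: measurable_funM; last exact: cmeas_normc2.
  exact: measurable_radial continuous_dens.
move=> p hp /=; have d1 := dens2_ge0 u hp; have d2 := dens2_ge0 v hp.
rewrite lee_fin (ger0_norm (dens2_ge0 _ hp)) ger0_norm; last first.
  by apply: addr_ge0; apply: mulr_ge0 => //; apply: mulr_ge0 => //; exact: sqr_ge0.
rewrite /dens2; have /domP[/ltW p0 _] := hp; have := dens_ge0 p0.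
move: (u _) (v _) (area_density n p.1) => x y D D0.
have : normc (a * x + b * y) ^+ 2 <= 2 * normc a ^+ 2 * normc x ^+ 2 + 2 * normc b ^+ 2 * normc y ^+ 2.
  have h : normc (a * x + b * y) <= normc a * normc x + normc b * normc y.
    by rewrite (le_trans (le_normcD _ _))// !normcM.
  have h2 : normc (a * x + b * y) ^+ 2 <= (normc a * normc x + normc b * normc y) ^+ 2.
    by rewrite ler_pXn2r ?nnegrE ?normc_ge0// addr_ge0// mulr_ge0// normc_ge0.
  rewrite (le_trans h2)//.
  have := sqr_ge0 (normc a * normc x - normc b * normc y).
  move: (normc a) (normc x) (normc b) (normc y) => A X B Y; lra.
move=> /(ler_wpM2l D0) h; rewrite (le_trans h)//.
by move: (normc a) (normc x) (normc b) (normc y) => A X B Y; lra.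
Qed.
End PolarIntegral.

(** * Fourier coefficients, reflection and inversion *)

Section AlmostEverywhere.
Variable R : realType.
Local Notation leb := (@lebesgue_measure R).
Local Notation RT := (measurableTypeR R).
Local Notation circ := (`[0%R, (2 * pi)%R]%classic : set RT).
Local Notation circo := (`]0%R, (2 * pi)%R[%classic : set RT).
Local Notation dom := (@polar_dom R : set (RT * RT)).
Local Notation leb2 := (leb \x leb)%E.
Implicit Types (h g : RT -> R[i]) (r t : R) (k : int).

Lemma pi2_gt0 : 0 < 2 * pi :> R. Proof. by rewrite mulr_gt0 ?pi_gt0. Qed.

(** A single point of the circle does not matter: Fourier coefficients are
    integrals over the closed interval, polar coordinates use a half-open one,
    and the open interval is stable under reflection. *)
Lemma integral_circ (f : RT -> \bar R) : measurable_fun circo f ->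
  (\int[leb]_(t in circ) f t = \int[leb]_(t in circo) f t)%E.
Proof.
move=> mf.
have mf' : measurable_fun (`]0%R, (2 * pi)%R]%classic : set RT) f.
  by apply/emeasurable_fun_itv_bndo_bndcP.
by rewrite -integral_itv_obnd_cbnd// -integral_itv_bndo_bndc.
Qed.

Lemma measurable_circ (f : RT -> R) : measurable_fun circo f -> measurable_fun circ f.
Proof.
move=> mf; apply/measurable_fun_itv_obnd_cbndP; exact/measurable_fun_itv_bndo_bndcP.
Qed.

Lemma integrable_circ (f : RT -> R) : leb.-integrable circo (EFin \o f) ->
  leb.-integrable circ (EFin \o f).
Proof.
move=> /integrableP[mf ff]; have mf' : measurable_fun circo f by apply/measurable_EFinP.
apply/integrableP; split; first by apply/measurable_EFinP; exact: measurable_circ.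
rewrite integral_circ//; exact: measurableT_comp.
Qed.

Lemma cint_circ h : cint leb circo h -> cint leb circ h.
Proof. by move=> [h1 h2]; split; exact: integrable_circ. Qed.

Definition circle_coef h k : R[i] := ((2 * pi)^-1)%:C * cintegral leb circ (fun t => h t * expi (- (k%:~R * t))).

Lemma fourierE (w : R -> R -> R[i]) k r : fourier w k r = circle_coef (w r) k.
Proof. by []. Qed.

Lemma measurable_circ_cont (f : R -> R) (D : set RT) : measurable D -> continuous f -> measurable_fun D f.
Proof. by move=> mD cf; apply: measurable_funTS; exact: continuous_measurable_fun. Qed.

Lemma cmeas_expi (D : set RT) (c : R) : measurable D -> cmeas D (fun t : RT => expi (c * t)).
Proof.
have cc : continuous (fun t : R => c * t) by move=> t; apply: cvgM; [exact: cvg_cst|exact: cvg_id].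
move=> mD; split; rewrite /expi /polar /=; under eq_fun do rewrite mul1r; apply: measurable_circ_cont => //.
  by move=> t; apply: continuous_comp; [exact: cc|exact: continuous_cos].
by move=> t; apply: continuous_comp; [exact: cc|exact: continuous_sin].
Qed.

Lemma normc_expi t : normc (expi t : R[i]) = 1.
Proof. by rewrite /expi /polar /= !mul1r cos2Dsin2 sqrtr1. Qed.

Lemma cint_expi h k : cint leb circ h -> cint leb circ (fun t => h t * expi (- (k%:~R * t))).
Proof.
move=> hh; have mh := cint_meas hh; have [h1 h2] := hh.
have mD : measurable circ by exact: measurable_itv.
have me : cmeas circ (fun t : RT => expi (- (k%:~R * t)) : R[i]).
  have := @cmeas_expi circ (- k%:~R) mD.
  by apply: cmeas_eq => t _; rewrite mulNr.
apply: (@cint_le _ _ _ leb circ mD _ (fun t => `|complex.Re (h t)| + `|complex.Im (h t)|)).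
- exact: (cmeasM mh me).
- move=> t _; rewrite normcM normc_expi mulr1; exact: normc_le_ReIm.
- have := @integrableD _ _ _ leb circ mD _ _ (integrable_abse h1) (integrable_abse h2).
  by [].
Qed.

Lemma circle_coef_lin h g k (a b : R[i]) : cint leb circ h -> cint leb circ g ->
  circle_coef (fun t => a * h t + b * g t) k = a * circle_coef h k + b * circle_coef g k.
Proof.
move=> /(@cint_expi h k) hh /(@cint_expi g k) hg; rewrite /circle_coef.
have -> : cintegral leb circ (fun t => (a * h t + b * g t) * expi (- (k%:~R * t))) =
  cintegral leb circ (fun t => a * (h t * expi (- (k%:~R * t))) + b * (g t * expi (- (k%:~R * t)))).
  by apply: eq_cintegral => t _; ring.
by rewrite cintegral_lin//; ring.
Qed.

Lemma circle_coef_eq h g k : (forall t, h t = g t) -> circle_coef h k = circle_coef g k.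
Proof. by move=> /funext ->. Qed.

Lemma circle_coef_null h k : cmeas circo h -> (\forall t \ae leb, circo t -> h t = 0) -> circle_coef h k = 0.
Proof.
move=> mh h0; rewrite /circle_coef.
have mD : measurable circo by exact: measurable_itv.
have me : cmeas circo (fun t : RT => h t * expi (- (k%:~R * t)) : R[i]).
  have := @cmeas_expi circo (- k%:~R) mD => me.
  have {}me : cmeas circo (fun t : RT => expi (- (k%:~R * t)) : R[i]).
    by apply: cmeas_eq me => t _; rewrite mulNr.
  exact: (cmeasM mh me).
have H (F : R[i] -> R) : F 0 = 0 -> measurable_fun circo (fun t => F (h t * expi (- (k%:~R * t)))) ->
    Rintegral leb circ (fun t => F (h t * expi (- (k%:~R * t)))) = 0.
  move=> F0 mF; rewrite /Rintegral integral_circ; last exact/measurable_EFinP.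
  rewrite (@ae_eq_integral _ _ _ leb circo (cst 0%E))//.
  - by rewrite integral0.
  - exact/measurable_EFinP.
  - by apply: filterS h0 => t ht /ht ->; rewrite mul0r F0.
case: me => m1 m2; rewrite /cintegral (H (@complex.Re R))// (H (@complex.Im R))//.
by rewrite mulr0.
Qed.

(** The change of angle theta -> - theta, seen on [0, 2 pi]. *)
Definition refl (t : RT) : RT := 2 * pi - t.

Lemma measurable_refl : measurable_fun setT refl.
Proof.
apply: measurable_circ_cont => //; move=> t; apply: cvgB; [exact: cvg_cst|exact: cvg_id].
Qed.

HB.instance Definition _ := isMeasurableFun.Build _ _ _ _ refl measurable_refl.

(** Lebesgue measure is invariant under t -> 2 pi - t; both sides are measures
    that agree on intervals. *)
Lemma leb_refl (A : set RT) : measurable A -> pushforward leb refl A = leb A.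
Proof.
move=> mA; apply/esym/lebesgue_measure_unique => //= _ [[a b]] _ <-.
rewrite /pushforward (_ : _ @^-1` _ = `[2 * pi - b, 2 * pi - a[%classic).
  rewrite !lebesgue_measure_itv /= !lte_fin ltrD2l ltrN2; case: ifP => // _.
  by rewrite -!EFinB; congr EFin; ring.
apply/seteqP; split => t /=; rewrite /refl !in_itv /= => /andP[h1 h2]; apply/andP; split; lra.
Qed.

Lemma refl_circo : refl @^-1` circo = circo.
Proof.
apply/seteqP; split => t /=; rewrite /refl !in_itv /= => /andP[h1 h2]; apply/andP; split; lra.
Qed.

Lemma integral_refl (f : RT -> \bar R) : measurable_fun circo f -> (forall t, 0 <= f t)%E ->
  (\int[leb]_(t in circo) f (refl t) = \int[leb]_(t in circo) f t)%E.
Proof.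
move=> mf f0; rewrite -[in LHS]refl_circo.
rewrite -(@ge0_integral_pushforward _ _ _ _ _ _ _ leb circo f)//=.
by apply: eq_measure_integral => //= A mA _; exact: leb_refl.
Qed.

Lemma measurable_reflo (f : RT -> R) : measurable_fun circo f -> measurable_fun circo (fun t => f (refl t)).
Proof.
move=> mf; apply: (measurable_comp (measurable_itv `]0%R, (2 * pi)%R[) _ mf (measurable_funTS measurable_refl)).
by move=> _ [t ht <-]; rewrite -refl_circo in ht.
Qed.

Lemma cmeas_refl h : cmeas circo h -> cmeas circo (fun t => h (refl t)).
Proof. by move=> [/measurable_reflo h1 /measurable_reflo h2]; split. Qed.

Lemma cint_refl h : cint leb circo h -> cint leb circo (fun t => h (refl t)).
Proof.
have H (f : RT -> R) : leb.-integrable circo (EFin \o f) -> leb.-integrable circo (EFin \o (fun t => f (refl t))).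
  move=> /integrableP[mf ff]; have mf' : measurable_fun circo f by apply/measurable_EFinP.
  apply/integrableP; split; first by apply/measurable_EFinP; exact: measurable_reflo.
  rewrite (_ : (\int[_]_(x in _) _)%E = (\int[leb]_(t in circo) (fun x => `|(f x)%:E|) (refl t))%E)//.
  by rewrite (@integral_refl (fun x => `|(f x)%:E|%E))//; exact: measurableT_comp.
by move=> [/H h1 /H h2]; split.
Qed.

Lemma ae0_normc2 h : cmeas circo h -> (\int[leb]_(t in circo) (normc (h t) ^+ 2)%:E = 0)%E ->
  \forall t \ae leb, circo t -> h t = 0.
Proof.
move=> mh h0; have mD : measurable circo by exact: measurable_itv.
have mf : measurable_fun circo (fun t : RT => (normc (h t) ^+ 2)%:E).
  by apply/measurable_EFinP; exact: cmeas_normc2.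
have : (\int[leb]_(t in circo) `|(normc (h t) ^+ 2)%:E| = 0)%E.
  rewrite -[RHS]h0; apply: eq_integral => t _ /=.
  by rewrite ger0_norm// sqr_ge0.
move=> /(ae_eq_integral_abs leb mD mf); apply: filterS => t ht /ht /=.
by move=> [/eqP]; rewrite sqrf_eq0 => /eqP /eq0_normc.
Qed.

Lemma refl_null h : cmeas circo h -> (\int[leb]_(t in circo) (normc (h t) ^+ 2)%:E = 0)%E ->
  \forall t \ae leb, circo t -> h (refl t) = 0.
Proof.
move=> mh h0; apply: ae0_normc2; first exact: cmeas_refl.
rewrite (integral_refl (f := fun t => (normc (h t) ^+ 2)%:E))//.
  by apply/measurable_EFinP; exact: cmeas_normc2.
by move=> t; rewrite lee_fin sqr_ge0.
Qed.

(** Inversion r -> 1/r preserves null sets: on [1/m, m] it stretches lengths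
    by a factor at most m^2. *)
Definition invset (m : R) (A : set RT) : set RT := [set r | (m^-1 <= r <= m) /\ A r^-1].

Lemma measurable_invpre (m : R) (A : set RT) : 0 < m -> measurable A ->
  measurable (invset m A).
Proof.
move=> m0 mA; have mi : 0 < m^-1 by rewrite invr_gt0.
rewrite (_ : invset m A = `[m^-1, m] `&` (GRing.inv @^-1` A)); last first.
  by apply/seteqP; split => r /=; rewrite !in_itv.
have : measurable_fun (`]0%R, +oo[%classic : set RT) (@GRing.inv R).
  apply: open_continuous_measurable_fun; first exact: interval_open.
  move=> r; rewrite inE /= in_itv /= andbT => r0.
  by apply: inv_continuous; rewrite gt_eqF.
move=> /measurable_funS mI.
have {}mI : measurable_fun (`[m^-1, m]%classic : set RT) (@GRing.inv R).
  apply: mI => // r /=; rewrite !in_itv /= andbT => /andP[h _]; exact: lt_le_trans h.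
by apply: mI => //; exact: measurable_itv.
Qed.

Lemma inv_itv_le (m a b : R) : 0 < m ->
  (leb (invset m `]a, b]) <= (m ^+ 2)%:E * leb (`]a, b]%classic : set RT))%E.
Proof.
move=> m0.
pose a' := Num.max a m^-1; pose b' := Num.min b m.
have mi : 0 < m^-1 by rewrite invr_gt0.
have [ab|ab] := leP a' b'; last first.
  rewrite (_ : invset m _ = set0) ?measure0 ?mule_ge0 ?lee_fin ?sqr_ge0//.
  apply/seteqP; split => // r /= [/andP[r1 r2]]; rewrite /= in_itv /= => /andP[r3 r4].
  have r0 : 0 < r by apply: lt_le_trans r1.
  have h1 : a' <= r^-1 by rewrite ge_max (ltW r3)/= lef_pV2 ?posrE.
  have h2 : r^-1 <= b' by rewrite le_min r4/= -[m]invrK lef_pV2 ?posrE.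
  by move: (le_trans h1 h2); rewrite leNgt ab.
have a'0 : 0 < a' by rewrite lt_max mi orbT.
have b'0 : 0 < b' by apply: lt_le_trans ab.
apply: (@le_trans _ _ (leb (`[b'^-1, a'^-1]%classic : set RT))).
  apply: le_measure; rewrite ?inE.
  - by apply: measurable_invpre => //; exact: measurable_itv.
  - exact: measurable_itv.
  - move=> r /= [/andP[r1 r2]]; rewrite /= in_itv /= => /andP[r3 r4]; have r0 : 0 < r by apply: lt_le_trans r1.
    have h1 : a' <= r^-1 by rewrite ge_max (ltW r3)/= lef_pV2 ?posrE.
    have h2 : r^-1 <= b' by rewrite le_min r4/= -[m]invrK lef_pV2 ?posrE.
    by rewrite in_itv /= -[r]invrK !lef_pV2 ?posrE ?invr_gt0// h1 h2.
rewrite !lebesgue_measure_itv /= !lte_fin.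
have aa : a <= a' by rewrite le_max lexx.
have bb : b' <= b by rewrite ge_min lexx.
have am : m^-1 <= a' by rewrite le_max lexx orbT.
case: ifPn => h1; last by rewrite mule_ge0 ?lee_fin ?sqr_ge0//; case: ifP => h2; rewrite -?EFinB ?lee_fin ?subr_ge0// ltW.
have ab' : a' < b' by move: h1; rewrite ltf_pV2.
have -> : (a < b) = true by apply: le_lt_trans aa (lt_le_trans ab' bb).
rewrite -!EFinB -EFinM lee_fin.
have -> : a'^-1 - b'^-1 = (b' - a') * (a'^-1 * b'^-1) by field; rewrite !gt_eqF.
have i1 : a'^-1 <= m by rewrite -[m]invrK lef_pV2 ?posrE.
have i2 : b'^-1 <= m by rewrite -[m]invrK lef_pV2 ?posrE// (le_trans am).
rewrite mulrC ler_pM ?mulr_ge0 ?invr_ge0 ?subr_ge0 ?(ltW a'0) ?(ltW b'0)//.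
  by rewrite expr2 ler_pM ?invr_ge0 ?(ltW a'0) ?(ltW b'0).
by rewrite lerB.
Qed.

Lemma inv_null_itv (m : R) (A : set RT) : 0 < m -> measurable A -> leb A = 0%E ->
  leb (invset m A) = 0%E.
Proof.
move=> m0 mA A0; apply/eqP; rewrite eq_le measure_ge0 andbT.
have m2 : 0 < m ^+ 2 by rewrite exprn_gt0.
suff : ((m ^- 2)%:E * leb (invset m A) <= leb A)%E.
  rewrite A0 => /(lee_wpmul2l (x := (m ^+ 2)%:E)) => /(_ _)/wrap[]; first by rewrite lee_fin ltW.
  by rewrite muleA -EFinM mulfV ?gt_eqF// mul1e mule0.
rewrite [leRHS]/lebesgue_measure /lebesgue_stieltjes_measure /measure_extension /mu_ext /=.
apply: le_ereal_inf_tmp => _ [F [mF FA] <-].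
have mF' (k : nat) : @measurable _ RT (F k).
  by have [[a b] _ <-] := mF k; exact: measurable_itv.
pose G (k : nat) := invset m (F k).
have h1 : (leb (invset m A) <= \sum_(k <oo) leb (G k))%E.
  apply: measure_sigma_subadditive.
  - by move=> k; exact: measurable_invpre.
  - exact: measurable_invpre.
  - by move=> r [hr /FA[k _ Fk]]; exists k.
have h2 (k : nat) : (leb (G k) <= (m ^+ 2)%:E * wlength idfun (F k))%E.
  have [[a b] _ Fk] := mF k.
  rewrite /G -Fk; apply: (le_trans (inv_itv_le a b m0)).
  by rewrite lebesgue_measure_itv wlength_itv.
have wl (k : nat) : (0 <= wlength (@idfun R) (F k))%E by exact: (wlength_ge0 (idfun : cumulative R R)).
apply: (@le_trans _ _ ((m ^- 2)%:E * \sum_(k <oo) ((m ^+ 2)%:E * wlength idfun (F k)))%E).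
  apply: lee_wpmul2l; first by rewrite lee_fin invr_ge0 ltW.
  apply: (le_trans h1).
  by apply: lee_nneseries => // k _; exact: measure_ge0.
rewrite nneseriesZl//.
by rewrite muleA -EFinM mulVf ?gt_eqF// mul1e.
Qed.

Lemma ae_inv (P : R -> Prop) : {ae leb, forall r : RT, 0 < r -> P r} -> {ae leb, forall r : RT, 0 < r -> P r^-1}.
Proof.
move=> [N [mN N0 HN]].
have : leb.-negligible (\bigcup_m invset (m.+1%:R) N).
  apply: negligible_bigcup => m; apply/negligibleP.
    by apply: measurable_invpre.
  by apply: inv_null_itv.
apply: negligibleS => r /= h.
have /not_implyP[r0 nP] : ~ (0 < r -> P r^-1) by [].
have [m hm] : exists m : nat, Num.max r r^-1 <= m.+1%:R.
  exists (Num.truncn (Num.max r r^-1)); apply: ltW; apply: truncnS_gt.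
exists m => //=; split.
  move: hm; rewrite ge_max => /andP[-> h2]; rewrite andbT.
  by rewrite -[r]invrK lef_pV2 ?posrE ?invr_gt0.
apply: HN => /= hh; apply: nP; apply: hh; by rewrite invr_gt0.
Qed.
End AlmostEverywhere.

(** * Fourier modes of square-integrable functions *)

Section ModesAlmostEverywhere.
Variable R : realType.
Variable n : nat.
Hypothesis n0 : (0 < n)%N.
Local Notation leb := (@lebesgue_measure R).
Local Notation RT := (measurableTypeR R).
Local Notation circ := (`[0%R, (2 * pi)%R]%classic : set RT).
Local Notation circo := (`]0%R, (2 * pi)%R[%classic : set RT).
Local Notation dom := (@polar_dom R : set (RT * RT)).
Local Notation leb2 := (leb \x leb)%E.
Implicit Types (u v w : R[i] -> R[i]) (r t : R) (k : int).

Lemma dens_gt0 r : 0 < r -> 0 < area_density n r.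
Proof.
move=> r0; rewrite /area_density divr_gt0 ?mulr_gt0 ?exprn_gt0 ?ltr0n//.
all: by rewrite addr_gt0// exprn_gt0.
Qed.

Lemma circo_dom r t : 0 < r -> circo t -> dom (r, t).
Proof. by move=> r0; rewrite /= in_itv /= => /andP[t0 t1]; apply/domP => /=; rewrite (ltW t0). Qed.

Lemma measurable_section (f : RT * RT -> R) r : measurable_fun dom f -> 0 < r ->
  measurable_fun circo (fun t : RT => f (r, t)).
Proof.
move=> mf r0; apply: (measurable_comp (@measurable_dom R) _ mf (measurable_funTS (pair1_measurable (r : RT)))).
by move=> _ [t ht <-]; exact: circo_dom.
Qed.

Lemma cmeas_section u r : cmeas dom (fun p : RT * RT => u (polar p.1 p.2)) -> 0 < r ->
  cmeas circo (fun t : RT => u (polar r t)).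
Proof.
move=> [m1 m2] r0; have h1 := measurable_section m1 r0; have h2 := measurable_section m2 r0.
by split.
Qed.

(** Fubini: almost every circle carries a finite integral of |u|^2, and on such a
    circle u is integrable because |u| <= 1 + |u|^2. *)
Lemma L2_ae_circle u : in_L2 n u ->
  {ae leb, forall r : RT, 0 < r ->
  cint leb circo (fun t : RT => u (polar r t))}.
Proof.
move=> /in_L2P[mu iu]; have mdom := @measurable_dom R.
have iu' := (integrable_mkcond _ mdom).1 iu.
have mC : measurable circo by exact: measurable_itv.
apply: filterS (ae_integrable1 iu') => r ir r0.
have ms := cmeas_section mu r0; have d0 := dens_gt0 r0.
have i1 : leb.-integrable circo (EFin \o (fun t : RT => dens2 n u (r, t))).
  have h := integrableS measurableT mC (@subsetT _ _) ir.
  apply: eq_integrable h => // t; rewrite inE => ht; rewrite patchE mem_set//.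
  exact: circo_dom.
have i2 : leb.-integrable circo (EFin \o (fun _ : RT => 1 : R)).
  apply/integrableP; split; first exact/measurable_EFinP/measurable_cst.
  rewrite (eq_integral (cst 1%E)); last by move=> t _; rewrite /= normr1.
  rewrite integral_cst//= mul1e lebesgue_measure_itv /= lte_fin pi2_gt0 -EFinB ltry//.
apply: (cint_le mC ms _ (integrable_lin mC 1 (area_density n r)^-1 i2 i1)) => t _ /=.
rewrite mul1r /dens2 /= mulKf ?gt_eqF//.
by have := sqr_ge0 (normc (u (polar r t)) - 1); have := sqr_ge0 (normc (u (polar r t))); lra.
Qed.

Lemma L2_ae_null w : in_L2 n w -> L2norm n w = 0 -> {ae leb, forall r : RT, 0 < r ->
  (\int[leb]_(t in circo) (normc (w (polar r t)) ^+ 2)%:E = 0)%E}.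
Proof.
move=> hw; have /in_L2P[mw iw] := hw; have [_ _ fin] := hw; have mdom := @measurable_dom R.
move=> /eqP; rewrite /L2norm sqrtr_eq0 => le0.
have L0 : L2norm2 n w = 0%E.
  have ge0 : (0 <= L2norm2 n w)%E.
    by apply: integral_ge0 => p hp; rewrite lee_fin; exact: dens2_ge0.
  move: le0 fin ge0; case: (L2norm2 n w) => [x|//|//] /= x0 _.
  by rewrite lee_fin => x1; congr EFin; apply/eqP; rewrite eq_le x0 x1.
pose f := (EFin \o dens2 n w) \_ dom.
have mf : measurable_fun setT f.
  by apply/(measurable_restrictT _ mdom); apply: measurable_int; exact: iw.
have f0 p : (0 <= f p)%E.
  rewrite /f patchE; case: ifPn => // /set_mem hp; rewrite lee_fin; exact: dens2_ge0.
have F0 : (\int[leb]_r fubini_F leb f r = 0)%E.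
  by rewrite -fubini_tonelli1// -[RHS]L0 /L2norm2 [in RHS]integral_mkcond.
have mF : measurable_fun setT (fubini_F leb f) by exact: measurable_fun_fubini_tonelli_F.
have Fge r : (0 <= fubini_F leb f r)%E by exact: integral_ge0.
have : (\int[leb]_r `|fubini_F leb f r| = 0)%E.
  by rewrite -[RHS]F0; apply: eq_integral => r _; rewrite gee0_abs.
move=> /(ae_eq_integral_abs leb measurableT mF); apply: filterS => r /(_ I) Fr r0.
have d0 := dens_gt0 r0.
have ms := cmeas_section mw r0; have mC : measurable circo by exact: measurable_itv.
have mn : measurable_fun circo (fun t : RT => (normc (w (polar r t)) ^+ 2)%:E).
  by apply/measurable_EFinP; exact: cmeas_normc2.
have h : ((area_density n r)%:E * \int[leb]_(t in circo) (normc (w (polar r t)) ^+ 2)%:E <= 0)%E.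
  rewrite -ge0_integralZl ?lee_fin ?(ltW d0)//; last by move=> t _; rewrite lee_fin sqr_ge0.
  rewrite -[leRHS]Fr /fubini_F integral_mkcond; apply: ge0_le_integral => //.
  - by move=> t _; rewrite patchE; case: ifPn => // _; rewrite mule_ge0 ?lee_fin ?(ltW d0) ?sqr_ge0.
  - apply/(measurable_restrictT _ mC); exact: measurable_funeM.
  - exact: (measurableT_comp mf (pair1_measurable _)).
  - move=> t _; rewrite /f !patchE; case: ifPn => [/set_mem ht|_].
      by rewrite mem_set//; exact: circo_dom.
    by case: ifPn => // /set_mem hp; rewrite lee_fin; exact: dens2_ge0.
apply/eqP; rewrite eq_le integral_ge0 ?andbT; last by move=> t _; rewrite lee_fin sqr_ge0.
by rewrite -(pmule_rle0 (x := (area_density n r)%:E)).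
Qed.

Lemma polar_inv r t : 0 < r -> (polar r t)^-1 = polar r^-1 (refl t) :> R[i].
Proof.
move=> r0; have nz : polar r t != 0.
  apply/eqP => /(congr1 (@normc R)); rewrite normc0 /polar /= !exprMn -mulrDr cos2Dsin2 mulr1.
  by rewrite sqrtr_sqr ger0_norm ?ltW// => /eqP; rewrite gt_eqF.
apply: (mulfI nz); rewrite divff//; apply: complexP; rewrite /polar ?ReM ?ImM /= /refl.
  rewrite cosB sinB (mulr_natl pi 2) cos2pi sin2pi.
  have -> : r * cos t * (r^-1 * (1 * cos t + 0 * sin t)) - r * sin t * (r^-1 * (0 * cos t - 1 * sin t)) =
     r / r * (cos t ^+ 2 + sin t ^+ 2) by ring.
  by rewrite cos2Dsin2 divff ?gt_eqF// mulr1.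
rewrite cosB sinB (mulr_natl pi 2) cos2pi sin2pi; ring.
Qed.

(** In the coordinate y = 1/x the angle changes sign; as angles run over
    [0, 2 pi], this is a reflection. *)
Lemma y_polarE u r t : 0 < r -> y_polar u r t = x_polar u r^-1 (refl t).
Proof. by move=> r0; rewrite /y_polar /x_polar polar_inv. Qed.

Lemma L2_ae_circle_y u : in_L2 n u ->
  {ae leb, forall r : RT, 0 < r ->
  cint leb circo (fun t : RT => y_polar u r t)}.
Proof.
move=> /L2_ae_circle/ae_inv; apply: filterS => r H r0.
have mC : measurable circo by exact: measurable_itv.
have E t : circo t -> u (polar r^-1 (refl t)) = y_polar u r t by move=> _; rewrite y_polarE.
exact: (cint_eq mC E (cint_refl (H r0))).
Qed.

Lemma x_fourier_sub u v k : in_L2 n u -> in_L2 n v -> {ae leb, forall r : RT, 0 < r ->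
  fourier (x_polar (fun z => u z - v z)) k r = fourier (x_polar u) k r - fourier (x_polar v) k r}.
Proof.
move=> /L2_ae_circle Hu /L2_ae_circle Hv; apply: filterS2 Hu Hv => r Hu Hv r0.
have := circle_coef_lin k 1 (-1) (cint_circ (Hu r0)) (cint_circ (Hv r0)); rewrite mul1r mulN1r => <-.
by apply: circle_coef_eq => t; rewrite mul1r mulN1r.
Qed.

Lemma y_fourier_sub u v k : in_L2 n u -> in_L2 n v -> {ae leb, forall r : RT, 0 < r ->
  fourier (y_polar (fun z => u z - v z)) k r = fourier (y_polar u) k r - fourier (y_polar v) k r}.
Proof.
move=> /L2_ae_circle_y Hu /L2_ae_circle_y Hv; apply: filterS2 Hu Hv => r Hu Hv r0.
have := circle_coef_lin k 1 (-1) (cint_circ (Hu r0)) (cint_circ (Hv r0)); rewrite mul1r mulN1r => <-.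
by apply: circle_coef_eq => t; rewrite mul1r mulN1r.
Qed.

Lemma x_fourier_null w k : in_L2 n w -> L2norm n w = 0 -> {ae leb, forall r : RT, 0 < r ->
  fourier (x_polar w) k r = 0}.
Proof.
move=> hw w0; have [mw _] := (in_L2P n w).1 hw.
apply: filterS (L2_ae_null hw w0) => r H r0; have ms := cmeas_section mw r0.
by rewrite fourierE; apply: circle_coef_null => //; apply: ae0_normc2 => //; exact: H.
Qed.

Lemma y_fourier_null w k : in_L2 n w -> L2norm n w = 0 -> {ae leb, forall r : RT, 0 < r ->
  fourier (y_polar w) k r = 0}.
Proof.
move=> hw w0; have [mw _] := (in_L2P n w).1 hw.
apply: filterS (ae_inv (L2_ae_null hw w0)) => r H r0.
have ri : 0 < r^-1 by rewrite invr_gt0.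
have ms := cmeas_section mw ri.
rewrite fourierE (circle_coef_eq (g := fun t : RT => w (polar r^-1 (refl t)))); last by move=> t; rewrite y_polarE.
apply: circle_coef_null; first exact: cmeas_refl ms.
exact: refl_null ms (H r0).
Qed.
End ModesAlmostEverywhere.

(** * Continuously differentiable functions of two variables *)

Section PlaneCalculus.
Variable R : realType.
Implicit Types (g : R * R -> R) (p v : R * R) (s t r : R).

Definition C1 g := (forall p v, derivable g p v) /\ forall v, continuous (fun p => 'D_v g p).

Lemma smooth2_C1 g (s : seq (R * R)) : smooth2 g -> C1 (iter_derive s g).
Proof.
move=> H; split; first by have [_] := H s.
by move=> v; have [] := H (v :: s).
Qed.

Lemma smooth2_cont g (s : seq (R * R)) : smooth2 g -> continuous (iter_derive s g).
Proof. by move=> H; have [] := H s. Qed.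

Lemma is_derive_epsP (f : R -> R) t (d : R) : is_derive t 1 f d <->
  forall e, 0 < e -> exists2 D, 0 < D & forall s, `|s| < D -> `|f (t + s) - f t - s * d| <= e * `|s|.
Proof.
split=> [[df dv] e e0|H].
  have L : (fun s : R => s^-1 *: ((f \o shift t) (s *: 1) - f t)) @ 0^' --> d.
    by rewrite -dv; exact: df.
  have := L => /cvgrPdist_le/(_ e e0); rewrite near_withinE => /nbhs_ballP[D /= D0 hD].
  exists D => // s sD; have [->|s0] := eqVneq s 0.
    by rewrite addr0 subrr mul0r subr0 normr0 mulr0.
  have := hD s; rewrite /ball /= sub0r normrN => /(_ sD s0).
  rewrite /GRing.scale /= mulr1 [s + t]addrC distrC => h.
  have -> : f (t + s) - f t - s * d = s * (s^-1 * (f (t + s) - f t) - d) by field.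
  by rewrite normrM mulrC ler_wpM2r.
have L : (fun s : R => s^-1 *: ((f \o shift t) (s *: 1) - f t)) @ 0^' --> d.
  apply/cvgrPdist_le => e e0; have [D D0 hD] := H e e0; near=> s.
  have s0 : s != 0 by near: s; exact: nbhs_dnbhs_neq.
  have sD : `|s| < D by near: s; apply: dnbhs0_lt.
  rewrite distrC /GRing.scale /= mulr1 [s + t]addrC.
  have -> : s^-1 * (f (t + s) - f t) - d = s^-1 * (f (t + s) - f t - s * d) by field.
  by rewrite normrM normfV ler_pdivrMl ?normr_gt0// [leRHS]mulrC hD.
split; first by apply/cvg_ex; exists d.
by apply/cvg_lim.
Unshelve. all: by end_near. Qed.

Lemma pair_line (x y a b s : R) : (x, y) + s *: (a, b) = (x + s * a, y + s * b) :> R * R.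
Proof. by []. Qed.

Lemma C1_line g p v s : C1 g -> is_derive s 1 (fun s => g (p + s *: v)) ('D_v g (p + s *: v)).
Proof.
move=> [dg _].
have E : (fun h : R => h^-1 *: (((fun s => g (p + s *: v)) \o shift s) (h *: 1) - g (p + s *: v))) =
   (fun h : R => h^-1 *: ((g \o shift (p + s *: v)) (h *: v) - g (p + s *: v))).
  apply/funext => h /=; congr (_ *: (g _ - _)).
  have -> : h%:A = h :> R by exact: mulr1.
  by rewrite scalerDl addrCA.
split; first by rewrite /derivable E; exact: dg.
by rewrite /derive E.
Qed.

Lemma mvt_le (F F' : R -> R) (c e D : R) : 0 <= D -> (forall s, `|s| <= D -> is_derive s 1 F (F' s)) ->
  (forall s, `|s| <= D -> `|F' s - c| <= e) -> forall h, `|h| <= D ->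
  `|F h - F 0 - h * c| <= e * `|h|.
Proof.
move=> D0 dF bF h hD.
have cF u w : `|u| <= D -> `|w| <= D -> {within `[u, w], continuous F}.
  move=> uD wD; apply: derivable_within_continuous => x; rewrite in_itv /= => /andP[x1 x2].
  have [] // := dF x _; move: uD wD; rewrite !ler_norml => /andP[? _] /andP[_ ?].
  by apply/andP; split; lra.
have [h0|h0] := leP 0 h.
  have [||x] := @MVT_segment R F F' 0 h h0.
  - move=> x; rewrite in_itv /= => /andP[x1 x2]; apply: dF; rewrite ger0_norm ?(ltW x1)//.
    by rewrite (le_trans (ltW x2))// -(ger0_norm h0).
  - by apply: cF => //; rewrite normr0.
  rewrite in_itv /= => /andP[x1 x2] ->.
  rewrite subr0 mulrC -mulrBr normrM mulrC ler_wpM2r// bF//.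
  by rewrite ger0_norm// (le_trans x2)// -(ger0_norm h0).
have h0' := ltW h0.
have [||x] := @MVT_segment R F F' h 0 h0'.
- move=> x; rewrite in_itv /= => /andP[x1 x2]; apply: dF; rewrite ler0_norm ?(ltW x2)//.
  by rewrite (le_trans _ hD)// ler0_norm// lerN2 ltW.
- by apply: cF => //; rewrite normr0.
rewrite in_itv /= => /andP[x1 x2] E.
have -> : F h - F 0 - h * c = h * (F' x - c).
  by rewrite -[F h - F 0]opprB E; ring.
rewrite normrM mulrC ler_wpM2r// bF//.
by rewrite ler0_norm// (le_trans _ hD)// ler0_norm// lerN2.
Qed.

(** Mean value theorem along two sides of a rectangle. *)
Lemma C1_eps g p : C1 g -> forall e, 0 < e -> exists2 D, 0 < D & forall h k, `|h| < D -> `|k| < D ->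
  `|g (p.1 + h, p.2 + k) - g p - (h * 'D_(1, 0) g p + k * 'D_(0, 1) g p)| <= e * (`|h| + `|k|).
Proof.
move=> hg e e0; have [_ cg] := hg.
have ev v : exists2 D, 0 < D & forall a b, `|a| < D -> `|b| < D ->
    `|'D_v g (p.1 + a, p.2 + b) - 'D_v g p| <= e.
  have := cg v p => /cvgrPdist_le/(_ e e0)/nbhs_ballP[D /= D0 hD]; exists D => // a b aD bD.
  rewrite distrC; apply: hD; split; rewrite /ball /= opprD addrA subrr sub0r normrN//.
have [D1 D10 h1] := ev (1, 0); have [D2 D20 h2] := ev (0, 1).
exists (Num.min D1 D2); first by rewrite lt_min D10.
move=> h k; rewrite !lt_min => /andP[hD1 hD2] /andP[kD1 kD2].
have a1 : `|g (p.1 + h, p.2) - g p - h * 'D_(1, 0) g p| <= e * `|h|.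
  have := @mvt_le (fun s => g (p + s *: (1, 0))) (fun s => 'D_(1, 0) g (p + s *: (1, 0)))
    ('D_(1, 0) g p) e `|h| (normr_ge0 _) _ _ h (lexx _).
  have E s : p + s *: (1, 0) = (p.1 + s, p.2) :> R * R.
    by rewrite [p]surjective_pairing pair_line mulr1 mulr0 addr0.
  rewrite !E addr0 -surjective_pairing; apply.
    by move=> s _; exact: C1_line.
  move=> s sh; rewrite E -{1}[p.2]addr0; apply: h1; rewrite ?normr0//.
  exact: le_lt_trans hD1.
have a2 : `|g (p.1 + h, p.2 + k) - g (p.1 + h, p.2) - k * 'D_(0, 1) g p| <= e * `|k|.
  have := @mvt_le (fun s => g ((p.1 + h, p.2) + s *: (0, 1))) (fun s => 'D_(0, 1) g ((p.1 + h, p.2) + s *: (0, 1)))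
    ('D_(0, 1) g p) e `|k| (normr_ge0 _) _ _ k (lexx _).
  have E s : (p.1 + h, p.2) + s *: (0, 1) = (p.1 + h, p.2 + s) :> R * R.
    by rewrite pair_line mulr1 mulr0 addr0.
  rewrite !E addr0; apply.
    by move=> s _; exact: C1_line.
  move=> s sh; rewrite E; apply: h2 => //.
  exact: le_lt_trans kD2.
rewrite [X in `|X|](_ : _ = (g (p.1 + h, p.2 + k) - g (p.1 + h, p.2) - k * 'D_(0, 1) g p) +
   (g (p.1 + h, p.2) - g p - h * 'D_(1, 0) g p)); last by ring.
by rewrite (le_trans (ler_normD _ _))// mulrDr addrC lerD.
Qed.

Lemma C1_chain g (a b : R -> R) t (a' b' : R) : C1 g -> is_derive t 1 a a' -> is_derive t 1 b b' ->
  is_derive t 1 (fun t => g (a t, b t)) (a' * 'D_(1, 0) g (a t, b t) + b' * 'D_(0, 1) g (a t, b t)).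
Proof.
move=> hg /is_derive_epsP da /is_derive_epsP db; apply/is_derive_epsP => e e0.
set gx := 'D_(1, 0) g _; set gy := 'D_(0, 1) g _.
have K0 : 0 < `|a'| + `|b'| + 2 by rewrite ltr_wpDl// addr_ge0.
have L0 : 0 < `|gx| + `|gy| + 1 by rewrite ltr_wpDl// addr_ge0.
have e20 : 0 < e / 2 / (`|a'| + `|b'| + 2) by rewrite !divr_gt0.
have [D D0 hD] := C1_eps (a t, b t) hg e20; rewrite /= -/gx -/gy in hD.
pose e1 := Num.min 1 (e / 2 / (`|gx| + `|gy| + 1)).
have e10 : 0 < e1 by rewrite lt_min ltr01 !divr_gt0.
have [Da Da0 ha] := da e1 e10; have [Db Db0 hb] := db e1 e10.
exists (Num.min (Num.min Da Db) (D / (`|a'| + `|b'| + 2))).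
  by rewrite !lt_min Da0 Db0 divr_gt0.
move=> s; rewrite !lt_min => /andP[/andP[sa sb]]; rewrite ltr_pdivlMr// => sD.
have {}ha := ha s sa; have {}hb := hb s sb.
set h := a (t + s) - a t in ha; set k := b (t + s) - b t in hb.
have s0 := normr_ge0 s.
have e11 : e1 <= 1 by rewrite ge_min lexx.
have h1 : `|h| <= (`|a'| + 1) * `|s|.
  rewrite -[h](subrK (s * a')) (le_trans (ler_normD _ _))// mulrDl mul1r addrC lerD//.
    by rewrite normrM mulrC.
  by rewrite (le_trans ha)// -[leRHS]mul1r ler_wpM2r.
have k1 : `|k| <= (`|b'| + 1) * `|s|.
  rewrite -[k](subrK (s * b')) (le_trans (ler_normD _ _))// mulrDl mul1r addrC lerD//.
    by rewrite normrM mulrC.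
  by rewrite (le_trans hb)// -[leRHS]mul1r ler_wpM2r.
have a0 := normr_ge0 a'; have b0 := normr_ge0 b'.
have aS : 0 <= `|a'| * `|s| by rewrite mulr_ge0.
have bS : 0 <= `|b'| * `|s| by rewrite mulr_ge0.
have hh : `|h| < D by apply: le_lt_trans h1 _; lra.
have kk : `|k| < D by apply: le_lt_trans k1 _; lra.
have := hD h k hh kk; rewrite /h /k ![_ + (_ - _)]addrC !subrK -/h -/k => H.
set G := g (a (t + s), b (t + s)) in H *; set G0 := g (a t, b t) in H *.
have -> : G - G0 - s * (a' * gx + b' * gy) = (G - G0 - (h * gx + k * gy)) + ((h - s * a') * gx + (k - s * b') * gy) by ring.
have H1 : `|G - G0 - (h * gx + k * gy)| <= e / 2 * `|s|.
  rewrite (le_trans H)//.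
  have : `|h| + `|k| <= (`|a'| + `|b'| + 2) * `|s| by lra.
  move=> /(ler_wpM2l (ltW e20)) hk; rewrite (le_trans hk)// mulrA divfK// gt_eqF//.
have H2 : `|(h - s * a') * gx + (k - s * b') * gy| <= e / 2 * `|s|.
  rewrite (le_trans (ler_normD _ _))// !normrM.
  have q1 : `|h - s * a'| * `|gx| <= e1 * `|s| * `|gx| by rewrite ler_wpM2r.
  have q2 : `|k - s * b'| * `|gy| <= e1 * `|s| * `|gy| by rewrite ler_wpM2r.
  have q3 : e1 * (`|gx| + `|gy| + 1) <= e / 2 by rewrite -ler_pdivlMr// ge_min lexx orbT.
  have q4 : e1 * (`|gx| + `|gy| + 1) * `|s| <= e / 2 * `|s| by rewrite ler_wpM2r.
  have q5 : 0 <= e1 * `|s| by rewrite mulr_ge0// ltW.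
  lra.
rewrite (le_trans (ler_normD _ _))//; lra.
Qed.

(** Derivatives are local, so they vanish off a closed set off which the function
    vanishes; hence derivatives of test functions are test functions. *)
Lemma iter_derive_off g (K : set (R * R)) : closed K -> (forall p, ~ K p -> g p = 0) ->
  forall (s : seq (R * R)) p, ~ K p -> iter_derive s g p = 0.
Proof.
move=> cK g0; elim => [|v s IH] p Kp /=; first exact: g0.
have oK : open (~` K) by rewrite openC.
rewrite (@near_eq_derive _ _ _ (iter_derive s g) (cst 0)) ?derive_cst//.
by apply: filterS (open_nbhs_nbhs (conj oK Kp)) => q /IH.
Qed.

Lemma smooth2_der g v : smooth2 g -> smooth2 (fun p => 'D_v g p).
Proof.
move=> H s; have := H (s ++ [:: v]).
by rewrite /iter_derive foldr_cat.
Qed.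

Lemma iter_derive_lin g g' (a b : R) (s : seq (R * R)) : smooth2 g -> smooth2 g' ->
  iter_derive s (fun p => a * g p + b * g' p) = (fun p => a * iter_derive s g p + b * iter_derive s g' p).
Proof.
move=> H H'; elim: s => [//|v s IH]; apply/funext => p /=.
have [_ d1] := H s; have [_ d2] := H' s.
rewrite IH (_ : (fun _ => _) = (a \*: iter_derive s g) + (b \*: iter_derive s g')) //.
by rewrite deriveD ?deriveZ//; apply: derivableZ.
Qed.

Lemma smooth2_lin g g' (a b : R) : smooth2 g -> smooth2 g' -> smooth2 (fun p => a * g p + b * g' p).
Proof.
move=> H H' s; rewrite iter_derive_lin//; have [c1 d1] := H s; have [c2 d2] := H' s.
have -> : (fun p => a * iter_derive s g p + b * iter_derive s g' p) = (a \*: iter_derive s g) + (b \*: iter_derive s g') by [].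
split => [p|p v]; last by apply: derivableD; apply: derivableZ.
by apply: cvgD; apply: cvgM; [exact: cvg_cst|exact: c1|exact: cvg_cst|exact: c2].
Qed.

Implicit Types (chi : R[i] -> R[i]).

(** Lets the two first-order factors of the Laplacian be integrated by parts one
    after the other. *)
Lemma test_wbar chi : test_function chi -> test_function (wirtinger_bar chi).
Proof.
move=> [s1 s2 cK K0].
have clK : closed (tsupport chi) by exact: closed_closure.
have e1 : re_cart (wirtinger_bar chi) = fun p => 2^-1 * 'D_(1, 0) (re_cart chi) p + - 2^-1 * 'D_(0, 1) (im_cart chi) p.
  apply/funext => -[x y]; rewrite {1}/re_cart /wirtinger_bar.
  set A := cderive _ _ _; set B := cderive _ _ _.
  rewrite (_ : 2^-1 = (2^-1 : R)%:C); last by rewrite rCV rCnat.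
  by rewrite ReM ReD [complex.Re ('i%C * B)]ReM /=; ring.
have e2 : im_cart (wirtinger_bar chi) = fun p => 2^-1 * 'D_(1, 0) (im_cart chi) p + 2^-1 * 'D_(0, 1) (re_cart chi) p.
  apply/funext => -[x y]; rewrite {1}/im_cart /wirtinger_bar.
  set A := cderive _ _ _; set B := cderive _ _ _.
  rewrite (_ : 2^-1 = (2^-1 : R)%:C); last by rewrite rCV rCnat.
  by rewrite ImM ImD [complex.Im ('i%C * B)]ImM /=; ring.
have off q : ~ tsupport chi q -> chi (q.1 +i* q.2) = 0.
  move=> nq; apply/eqP; apply: contrapT => /negP h; apply: nq; exact: subset_closure.
have dr v q : ~ tsupport chi q -> 'D_v (re_cart chi) q = 0.
  by apply: (@iter_derive_off (re_cart chi) _ clK _ [:: v]) => p /off; rewrite /re_cart => ->.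
have di v q : ~ tsupport chi q -> 'D_v (im_cart chi) q = 0.
  by apply: (@iter_derive_off (im_cart chi) _ clK _ [:: v]) => p /off; rewrite /im_cart => ->.
have S0 : [set p | wirtinger_bar chi (p.1 +i* p.2) != 0] `<=` tsupport chi.
  move=> p /= hp; apply: contrapT => nK; move/eqP: hp; apply; apply: complexP.
    have := congr1 (fun f => f p) e1; rewrite {1}/re_cart /= => ->.
    by rewrite dr// di// !mulr0 addr0.
  have := congr1 (fun f => f p) e2; rewrite {1}/im_cart /= => ->.
  by rewrite dr// di// !mulr0 addr0.
have S : tsupport (wirtinger_bar chi) `<=` tsupport chi.
  move=> p /(closure_subset S0); by move/closure_id: clK => <-.
split.
- by rewrite e1; apply: smooth2_lin; exact: smooth2_der.
- by rewrite e2; apply: smooth2_lin; exact: smooth2_der.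
- by apply: subclosed_compact S => //; exact: closed_closure.
- by move=> /S.
Qed.

Lemma polar_dr chi r t : C1 (re_cart chi) -> C1 (im_cart chi) ->
  cder (fun r => chi (polar r t)) r
    ((cos t)%:C * cderive (1, 0) chi (polar r t) + (sin t)%:C * cderive (0, 1) chi (polar r t)).
Proof.
move=> h1 h2.
have d1 : is_derive r 1 (fun r => r * cos t) (cos t).
  by apply: (is_derive_eqd (is_deriveMf (is_derive_id r 1) (is_derive_cst (cos t) r 1))); rewrite /cst; ring.
have d2 : is_derive r 1 (fun r => r * sin t) (sin t).
  by apply: (is_derive_eqd (is_deriveMf (is_derive_id r 1) (is_derive_cst (sin t) r 1))); rewrite /cst; ring.
split.
- by apply: (is_derive_eqd (C1_chain h1 d1 d2)); rewrite ReD !ReM /=; ring.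
- by apply: (is_derive_eqd (C1_chain h2 d1 d2)); rewrite ImD !ImM /=; ring.
Qed.

Lemma polar_dt chi r t : C1 (re_cart chi) -> C1 (im_cart chi) ->
  cder (fun t => chi (polar r t)) t
    (r%:C * ((cos t)%:C * cderive (0, 1) chi (polar r t) - (sin t)%:C * cderive (1, 0) chi (polar r t))).
Proof.
move=> h1 h2.
have d1 : is_derive t 1 (fun t => r * cos t) (r * - sin t) by apply: is_deriveZf.
have d2 : is_derive t 1 (fun t => r * sin t) (r * cos t) by apply: is_deriveZf.
split.
- by apply: (is_derive_eqd (C1_chain h1 d1 d2)); rewrite ReM ReB !ReM /=; ring.
- by apply: (is_derive_eqd (C1_chain h2 d1 d2)); rewrite ImM ImB !ImM /=; ring.
Qed.
End PlaneCalculus.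

(** * Integration against test functions *)

Section PlaneIntegration.
Variable R : realType.
Local Notation leb := (@lebesgue_measure R).
Local Notation RT := (measurableTypeR R).
Local Notation circ := (`[0%R, (2 * pi)%R[%classic : set RT).
Local Notation Rpos := (`]0%R, +oo[%classic : set RT).
Local Notation dom := (@polar_dom R : set (RT * RT)).
Local Notation leb2 := (leb \x leb)%E.
Implicit Types (r t : R) (k m : int) (Q : R -> R -> R[i]) (V U : R -> R[i]) (chi : R[i] -> R[i]).

(** Rounding r down to a multiple of 1 / (N + 1) gives measurable functions that
    converge pointwise. *)
Lemma caratheodory_measurable (G : R -> R -> R) : (forall r, 0 <= r -> continuous (G r)) ->
  (forall t r, 0 < r -> {for r, continuous (G ^~ t)}) ->
  measurable_fun dom (fun p : RT * RT => G p.1 p.2).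
Proof.
move=> ct cr.
pose s (N : nat) r : R := (Num.truncn (N.+1%:R * r))%:R / N.+1%:R.
have N0 (N : nat) : 0 < N.+1%:R :> R by rewrite ltr0n.
apply: (@measurable_fun_cvg _ _ _ _ (fun N (p : RT * RT) => G (s N p.1) p.2)) => [N|p /domP[r0 _]].
  pose A (i : nat) : set (RT * RT) := (Rpos `&` `[i%:R / N.+1%:R, i.+1%:R / N.+1%:R[) `*` circ.
  have mA i : measurable (A i).
    by apply: measurableX; [apply: measurableI; exact: measurable_itv|exact: measurable_itv].
  have -> : dom = \bigcup_i A i.
    apply/seteqP; split => [p /domP[p0 p2]|p [i _ [[h1 h2] h3]]].
      have p0' := ltW p0.
      exists (Num.truncn (N.+1%:R * p.1)) => //; split; last by rewrite /= in_itv.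
      split; rewrite /= in_itv /= ?p0//.
      have /andP[h1 h2] := truncn_itv (mulr_ge0 (ltW (N0 N)) p0').
      by rewrite ler_pdivrMr// ltr_pdivlMr// [p.1 * _]mulrC h1 h2.
    by apply/domP; move: h1 h3; rewrite /= !in_itv /= andbT.
  apply/measurable_fun_bigcup => // i.
  apply: (@eq_measurable_fun _ _ _ _ _ (fun p : RT * RT => G (i%:R / N.+1%:R) p.2)).
    move=> p; rewrite inE => -[[h1 h2] _]; congr (G _ _); rewrite /s; congr (_%:R / _).
    have p0 : 0 <= p.1 by move: h1; rewrite /= in_itv /= andbT => /ltW.
    move: h2; rewrite /= in_itv /= ler_pdivrMr// ltr_pdivlMr// [p.1 * _]mulrC => h2.
    by apply/esym; apply: truncn_def.
  apply: measurable_funTS; apply: (measurableT_comp (continuous_measurable_fun (ct _ _))); last exact: measurable_snd.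
  by rewrite divr_ge0.
have sc : (fun N => s N p.1) @ \oo --> p.1.
  apply: (@squeeze_cvgr _ _ _ _ (fun N => p.1 - N.+1%:R^-1) (fun=> p.1)).
  - apply: nearW => N; have /andP[h1 h2] := truncn_itv (mulr_ge0 (ltW (N0 N)) (ltW r0)).
    rewrite /s ler_pdivrMr// [p.1 * _]mulrC h1 andbT ler_pdivlMr// mulrBl mulVf ?gt_eqF//.
    by rewrite lerBlDr natr1 mulrC ltW.
  - rewrite -[X in _ --> X]subr0; apply: cvgB; [exact: cvg_cst|exact: cvg_harmonic].
  - exact: cvg_cst.
exact: (continuous_cvg _ (cr p.2 p.1 r0) sc).
Qed.

(** The class of all integrands met in an integration by parts; it is stable under
    products with continuous radial functions and bounded angular ones. *)
Definition bsupp Q := cmeas dom (fun p : RT * RT => Q p.1 p.2) /\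
  exists a b C, [/\ 0 < a, 0 <= C &
    forall r t, 0 < r -> normc (Q r t) <= C * \1_(`[a, b]%classic) r].

Lemma bsupp_cint Q : bsupp Q -> cint leb2 dom (fun p : RT * RT => Q p.1 p.2).
Proof.
move=> [mQ [a [b [C [a0 C0 H]]]]].
have i := integrable_annulus b a0 C0.
by apply: (cint_le (@measurable_dom R) mQ _ i) => p /domP[p0 _]; exact: H.
Qed.

Lemma bsuppD Q Q' : bsupp Q -> bsupp Q' -> bsupp (fun r t => Q r t + Q' r t).
Proof.
move=> [mQ [a [b [C [a0 C0 H]]]]] [mQ' [a' [b' [C' [a'0 C'0 H']]]]]; split; first exact (cmeasD mQ mQ').
exists (Num.min a a'), (Num.max b b'), (C + C'); split; rewrite ?lt_min ?a0 ?addr_ge0// => r t r0.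
rewrite (le_trans (le_normcD _ _))// mulrDl lerD//.
- rewrite (le_trans (H r t r0))// ler_wpM2l// !indicE ler_nat; case: (boolP (r \in `[a, b]%classic)) => //.
  rewrite inE /= in_itv /= => /andP[h1 h2]; rewrite mem_set//= in_itv /=.
  by rewrite ge_min h1 le_max h2.
- rewrite (le_trans (H' r t r0))// ler_wpM2l// !indicE ler_nat; case: (boolP (r \in `[a', b']%classic)) => //.
  rewrite inE /= in_itv /= => /andP[h1 h2]; rewrite mem_set//= in_itv /=.
  by rewrite ge_min h1 le_max h2 !orbT.
Qed.

Lemma cmeas_rad V : (forall r, 0 < r -> ctends (nbhs r) V (V r)) -> cmeas dom (fun p : RT * RT => V p.1).
Proof.
move=> cV.
have q1 r : 0 < r -> {for r, continuous (fun r => complex.Re (V r))} by move=> /cV /ctends_Re.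
have q2 r : 0 < r -> {for r, continuous (fun r => complex.Im (V r))} by move=> /cV /ctends_Im.
have h1 := measurable_radial q1; have h2 := measurable_radial q2.
by split.
Qed.

Lemma bsupp_rad V Q : (forall r, 0 < r -> ctends (nbhs r) V (V r)) -> bsupp Q ->
  bsupp (fun r t => V r * Q r t).
Proof.
move=> cV [mQ [a [b [C [a0 C0 H]]]]]; split; first exact (cmeasM (cmeas_rad cV) mQ).
have [ab|ab] := leP a b; last first.
  exists a, b, C; split => // r t r0; rewrite normcM.
  have := H r t r0; rewrite !indicE memNset ?mulr0//= => [h|]; last first.
    by rewrite in_itv /= => /andP[h1 h2]; move: (le_trans h1 h2); rewrite leNgt ab.
  by have -> : normc (Q r t) = 0; [apply/eqP; rewrite eq_le h normc_ge0|rewrite mulr0].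
have cn r : 0 < r -> {for r, continuous (fun r => normc (V r))} by move=> /cV /ctends_normc.
have wc : {within `[a, b], continuous (fun r => normc (V r))}.
  apply: continuous_in_subspaceT => r; rewrite inE /= in_itv /= => /andP[h1 _].
  by apply: cn; exact: lt_le_trans h1.
have [c _ hc] := EVT_max ab wc.
exists a, b, (normc (V c) * C); split; rewrite ?mulr_ge0 ?normc_ge0// => r t r0.
rewrite normcM; have h := H r t r0; have n0 := normc_ge0 (Q r t).
case: (boolP (r \in `[a, b]%classic)) h => hr; rewrite indicE => h.
  have e1 : (r \in `[a, b]%classic)%:R = 1 :> R by rewrite hr.
  rewrite e1 mulr1 in h *; rewrite mulr1 ler_pM ?normc_ge0//.
  by apply: hc; move: hr; rewrite inE.
have e1 : (r \in `[a, b]%classic)%:R = 0 :> R by rewrite (negPf hr).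
rewrite e1 !mulr0 in h *.
by have -> : normc (Q r t) = 0; [apply/eqP; rewrite eq_le h n0|rewrite mulr0].
Qed.

Lemma bsuppZ (c : R[i]) Q : bsupp Q -> bsupp (fun r t => c * Q r t).
Proof. by apply: bsupp_rad => r _; exact: ctends_cst. Qed.

Lemma bsupp_ang (E : R -> R[i]) Q : continuous (fun t => complex.Re (E t)) ->
  continuous (fun t => complex.Im (E t)) -> (forall t, normc (E t) <= 1) -> bsupp Q ->
  bsupp (fun r t => E t * Q r t).
Proof.
move=> c1 c2 nE [mQ [a [b [C [a0 C0 H]]]]].
have mE : cmeas dom (fun p : RT * RT => E p.2).
  by have h1 := measurable_angular c1; have h2 := measurable_angular c2; split.
split; first exact (cmeasM mE mQ).
exists a, b, C; split => // r t r0; rewrite normcM (le_trans _ (H r t r0))//.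
by rewrite -[leRHS]mul1r ler_wpM2r// normc_ge0.
Qed.

Lemma cont_linear (c : R) : continuous (fun t : R => c * t).
Proof. by move=> t; apply: cvgM; [exact: cvg_cst|exact: cvg_id]. Qed.

Lemma bsupp_expi (c : R) Q : bsupp Q -> bsupp (fun r t => expi (c * t) * Q r t).
Proof.
apply: bsupp_ang => [||t]; last by rewrite normc_expi.
- rewrite /expi /polar /=; under eq_fun do rewrite mul1r.
  by move=> t; apply: continuous_comp; [exact: cont_linear|exact: continuous_cos].
- rewrite /expi /polar /=; under eq_fun do rewrite mul1r.
  by move=> t; apply: continuous_comp; [exact: cont_linear|exact: continuous_sin].
Qed.

Lemma bsupp_cos Q : bsupp Q -> bsupp (fun r t => (cos t)%:C * Q r t).
Proof.
apply: bsupp_ang => [||t]; [exact: continuous_cos|move=> t; exact: cvg_cst|].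
by rewrite normc_real ler_norml cos_geN1 cos_le1.
Qed.

Lemma bsupp_sin Q : bsupp Q -> bsupp (fun r t => (sin t)%:C * Q r t).
Proof.
apply: bsupp_ang => [||t]; [exact: continuous_sin|move=> t; exact: cvg_cst|].
by rewrite normc_real ler_norml sin_geN1 sin_le1.
Qed.

(** Compactness in the punctured plane keeps the support away from 0 and from
    infinity. *)
Lemma test_annulus chi : test_function chi -> exists a b, [/\ 0 < a, a < b &
  forall r t, 0 < r -> tsupport chi (r * cos t, r * sin t) -> a < r < b].
Proof.
move=> [_ _ cK K0].
have clK : closed (tsupport chi) by exact: closed_closure.
have [M [Mr hM]] := compact_bounded cK.
have oK : open (~` tsupport chi) by rewrite openC.
have := open_nbhs_nbhs (conj oK K0) => /nbhs_ballP[d /= d0 hd].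
have [B B0 hB] : exists2 B : R, 0 < B & forall p, tsupport chi p -> `|p| <= B.
  exists (`|M| + 1); first by rewrite ltr_wpDl.
  by move=> p Kp; apply: (hM (`|M| + 1)) => //; have := ler_norm M; lra.
exists (Num.min (d / 2) 1), (2 * B + 1).
have m1 : Num.min (d / 2) 1 <= 1 by rewrite ge_min lexx orbT.
split; [by rewrite lt_min divr_gt0 ?ltr01|by lra|].
move=> r t r0 Kp; apply/andP; split.
  rewrite gt_min; apply/orP; left; rewrite ltNge; apply/negP => rd.
  have rd' : r < d by lra.
  apply: (hd (r * cos t, r * sin t)) Kp; split; rewrite /ball /= sub0r normrN normrM (ger0_norm (ltW r0));
    apply: le_lt_trans rd'; rewrite -[leRHS]mulr1 ler_wpM2l ?(ltW r0)// ler_norml.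
  - by rewrite cos_geN1 cos_le1.
  - by rewrite sin_geN1 sin_le1.
have := hB _ Kp; rewrite prod_normE /= ge_max => /andP[].
move=> h1 h2.
have sq x : `|x| <= B -> x ^+ 2 <= B ^+ 2.
  by move=> xB; rewrite -(real_normK (num_real x)) ler_pXn2r ?nnegrE// ltW.
have e : r ^+ 2 <= (2 * B) ^+ 2.
  have -> : r ^+ 2 = (r * cos t) ^+ 2 + (r * sin t) ^+ 2 by rewrite !exprMn -mulrDr cos2Dsin2 mulr1.
  apply: (le_trans (lerD (sq _ h1) (sq _ h2))).
  have -> : (2 * B) ^+ 2 = 4 * B ^+ 2 by ring.
  have := sqr_ge0 B; lra.
have : r <= 2 * B by rewrite -(ler_pXn2r (n := 2)) ?nnegrE ?(ltW r0)// mulr_ge0// ltW.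
lra.
Qed.

Lemma bsupp_test chi (g1 g2 : R * R -> R) : test_function chi -> continuous g1 -> continuous g2 ->
  (forall p, ~ tsupport chi p -> g1 p = 0) -> (forall p, ~ tsupport chi p -> g2 p = 0) ->
  bsupp (fun r t => g1 (r * cos t, r * sin t) +i* g2 (r * cos t, r * sin t)).
Proof.
move=> tc c1 c2 z1 z2; have [a [b [a0 ab hab]]] := test_annulus tc; have [_ _ cK _] := tc.
have pc r : continuous (fun t : R => (r * cos t, r * sin t) : R * R).
  move=> t; have q1 : (fun t => r * cos t) @ t --> r * cos t by apply: cvgM; [exact: cvg_cst|exact: continuous_cos].
  have q2 : (fun t => r * sin t) @ t --> r * sin t by apply: cvgM; [exact: cvg_cst|exact: continuous_sin].
  exact (cvg_pair q1 q2).
have rc t : continuous (fun r : R => (r * cos t, r * sin t) : R * R).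
  move=> r; have q1 : (fun r => r * cos t) @ r --> r * cos t by apply: cvgM; [exact: cvg_id|exact: cvg_cst].
  have q2 : (fun r => r * sin t) @ r --> r * sin t by apply: cvgM; [exact: cvg_id|exact: cvg_cst].
  exact (cvg_pair q1 q2).
have mg (g : R * R -> R) : continuous g -> measurable_fun dom (fun p : RT * RT => g (p.1 * cos p.2, p.1 * sin p.2)).
  move=> cg; apply: (@caratheodory_measurable (fun r t => g (r * cos t, r * sin t))).
  - by move=> r _ t; apply: continuous_comp; [exact: pc|exact: cg].
  - by move=> t r _; apply: continuous_comp; [exact: (rc t)|exact: cg].
have bg (g : R * R -> R) : continuous g -> (forall p, ~ tsupport chi p -> g p = 0) ->
    exists2 C, 0 <= C & forall p, `|g p| <= C.
  move=> cg zg; have cI := continuous_compact (continuous_subspaceT cg) cK.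
  have [M [Mr hM]] := compact_bounded cI; exists (`|M| + 1); first by rewrite addr_ge0.
  move=> p; have [Kp|nK] := pselect (tsupport chi p); last by rewrite zg// normr0 addr_ge0.
  apply: (hM (`|M| + 1)); last by exists p.
  by have := ler_norm M; lra.
have [C1 C10 h1] := bg g1 c1 z1; have [C2 C20 h2] := bg g2 c2 z2.
have m1 := mg g1 c1; have m2 := mg g2 c2.
split; first by split.
exists a, b, (C1 + C2); split; rewrite ?addr_ge0// => r t r0.
have [Kp|nK] := pselect (tsupport chi (r * cos t, r * sin t)); last first.
  rewrite z1// z2// /normc expr0n addr0 sqrtr0 mulr_ge0 ?addr_ge0//.
have /andP[ra rb] := hab r t r0 Kp.
rewrite indicE mem_set ?mulr1; last by rewrite /= in_itv /= !ltW.
by rewrite (le_trans (normc_le_ReIm _))// lerD// ?h1 ?h2.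
Qed.

Lemma test_off chi p : test_function chi -> ~ tsupport chi p -> chi (p.1 +i* p.2) = 0.
Proof.
move=> _ nq; apply/eqP; apply: contrapT => /negP h; apply: nq; exact: subset_closure.
Qed.

Lemma bsupp_chi chi : test_function chi -> bsupp (fun r t => chi (polar r t)).
Proof.
move=> tc; have [s1 s2 _ _] := tc.
have := @bsupp_test chi (re_cart chi) (im_cart chi) tc (smooth2_cont (s := [::]) s1) (smooth2_cont (s := [::]) s2).
have -> : (fun r t => re_cart chi (r * cos t, r * sin t) +i* im_cart chi (r * cos t, r * sin t)) = (fun r t => chi (polar r t)).
  by apply/funext => r; apply/funext => t; apply: complexP.
by apply => p /(test_off tc); rewrite /re_cart /im_cart => ->.
Qed.

Lemma bsupp_cderive chi v : test_function chi -> bsupp (fun r t => cderive v chi (polar r t)).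
Proof.
move=> tc; have [s1 s2 _ _] := tc.
have clK : closed (tsupport chi) by exact: closed_closure.
apply: (@bsupp_test chi (iter_derive [:: v] (re_cart chi)) (iter_derive [:: v] (im_cart chi)) tc).
- exact: smooth2_cont.
- exact: smooth2_cont.
- by apply: (@iter_derive_off _ (re_cart chi) _ clK) => p /(test_off tc); rewrite /re_cart => ->.
- by apply: (@iter_derive_off _ (im_cart chi) _ clK) => p /(test_off tc); rewrite /im_cart => ->.
Qed.

Lemma ftc_segment (F F' : R -> R) (a b : R) : a < b -> (forall r, a <= r <= b -> is_derive r 1 F (F' r)) ->
  (forall r, a <= r <= b -> {for r, continuous F'}) ->
  (\int[leb]_(r in (`[a, b]%classic : set RT)) (F' r)%:E = (F b - F a)%:E)%E.
Proof.
move=> ab dF cF.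
have cont r : a <= r <= b -> {for r, continuous F}.
  by move=> /dF [h _]; apply: differentiable_continuous; apply/derivable1_diffP.
rewrite EFinB; apply: continuous_FTC2 => //.
- by apply: continuous_in_subspaceT => r; rewrite inE /= in_itv /= => /cF.
- split.
  + by move=> r; rewrite in_itv /= => /andP[h1 h2]; have [] := dF r; rewrite ?(ltW h1) ?(ltW h2).
  + by apply: cvg_at_right_filter; apply: cont; rewrite lexx ltW.
  + by apply: cvg_at_left_filter; apply: cont; rewrite lexx ltW.
- move=> r; rewrite in_itv /= => /andP[h1 h2]; rewrite derive1E.
  by have [] := dF r; rewrite ?(ltW h1) ?(ltW h2).
Qed.

Lemma ftc_radial (F F' : R -> R) (a b : R) : 0 < a -> a < b ->
  (forall r, 0 < r -> is_derive r 1 F (F' r)) -> (forall r, 0 < r -> {for r, continuous F'}) ->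
  F a = 0 -> F b = 0 -> (forall r, 0 < r -> ~ (a < r < b) -> F' r = 0) ->
  (\int[leb]_(r in Rpos) (F' r)%:E = 0)%E.
Proof.
move=> a0 ab dF cF Fa Fb F'0.
have <- : (\int[leb]_(r in (`[a, b]%classic : set RT)) (F' r)%:E = 0)%E.
  have d1 r : a <= r <= b -> is_derive r 1 F (F' r) by move=> /andP[h _]; apply: dF; exact: lt_le_trans h.
  have c1 r : a <= r <= b -> {for r, continuous F'} by move=> /andP[h _]; apply: cF; exact: lt_le_trans h.
  by rewrite (ftc_segment ab d1 c1) Fa Fb subrr.
rewrite integral_mkcond [RHS]integral_mkcond; apply: eq_integral => r _; rewrite !patchE.
case: ifPn => [/set_mem|/negP]; case: ifPn => [/set_mem|/negP]; rewrite ?inE /= ?in_itv /= ?andbT//.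
  move=> h r0; rewrite F'0// => /andP[h1 h2]; by apply: h; rewrite !ltW.
move=> /andP[h1 h2] h; exfalso; apply: h; exact: lt_le_trans h1.
Qed.

Lemma ftc_circle (F F' : R -> R) : (forall t, is_derive t 1 F (F' t)) -> continuous F' ->
  F 0 = F (2 * pi) -> (\int[leb]_(t in circ) (F' t)%:E = 0)%E.
Proof.
move=> dF cF F0; rewrite integral_itv_bndo_bndc.
  by rewrite (ftc_segment (@pi2_gt0 R)) ?F0 ?subrr// => r _; exact: cF.
by apply/measurable_EFinP; apply: measurable_funTS; exact: continuous_measurable_fun.
Qed.

(** Fundamental theorem of calculus along each ray, then Fubini. *)
Lemma int_radial_derivative Q (a b : R) : bsupp Q -> 0 < a -> a < b ->
  (forall t, exists H, [/\ forall r, 0 < r -> cder H r (Q r t), H a = 0 & H b = 0]) ->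
  (forall t r, 0 < r -> ctends (nbhs r) (Q^~ t) (Q r t)) ->
  (forall r t, 0 < r -> ~ (a < r < b) -> Q r t = 0) ->
  cintegral leb2 dom (fun p : RT * RT => Q p.1 p.2) = 0.
Proof.
move=> /bsupp_cint [i1 i2] a0 ab HH cQ Q0.
have e1 : Rintegral leb2 dom (fun p : RT * RT => complex.Re (Q p.1 p.2)) = 0.
  apply: fubini_r => // t _ /=; have [H [dH Ha Hb]] := HH t.
  apply: (@ftc_radial (fun r => complex.Re (H r)) (fun r => complex.Re (Q r t)) a b) => //.
  - by move=> r /dH [].
  - by move=> r /(cQ t) /ctends_Re.
  - by rewrite Ha.
  - by rewrite Hb.
  - by move=> r r0 h; rewrite Q0.
have e2 : Rintegral leb2 dom (fun p : RT * RT => complex.Im (Q p.1 p.2)) = 0.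
  apply: fubini_r => // t _ /=; have [H [dH Ha Hb]] := HH t.
  apply: (@ftc_radial (fun r => complex.Im (H r)) (fun r => complex.Im (Q r t)) a b) => //.
  - by move=> r /dH [].
  - by move=> r /(cQ t) /ctends_Im.
  - by rewrite Ha.
  - by rewrite Hb.
  - by move=> r r0 h; rewrite Q0.
by rewrite /cintegral e1 e2.
Qed.

(** The same along circles, on which primitives are periodic. *)
Lemma int_angular_derivative Q : bsupp Q ->
  (forall r, 0 < r -> exists H, (forall t, cder H t (Q r t)) /\ H 0 = H (2 * pi)) ->
  (forall r, 0 < r -> forall t, ctends (nbhs t) (Q r) (Q r t)) ->
  cintegral leb2 dom (fun p : RT * RT => Q p.1 p.2) = 0.
Proof.
move=> /bsupp_cint [i1 i2] HH cQ.
have e1 : Rintegral leb2 dom (fun p : RT * RT => complex.Re (Q p.1 p.2)) = 0.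
  apply: fubini_t => // r r0 /=; have [H [dH H0]] := HH r r0.
  apply: (@ftc_circle (fun t => complex.Re (H t)) (fun t => complex.Re (Q r t))) => //.
  - by move=> t; have [] := dH t.
  - by move=> t; have /ctends_Re := cQ r r0 t.
  - by rewrite H0.
have e2 : Rintegral leb2 dom (fun p : RT * RT => complex.Im (Q p.1 p.2)) = 0.
  apply: fubini_t => // r r0 /=; have [H [dH H0]] := HH r r0.
  apply: (@ftc_circle (fun t => complex.Im (H t)) (fun t => complex.Im (Q r t))) => //.
  - by move=> t; have [] := dH t.
  - by move=> t; have /ctends_Im := cQ r r0 t.
  - by rewrite H0.
by rewrite /cintegral e1 e2.
Qed.

Lemma expiD (x y : R) : expi (x + y) = expi x * expi y :> R[i].
Proof.
apply: complexP; rewrite /expi /polar ?ReM ?ImM /= !mul1r.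
- by rewrite cosD.
- by rewrite sinD; ring.
Qed.

Lemma expi0 : expi 0 = 1 :> R[i].
Proof. by rewrite /expi /polar cos0 sin0 mulr1 mulr0. Qed.

Lemma expi_2pi m : expi (m%:~R * (2 * pi)) = 1 :> R[i].
Proof.
have P (j : nat) : expi (j%:R * (2 * pi)) = 1 :> R[i].
  elim: j => [|j IH]; first by rewrite mul0r expi0.
  rewrite -natr1 mulrDl mul1r expiD IH mul1r /expi /polar (mulr_natl pi 2) cos2pi sin2pi.
  by rewrite mulr1 mulr0.
case: m => j; first exact: P.
rewrite NegzE mulrNz mulNr -[LHS]mulr1 -(P j.+1) -expiD addNr expi0//.
Qed.

Lemma cder_expi (c : R) t : cder (fun t => expi (c * t)) t ('i%C * c%:C * expi (c * t)).
Proof.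
have dl : is_derive t 1 (fun t => c * t) c.
  by apply: (is_derive_eqd (is_deriveZf c (is_derive_id t 1))); rewrite mulr1.
split; rewrite /expi /polar /=; under eq_fun do rewrite mul1r.
- apply: (is_derive_eqd (is_derive1_compE (is_derive_cos (c * t)) dl)).
  by rewrite /=; ring.
- apply: (is_derive_eqd (is_derive1_compE (is_derive_sin (c * t)) dl)).
  by rewrite /=; ring.
Qed.
End PlaneIntegration.

(** * Integration by parts in polar coordinates *)

Section Modes.
Variable R : realType.
Local Notation leb := (@lebesgue_measure R).
Local Notation RT := (measurableTypeR R).
Local Notation dom := (@polar_dom R : set (RT * RT)).
Local Notation leb2 := (leb \x leb)%E.
Implicit Types (r t : R) (k m : int) (V U : R -> R[i]) (chi : R[i] -> R[i]).

Definition dr_polar chi r t : R[i] :=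
  (cos t)%:C * cderive (1, 0) chi (polar r t) + (sin t)%:C * cderive (0, 1) chi (polar r t).
Definition dt_polar chi r t : R[i] :=
  r%:C * ((cos t)%:C * cderive (0, 1) chi (polar r t) - (sin t)%:C * cderive (1, 0) chi (polar r t)).

Lemma ctends_cos t : ctends (nbhs t) (fun t => (cos t)%:C : R[i]) (cos t)%:C.
Proof. by apply: ctends_realC; exact: continuous_cos. Qed.
Lemma ctends_sin t : ctends (nbhs t) (fun t => (sin t)%:C : R[i]) (sin t)%:C.
Proof. by apply: ctends_realC; exact: continuous_sin. Qed.
Lemma ctends_id r : ctends (nbhs r) (fun r => r%:C : R[i]) r%:C.
Proof. by apply: ctends_realC; exact: cvg_id. Qed.

Lemma test_C1 chi : test_function chi -> C1 (re_cart chi) /\ C1 (im_cart chi).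
Proof. by move=> [s1 s2 _ _]; split; [exact: (@smooth2_C1 _ _ [::] s1)|exact: (@smooth2_C1 _ _ [::] s2)]. Qed.

Lemma ctends_cderive_r chi v t r : test_function chi ->
  ctends (nbhs r) (fun r => cderive v chi (polar r t)) (cderive v chi (polar r t)).
Proof.
move=> tc; have [[_ c1] [_ c2]] := test_C1 tc.
have q : (fun r : R => (r * cos t, r * sin t) : R * R) @ r --> (r * cos t, r * sin t).
  have q1 : (fun r => r * cos t) @ r --> r * cos t by apply: cvgM; [exact: cvg_id|exact: cvg_cst].
  have q2 : (fun r => r * sin t) @ r --> r * sin t by apply: cvgM; [exact: cvg_id|exact: cvg_cst].
  exact (cvg_pair q1 q2).
by apply: ctends_ReIm; [exact: (continuous_cvg _ (c1 v _) q)|exact: (continuous_cvg _ (c2 v _) q)].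
Qed.

Lemma ctends_cderive_t chi v t r : test_function chi ->
  ctends (nbhs t) (fun t => cderive v chi (polar r t)) (cderive v chi (polar r t)).
Proof.
move=> tc; have [[_ c1] [_ c2]] := test_C1 tc.
have q : (fun t : R => (r * cos t, r * sin t) : R * R) @ t --> (r * cos t, r * sin t).
  have q1 : (fun t => r * cos t) @ t --> r * cos t by apply: cvgM; [exact: cvg_cst|exact: continuous_cos].
  have q2 : (fun t => r * sin t) @ t --> r * sin t by apply: cvgM; [exact: cvg_cst|exact: continuous_sin].
  exact (cvg_pair q1 q2).
by apply: ctends_ReIm; [exact: (continuous_cvg _ (c1 v _) q)|exact: (continuous_cvg _ (c2 v _) q)].
Qed.

Lemma bsupp_dr chi : test_function chi -> bsupp (dr_polar chi).
Proof. by move=> tc; apply: bsuppD; [apply: bsupp_cos|apply: bsupp_sin]; exact: bsupp_cderive. Qed.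

Lemma bsupp_dt chi : test_function chi -> bsupp (dt_polar chi).
Proof.
move=> tc; apply: bsupp_rad; first by move=> r _; exact: ctends_id.
have h := bsuppD (bsupp_cos (bsupp_cderive (0, 1) tc)) (bsuppZ (-1) (bsupp_sin (bsupp_cderive (1, 0) tc))).
rewrite (_ : (fun r t => _) = (fun r t => (cos t)%:C * cderive (0, 1) chi (polar r t) +
   -1 * ((sin t)%:C * cderive (1, 0) chi (polar r t))))//.
by apply/funext => r; apply/funext => t; rewrite mulN1r.
Qed.

Lemma test_vanish chi : test_function chi -> exists a b, [/\ 0 < a, a < b &
  forall r t, 0 < r -> ~ (a < r < b) -> chi (polar r t) = 0 /\ dr_polar chi r t = 0].
Proof.
move=> tc; have [a [b [a0 ab h]]] := test_annulus tc; exists a, b; split => // r t r0 hr.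
have nK : ~ tsupport chi (r * cos t, r * sin t) by move=> /(h r t r0).
have [s1 s2 _ _] := tc; have clK : closed (tsupport chi) by exact: closed_closure.
have z v : cderive v chi (polar r t) = 0.
  apply: complexP => /=.
  - by apply: (@iter_derive_off _ (re_cart chi) _ clK _ [:: v] _ nK) => p /(test_off tc); rewrite /re_cart => ->.
  - by apply: (@iter_derive_off _ (im_cart chi) _ clK _ [:: v] _ nK) => p /(test_off tc); rewrite /im_cart => ->.
by split; [exact: (test_off tc nK)|rewrite /dr_polar !z !mulr0 addr0].
Qed.

(** The r-part is the derivative of r V(r) exp(imt) chi along rays, the t-part a
    derivative along circles; both integrate to 0 over X'. With s = -1 and
    s = 1 the operator is, up to a rotation, twice r times one of the two
    Wirtinger operators. *)
Lemma polar_ibp chi V V' m (s : R[i]) : test_function chi ->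
  (forall r, 0 < r -> cder V r (V' r)) -> (forall r, 0 < r -> ctends (nbhs r) V' (V' r)) ->
  cintegral leb2 dom (fun p : RT * RT => V p.1 * (expi (m%:~R * p.2) *
     (p.1%:C * dr_polar chi p.1 p.2 + s * 'i%C * dt_polar chi p.1 p.2))) =
  cintegral leb2 dom (fun p : RT * RT => ((s * m%:~R - 1) * V p.1 - p.1%:C * V' p.1) *
     (expi (m%:~R * p.2) * chi (polar p.1 p.2))).
Proof.
move=> tc dV cV'; have [k1 k2] := test_C1 tc.
have cV r : 0 < r -> ctends (nbhs r) V (V r) by move=> /dV /cder_cont.
have bX := bsupp_chi tc; have bR := bsupp_dr tc; have bT := bsupp_dt tc.
have [a [b [a0 ab off]]] := test_vanish tc.
pose e t : R[i] := expi (m%:~R * t).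
pose QA r t := (V r + r%:C * V' r) * (e t * chi (polar r t)) + (r%:C * V r) * (e t * dr_polar chi r t).
pose QB r t := V r * (e t * (('i%C * m%:~R) * chi (polar r t) + dt_polar chi r t)).
pose QC r t := ((s * m%:~R - 1) * V r - r%:C * V' r) * (e t * chi (polar r t)).
have c1 r : 0 < r -> ctends (nbhs r) (fun r => V r + r%:C * V' r) (V r + r%:C * V' r).
  by move=> r0; apply: ctendsD; [exact: cV|apply: ctendsM; [exact: ctends_id|exact: cV']].
have c2 r : 0 < r -> ctends (nbhs r) (fun r => r%:C * V r) (r%:C * V r).
  by move=> r0; apply: ctendsM; [exact: ctends_id|exact: cV].
have c3 r : 0 < r -> ctends (nbhs r) (fun r => (s * m%:~R - 1) * V r - r%:C * V' r) ((s * m%:~R - 1) * V r - r%:C * V' r).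
  by move=> r0; apply: ctendsB; [apply: ctendsZ; exact: cV|apply: ctendsM; [exact: ctends_id|exact: cV']].
have bA : bsupp QA by apply: bsuppD; apply: bsupp_rad => //; exact: bsupp_expi.
have bB : bsupp QB by apply: bsupp_rad => //; apply: bsupp_expi; apply: bsuppD => //; exact: bsuppZ.
have bC : bsupp QC by apply: bsupp_rad => //; exact: bsupp_expi.
have A0 : cintegral leb2 dom (fun p : RT * RT => QA p.1 p.2) = 0.
  apply: (int_radial_derivative bA a0 ab).
  - move=> t; exists (fun r => r%:C * V r * (e t * chi (polar r t))); split.
    + move=> r r0.
      have d1 := cderM (cderM (cder_real (is_derive_id r 1)) (dV r r0)) (cderZ (e t) (polar_dr r t k1 k2)).
      by apply: (cder_eq d1); rewrite /QA /dr_polar mul1r.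
    + have na : ~ a < a < b by rewrite ltxx.
      by have [-> _] := off a t a0 na; rewrite !mulr0.
    + have nb : ~ a < b < b by rewrite ltxx andbF.
      by have [-> _] := off b t (lt_trans a0 ab) nb; rewrite !mulr0.
  - move=> t r r0; apply: ctendsD; apply: ctendsM; [exact: c1| |exact: c2|]; apply: ctendsZ.
      exact: cder_cont (polar_dr r t k1 k2).
    by apply: ctendsD; apply: ctendsZ; exact: ctends_cderive_r.
  - by move=> r t r0 /(off r t r0)[h1 h2]; rewrite /QA h1 h2 !mulr0 addr0.
have ce t : ctends (nbhs t) e (e t) by exact: cder_cont (cder_expi m%:~R t).
have B0 : cintegral leb2 dom (fun p : RT * RT => QB p.1 p.2) = 0.
  apply: (int_angular_derivative bB).
  - move=> r r0; exists (fun t => V r * (e t * chi (polar r t))); split.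
      move=> t; have d1 := cderZ (V r) (cderM (cder_expi m%:~R t) (polar_dt r t k1 k2)).
      apply: (cder_eq d1); rewrite /QB /dt_polar -/(e t).
      have -> : (m%:~R : R)%:C = m%:~R :> R[i].
        by rewrite -[LHS]/(real_complex R _) rmorph_int.
      ring.
    by rewrite /e mulr0 expi0 expi_2pi /polar cos0 sin0 (mulr_natl pi 2) cos2pi sin2pi.
  - move=> r r0 t; apply: ctendsZ; apply: ctendsM => //; apply: ctendsD.
      by apply: ctendsZ; exact: cder_cont (polar_dt r t k1 k2).
    by apply: ctendsZ; apply: ctendsB; apply: ctendsM;
      [exact: ctends_cos|exact: ctends_cderive_t|exact: ctends_sin|exact: ctends_cderive_t].
have iA := bsupp_cint bA; have iB := bsupp_cint bB; have iC := bsupp_cint bC.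
have mdom := @measurable_dom R.
have iAB := cint_lin mdom 1 (s * 'i%C) iA iB.
transitivity (cintegral leb2 dom (fun p : RT * RT => 1 * (1 * QA p.1 p.2 + s * 'i%C * QB p.1 p.2) + 1 * QC p.1 p.2)).
  apply: eq_cintegral => p _; rewrite /QA /QB /QC -/(e p.2).
  have ii : 'i%C * 'i%C = -1 :> R[i] by rewrite -expr2 sqr_i.
  have -> : s * 'i%C * (V p.1 * (e p.2 * ('i%C * m%:~R * chi (polar p.1 p.2) + dt_polar chi p.1 p.2))) =
    s * ('i%C * 'i%C) * m%:~R * V p.1 * e p.2 * chi (polar p.1 p.2) + s * 'i%C * V p.1 * e p.2 * dt_polar chi p.1 p.2.
    ring.
  rewrite ii; move: (dt_polar _ _ _) (dr_polar _ _ _) (e _) (chi _) (V p.1) (V' p.1) (p.1%:C) (m%:~R : R[i]) => T D E X v v' r mm.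
  ring.
rewrite (cintegral_lin mdom 1 1 iAB iC) (cintegral_lin mdom 1 (s * 'i%C) iA iB) A0 B0.
by rewrite !mulr0 addr0 mulr0 add0r mul1r.
Qed.

Lemma wirtinger_polar chi r t :
  r%:C * (2 * wirtinger chi (polar r t)) = expi (- t) * (r%:C * dr_polar chi r t + (-1) * 'i%C * dt_polar chi r t).
Proof.
rewrite /wirtinger /dr_polar /dt_polar.
have -> : expi (- t) = (cos t)%:C - 'i%C * (sin t)%:C :> R[i].
  by apply: complexP; rewrite /expi /polar cosN sinN ?ReB ?ImB ?ReM ?ImM /=; ring.
have h : (cos t)%:C * (cos t)%:C + (sin t)%:C * (sin t)%:C = 1 :> R[i].
  by rewrite -!rCM -rCD -!expr2 cos2Dsin2.
have ii : 'i%C * 'i%C = -1 :> R[i] by rewrite -expr2 sqr_i.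
move: (cderive (1, 0) chi _) (cderive (0, 1) chi _) ((cos t)%:C : R[i]) ((sin t)%:C : R[i]) (r%:C : R[i]) ('i%C : R[i]) h ii => A B c s rr I h ii.
transitivity (rr * ((c * c + s * s) * A - (c * c + s * s) * I * B)); first by rewrite h; field.
have ii2 : I * I + 1 = 0 by rewrite ii addNr.
transitivity (rr * ((c * c + s * s) * A - (c * c + s * s) * I * B) + (I * I + 1) * rr * s * (c * B - s * A)).
  by rewrite ii2; ring.
ring.
Qed.

Lemma wirtinger_bar_polar chi r t :
  r%:C * (2 * wirtinger_bar chi (polar r t)) = expi t * (r%:C * dr_polar chi r t + 1 * 'i%C * dt_polar chi r t).
Proof.
rewrite /wirtinger_bar /dr_polar /dt_polar.
have -> : expi t = (cos t)%:C + 'i%C * (sin t)%:C :> R[i].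
  by apply: complexP; rewrite /expi /polar ?ReD ?ImD ?ReM ?ImM /=; ring.
have h : (cos t)%:C * (cos t)%:C + (sin t)%:C * (sin t)%:C = 1 :> R[i].
  by rewrite -!rCM -rCD -!expr2 cos2Dsin2.
have ii : 'i%C * 'i%C = -1 :> R[i] by rewrite -expr2 sqr_i.
move: (cderive (1, 0) chi _) (cderive (0, 1) chi _) ((cos t)%:C : R[i]) ((sin t)%:C : R[i]) (r%:C : R[i]) ('i%C : R[i]) h ii => A B c s rr I h ii.
transitivity (rr * ((c * c + s * s) * A + (c * c + s * s) * I * B)); first by rewrite h; field.
have ii2 : I * I + 1 = 0 by rewrite ii addNr.
transitivity (rr * ((c * c + s * s) * A + (c * c + s * s) * I * B) + (I * I + 1) * rr * s * (c * B - s * A)).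
  by rewrite ii2; ring.
ring.
Qed.
End Modes.

(** * The distributional equation *)

Section FormalSolutions.
Variable R : realType.
Variables (n : nat) (lam : R[i]).
Hypothesis n0 : (0 < n)%N.
Local Notation leb := (@lebesgue_measure R).
Local Notation RT := (measurableTypeR R).
Local Notation dom := (@polar_dom R : set (RT * RT)).
Local Notation leb2 := (leb \x leb)%E.
Implicit Types (r t : R) (k m : int) (V U DU : R -> R[i]) (u v f g phi : R[i] -> R[i]).

Lemma normc_polar r t : 0 < r -> normc (polar r t) = r.
Proof.
by move=> r0; rewrite /normc /polar !exprMn -mulrDr cos2Dsin2 mulr1 sqrtr_sqr ger0_norm// ltW.
Qed.

(** The Laplacian times the area density is - 4 r times d/dx d/dxbar: the
    conformal factor drops out. *)
Lemma dens_coef r : 0 < r ->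
  area_density n r * ((1 + r ^+ (2 * n)) ^+ 2 / (n%:R ^+ 2 * r ^+ (2 * n - 2))) = 4 * r.
Proof.
move=> r0; rewrite /area_density.
have -> : r ^+ (2 * n - 1) = r * r ^+ (2 * n - 2).
  by rewrite -exprS; congr (_ ^+ _); clear -n0; lia.
have e0 : r ^+ (2 * n - 2) != 0 by rewrite gt_eqF// exprn_gt0.
have s0 : 1 + r ^+ (2 * n) != 0 by rewrite gt_eqF// onep_gt0.
have nn : n%:R != 0 :> R by rewrite pnatr_eq0 -lt0n.
move: (r ^+ (2 * n - 2)) (1 + r ^+ (2 * n)) (n%:R : R) e0 s0 nn => E S N e0 s0 nn.
by field; rewrite e0 s0 nn.
Qed.

Lemma bsupp_ext (Q Q' : R -> R -> R[i]) : (forall r t, 0 < r -> Q r t = Q' r t) -> bsupp Q -> bsupp Q'.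
Proof.
move=> E [mQ [a [b [C [a0 C0 H]]]]]; split.
  have E' (p : RT * RT) : dom p -> Q p.1 p.2 = Q' p.1 p.2 by move=> /domP[p0 _]; exact: E.
  exact (cmeas_eq E' mQ).
by exists a, b, C; split => // r t r0; rewrite -E ?H.
Qed.

Lemma bsupp_L2 u : bsupp (fun r t => u (polar r t)) -> in_L2 n u.
Proof.
move=> bu; have mdom := @measurable_dom R; apply/in_L2P; have [mu [a [b [C [a0 C0 H]]]]] := bu.
split => //.
have cd r : 0 < r -> ctends (nbhs r) (fun r => (area_density n r)%:C : R[i]) (area_density n r)%:C.
  by move=> r0; apply: ctends_realC; exact: continuous_dens.
have [_ [a' [b' [C' [a'0 C'0 H']]]]] := bsupp_rad cd bu.
apply: (le_integrable mdom _ _ (integrable_annulus b' a'0 (mulr_ge0 C'0 C0))).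
  apply/measurable_EFinP; apply: measurable_funM; last exact: cmeas_normc2.
  exact: measurable_radial (@continuous_dens R n).
move=> p hp /=; have /domP[p0 _] := hp; rewrite lee_fin (ger0_norm (dens2_ge0 _ _ hp)).
rewrite ger0_norm ?mulr_ge0//.
have := H' p.1 p.2 p0; have := H p.1 p.2 p0.
rewrite normcM normc_real (ger0_norm (dens_ge0 n (ltW p0))) /dens2.
set N := normc _; have N0 : 0 <= N by exact: normc_ge0.
move=> h1 h2; have h3 : N <= C.
  by rewrite (le_trans h1)// -[leRHS]mulr1 ler_wpM2l// indicE lern1 leq_b1.
rewrite expr2 mulrA [leRHS]mulrAC; apply: ler_pM => //.
by rewrite mulr_ge0// dens_ge0// ltW.
Qed.

Lemma laplacian_L2 phi : test_function phi -> in_L2 n (laplacian n phi).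
Proof.
move=> tc; have tw := test_wbar tc; apply: bsupp_L2.
pose coef r : R[i] := - ((1 + r ^+ (2 * n)) ^+ 2 / (n%:R ^+ 2 * r ^+ (2 * n - 2)))%:C.
pose W r t := 2^-1 * (cderive (1, 0) (wirtinger_bar phi) (polar r t) + (- 'i%C) * cderive (0, 1) (wirtinger_bar phi) (polar r t)).
have bW : bsupp W by apply: bsuppZ; apply: bsuppD; [|apply: bsuppZ]; exact: bsupp_cderive.
have cc r : 0 < r -> ctends (nbhs r) coef (coef r).
  move=> r0; apply: ctendsN; apply: ctends_realC; apply: cvgM.
    have c1 : {for r, continuous (fun x : R => 1 + x ^+ (2 * n))}.
      by apply: cvgD; [exact: cvg_cst|exact: exprn_continuous].
    by under eq_fun do rewrite expr2; rewrite expr2; exact: cvgM.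
  apply: cvgV; first by rewrite mulf_neq0// expf_neq0 ?pnatr_eq0 -?lt0n// gt_eqF.
  by apply: cvgM; [exact: cvg_cst|exact: exprn_continuous].
apply: bsupp_ext (bsupp_rad cc bW) => r t r0.
rewrite /laplacian normc_polar// /wirtinger /coef /W; congr (_ * (_ * (_ + _))).
by rewrite mulNr.
Qed.

Lemma test_L2 phi : test_function phi -> in_L2 n phi.
Proof. by move=> tc; apply: bsupp_L2; exact: bsupp_chi. Qed.

Lemma dist_laplacian_lin u v f g (a b : R[i]) : in_L2 n u -> in_L2 n v -> in_L2 n f -> in_L2 n g ->
  dist_laplacian n u f -> dist_laplacian n v g ->
  dist_laplacian n (fun z => a * u z + b * v z) (fun z => a * f z + b * g z).
Proof.
move=> hu hv hf hg du dv phi tc; have hp := test_L2 tc; have hl := laplacian_L2 tc.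
have E w w' h : in_L2 n w -> in_L2 n w' -> in_L2 n h ->
    integral_dA n (fun z => (a * w z + b * w' z) * h z) =
    a * integral_dA n (fun z => w z * h z) + b * integral_dA n (fun z => w' z * h z).
  move=> hw hw' hh; have i1 := L2_mul_cint hw hh; have i2 := L2_mul_cint hw' hh.
  rewrite /integral_dA -(cintegral_lin (@measurable_dom R) a b i1 i2).
  by apply: eq_cintegral => p _; ring.
by rewrite !E// du// dv.
Qed.

Lemma in_L2_zero : in_L2 n (fun=> 0 : R[i]).
Proof.
apply: bsupp_L2; split; first exact: cmeas_cst.
by exists 1, 1, 0; split => // r t _; rewrite normc0 mul0r.
Qed.

Lemma dist_laplacian_zero : dist_laplacian n (fun=> 0 : R[i]) (fun z => lam * 0).
Proof.
by move=> phi tc; congr (cintegral _ _ _); apply/funext => p; rewrite mulr0 !mul0r.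
Qed.

(** The Laplacian is a product of the two Wirtinger operators. Two integrations by
    parts move them onto U (r) exp (i k t): the first produces (k U + r U') / r
    in mode k - 1, the second the radial equation. *)
Lemma mode_dist u U DU k : (forall r t, 0 < r -> u (polar r t) = U r * expi (k%:~R * t)) ->
  radial_sol n lam `|k|%N U DU -> dist_laplacian n u (fun z => lam * u z).
Proof.
move=> uE sol phi tc; have tw := test_wbar tc.
pose E r : R[i] := `|k|%N%:R ^+ 2 * U r - lam * (r * area_density n r)%:C * U r.
have dU r : 0 < r -> cder U r (DU r / r%:C) by move=> /sol[].
have dDU r : 0 < r -> cder DU r (E r / r%:C) by move=> /sol[].
have rC r : 0 < r -> r%:C != 0 :> R[i] by move=> r0; rewrite rC_eq0 gt_eqF.
have cU r : 0 < r -> ctends (nbhs r) U (U r) by move=> /dU /cder_cont.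
have cDU r : 0 < r -> ctends (nbhs r) DU (DU r) by move=> /dDU /cder_cont.
have cI r : 0 < r -> ctends (nbhs r) (fun r => (r%:C)^-1 : R[i]) (r%:C)^-1.
  by move=> r0; apply: ctendsV; [exact: rC|exact: ctends_id].
have cE r : 0 < r -> ctends (nbhs r) E (E r).
  move=> r0; apply: ctendsB; first by apply: ctendsZ; exact: cU.
  apply: ctendsM; last exact: cU.
  apply: ctendsZ; apply: ctends_realC; apply: cvgM; [exact: cvg_id|exact: continuous_dens].
pose V1 r := (-2) * U r; pose V1' r := (-2) * (DU r / r%:C).
have dV1 r : 0 < r -> cder V1 r (V1' r) by move=> r0; apply: cderZ; exact: dU.
have cV1 r : 0 < r -> ctends (nbhs r) V1' (V1' r).
  by move=> r0; apply: ctendsZ; apply: ctendsM; [exact: cDU|exact: cI].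
pose V2 r := (k%:~R * U r + DU r) / r%:C.
pose V2' r := (k%:~R * (DU r / r%:C) + E r / r%:C) / r%:C + (k%:~R * U r + DU r) * - ((r%:C)^-1 * (r%:C)^-1).
have dV2 r : 0 < r -> cder V2 r (V2' r).
  move=> r0; have h := cderM (cderD (cderZ k%:~R (dU r r0)) (dDU r r0)) (cder_real (is_derive_inv r0)).
  have {}h : cder (fun r => (k%:~R * U r + DU r) * (r^-1)%:C) r (V2' r).
    by apply: (cder_eq h); rewrite rCN !rCV rCX /V2' expr2 invfM.
  by rewrite /V2; under eq_fun do rewrite -rCV; exact: h.
have cV2 r : 0 < r -> ctends (nbhs r) V2' (V2' r).
  move=> r0; have i1 := cI r r0; have u1 := cU r r0; have d1 := cDU r r0; have e1 := cE r r0.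
  apply: ctendsD.
    by apply: ctendsM => //; apply: ctendsD; [apply: ctendsZ|]; apply: ctendsM.
  apply: ctendsM; first by apply: ctendsD => //; exact: ctendsZ.
  by apply: ctendsN; apply: ctendsM.
have step1 := polar_ibp (k - 1) (-1) tw dV1 cV1.
have step2 := polar_ibp k 1 tc dV2 cV2.
have mI (m : int) : (m%:~R : R)%:C = m%:~R :> R[i] by rewrite -[LHS]/(real_complex R _) rmorph_int.
have kE t : expi (k%:~R * t) = expi ((k - 1)%:~R * t) * expi t :> R[i].
  by rewrite -expiD; congr expi; rewrite intrB mulrBl mul1r subrK.
have kk : `|k|%N%:R ^+ 2 = k%:~R ^+ 2 :> R[i].
  have : (`|k|%N%:R : R) ^+ 2 = k%:~R ^+ 2 by rewrite natr_absz intr_norm real_normK ?num_real.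
  by move=> /(congr1 (real_complex R)); rewrite !rmorphXn /= rmorph_int rmorph_nat.
transitivity (cintegral leb2 dom (fun p : RT * RT => V1 p.1 * (expi ((k - 1)%:~R * p.2) *
     (p.1%:C * dr_polar (wirtinger_bar phi) p.1 p.2 + (-1) * 'i%C * dt_polar (wirtinger_bar phi) p.1 p.2)))).
  apply: eq_cintegral => p /domP[p0 _].
  rewrite uE// /laplacian normc_polar// kE.
  have e1 : expi p.2 * expi (- p.2) = 1 :> R[i] by rewrite -expiD subrr expi0.
  have := wirtinger_polar (wirtinger_bar phi) p.1 p.2.
  move: (wirtinger _ _) (_ + _ * dt_polar _ _ _) => w X hX.
  have dc : (area_density n p.1)%:C * ((1 + p.1 ^+ (2 * n)) ^+ 2 / (n%:R ^+ 2 * p.1 ^+ (2 * n - 2)))%:C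
     = 4 * p.1%:C :> R[i] by rewrite -[LHS]rCM dens_coef// rCM rCnat.
  move: dc; move: (area_density n p.1)%:C ((1 + p.1 ^+ (2 * n)) ^+ 2 / (n%:R ^+ 2 * p.1 ^+ (2 * n - 2)))%:C => d c dc.
  transitivity (- (d * c) * U p.1 * (expi ((k - 1)%:~R * p.2) * expi p.2) * w); first by ring.
  rewrite dc; transitivity ((-2) * U p.1 * expi ((k - 1)%:~R * p.2) * expi p.2 * (p.1%:C * (2 * w))); first by ring.
  rewrite hX; transitivity ((-2) * U p.1 * expi ((k - 1)%:~R * p.2) * (expi p.2 * expi (- p.2)) * X); first by ring.
  by rewrite e1 mulr1 /V1 !mulrA.
rewrite step1.
transitivity (cintegral leb2 dom (fun p : RT * RT => V2 p.1 * (expi (k%:~R * p.2) *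
     (p.1%:C * dr_polar phi p.1 p.2 + 1 * 'i%C * dt_polar phi p.1 p.2)))).
  apply: eq_cintegral => p /domP[p0 _].
  rewrite kE; have := wirtinger_bar_polar phi p.1 p.2.
  move: (_ + _ * dt_polar _ _ _) => X hX.
  transitivity (V2 p.1 * expi ((k - 1)%:~R * p.2) * (expi p.2 * X)); last by ring.
  rewrite -hX /V2 /V1 /V1' intrB; have := rC _ p0.
  move: (wirtinger_bar _ _) (p.1%:C : R[i]) (expi _ : R[i]) (k%:~R : R[i]) (U _) (DU _) => w rr e kk' x y r1.
  by field.
rewrite step2; apply: eq_cintegral => p /domP[p0 _].
rewrite uE// /V2 /V2' /E kk rCM; have := rC _ p0.
move: (phi _) (p.1%:C : R[i]) (expi _ : R[i]) (k%:~R : R[i]) (U _) (DU _) ((area_density _ _)%:C) => w rr e kk' x y d r1.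
by field.
Qed.
End FormalSolutions.

(** * Separated solutions *)

Section SeparatedSolutions.
Variable R : realType.
Variables (n : nat) (lam : R[i]).
Hypothesis n0 : (0 < n)%N.
Local Notation leb := (@lebesgue_measure R).
Local Notation RT := (measurableTypeR R).
Local Notation dom := (@polar_dom R : set (RT * RT)).
Local Notation leb2 := (leb \x leb)%E.
Local Notation circ := (`[0%R, (2 * pi)%R]%classic : set RT).
Implicit Types (r t : R) (k j m : int) (s : seq int) (a b : int -> R[i]) (u : R[i] -> R[i]).
Local Arguments normc : simpl never.

Lemma expi_int k t : expi t ^ k = expi (k%:~R * t) :> R[i].
Proof.
have P (i : nat) : expi t ^+ i = expi (i%:R * t) :> R[i].
  elim: i => [|i IH]; first by rewrite expr0 mul0r expi0.
  by rewrite exprS IH -natr1 mulrDl mul1r addrC expiD.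
case: k => i; first exact: P.
rewrite /exprz P NegzE mulrNz mulNr; apply: (mulfI (_ : expi (i.+1%:R * t) != 0)).
  apply/eqP => /(congr1 (@normc R)); rewrite normc_expi normc0 => /eqP; by rewrite oner_eq0.
rewrite divff; last first.
  apply/eqP => /(congr1 (@normc R)); rewrite normc_expi normc0 => /eqP; by rewrite oner_eq0.
by rewrite -expiD subrr expi0.
Qed.

(** exp (i t) at z = r exp (i t), so that integer powers give the angular modes
    without choosing an argument. *)
Definition phase (z : R[i]) : R[i] := z / (normc z)%:C.

Lemma phase_polar r t : 0 < r -> phase (polar r t) = expi t.
Proof.
move=> r0; rewrite /phase normc_polar//.
have -> : polar r t = r%:C * expi t.
  by apply: complexP; rewrite /expi /polar ?ReM ?ImM /=; ring.
by rewrite mulrAC divff ?mul1r// rC_eq0 gt_eqF.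
Qed.

(** A general solution of the radial equation in mode k, in the basis Y(r),
    Y(1/r). *)
Definition amp k (x y : R[i]) r : R[i] := x * ysol n lam `|k|%N r + y * ysol n lam `|k|%N r^-1.
Definition amp' k (x y : R[i]) r : R[i] := x * ysol' n lam `|k|%N r + y * - ysol' n lam `|k|%N r^-1.

Lemma amp_sol k x y : radial_sol n lam `|k|%N (amp k x y) (amp' k x y).
Proof. have h := ysol_sol lam n0 `|k|%N; exact (radial_sol_lin x y h (radial_sol_inv n0 h)). Qed.

(** Finite superposition of separated solutions; it exhibits all boundary data
    of formal solutions. *)
Definition sol s a b (z : R[i]) : R[i] :=
  \sum_(k <- s) amp k (a k) (b k) (normc z) * phase z ^ k.

Lemma sol_polar s a b r t : 0 < r ->
  sol s a b (polar r t) = \sum_(k <- s) amp k (a k) (b k) r * expi (k%:~R * t).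
Proof.
by move=> r0; apply: eq_bigr => k _; rewrite normc_polar// phase_polar// expi_int.
Qed.

Lemma sol_y_polar s a b r t : 0 < r ->
  y_polar (sol s a b) r t = \sum_(k <- s) amp k (a k) (b k) r^-1 * expi ((- k)%:~R * t).
Proof.
move=> r0; rewrite y_polarE// /x_polar sol_polar ?invr_gt0//; apply: eq_bigr => k _; congr (_ * _).
by rewrite /refl mulrBr expiD expi_2pi mul1r mulrNz mulNr.
Qed.

Lemma amp_cont k x y r : 0 < r -> ctends (nbhs r) (amp k x y) (amp k x y r).
Proof. by move=> r0; have [h _] := amp_sol k x y r0; exact: cder_cont h. Qed.

Lemma amp_L2 k x y : (`|k| < n)%N -> exists2 C, 0 <= C & forall r, 0 < r ->
  area_density n r * normc (amp k x y r) ^+ 2 <= C / (1 + r ^+ 2).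
Proof.
move=> kn; have [C1 h1] := ysol_L2 lam n0; have [C2 h2] := ysol_inv_L2 lam n0.
have [X1 E1] : exists X, X = 2 * normc x ^+ 2 by exists (2 * normc x ^+ 2).
have [X2 E2] : exists X, X = 2 * normc y ^+ 2 by exists (2 * normc y ^+ 2).
have x0 : 0 <= X1 by rewrite E1 mulr_ge0// sqr_ge0.
have y0 : 0 <= X2 by rewrite E2 mulr_ge0// sqr_ge0.
exists (X1 * `|C1| + X2 * `|C2|); first by apply: addr_ge0; apply: mulr_ge0.
move=> r r0; have r2 : 0 < 1 + r ^+ 2 by rewrite ltr_pwDl// sqr_ge0.
have {}h1 := h1 _ r kn r0; have {}h2 := h2 _ r kn r0; have D0 := dens_ge0 n (ltW r0).
have e1 : C1 / (1 + r ^+ 2) <= `|C1| / (1 + r ^+ 2) by rewrite ler_pM2r ?invr_gt0// ler_norm.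
have e2 : C2 / (1 + r ^+ 2) <= `|C2| / (1 + r ^+ 2) by rewrite ler_pM2r ?invr_gt0// ler_norm.
rewrite /amp; move: (ysol _ _ _ r) (ysol _ _ _ r^-1) h1 h2 => Y Z h1 h2.
have q : normc (x * Y + y * Z) ^+ 2 <= X1 * normc Y ^+ 2 + X2 * normc Z ^+ 2.
  have q1 : normc (x * Y + y * Z) <= normc x * normc Y + normc y * normc Z.
    by rewrite (le_trans (le_normcD _ _))// !normcM.
  have q2 : normc (x * Y + y * Z) ^+ 2 <= (normc x * normc Y + normc y * normc Z) ^+ 2.
    by rewrite ler_pXn2r ?nnegrE ?normc_ge0// addr_ge0// mulr_ge0// normc_ge0.
  rewrite E1 E2 (le_trans q2)//; have := sqr_ge0 (normc x * normc Y - normc y * normc Z).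
  by move: (normc x) (normc Y) (normc y) (normc Z) => *; lra.
have q1 := ler_wpM2l x0 (le_trans h1 e1); have q2 := ler_wpM2l y0 (le_trans h2 e2).
have q3 := ler_wpM2l D0 q.
rewrite (le_trans q3)// mulrDl.
move: (area_density n r) (normc Y ^+ 2) (normc Z ^+ 2) q1 q2 => D YY ZZ q1 q2.
have -> : D * (X1 * YY + X2 * ZZ) = X1 * (D * YY) + X2 * (D * ZZ) by ring.
by rewrite -!mulrA lerD.
Qed.

Lemma mode_L2 u (U : R -> R[i]) k C : (forall r t, 0 < r -> u (polar r t) = U r * expi (k%:~R * t)) ->
  (forall r, 0 < r -> ctends (nbhs r) U (U r)) -> 0 <= C ->
  (forall r, 0 < r -> area_density n r * normc (U r) ^+ 2 <= C / (1 + r ^+ 2)) -> in_L2 n u.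
Proof.
move=> uE cU C0 H; have mdom := @measurable_dom R; apply/in_L2P.
have mu : cmeas dom (fun p : RT * RT => u (polar p.1 p.2)).
  have mE : cmeas dom (fun p : RT * RT => expi (k%:~R * p.2) : R[i]).
    have c1 : continuous (fun t : R => complex.Re (expi (k%:~R * t))).
      rewrite /expi /polar /=; under eq_fun do rewrite mul1r.
      by move=> t; apply: continuous_comp; [exact: cont_linear|exact: continuous_cos].
    have c2 : continuous (fun t : R => complex.Im (expi (k%:~R * t))).
      rewrite /expi /polar /=; under eq_fun do rewrite mul1r.
      by move=> t; apply: continuous_comp; [exact: cont_linear|exact: continuous_sin].
    by have h1 := measurable_angular c1; have h2 := measurable_angular c2; split.
  have h := cmeasM (cmeas_rad cU) mE.
  have E (p : RT * RT) : dom p -> U p.1 * expi (k%:~R * p.2) = u (polar p.1 p.2) by move=> /domP[p0 _]; rewrite uE.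
  exact (cmeas_eq E h).
split => //; apply: (le_integrable mdom _ _ (integrable_oneDsqr C0)).
  apply/measurable_EFinP; apply: measurable_funM; last exact: cmeas_normc2.
  exact: measurable_radial (@continuous_dens R n).
move=> p hp /=; have /domP[p0 _] := hp; rewrite lee_fin (ger0_norm (dens2_ge0 _ _ hp)).
rewrite ger0_norm; last by rewrite divr_ge0// addr_ge0// sqr_ge0.
by rewrite /dens2 uE// normcM normc_expi mulr1 H.
Qed.

Lemma sol_formal s a b : all (fun k => (`|k| < n)%N) s -> in_L2 n (sol s a b) /\
  dist_laplacian n (sol s a b) (fun z => lam * sol s a b z).
Proof.
elim: s => [_|k s IH /= /andP[kn ks]].
  have -> : sol [::] a b = fun=> 0 by apply/funext => z; rewrite /sol big_nil.
  by split; [exact: in_L2_zero|exact: dist_laplacian_zero].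
have [hs ds] := IH ks.
pose u1 z := amp k (a k) (b k) (normc z) * phase z ^ k.
have u1E r t : 0 < r -> u1 (polar r t) = amp k (a k) (b k) r * expi (k%:~R * t).
  by move=> r0; rewrite /u1 normc_polar// phase_polar// expi_int.
have [C C0 hC] := amp_L2 (a k) (b k) kn.
have h1 : in_L2 n u1 := mode_L2 u1E (@amp_cont k (a k) (b k)) C0 hC.
have d1 : dist_laplacian n u1 (fun z => lam * u1 z) := mode_dist n0 u1E (@amp_sol k (a k) (b k)).
have E : sol (k :: s) a b = fun z => 1 * u1 z + 1 * sol s a b z.
  by apply/funext => z; rewrite /sol big_cons !mul1r.
have lin g : in_L2 n g -> in_L2 n (fun z => lam * g z).
  move=> hg; have := in_L2_lin lam 0 hg hg; congr in_L2; apply/funext => z; by rewrite mul0r addr0.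
rewrite E; split; first exact: in_L2_lin.
have := dist_laplacian_lin n0 1 1 h1 hs (lin _ h1) (lin _ hs) d1 ds.
by under [X in dist_laplacian n _ X -> _]eq_fun do rewrite mulrCA [1 * (lam * _)]mulrCA -mulrDr.
Qed.

Lemma cint_expi1 j : cint leb circ (fun t : RT => expi (j%:~R * t) : R[i]).
Proof.
split; apply: continuous_compact_integrable => //; try exact: segment_compact;
  apply: continuous_subspaceT; rewrite /expi /polar /=; under eq_fun do rewrite mul1r.
- by move=> t; apply: continuous_comp; [exact: cont_linear|exact: continuous_cos].
- by move=> t; apply: continuous_comp; [exact: cont_linear|exact: continuous_sin].
Qed.

Lemma cder_ctsT (f f' : R -> R[i]) : (forall t, cder f t (f' t)) -> forall t, ctends (nbhs t) f (f t).
Proof. by move=> H t; exact: cder_cont (H t). Qed.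

Lemma circle_coef_expi j k : circle_coef (fun t : RT => expi (j%:~R * t) : R[i]) k = (j == k)%:R.
Proof.
have p2 := @pi2_gt0 R.
have E t : expi (j%:~R * t) * expi (- (k%:~R * t)) = expi ((j - k)%:~R * t) :> R[i].
  by rewrite -expiD intrB mulrBl.
have -> : circle_coef (fun t : RT => expi (j%:~R * t) : R[i]) k = ((2 * pi)^-1)%:C * cintegral leb circ (fun t : RT => expi ((j - k)%:~R * t) : R[i]).
  by congr (_ * _); apply: eq_cintegral => t _; exact: E.
have [->|jk] := eqVneq j k.
  have -> : cintegral leb circ (fun t : RT => expi ((k - k)%:~R * t) : R[i]) = cintegral leb circ (fun _ : RT => 1 : R[i]).
    by apply: eq_cintegral => t _; rewrite subrr mul0r expi0.
  rewrite /cintegral /= !Rintegral_cst//= mul0r mul1r.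
  rewrite lebesgue_measure_itv /= lte_fin p2 -EFinB subr0 /=.
  by rewrite -[X in _ * X]/((2 * pi)%:C) -rCM mulVf ?gt_eqF.
set c := (j - k)%:~R : R.
have c0 : c != 0 by rewrite intr_eq0 subr_eq0.
have ic0 : 'i%C * c%:C != 0 :> R[i].
  rewrite mulf_neq0// ?rC_eq0//; apply/eqP => /(congr1 (fun z : R[i] => complex.Im z)) /= /eqP.
  by rewrite oner_eq0.
pose h t : R[i] := ('i%C * c%:C)^-1 * expi (c * t).
have dh t : cder h t (expi (c * t)).
  by apply: (cder_eq (cderZ ('i%C * c%:C)^-1 (cder_expi c t))); rewrite mulKf.
have ce := cder_ctsT (cder_expi c).
have h2 : h (2 * pi) = h 0 by rewrite /h /c expi_2pi mulr0 expi0.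
have e1 : Rintegral leb circ (fun t => complex.Re (expi (c * t))) = 0.
  have -> : Rintegral leb circ (fun t => complex.Re (expi (c * t))) = complex.Re (h (2 * pi)) - complex.Re (h 0).
    have FT := @ftc_segment R (fun t => complex.Re (h t)) (fun t => complex.Re (expi (c * t))) 0 (2 * pi) p2; rewrite /Rintegral; apply: (etrans (congr1 fine (FT _ _))) => //.
    - by move=> t _; have [] := dh t.
    - by move=> t _; have /ctends_Re := ce t.
  by rewrite h2 subrr.
have e2 : Rintegral leb circ (fun t => complex.Im (expi (c * t))) = 0.
  have -> : Rintegral leb circ (fun t => complex.Im (expi (c * t))) = complex.Im (h (2 * pi)) - complex.Im (h 0).
    have FT := @ftc_segment R (fun t => complex.Im (h t)) (fun t => complex.Im (expi (c * t))) 0 (2 * pi) p2; rewrite /Rintegral; apply: (etrans (congr1 fine (FT _ _))) => //.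
    - by move=> t _; have [] := dh t.
    - by move=> t _; have /ctends_Im := ce t.
  by rewrite h2 subrr.
by rewrite /cintegral e1 e2 mulr0.
Qed.

(** Orthogonality of the exponentials. *)
Lemma circle_coef_trig s (c : int -> R[i]) (e : int -> int) k :
  circle_coef (fun t : RT => \sum_(j <- s) c j * expi ((e j)%:~R * t)) k = \sum_(j <- s) c j * (e j == k)%:R.
Proof.
have mC : measurable circ by exact: measurable_itv.
suff [] : cint leb circ (fun t : RT => \sum_(j <- s) c j * expi ((e j)%:~R * t)) /\
   circle_coef (fun t : RT => \sum_(j <- s) c j * expi ((e j)%:~R * t)) k = \sum_(j <- s) c j * (e j == k)%:R by [].
elim: s => [|j s [IH1 IH2]].
  have E : (fun t : RT => \sum_(j <- [::]) c j * expi ((e j)%:~R * t)) = (fun t : RT => 0 * expi (0%:~R * t) + 0 * expi (0%:~R * t)).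
    by apply/funext => t; rewrite big_nil !mul0r addr0.
  rewrite E big_nil; split; first by apply: cint_lin => //; exact: cint_expi1.
  by rewrite circle_coef_lin ?mul0r ?addr0//; exact: cint_expi1.
have E : (fun t : RT => \sum_(i <- j :: s) c i * expi ((e i)%:~R * t)) =
    (fun t : RT => c j * expi ((e j)%:~R * t) + 1 * \sum_(i <- s) c i * expi ((e i)%:~R * t)).
  by apply/funext => t; rewrite big_cons mul1r.
rewrite E big_cons; split; first by apply: cint_lin => //; exact: cint_expi1.
by rewrite circle_coef_lin ?mul1r ?IH2 ?circle_coef_expi//; exact: cint_expi1.
Qed.

Lemma sum_delta s (c : int -> R[i]) (e : int -> int) k : uniq s -> (forall j, (e j == k) = (j == e k)) ->
  \sum_(j <- s) c j * (e j == k)%:R = if e k \in s then c (e k) else 0.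
Proof.
move=> us he; case: ifPn => ks.
  rewrite (bigD1_seq (e k))//= he eqxx mulr1 big1 ?addr0// => j jk.
  by rewrite he (negPf jk) mulr0.
rewrite big1_seq// => j /= js; rewrite he.
have [jk|jk] := eqVneq j (e k); last by rewrite mulr0.
by move: js; rewrite jk (negPf ks).
Qed.

Lemma sol_fourier s a b k r : uniq s -> 0 < r ->
  fourier (x_polar (sol s a b)) k r = if k \in s then amp k (a k) (b k) r else 0.
Proof.
move=> us r0; rewrite fourierE.
rewrite (circle_coef_eq (g := fun t : RT => \sum_(j <- s) amp j (a j) (b j) r * expi ((idfun j)%:~R * t))).
  by rewrite circle_coef_trig (sum_delta _ us).
by move=> t; exact: sol_polar.
Qed.

Lemma sol_y_fourier s a b k r : uniq s -> 0 < r ->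
  fourier (y_polar (sol s a b)) k r = if - k \in s then amp (- k) (a (- k)) (b (- k)) r^-1 else 0.
Proof.
move=> us r0; rewrite fourierE.
rewrite (circle_coef_eq (g := fun t : RT => \sum_(j <- s) amp j (a j) (b j) r^-1 * expi ((- j)%:~R * t))).
  by rewrite (circle_coef_trig s (fun j => amp j (a j) (b j) r^-1) (@GRing.opp int)) sum_delta// => j; rewrite eqr_oppLR.
by move=> t; exact: sol_y_polar.
Qed.
End SeparatedSolutions.

(** * Boundary expansions *)

Section Expansions.
Variable R : realType.
Local Notation leb := (@lebesgue_measure R).
Local Notation RT := (measurableTypeR R).
Implicit Types (r t : R) (k j m : int) (s : seq int) (w : R -> R -> R[i]) (c : R[i] * R[i]).
Local Arguments normc : simpl never.

(** A null set cannot contain an interval; this turns almost-everywhere estimates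
    near 0 into estimates at some arbitrarily small radius. *)
Lemma ae_pick (P : R -> Prop) (d : R) : 0 < d -> {ae leb, forall r : RT, P r} -> exists2 r, 0 < r < d & P r.
Proof.
move=> d0 [N [mN N0 sub]]; apply: contrapT => H.
have sN : (`]0, d[%classic : set RT) `<=` N.
  move=> r /=; rewrite in_itv /= => hr; apply: sub => Pr; apply: H; by exists r.
have mI : measurable (`]0, d[%classic : set RT) by exact: measurable_itv.
have : (leb (`]0%R, d[%classic : set RT) <= 0)%E by rewrite -N0; exact (le_measure leb (mem_set mI) (mem_set mN) sN).
rewrite lebesgue_measure_itv /= lte_fin d0.
by rewrite -EFinB subr0 lee_fin leNgt d0.
Qed.

Lemma reg_gt0 k r : 0 < r -> 0 < regular_radial k r.
Proof. by move=> r0; rewrite /regular_radial; case: ifP => // _; rewrite exprn_gt0. Qed.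

(** Both |ln r| and the quotient r^(-2 |k|) tend to +oo as r -> 0+. *)
Lemma sing_large k (M : R) : 0 < M -> exists2 d, 0 < d & forall r, 0 < r < d ->
  M * regular_radial k r <= `|singular_radial k r|.
Proof.
move=> M0; rewrite /regular_radial /singular_radial; have [_|k0] := eqVneq k 0.
  exists (expR (- M)); first exact: expR_gt0.
  move=> r /andP[r0 rd]; rewrite mulr1.
  have : ln r < - M by rewrite -[X in _ < X]expRK ltr_ln// posrE expR_gt0.
  by move=> h; rewrite ler_normr; apply/orP; right; rewrite lerNr ltW.
have k1 : (0 < `|k|)%N by rewrite absz_gt0.
exists (1 + M)^-1; first by rewrite invr_gt0 addr_gt0.
move=> r /andP[r0 rd]; have M1 : 0 < 1 + M by rewrite addr_gt0.
have r1 : r * (1 + M) < 1 by rewrite -ltr_pdivlMr// div1r.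
have r2 : r <= 1.
  have : r * 1 <= r * (1 + M) by rewrite ler_pM2l// lerDl ltW.
  by rewrite mulr1 => /le_trans; apply; exact: ltW.
have rk0 : 0 < r ^+ `|k| by rewrite exprn_gt0.
rewrite ger0_norm ?invr_ge0 ?(ltW rk0)// -[X in _ <= X]div1r ler_pdivlMr// -mulrA -exprD.
have h : r ^+ (`|k| + `|k|) <= r.
  by rewrite -[X in _ <= X]expr1 ler_wiXn2l// ?ltW//; clear -k1; lia.
apply: (le_trans (ler_wpM2l (ltW M0) h)); rewrite mulrDr mulr1 in r1.
by rewrite mulrC; lra.
Qed.

Lemma reg_sing_unique k (A B : R[i]) :
  (forall e d : R, 0 < e -> 0 < d -> exists2 r, 0 < r < d &
     normc (A * (regular_radial k r)%:C + B * (singular_radial k r)%:C) <= e * regular_radial k r) ->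
  A = 0 /\ B = 0.
Proof.
move=> H.
have B0 : B = 0.
  apply/eqP; apply: contraT => B0; have nB : 0 < normc B by rewrite lt_neqAle normc_ge0 eq_sym andbT; apply: contraNN B0 => /eqP/eq0_normc ->.
  pose M := (normc A + 2) / normc B.
  have M0 : 0 < M by rewrite divr_gt0// ltr_wpDl// normc_ge0.
  have [d d0 hd] := sing_large k M0; have [r hr] := H 1 d ltr01 d0.
  have r0 : 0 < r by case/andP: hr.
  have := hd r hr; have g0 := reg_gt0 k r0.
  set X := regular_radial k r in g0 *; set Y := singular_radial k r => q1.
  have q2 : normc (B * Y%:C) <= normc (A * X%:C + B * Y%:C) + normc (A * X%:C).
    rewrite [X in normc X <= _](_ : _ = (A * X%:C + B * Y%:C) + - (A * X%:C)); last by ring.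
    by rewrite (le_trans (le_normcD _ _))// normcN.
  rewrite mul1r => q3; move: q2; rewrite !normcM !normc_real (gtr0_norm g0) => q2.
  have q4 : (normc A + 2) * X <= normc B * `|Y|.
    rewrite (_ : (normc A + 2) * X = normc B * (M * X)); first by rewrite ler_pM2l.
    by rewrite mulrA /M [normc B * _]mulrC mulfVK// gt_eqF.
  move: (normc B * `|Y|) (normc _) q2 q3 q4 => b a q2 q3 q4; rewrite mulrDl in q4; lra.
split => //; apply/eqP; apply: contraT => A0; have nA : 0 < normc A by rewrite lt_neqAle normc_ge0 eq_sym andbT; apply: contraNN A0 => /eqP/eq0_normc ->.
have A2 : 0 < normc A / 2 by rewrite divr_gt0.
have [r /andP[r0 _]] := H (normc A / 2) 1 A2 ltr01.
have g0 := reg_gt0 k r0; rewrite B0 mul0r addr0 normcM normc_real (gtr0_norm g0) ler_pM2r//.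
by rewrite ler_pdivlMr// -[X in _ <= X]mulr1 ler_pM2l// (ler_nat R 2 1).
Qed.

Lemma boundary_expansion_unique w k c c' :
  boundary_expansion w k c -> boundary_expansion w k c' -> c = c'.
Proof.
move=> H H'; have [|] := @reg_sing_unique k (c.1 - c'.1) (c.2 - c'.2).
  move=> e d e0 d0; have e2 : 0 < e / 2 by rewrite divr_gt0.
  have [d1 d10 h1] := H _ e2; have [d2 d20 h2] := H' _ e2.
  have d3 : 0 < Num.min d (Num.min d1 d2) by rewrite !lt_min d0 d10 d20.
  have h3 : {ae leb, forall r : RT, (0 < r < d1 -> normc (fourier w k r - (c.1 * (regular_radial k r)%:C
      + c.2 * (singular_radial k r)%:C)) <= e / 2 * regular_radial k r) /\
    (0 < r < d2 -> normc (fourier w k r - (c'.1 * (regular_radial k r)%:C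
      + c'.2 * (singular_radial k r)%:C)) <= e / 2 * regular_radial k r)}.
    have h1' : {ae leb, forall r : RT, 0 < r < d1 -> normc (fourier w k r - (c.1 * (regular_radial k r)%:C
      + c.2 * (singular_radial k r)%:C)) <= e / 2 * regular_radial k r} := h1.
    have h2' : {ae leb, forall r : RT, 0 < r < d2 -> normc (fourier w k r - (c'.1 * (regular_radial k r)%:C
      + c'.2 * (singular_radial k r)%:C)) <= e / 2 * regular_radial k r} := h2.
    by apply: filterS2 h1' h2' => r a b; split.
  have [r /andP[r0]] := ae_pick d3 h3.
  rewrite !lt_min => /and3P[rd r1 r2] [h h']; exists r; first by rewrite r0.
  move: h h'; rewrite r0 r1 r2 => /(_ isT) h /(_ isT) h'.
  set F := fourier w k r in h h'; set X := _%:C in h h' *; set Y := _%:C in h h' *.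
  have -> : (c.1 - c'.1) * X + (c.2 - c'.2) * Y = (F - (c'.1 * X + c'.2 * Y)) + - (F - (c.1 * X + c.2 * Y)) by ring.
  rewrite (le_trans (le_normcD _ _))// normcN [e]splitr mulrDl; exact: lerD.
by case: c c' {H H'} => x y [x' y'] /= /eqP; rewrite subr_eq0 => /eqP -> /eqP; rewrite subr_eq0 => /eqP ->.
Qed.

Lemma boundary_coefE w k c : boundary_expansion w k c -> boundary_coef w k = c.
Proof.
move=> H; have := @xgetPex _ (0, 0) [set c | boundary_expansion w k c] (ex_intro _ c H).
move=> H'; exact: boundary_expansion_unique H' H.
Qed.

(** Without an expansion the default value has singular part 0, as if the
    function lay in the domain of the Friedrichs extension. *)
Lemma boundary_coef_none w k : ~ (exists c, boundary_expansion w k c) -> boundary_coef w k = (0, 0).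
Proof. by move=> H; apply: xgetPN => c hc; apply: H; exists c. Qed.

Lemma boundary_expansion_ae w w' k c :
  {ae leb, forall r : RT, 0 < r -> fourier w' k r = fourier w k r} ->
  boundary_expansion w k c -> boundary_expansion w' k c.
Proof.
move=> E H e e0; have [d d0 hd] := H e e0; exists d => //.
apply: filterS2 E hd => r E hd /[dup] hr /andP[r0 _]; rewrite E//; exact: hd.
Qed.

Lemma boundary_coef_ae w w' k : {ae leb, forall r : RT, 0 < r -> fourier w k r = fourier w' k r} ->
  boundary_coef w k = boundary_coef w' k.
Proof.
move=> E; congr xget; apply/seteqP; split => c /=; apply: boundary_expansion_ae => //.
by apply: filterS E => r E r0; rewrite E.
Qed.

Lemma boundary_expansion_lin (x : R[i]) u v w k c c' : normc x = 1 ->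
  {ae leb, forall r : RT, 0 < r -> fourier w k r = fourier u k r + x * fourier v k r} ->
  boundary_expansion u k c -> boundary_expansion v k c' ->
  boundary_expansion w k (c.1 + x * c'.1, c.2 + x * c'.2).
Proof.
move=> x1 E H H' e e0; have e2 : 0 < e / 2 by rewrite divr_gt0.
have [d1 d10 h1] := H _ e2; have [d2 d20 h2] := H' _ e2.
exists (Num.min d1 d2); first by rewrite lt_min d10 d20.
apply: filterS3 E h1 h2 => r E {}h1 {}h2 /andP[r0]; rewrite lt_min => /andP[r1 r2].
move: h1 h2; rewrite r0 r1 r2 E// => /(_ isT) h /(_ isT) h'.
move: (fourier u k r) (fourier v k r) h h' => F G h h'; set X := _%:C in h h' *; set Y := _%:C in h h' *.
rewrite [X in normc X <= _](_ : _ = (F - (c.1 * X + c.2 * Y)) + x * (G - (c'.1 * X + c'.2 * Y))); last by rewrite /=; ring.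
rewrite (le_trans (le_normcD _ _))// normcM x1 mul1r [e]splitr mulrDl; exact: lerD.
Qed.

Lemma boundary_expansion0 w k : {ae leb, forall r : RT, 0 < r -> fourier w k r = 0} ->
  boundary_expansion w k (0, 0).
Proof.
move=> E e e0; exists 1 => //; apply: filterS E => r E /andP[r0 _].
by rewrite E//= !mul0r addr0 subr0 normc0 mulr_ge0 ?ltW// reg_gt0.
Qed.

Lemma boundary_expansion_osmall w k c F : (forall r, 0 < r -> fourier w k r = F r) ->
  osmall (fun r => F r - (c.1 * (regular_radial k r)%:C + c.2 * (singular_radial k r)%:C)) (regular_radial k) ->
  boundary_expansion w k c.
Proof.
move=> E H e e0; have [d d0 hd] := H e e0; exists d => //; apply: aeW => r hr.
by rewrite E ?hd//; case/andP: hr.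
Qed.

Lemma reg_abs k r : regular_radial k r = regular_radial `|k|%N%:Z r.
Proof. by rewrite /regular_radial absz_id [in RHS]eqz_nat absz_eq0. Qed.

Lemma sing_abs k r : singular_radial k r = singular_radial `|k|%N%:Z r.
Proof. by rewrite /singular_radial absz_id [in RHS]eqz_nat absz_eq0. Qed.

(** Y(r) is regular, Y(1/r) splits by the connection coefficients. *)
Lemma amp_expansion (n : nat) (lam : R[i]) w k (x y : R[i]) : (0 < n)%N -> (`|k| < n)%N ->
  (forall r, 0 < r -> fourier w k r = x * ysol n lam `|k|%N r + y * ysol n lam `|k|%N r^-1) ->
  boundary_expansion w k (x + y * conA n lam `|k|%N, y * conB n lam `|k|%N).
Proof.
move=> n0 kn E; apply: (boundary_expansion_osmall E) => /=.
have R0 r : 0 < r -> 0 <= regular_radial k r by move=> r0; rewrite ltW// reg_gt0.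
have RE : regular_radial k = regular_radial `|k|%N%:Z :> (R -> R) by apply/funext => r; exact: reg_abs.
have SE : singular_radial k = singular_radial `|k|%N%:Z :> (R -> R) by apply/funext => r; exact: sing_abs.
have h1 := osmallZ x R0 (_ : osmall (fun r => ysol n lam `|k|%N r - (r ^+ `|k|)%:C) (regular_radial k)).
have {}h1 : osmall (fun r => x * (ysol n lam `|k|%N r - (r ^+ `|k|)%:C)) (regular_radial k).
  apply: h1; rewrite RE; have := ysol_zero lam n0 `|k|%N; congr osmall.
  by apply/funext => r; rewrite reg_nat.
have h2 : osmall (fun r => ysol n lam `|k|%N r^-1 - (conA n lam `|k|%N * (regular_radial k r)%:C
     + conB n lam `|k|%N * (singular_radial k r)%:C)) (regular_radial k).
  by rewrite RE SE; exact: ysol_inv_zero.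
have h := osmallD h1 (osmallZ y R0 h2). apply: osmall_ext h => r r0; rewrite reg_abs reg_nat.
move: (ysol _ _ _ r) (ysol _ _ _ r^-1) (conA _ _ _) (conB _ _ _) (_%:C) (_%:C) => *; ring.
Qed.

Lemma sol_x_expansion (n : nat) (lam : R[i]) s (a b : int -> R[i]) k : (0 < n)%N -> (`|k| < n)%N -> uniq s ->
  k \in s -> boundary_expansion (x_polar (sol n lam s a b)) k
    (a k + b k * conA n lam `|k|%N, b k * conB n lam `|k|%N).
Proof.
move=> n0 kn us ks; apply: amp_expansion => // r r0.
by rewrite sol_fourier// ks.
Qed.

(** Inversion exchanges Y(r) and Y(1/r) and sends mode k to mode - k. *)
Lemma sol_y_expansion (n : nat) (lam : R[i]) s (a b : int -> R[i]) k : (0 < n)%N -> (`|k| < n)%N -> uniq s ->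
  k \in s -> boundary_expansion (y_polar (sol n lam s a b)) (- k)
    (b k + a k * conA n lam `|k|%N, a k * conB n lam `|k|%N).
Proof.
move=> n0 kn us ks; have E : `|- k|%N = `|k|%N by rewrite abszN.
rewrite -E; apply: amp_expansion => //; first by rewrite E.
by move=> r r0; rewrite sol_y_fourier// opprK ks /amp E invrK addrC.
Qed.

Lemma sol_x_expansion0 (n : nat) (lam : R[i]) s (a b : int -> R[i]) k : uniq s -> k \notin s ->
  boundary_expansion (x_polar (sol n lam s a b)) k (0, 0).
Proof.
by move=> us ks; apply: boundary_expansion0; apply: aeW => r r0; rewrite sol_fourier// (negPf ks).
Qed.

Lemma sol_y_expansion0 (n : nat) (lam : R[i]) s (a b : int -> R[i]) k : uniq s -> - k \notin s ->
  boundary_expansion (y_polar (sol n lam s a b)) k (0, 0).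
Proof.
by move=> us ks; apply: boundary_expansion0; apply: aeW => r r0; rewrite sol_y_fourier// (negPf ks).
Qed.

Lemma mem_signed_pairs (l : seq nat) k : (k \in flatten [seq [:: j%:Z; - j%:Z] | j : nat <- l]) = (`|k|%N \in l).
Proof.
elim: l => //= j l IH; rewrite !inE IH orbA; congr (_ || _).
by clear; lia.
Qed.

Lemma mem_modes (n : nat) k : (0 < n)%N -> (k \in modes n) = (`|k| < n)%N.
Proof. by move=> n0; rewrite inE mem_signed_pairs mem_iota; clear -n0; lia. Qed.

Lemma uniq_modes (n : nat) : uniq (modes n).
Proof.
rewrite /= mem_signed_pairs mem_iota /=.
have : all (leq 1) (iota 1 n.-1) by apply/allP => j; rewrite mem_iota => /andP[].
elim: (iota 1 n.-1) (iota_uniq 1 n.-1) => //= j l IH /andP[jl ul] /andP[j0 l0].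
rewrite inE !mem_signed_pairs abszN absz_nat (negPf jl) /= IH// orbF andbT.
by clear -j0; lia.
Qed.

Lemma modesN (n : nat) k : (0 < n)%N -> (- k \in modes n) = (k \in modes n).
Proof. by move=> n0; rewrite !mem_modes// abszN. Qed.
End Expansions.

(** * The boundary space *)

Section BoundaryAlgebra.
Variable R : realType.
Variable n : nat.
Hypothesis n0 : (0 < n)%N.
Local Notation RT := (measurableTypeR R).
Local Notation V := (boundary_space R).
Implicit Types (r t : R) (k j m : int) (c d : int -> R[i]).
Local Arguments normc : simpl never.

(** Coefficients indexed by all naturals avoid transport along equalities of
    sizes. *)
Lemma cspanP (s : seq V) (v : V) :
  cspan s v <-> exists a : nat -> R[i], v = \sum_(i < size s) a i *: s`_i.
Proof.
split=> [[a ->]|[a ->]]; last by exists (fun i => a i).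
exists (fun i => if insub i is Some j then a j else 0).
by apply: eq_bigr => i _; rewrite valK.
Qed.

Lemma cspan_map (T : eqType) (G : T -> V) (l : seq T) (v : V) : uniq l ->
  cspan (map G l) v <-> exists a : T -> R[i], v = \sum_(x <- l) a x *: G x.
Proof.
move=> ul; rewrite cspanP size_map; split=> -[a ->].
  exists (fun x => a (index x l)); case: l ul => [|x0 l] ul; first by rewrite big_nil big_ord0.
  rewrite (big_nth x0) big_mkord; apply: eq_bigr => i _.
  by rewrite index_uniq// (nth_map x0).
case: l ul => [|x0 l] ul; first by exists (fun=> 0); rewrite big_nil big_ord0.
exists (fun i => a (nth x0 (x0 :: l) i)).
by rewrite (big_nth x0) big_mkord; apply: eq_bigr => i _; rewrite (nth_map x0).
Qed.

Lemma cspan_perm (T : eqType) (G : T -> V) (l l' : seq T) : uniq l -> perm_eq l l' ->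
  cspan (map G l) = cspan (map G l').
Proof.
move=> ul ll'; have ul' : uniq l' by rewrite -(perm_uniq ll').
by apply/seteqP; split=> v; rewrite !cspan_map// => -[a ->]; exists a; rewrite (perm_big _ ll').
Qed.

Lemma ordered_basis_map (T : eqType) (G : T -> V) (l : seq T) (W : set V) : uniq l ->
  cspan (map G l) = W ->
  (forall a : T -> R[i], \sum_(x <- l) a x *: G x = 0 -> forall x, x \in l -> a x = 0) ->
  ordered_basis (map G l) W.
Proof.
move=> ul E H; split=> // a; pose b (i : nat) := if insub i is Some j then a j else 0.
have ab i : a i = b i by rewrite /b valK.
under eq_bigr do rewrite ab.
move=> S0 i; rewrite ab; move: (b) (ltn_ord i) S0 => {ab a} {}b; case: i => i /= _.
rewrite size_map => il; case: l ul H il {E} => [|x0 l] // ul H il S0.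
have := H (fun x => b (index x (x0 :: l))); rewrite (big_nth x0) big_mkord.
have -> : \sum_(j < size (x0 :: l)) b (index (nth x0 (x0 :: l) j) (x0 :: l)) *: G (nth x0 (x0 :: l) j) =
  \sum_(j < size (x0 :: l)) b j *: (map G (x0 :: l))`_j.
  by apply: eq_bigr => j _; rewrite index_uniq// (nth_map x0).
move=> /(_ S0 (nth x0 (x0 :: l) i)); rewrite index_uniq// => -> //.
exact: mem_nth.
Qed.

(** The common form of all boundary data: regular and singular coefficients in
    each mode. Components, bases and projections become operations on the
    coefficient functions c and d. *)
Definition bform c d : R -> R -> R[i] := fun r t =>
  \sum_(k <- modes n) (c k * (regular_radial k r)%:C + d k * (singular_radial k r)%:C) * expi (k%:~R * t).

Lemma bformD c d c' d' : bform c d + bform c' d' = bform (fun k => c k + c' k) (fun k => d k + d' k).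
Proof.
apply/funext => r; apply/funext => t.
have E (f g : R -> R -> R[i]) : (f + g) r t = f r t + g r t by [].
rewrite E /bform -big_split; apply: eq_bigr => k _ /=.
by move: (c k) (c' k) (d k) (d' k) => *; ring.
Qed.

Lemma bform0 : bform (fun=> 0) (fun=> 0) = 0.
Proof.
apply/funext => r; apply/funext => t.
by rewrite /bform big1// => k _; rewrite !mul0r addr0 mul0r.
Qed.

Lemma eq_bform c d c' d' : {in modes n, c =1 c'} -> {in modes n, d =1 d'} -> bform c d = bform c' d'.
Proof.
move=> E E'; apply/funext => r; apply/funext => t.
by apply: eq_big_seq => k hk; rewrite E ?E'.
Qed.

(** Distinct modes, and the two radial behaviours of one mode, separate the coefficients. *)
Lemma bform_inj c d c' d' : bform c d = bform c' d' ->
  {in modes n, c =1 c'} /\ {in modes n, d =1 d'}.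
Proof.
move=> E; suff H k : k \in modes n -> c k - c' k = 0 /\ d k - d' k = 0.
  by split=> k /H[/eqP h /eqP h']; apply/eqP; rewrite -subr_eq0.
move=> hk; apply: (@reg_sing_unique R k) => e dl e0 dl0; exists (dl / 2).
  by rewrite divr_gt0//= ltr_pdivrMr// ltr_pMr// ltr1n.
have r0 : 0 < dl / 2 by rewrite divr_gt0.
set r := dl / 2 in r0 *.
have F (a b : int -> R[i]) : circle_coef (fun t : RT => bform a b r t) k = a k * (regular_radial k r)%:C + b k * (singular_radial k r)%:C.
  rewrite /bform (circle_coef_trig (modes n) (fun k => a k * (regular_radial k r)%:C + b k * (singular_radial k r)%:C) idfun).
  by rewrite sum_delta ?hk ?uniq_modes.
have := F c d; rewrite E F => h.
rewrite (_ : _ + _ = 0); first by rewrite normc0 mulr_ge0 ?ltW// reg_gt0.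
by rewrite !mulrBl addrACA -opprD -h subrr.
Qed.

Definition sharp_norm k : R := (if k == 0 then -1 else 1) * mode_norm R k.

Lemma mode_norm_neq0 k : mode_norm R k != 0.
Proof.
have p := @pi_gt0 R; rewrite /mode_norm; have [_|k0] := eqVneq k 0.
  by rewrite invr_eq0 gt_eqF// sqrtr_gt0 mulr_gt0.
by rewrite invr_eq0 gt_eqF// sqrtr_gt0 !mulr_gt0// ltr0n absz_gt0.
Qed.

Lemma sharp_norm_neq0 k : sharp_norm k != 0.
Proof. by rewrite mulf_neq0 ?mode_norm_neq0//; case: ifP; rewrite ?oppr_eq0 oner_eq0. Qed.

Definition side (p : int + int) : int := match p with inl k => k | inr k => k end.
Definition base_f (p : int + int) : V := match p with inl k => f_ R k | inr k => g_ R k end.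
Definition base_s (p : int + int) : V := match p with inl k => f_sharp R k | inr k => g_sharp R k end.
(** The vectors of both bases are indexed by int + int, the left summand for the
    puncture 0 and the right one for infinity; index_pairs is the order of the
    spanning families, index_blocks that of the ordered bases. *)
Definition index_pairs : seq (int + int) := [seq inl k | k <- modes n] ++ [seq inr k | k <- modes n].
Definition index_blocks : seq (int + int) := flatten [seq [:: inl k; inr (- k)] | k <- modes n].

Lemma uniq_pairs : uniq index_pairs.
Proof.
rewrite /index_pairs; move: (modes n) (uniq_modes n) => l ul.
rewrite cat_uniq !map_inj_uniq ?ul//=; try by move=> ? ? [].
by rewrite andbT; apply/hasPn => p /mapP[k _ ->]; apply/negP => /mapP[].
Qed.

Lemma perm_blocks : perm_eq index_pairs index_blocks.
Proof.
have h (l : seq int) : perm_eq ([seq inl k | k <- l] ++ [seq inr (- k) | k <- l] : seq (int + int)) (flatten [seq [:: inl k; inr (- k)] | k <- l]).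
  elim: l => //= k l IH; rewrite perm_cons perm_sym -cat1s perm_sym.
  by rewrite -[_ :: _]cat1s perm_catCA perm_cat2l.
apply: perm_trans (h (modes n)); rewrite perm_cat2l.
rewrite (map_comp (inr : int -> int + int) (@GRing.opp int)); apply: perm_map.
apply: uniq_perm; rewrite ?(map_inj_uniq (@oppr_inj _)) ?uniq_modes//.
move=> k; apply/idP/mapP => [hk|[j hj ->]]; last by rewrite modesN.
by exists (- k); rewrite ?opprK ?modesN.
Qed.

Lemma beta_blocks : beta R n = map base_f index_blocks.
Proof.
rewrite /beta /index_blocks /modes /= oppr0; congr [:: _, _ & _].
by elim: (iota 1 n.-1) => //= j l IH; rewrite IH opprK.
Qed.

Lemma beta_sharp_blocks : beta_sharp R n = map base_s index_blocks.
Proof.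
rewrite /beta_sharp /index_blocks /modes /= oppr0; congr [:: _, _ & _].
by elim: (iota 1 n.-1) => //= j l IH; rewrite IH opprK.
Qed.

Lemma pair_sum (T : Type) (l : seq T) (F G : T -> R -> R -> R[i]) :
  \sum_(x <- l) ((F x, G x) : V) = (\sum_(x <- l) F x, \sum_(x <- l) G x).
Proof. by elim: l => [|x l IH]; rewrite ?big_nil// !big_cons IH. Qed.

Lemma pair_add (f g : R -> R -> R[i]) : ((f, 0) : V) + (0, g) = (f, g).
Proof. by congr (_, _); [exact: addr0|exact: add0r]. Qed.

Lemma sum_fun2 (T : Type) (l : seq T) (F : T -> R -> R -> R[i]) r t :
  (\sum_(x <- l) F x) r t = \sum_(x <- l) F x r t.
Proof. by elim: l => [|x l IH]; rewrite ?big_nil// !big_cons -IH. Qed.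

Lemma scale_regular x k r t : (x *: mode_regular k : R -> R -> R[i]) r t =
  x * (mode_norm R k)%:C * (regular_radial k r)%:C * expi (k%:~R * t).
Proof.
rewrite -[LHS]/(x * ((mode_norm R k * regular_radial k r)%:C * expi (k%:~R * t))).
by rewrite rCM !mulrA.
Qed.

Lemma scale_singular x k r t : (x *: mode_singular k : R -> R -> R[i]) r t =
  x * (sharp_norm k)%:C * (singular_radial k r)%:C * expi (k%:~R * t).
Proof.
rewrite -[LHS]/(x * ((sharp_norm k * singular_radial k r)%:C * expi (k%:~R * t))).
by rewrite rCM !mulrA.
Qed.

Lemma sum_base_f (a : int + int -> R[i]) : \sum_(p <- index_pairs) a p *: base_f p =
  (bform (fun k => a (inl k) * (mode_norm R k)%:C) (fun=> 0), bform (fun k => a (inr k) * (mode_norm R k)%:C) (fun=> 0)) :> V.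
Proof.
rewrite big_cat !big_map /=.
rewrite (eq_bigr (fun k => (a (inl k) *: mode_regular k, 0) : V)); last by move=> k _; congr (_, _); exact: scaler0.
rewrite [X in _ + X](eq_bigr (fun k => (0, a (inr k) *: mode_regular k) : V)); last by move=> k _; congr (_, _); exact: scaler0.
rewrite !pair_sum !big1_eq pair_add; congr (_, _); apply/funext => r; apply/funext => t; rewrite sum_fun2; apply: eq_bigr => k _.
all: by rewrite mul0r addr0 scale_regular.
Qed.

Lemma sum_base_s (a : int + int -> R[i]) : \sum_(p <- index_pairs) a p *: base_s p =
  (bform (fun=> 0) (fun k => a (inl k) * (sharp_norm k)%:C), bform (fun=> 0) (fun k => a (inr k) * (sharp_norm k)%:C)) :> V.
Proof.
rewrite big_cat !big_map /=.
rewrite (eq_bigr (fun k => (a (inl k) *: mode_singular k, 0) : V)); last by move=> k _; congr (_, _); exact: scaler0.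
rewrite [X in _ + X](eq_bigr (fun k => (0, a (inr k) *: mode_singular k) : V)); last by move=> k _; congr (_, _); exact: scaler0.
rewrite !pair_sum !big1_eq pair_add; congr (_, _); apply/funext => r; apply/funext => t; rewrite sum_fun2; apply: eq_bigr => k _.
all: by rewrite mul0r add0r scale_singular.
Qed.

Lemma F_spaceE : F_space n = cspan (map base_f index_pairs).
Proof. by rewrite /F_space /index_pairs map_cat -!map_comp. Qed.

Lemma F_sharp_spaceE : F_sharp_space n = cspan (map base_s index_pairs).
Proof. by rewrite /F_sharp_space /index_pairs map_cat -!map_comp. Qed.

Lemma F_spaceP (v : V) : F_space n v <-> exists c c', v = (bform c (fun=> 0), bform c' (fun=> 0)).
Proof.
rewrite F_spaceE (cspan_map _ _ uniq_pairs); split=> [[a ->]|[c [c' ->]]].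
  by rewrite sum_base_f; do 2 eexists.
exists (fun p => (match p with inl k => c k | inr k => c' k end) / (mode_norm R (side p))%:C).
by rewrite sum_base_f; congr (_, _); apply: eq_bform => k _ //=; rewrite mulfVK// rC_eq0 mode_norm_neq0.
Qed.

Lemma F_sharp_spaceP (v : V) : F_sharp_space n v <-> exists d d', v = (bform (fun=> 0) d, bform (fun=> 0) d').
Proof.
rewrite F_sharp_spaceE (cspan_map _ _ uniq_pairs); split=> [[a ->]|[c [c' ->]]].
  by rewrite sum_base_s; do 2 eexists.
exists (fun p => (match p with inl k => c k | inr k => c' k end) / (sharp_norm (side p))%:C).
by rewrite sum_base_s; congr (_, _); apply: eq_bform => k _ //=; rewrite mulfVK// rC_eq0 sharp_norm_neq0.
Qed.

Lemma beta_basis : ordered_basis (beta R n) (F_space n).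
Proof.
rewrite beta_blocks; have ub : uniq index_blocks by rewrite -(perm_uniq perm_blocks) uniq_pairs.
apply: ordered_basis_map => //; first by rewrite F_spaceE (cspan_perm _ uniq_pairs perm_blocks).
move=> a; rewrite -(perm_big _ perm_blocks) sum_base_f => S0.
have {S0} := etrans S0 (_ : 0 = (bform (fun=> 0) (fun=> 0), bform (fun=> 0) (fun=> 0)) :> V).
rewrite bform0 => /(_ erefl) -[]; rewrite -bform0 => /bform_inj[h1 _] /bform_inj[h2 _] p.
rewrite -(perm_mem perm_blocks) mem_cat => /orP[] /mapP[k hk ->].
  by apply/eqP; have /eqP := h1 k hk; rewrite mulf_eq0 rC_eq0 (negPf (mode_norm_neq0 _)) orbF.
by apply/eqP; have /eqP := h2 k hk; rewrite mulf_eq0 rC_eq0 (negPf (mode_norm_neq0 _)) orbF.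
Qed.

Lemma beta_sharp_basis : ordered_basis (beta_sharp R n) (F_sharp_space n).
Proof.
rewrite beta_sharp_blocks; have ub : uniq index_blocks by rewrite -(perm_uniq perm_blocks) uniq_pairs.
apply: ordered_basis_map => //; first by rewrite F_sharp_spaceE (cspan_perm _ uniq_pairs perm_blocks).
move=> a; rewrite -(perm_big _ perm_blocks) sum_base_s => S0.
have {S0} := etrans S0 (_ : 0 = (bform (fun=> 0) (fun=> 0), bform (fun=> 0) (fun=> 0)) :> V).
rewrite bform0 => /(_ erefl) -[]; rewrite -bform0 => /bform_inj[_ h1] /bform_inj[_ h2] p.
rewrite -(perm_mem perm_blocks) mem_cat => /orP[] /mapP[k hk ->].
  by apply/eqP; have /eqP := h1 k hk; rewrite mulf_eq0 rC_eq0 (negPf (sharp_norm_neq0 _)) orbF.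
by apply/eqP; have /eqP := h2 k hk; rewrite mulf_eq0 rC_eq0 (negPf (sharp_norm_neq0 _)) orbF.
Qed.

Lemma decomposition c d c' d' (h h' : V) : F_space n h -> F_sharp_space n h' ->
  (bform c d, bform c' d') = h + h' ->
  h = (bform c (fun=> 0), bform c' (fun=> 0)) /\ h' = (bform (fun=> 0) d, bform (fun=> 0) d').
Proof.
move=> /F_spaceP[e [e' ->]] /F_sharp_spaceP[g [g' ->]] [].
rewrite !bformD => /bform_inj[h1 h2] /bform_inj[h3 h4].
by split; congr (_, _); apply: eq_bform => // k hk; rewrite ?(h1 k hk, h2 k hk, h3 k hk, h4 k hk) ?addr0 ?add0r.
Qed.

Lemma F_componentE c d c' d' :
  F_component n (bform c d, bform c' d') = (bform c (fun=> 0), bform c' (fun=> 0)).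
Proof.
rewrite /F_component; set S := [set h | _].
have [|Fx [y Fy]] := @xgetPex _ 0 S; last by move=> /(decomposition Fx Fy)[].
exists (bform c (fun=> 0), bform c' (fun=> 0)); split; first by apply/F_spaceP; exists c, c'.
exists (bform (fun=> 0) d, bform (fun=> 0) d'); first by apply/F_sharp_spaceP; exists d, d'.
by congr (_, _); rewrite bformD; apply: eq_bform => k _; rewrite ?addr0 ?add0r.
Qed.

Lemma F_sharp_componentE c d c' d' :
  F_sharp_component n (bform c d, bform c' d') = (bform (fun=> 0) d, bform (fun=> 0) d').
Proof.
rewrite /F_sharp_component; set S := [set h | _].
have [|Fx [y Fy]] := @xgetPex _ 0 S; last by move=> /(decomposition Fy Fx)[].
exists (bform (fun=> 0) d, bform (fun=> 0) d'); split; first by apply/F_sharp_spaceP; exists d, d'.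
exists (bform c (fun=> 0), bform c' (fun=> 0)); first by apply/F_spaceP; exists c, c'.
by congr (_, _); rewrite bformD; apply: eq_bform => k _; rewrite ?addr0 ?add0r.
Qed.

Lemma pi_SE (u : R[i] -> R[i]) c d c' d' :
  {in modes n, forall k, boundary_coef (x_polar u) k = (c k, d k)} ->
  {in modes n, forall k, boundary_coef (y_polar u) k = (c' k, d' k)} ->
  pi_S n u = (bform c d, bform c' d').
Proof.
move=> h1 h2; congr (_, _); apply/funext => r; apply/funext => t; apply: eq_big_seq => k hk.
  by rewrite h1.
by rewrite h2.
Qed.
End BoundaryAlgebra.

(** * Consequences of the resolvent estimate *)

Section ResolventConsequences.
Variable R : realType.
Variables (n : nat) (lam : R[i]).
Hypothesis n0 : (0 < n)%N.
Hypothesis hres : resolvent_set n lam.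
Local Notation leb := (@lebesgue_measure R).
Local Notation RT := (measurableTypeR R).
Local Notation V := (boundary_space R).
Implicit Types (r t : R) (k j m : int) (a b c d : int -> R[i]) (u w : R[i] -> R[i]).
Local Notation A k := (conA n lam `|k|%N).
Local Notation B k := (conB n lam `|k|%N).
Local Notation esol := (sol n lam).
Local Arguments normc : simpl never.

Lemma L2norm_zero : L2norm n (fun=> 0 : R[i]) = 0.
Proof.
rewrite /L2norm /L2norm2.
under eq_integral do rewrite normc0 expr0n mulr0.
by rewrite integral0 /= sqrtr0.
Qed.

Lemma in_L2Z (x : R[i]) u : in_L2 n u -> in_L2 n (fun z => x * u z).
Proof.
by move=> hu; have := in_L2_lin x 0 hu hu; congr in_L2; apply/funext => z; rewrite mul0r addr0.
Qed.

Lemma pi_S_F u : {in modes n, forall k, (boundary_coef (x_polar u) k).2 = 0} ->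
  {in modes n, forall k, (boundary_coef (y_polar u) k).2 = 0} -> F_space n (pi_S n u).
Proof.
move=> h1 h2; apply/F_spaceP => //.
exists (fun k => (boundary_coef (x_polar u) k).1), (fun k => (boundary_coef (y_polar u) k).1).
by apply: pi_SE => k hk; [rewrite -(h1 k hk)|rewrite -(h2 k hk)]; case: boundary_coef.
Qed.

(** A solution without singular boundary data lies in the domain of the
    Friedrichs extension, and the resolvent estimate bounds its norm by 0. *)
Lemma resolvent_null w : in_L2 n w -> dist_laplacian n w (fun z => lam * w z) ->
  {in modes n, forall k, (boundary_coef (x_polar w) k).2 = 0} ->
  {in modes n, forall k, (boundary_coef (y_polar w) k).2 = 0} -> L2norm n w = 0.
Proof.
move=> hw dw h1 h2; have [_ [K hK]] := hres; have hl := in_L2Z lam hw.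
have DF : D_F n w by split; [split => //; exists (fun z => lam * w z)|exact: pi_S_F].
have := hK w _ DF hl dw; have -> : (fun z => lam * w z - lam * w z) = fun=> 0.
  by apply/funext => z; rewrite subrr.
rewrite L2norm_zero mulr0 => h; apply/eqP; rewrite eq_le h /=; exact: sqrtr_ge0.
Qed.

(** If B vanished, the solution that is regular at 0 would be regular at infinity
    too: a nonzero eigenfunction of the Friedrichs extension. *)
Lemma conB_neq0 (k : nat) : (k < n)%N -> conB n lam k != 0.
Proof.
move=> kn; apply/eqP => B0; pose s : seq int := [:: k%:Z].
have us : uniq s by [].
have ks : all (fun k => (`|k| < n)%N) s by rewrite /= kn.
have [hu du] := sol_formal lam n0 (fun=> 1) (fun=> 0) ks; set u := esol s _ _ in hu du.
have ex : boundary_expansion (x_polar u) k%:Z (1, 0).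
  have := sol_x_expansion lam (fun=> 1) (fun=> 0) n0 (kn : (`|k%:Z| < n)%N) us (mem_head _ _).
  by rewrite /= !mul0r addr0.
have u0 : L2norm n u = 0.
  apply: resolvent_null => // j _.
    have [->|jk] := eqVneq j k%:Z; first by rewrite (boundary_coefE ex).
    have js : j \notin s by rewrite inE.
    by rewrite (boundary_coefE (sol_x_expansion0 n lam (fun=> 1) (fun=> 0) us js)).
  have [jk|jk] := eqVneq (- j) k%:Z; last first.
    have js : - j \notin s by rewrite inE.
    by rewrite (boundary_coefE (sol_y_expansion0 n lam (fun=> 1) (fun=> 0) us js)).
  have := sol_y_expansion lam (fun=> 1) (fun=> 0) n0 (kn : (`|k%:Z| < n)%N) us (mem_head _ _).
  by rewrite -jk opprK abszN -[`|j|%N]abszN jk => /boundary_coefE -> /=; rewrite mul1r.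
have e0 : boundary_expansion (x_polar u) k%:Z (0, 0).
  apply: boundary_expansion0; exact (x_fourier_null n0 k%:Z hu u0).
by have := boundary_expansion_unique ex e0 => -[] /eqP; rewrite oner_eq0.
Qed.

Lemma sol_pi_S a b : pi_S n (esol (modes n) a b) =
  (bform n (fun k => a k + b k * A k) (fun k => b k * B k),
   bform n (fun k => b (- k) + a (- k) * A k) (fun k => a (- k) * B k)).
Proof.
have us := uniq_modes n; apply: pi_SE => k hk; apply: boundary_coefE.
  by apply: sol_x_expansion => //; rewrite -mem_modes.
have hk' : - k \in modes n by rewrite modesN.
have := @sol_y_expansion R n lam (modes n) a b (- k) n0 _ us hk'.
by rewrite opprK abszN; apply; rewrite -mem_modes.
Qed.

Lemma modes_all : all (fun k => (`|k| < n)%N) (modes n).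
Proof. by apply/allP => k; rewrite mem_modes. Qed.

Lemma boundary_part_eq (U W : R -> R -> R[i]) :
  {in modes n, boundary_coef U =1 boundary_coef W} -> boundary_part n U = boundary_part n W.
Proof.
move=> E; apply/funext => r; apply/funext => t; rewrite /boundary_part.
by apply: eq_big_seq => k hk; rewrite (E k hk).
Qed.

(** Subtract from u the separated solution E with the same singular data. Where u
    has an expansion, so has u - E, without singular part; where u has none,
    neither has u - E, and its coefficient is the default 0. Hence u - E is
    null by the resolvent estimate, and null functions do not change Fourier
    modes almost everywhere. *)
Lemma formal_pi_S u : formal_solution n lam u ->
  exists a b, pi_S n u = pi_S n (esol (modes n) a b).
Proof.
move=> [[hu _] du]; have us := uniq_modes n.
pose b k := (boundary_coef (x_polar u) k).2 / B k.
pose a k := (boundary_coef (y_polar u) (- k)).2 / B k.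
exists a, b; have [hE dE] := sol_formal lam n0 a b modes_all.
set E := esol (modes n) a b in hE dE *.
pose w z := u z - E z.
have wE : w = fun z => 1 * u z + (- 1) * E z by apply/funext => z; rewrite mul1r mulN1r.
have hw : in_L2 n w by rewrite wE; exact: in_L2_lin.
have dw : dist_laplacian n w (fun z => lam * w z).
  have := dist_laplacian_lin n0 1 (- 1) hu hE (in_L2Z lam hu) (in_L2Z lam hE) du dE.
  by rewrite -wE; congr dist_laplacian; apply/funext => z; rewrite /w; ring.
have fx k : {ae leb, forall r : RT, 0 < r -> fourier (x_polar w) k r = fourier (x_polar u) k r - fourier (x_polar E) k r}.
  exact (x_fourier_sub n0 k hu hE).
have fy k : {ae leb, forall r : RT, 0 < r -> fourier (y_polar w) k r = fourier (y_polar u) k r - fourier (y_polar E) k r}.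
  exact (y_fourier_sub n0 k hu hE).
have N1 : normc (- 1 : R[i]) = 1 by rewrite normcN normc1.
have core (U W F : R -> R -> R[i]) k (c : R[i] * R[i]) :
    {ae leb, forall r : RT, 0 < r -> fourier W k r = fourier U k r - fourier F k r} ->
    boundary_expansion F k c -> c.2 = (boundary_coef U k).2 -> (boundary_coef W k).2 = 0.
  move=> h hF c2; have [[c' hc']|no] := pselect (exists c' : R[i] * R[i], boundary_expansion U k c').
    have h' : {ae leb, forall r : RT, 0 < r -> fourier W k r = fourier U k r + (- 1) * fourier F k r}.
      by apply: filterS h => r h r0; rewrite h// mulN1r.
    rewrite (boundary_coefE (boundary_expansion_lin N1 h' hc' hF)) /= c2 (boundary_coefE hc').
    by rewrite mulN1r subrr.
  rewrite boundary_coef_none// => -[c' hc']; apply: no; eexists.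
  apply: (boundary_expansion_lin (normc1 _) _ hc' hF); apply: filterS h => r h r0.
  by rewrite h// mul1r subrK.
have bB k : k \in modes n -> b k * B k = (boundary_coef (x_polar u) k).2.
  by move=> hk; rewrite /b divfK// conB_neq0// -mem_modes.
have aB k : k \in modes n -> a (- k) * B k = (boundary_coef (y_polar u) k).2.
  by move=> hk; rewrite /a opprK abszN divfK// conB_neq0// -mem_modes.
have w0 : L2norm n w = 0.
  apply: resolvent_null => // k hk.
    apply: (core _ _ _ _ _ (fx k) (sol_x_expansion lam a b n0 _ us hk)); first by rewrite -mem_modes.
    exact: bB.
  have hk' : - k \in modes n by rewrite modesN.
  have kn : (`|- k| < n)%N by rewrite -mem_modes.
  have := sol_y_expansion lam a b n0 kn us hk'; rewrite opprK abszN => h.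
  by apply: (core _ _ _ _ _ (fy k) h); exact: aB.
have zx k := x_fourier_null n0 k hw w0; have zy k := y_fourier_null n0 k hw w0.
have hx : boundary_part n (x_polar u) = boundary_part n (x_polar E).
  apply: boundary_part_eq => k _; apply: boundary_coef_ae.
  by apply: filterS2 (fx k) (zx k) => x h1 h2 x0; exact: subr0_eq (etrans (esym (h1 x0)) (h2 x0)).
have hy : boundary_part n (y_polar u) = boundary_part n (y_polar E).
  apply: boundary_part_eq => k _; apply: boundary_coef_ae.
  by apply: filterS2 (fy k) (zy k) => x h1 h2 x0; exact: subr0_eq (etrans (esym (h1 x0)) (h2 x0)).
by rewrite /pi_S hx hy.
Qed.

(** Solving b B = d k and a B = d' (- k) for the two amplitudes of mode k and
    reading off the regular coefficients a + b A at 0 and b + a A at infinity. *)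
Lemma weyl_bform d d' : weyl n lam (bform n (fun=> 0) d, bform n (fun=> 0) d') =
  (bform n (fun k => (d' (- k) + d k * A k) / B k) (fun=> 0),
   bform n (fun k => (d (- k) + d' k * A k) / B k) (fun=> 0)).
Proof.
have Bn k : k \in modes n -> B k != 0 by move=> hk; rewrite conB_neq0// -mem_modes.
rewrite /weyl; set h := (_, _); set u := Gamma_field _ _ _.
have [fu hu] : [set u | formal_solution n lam u /\ F_sharp_component n (pi_S n u) = h] u.
  apply: xgetPex; exists (esol (modes n) (fun k => d' (- k) / B k) (fun k => d k / B k)).
  have [h1 h2] := sol_formal lam n0 (fun k => d' (- k) / B k) (fun k => d k / B k) modes_all.
  split; first by split => //; split => //; eexists; [exact: in_L2Z h1|exact: h2].
  rewrite sol_pi_S F_sharp_componentE; congr (_, _); apply: eq_bform => // k hk.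
    by rewrite divfK// Bn.
  by rewrite abszN opprK divfK// Bn.
have [a [b E]] := formal_pi_S fu; rewrite sol_pi_S in E; rewrite E in hu *.
have := @F_sharp_componentE R n (fun k => a k + b k * A k) (fun k => b k * B k)
  (fun k => b (- k) + a (- k) * A k) (fun k => a (- k) * B k).
have -> := @F_componentE R n (fun k => a k + b k * A k) (fun k => b k * B k)
  (fun k => b (- k) + a (- k) * A k) (fun k => a (- k) * B k).
rewrite hu /h.
move=> -[/bform_inj[_ h1] /bform_inj[_ h2]].
congr (_, _); apply: eq_bform => // k hk; apply: (mulIf (Bn k hk)); rewrite divfK ?Bn//.
  have hk' : - k \in modes n by rewrite modesN.
  by rewrite (h1 k hk) (h2 _ hk') opprK abszN; ring.
have hk' : - k \in modes n by rewrite modesN.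
by rewrite (h2 k hk) (h1 _ hk') abszN; ring.
Qed.
End ResolventConsequences.

(** * Block structure of the matrix *)

Section Matrix.
Variable R : realType.
Variable n : nat.
Hypothesis n0 : (0 < n)%N.
Local Notation N := (n.*2.-1).
Local Notation p := (\sum_(b < N) 2)%N.
Local Notation V := (boundary_space R).
Local Notation Rank b j := (@tagnat.Rank N (fun=> 2%N) b j).
Local Arguments modes : simpl never.
Local Arguments index_blocks : simpl never.
Local Arguments tagnat.Rank : simpl never.
Implicit Types (k : int) (b : 'I_N) (v : 'I_p -> R[i]).

Lemma size_modes : size (modes n) = N.
Proof.
have E (l : seq nat) : size (flatten [seq [:: j%:Z; - j%:Z] | j : nat <- l]) = (size l).*2.
  by elim: l => //= j l ->.
by rewrite /modes /= E size_iota; clear -n0; lia.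
Qed.

Lemma abs_nth_pairs (l : seq nat) i : absz (nth (0 : int) (flatten [seq [:: j%:Z; - j%:Z] | j : nat <- l]) i) = nth 0%N l i./2.
Proof.
elim: l i => [|j l IH] [|[|i]] //=; by rewrite ?nth_nil ?abszN.
Qed.

Lemma abs_nth_modes i : (i < N)%N -> absz (nth (0 : int) (modes n) i) = uphalf i.
Proof.
case: i => [|i] hi //; rewrite /modes /=; rewrite abs_nth_pairs nth_iota ?add1n//.
by clear -hi; lia.
Qed.

Lemma nth_pairs (T : Type) (x0 : T) (F H : int -> T) (l : seq int) i : (i < size l)%N ->
  nth x0 (flatten [seq [:: F k; H k] | k <- l]) i.*2 = F (nth 0 l i) /\
  nth x0 (flatten [seq [:: F k; H k] | k <- l]) i.*2.+1 = H (nth 0 l i).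
Proof. by elim: l i => [|k l IH] [|i]//= /IH. Qed.

Lemma Rank_val b (j : 'I_2) : Rank b j = (b.*2 + j)%N :> nat.
Proof.
rewrite tagnat.RankEsum; congr (_ + _)%N.
by rewrite -(big_ord_widen N (fun=> 2%N) (ltnW (ltn_ord b))) sum_nat_const card_ord muln2.
Qed.

(** A vector whose index set is a sum of blocks of size 2 is a family of pairs. *)
Lemma sum_ordblocks v (s : seq V) : \sum_(i < p) v i *: s`_i =
  \sum_b (v (Rank b ord0) *: s`_(b.*2) + v (Rank b ord_max) *: s`_(b.*2.+1)).
Proof.
rewrite (reindex _ (@tagnat.rank_bij_on N (fun=> 2%N))) /=.
transitivity (\sum_b \sum_(j < 2) v (Rank b j) *: s`_(Rank b j)).
  by rewrite sig_big_dep /=; apply: eq_bigr => -[b j] _.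
apply: eq_bigr => b _.
transitivity (\sum_(j < 2) v (Rank b j) *: s`_(b.*2 + j)).
  by apply: eq_bigr => j _; rewrite Rank_val.
rewrite big_ord_recr big_ord1 /= addn0 addn1.
have -> // : widen_ord (leqnSn 1) ord0 = ord0 :> 'I_2 by apply: val_inj.
Qed.

(** Entries of a column vector read through the labels of the basis vectors. *)
Definition coord v (q : int + int) : R[i] :=
  match q with
  | inl k => if insub (index k (modes n)) is Some b then v (Rank b ord0) else 0
  | inr k => if insub (index (- k) (modes n)) is Some b then v (Rank b ord_max) else 0
  end.

Lemma coordl v b : coord v (inl (nth 0 (modes n) b)) = v (Rank b ord0).
Proof. by rewrite /coord index_uniq ?uniq_modes ?size_modes// valK. Qed.

Lemma coordr v b : coord v (inr (- nth 0 (modes n) b)) = v (Rank b ord_max).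
Proof. by rewrite /coord opprK index_uniq ?uniq_modes ?size_modes// valK. Qed.

Lemma sum_index_blocks (F : int + int -> V) :
  \sum_(q <- index_blocks n) F q = \sum_(k <- modes n) (F (inl k) + F (inr (- k))).
Proof.
rewrite /index_blocks; elim: (modes n) => [|k l IH]; first by rewrite !big_nil.
by rewrite /= !big_cons IH addrA.
Qed.

Lemma sum_coord v (G : int + int -> V) :
  \sum_(i < p) v i *: (map G (index_blocks n))`_i = \sum_(q <- index_pairs n) coord v q *: G q.
Proof.
rewrite sum_ordblocks (perm_big _ (perm_blocks n0)) sum_index_blocks (big_nth 0) size_modes big_mkord.
apply: eq_bigr => b _; rewrite coordl coordr.
have bl : (b < size (modes n))%N by rewrite size_modes.
have := @nth_pairs V 0 (G \o inl) (G \o inr \o -%R) (modes n) b bl.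
have -> : flatten [seq [:: (G \o inl) k; (G \o inr \o -%R) k] | k <- modes n] = map G (index_blocks n).
  by rewrite /index_blocks; elim: (modes n) => //= k l ->.
by move=> [-> ->].
Qed.

Lemma modes_index k : k \in modes n -> exists b, k = nth 0 (modes n) b.
Proof.
move=> hk; have h : (index k (modes n) < N)%N by rewrite -size_modes index_mem.
by exists (Ordinal h); rewrite /= nth_index.
Qed.

Lemma mul_mxdiag_Rank (D : forall b : 'I_N, 'M[R[i]]_2) (a : 'cV[R[i]]_p) b (j : 'I_2) :
  ((\mxdiag_(b < N) D b) *m a) (Rank b j) 0 = D b j ord0 * a (Rank b ord0) 0 + D b j ord_max * a (Rank b ord_max) 0.
Proof.
pose C b : 'cV_2 := submxcol a b.
have E : (\mxdiag_(b < N) D b) *m a = \mxcol_b (D b *m C b) by rewrite -mul_mxdiag_mxcol submxcolK.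
have := congr1 (fun X => submxcol X b j 0) E; rewrite mxcolK mxE => ->.
rewrite mxE big_ord_recr big_ord1 /= !mxE.
by have -> // : widen_ord (leqnSn 1) ord0 = ord0 :> 'I_2 by apply: val_inj.
Qed.

Lemma mx22E (e x1 x2 x3 x4 : R[i]) :
  let M := e *: mx22 x1 x2 x3 x4 in
  ((M ord0 ord0 = e * x1)%R * (M ord0 ord_max = e * x2)%R *
   (M ord_max ord0 = e * x3)%R * (M ord_max ord_max = e * x4)%R)%type.
Proof. by do !split; rewrite !mxE. Qed.

Lemma sharp_normN k : sharp_norm R (- k) = sharp_norm R k.
Proof. by rewrite /sharp_norm /mode_norm oppr_eq0 abszN. Qed.

Lemma sharp_normC k : (sharp_norm R k)%:C = (if k == 0 then -1 else 1) * (mode_norm R k)%:C.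
Proof. by rewrite /sharp_norm rCM; case: ifP; rewrite ?rCN. Qed.

Lemma size_blocks (T : Type) (G : int + int -> T) : size (map G (index_blocks n)) = p.
Proof.
rewrite size_map sum_nat_const card_ord -size_modes /index_blocks.
by elim: (modes n) => //= k l ->; rewrite mulSn.
Qed.
End Matrix.

Theorem mainTheorem3 (R : realType) (n : nat) (lam nu : R[i])
    (hn : (2 <= n)%N) (hlam : resolvent_set n lam)
    (hnu : lam = nu * (nu + 1)) :
  is_matrix_of (F_sharp_space n) (F_space n) (beta_sharp R n) (beta R n)
    (weyl n lam) (S_matrix n nu).
Proof.
have n0 : (0 < n)%N by apply: ltnW.
split.
- by split; [rewrite beta_sharp_blocks size_blocks|exact: beta_sharp_basis].
- by split; [rewrite beta_blocks size_blocks|exact: beta_basis].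
move=> a; rewrite beta_blocks beta_sharp_blocks.
pose x := coord (a^~ 0); pose y := coord ((S_matrix n nu *m a)^~ 0).
have sx := sum_coord n0 (a^~ 0) (@base_s R); rewrite -/x in sx.
have sy := sum_coord n0 ((S_matrix n nu *m a)^~ 0) (@base_f R); rewrite -/y in sy.
have bx := sum_base_s n x.
have by_ := sum_base_f n y.
have wx := weyl_bform n0 hlam (fun k => x (inl k) * (sharp_norm R k)%:C)
  (fun k => x (inr k) * (sharp_norm R k)%:C).
apply: (etrans (congr1 (weyl n lam) (etrans sx bx))).
apply: (etrans wx); apply: (etrans _ (esym (etrans sy by_))).
pose A k := conA n lam `|k|%N; pose B k := conB n lam `|k|%N.
have blk (b : 'I_(n.*2.-1)) : let k := nth 0 (modes n) b in S_block n (uphalf b) nu =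
    (if k == 0 then -1 else 1) *: mx22 (A k / B k) (B k)^-1 (B k)^-1 (A k / B k) /\ B k != 0.
  move=> k; have kb : `|k|%N = uphalf b by apply: abs_nth_modes.
  have kn : (uphalf b < n)%N by have := ltn_ord b; clear -n0; lia.
  have B0 := conB_neq0 n0 hlam kn.
  by rewrite /A /B kb (S_block_con n0 hnu kn B0) -absz_eq0 kb.
congr (_, _); apply: eq_bform => // k hk.
  have [b kb] := modes_index n0 hk.
  have [Sb B0] := blk b; rewrite -kb in Sb B0.
  have xl : x (inl k) = a (tagnat.Rank b ord0) 0 by rewrite /x kb coordl.
  have xr : x (inr (- k)) = a (tagnat.Rank b ord_max) 0 by rewrite /x kb coordr.
  have yl : y (inl k) = (S_matrix n nu *m a) (tagnat.Rank b ord0) 0 by rewrite /y kb coordl.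
  rewrite xl xr yl mul_mxdiag_Rank Sb !mx22E sharp_normN sharp_normC -/(A k) -/(B k).
  move: (A k) (B k) (a _ 0) (a _ 0) ((mode_norm R k)%:C) (if _ then _ else _) B0 => *; by field.
have hk' : - k \in modes n by rewrite modesN.
have [b kb] := modes_index n0 hk'; have [Sb B0] := blk b; rewrite -kb in Sb B0.
have xl : x (inl (- k)) = a (tagnat.Rank b ord0) 0 by rewrite /x kb coordl.
have xr : x (inr k) = a (tagnat.Rank b ord_max) 0 by rewrite /x -[k]opprK kb coordr.
have yr : y (inr k) = (S_matrix n nu *m a) (tagnat.Rank b ord_max) 0 by rewrite /y -[k]opprK kb coordr.
have AB : A (- k) = A k /\ B (- k) = B k by rewrite /A /B abszN.
rewrite oppr_eq0 AB.1 AB.2 in Sb B0.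
rewrite xl xr yr mul_mxdiag_Rank Sb !mx22E sharp_normN sharp_normC -/(A k) -/(B k).
move: (A k) (B k) (a _ 0) (a _ 0) ((mode_norm R k)%:C) (if _ then _ else _) B0 => *; by field.
Qed.
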